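(* Let $\Omega=(-1,1)\times(0,\pi)$. Let $\gamma_1,\gamma_2\colon[0,\pi]\to(-1,1)$ be two continuous functions such that $\gamma_1<\gamma_2$ on $[0,\pi]$, let $$\omega=\{(x,y)\in\Omega:\ \gamma_1(y)<x<\gamma_2(y)\},$$ and let $a=\max\big(\max(\gamma_2^-),\max(\gamma_1^+)\big)$, where $\gamma^+=\max(0,\gamma)$ and $\gamma^-=\max(0,-\gamma)$. Then, for $T>0$: (i) if $T>a^2/2$, the Grushin equation on $\Omega$ with control region $\omega$ is null-controllable in time $T$; (ii) if $T<a^2/2$, the Grushin equation on $\Omega$ with control region $\omega$ is not null-controllable in time $T$.
   Context: Let $\Omega=(-1,1)\times(0,\pi)$, let $\omega\subset\Omega$ and $T>0$. The (controlled) Grushin equation on $\Omega$ with control region $\omega$ is $$\begin{cases}(\partial_t-\partial_x^2-x^2\partial_y^2)f(t,x,y)=\mathbf 1_\omega u(t,x,y), & t\in[0,T],\ (x,y)\in\Omega,\\ f(t,x,y)=0, & t\in[0,T],\ (x,y)\in\partial\Omega,\\ f(0,x,y)=f_0(x,y), & (x,y)\in\Omega,\end{cases}$$ with initial data $f_0\in L^2(\Omega)$ and control $u\in L^2((0,T)\times\Omega)$. Put $(f,g):=\int_\Omega(\partial_xf\,\partial_xg+x^2\partial_yf\,\partial_yg)\,dx\,dy$ for $f,g\in C_0^\infty(\Omega)$ and let $V(\Omega)$ be the completion of $C_0^\infty(\Omega)$ for the norm $(\cdot,\cdot)^{1/2}$. For all $f_0$ and $u$ the equation has a unique weak solution $f\in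 C([0,T];L^2(\Omega))\cap L^2(0,T;V(\Omega))$, i.e. $f(0)=f_0$ and $\frac{d}{dt}\langle f(t),\varphi\rangle_{L^2(\Omega)}+(f(t),\varphi)=\langle\mathbf 1_\omega u(t),\varphi\rangle_{L^2(\Omega)}$ for all $\varphi\in V(\Omega)$, in the sense of distributions on $(0,T)$. The equation is null-controllable (on $\omega$) in time $T>0$ if for every $f_0\in L^2(\Omega)$ there exists a control $u\in L^2((0,T)\times\Omega)$ such that the solution satisfies $f(T,\cdot,\cdot)=0$ in $\Omega$. *)

(* Defs.v *)
From HB Require Import structures.
From mathcomp Require Export all_boot all_order all_algebra.
From mathcomp Require Export all_classical all_reals all_analysis.

Set Implicit Arguments.
Unset Strict Implicit.
Unset Printing Implicit Defensive.

Export Order.TTheory GRing.Theory Num.Theory.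
Export numFieldNormedType.Exports.

Global Open Scope classical_set_scope.
Global Open Scope ring_scope.

Section test_functions.
Context {R : realType} {V : normedModType R}.

(* On a finite-dimensional V this is the class C^oo: all iterated directional
   derivatives exist and are continuous. *)
Definition smooth (f : V -> R) : Prop :=
  forall s : seq V,
    let g : V -> R := foldr (fun v (h : V -> R) x => 'D_v h x) f s in
    continuous g /\ forall x v, derivable g x v.

(* C_0^oo(D); test functions are extended by 0 to the whole space V. *)
Definition test_function (D : set V) (f : V -> R) : Prop :=
  let supp := closure [set x | f x != 0] in
  [/\ smooth f, compact supp & supp `<=` D].

End test_functions.

Section grushin.
Context {R : realType}.

(* [measurableTypeR R] is R with its Borel sigma-algebra, under the display
   expected by [lebesgue_measure]. *)
Local Notation plane := (measurableTypeR R * measurableTypeR R)%type.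
Local Notation space := (measurableTypeR R * plane)%type.

Definition lebesgue2 : set plane -> \bar R :=
  (@lebesgue_measure R \x @lebesgue_measure R)%E.

HB.instance Definition _ := Measure.on lebesgue2.

Lemma lebesgue2_sigma_finite : sigma_finite [set: plane] lebesgue2.
Proof.
have /sigma_finiteP[F [TF ndF Foo]] := sigma_finiteT (@lebesgue_measure R).
exists (fun n => F n `*` F n).
  rewrite -setXTT [LHS](_ : _ = [set: R] `*` [set: R])// TF predeqE => -[x y].
  split.
    move=> [/= [n _ Fnx] [k _ Fky]]; exists (maxn n k) => //; split.
    - by move: x Fnx; exact/subsetPset/ndF/leq_maxl.
    - by move: y Fky; exact/subsetPset/ndF/leq_maxr.
  by move=> [n _ []/= ? ?]; split; exists n.
move=> k; have [? ?] := Foo k; split; first exact: measurableX.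
by rewrite /lebesgue2/= product_measure1E// lte_mul_pinfty// ge0_fin_numE.
Qed.

HB.instance Definition _ :=
  Measure_isSigmaFinite.Build _ _ _ lebesgue2 lebesgue2_sigma_finite.

Definition lebesgue3 : {measure set space -> \bar R} :=
  (@lebesgue_measure R \x lebesgue2)%E.

Definition Omega : set (R * R) :=
  `]-1, 1[%classic `*` `]0, pi[%classic.

Lemma measurable_Omega : measurable (Omega : set plane).
Proof. by apply: measurableX; exact: measurable_itv. Qed.

(* (0, T) x Omega *)
Definition cylinder (T : R) : set (R * (R * R)) :=
  `]0, T[%classic `*` Omega.

Lemma measurable_cylinder (T : R) : measurable (cylinder T : set space).
Proof.
by apply: measurableX; [exact: measurable_itv|exact: measurable_Omega].
Qed.

(* L^2(Omega) is [Lfun mu_Omega 2%:E] up to equality [mu_Omega]-almost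
   everywhere; the values of a representative outside Omega are irrelevant. *)
Definition mu_Omega : {measure set plane -> \bar R} :=
  mrestr lebesgue2 measurable_Omega.

Definition mu_cylinder (T : R) : {measure set space -> \bar R} :=
  mrestr lebesgue3 (measurable_cylinder T).

Definition L2_dist (f g : R * R -> R) : \bar R :=
  'N[mu_Omega]_2%:E[EFin \o (f \- g)].

Definition L2_dot (f g : R * R -> R) : R :=
  \int[mu_Omega]_p (f p * g p).

Definition dx (f : R * R -> R) (p : R * R) : R := 'D_((1, 0) : R * R) f p.

Definition xdy (f : R * R -> R) (p : R * R) : R :=
  p.1 * 'D_((0, 1) : R * R) f p.

(* [V_grad f g h]: f is in V(Omega), with g = d_x f and h = x d_y f.
   The completion V(Omega) of C_0^oo(Omega) for the norm
   (|d_x f|^2 + |x d_y f|^2)^(1/2) is realized inside L^2(Omega): by Poincare's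
   inequality in x on (-1, 1), a Cauchy sequence for this norm is also Cauchy
   in L^2(Omega), and, d_x and x d_y being closable, its limit in L^2(Omega)
   determines its class in the completion (so g and h are determined by f
   almost everywhere). *)
Definition V_grad (f g h : R * R -> R) : Prop :=
  [/\ f \in Lfun mu_Omega 2%:E, g \in Lfun mu_Omega 2%:E,
      h \in Lfun mu_Omega 2%:E &
      exists phi : nat -> R * R -> R,
        [/\ forall n, test_function Omega (phi n),
            L2_dist (phi n) f @[n --> \oo] --> 0%E,
            L2_dist (dx (phi n)) g @[n --> \oo] --> 0%E &
            L2_dist (xdy (phi n)) h @[n --> \oo] --> 0%E]].

(* f in C([0, T]; L^2(Omega)); f t is a representative of the class f(t). *)
Definition continuous_L2 (T : R) (f : R -> R * R -> R) : Prop :=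
  (forall t, t \in `[0, T] -> f t \in Lfun mu_Omega 2%:E) /\
  (forall t0, t0 \in `[0, T] ->
     L2_dist (f t) (f t0) @[t --> within `[0, T] (nbhs t0)] --> 0%E).

(* f in L^2(0, T; V(Omega)) with d_x f = g and x d_y f = h: as
   v |-> (d_x v, x d_y v) is an isometry of V(Omega) onto a closed subspace of
   L^2(Omega)^2, and L^2(0, T; L^2(Omega)) = L^2((0, T) x Omega), only g and h
   need to be jointly measurable and square integrable. *)
Definition L2_V_grad (T : R) (f : R -> R * R -> R)
    (g h : R * (R * R) -> R) : Prop :=
  [/\ g \in Lfun (mu_cylinder T) 2%:E, h \in Lfun (mu_cylinder T) 2%:E &
      {ae @lebesgue_measure R, forall t, t \in `]0, T[ ->
         V_grad (f t) (fun p => g (t, p)) (fun p => h (t, p))}].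

(* The last clause is
     d/dt <f(t), phi> + (f(t), phi) = <1_omega u(t), phi>
   for all phi in V(Omega), in the sense of distributions on (0, T). *)
Definition weak_solution (omega : set (R * R)) (T : R) (f0 : R * R -> R)
    (u : R * (R * R) -> R) (f : R -> R * R -> R) : Prop :=
  [/\ continuous_L2 T f,
      f 0 = f0 %[ae mu_Omega] &
      exists g h : R * (R * R) -> R,
        L2_V_grad T f g h /\
        forall phi phix phiy, V_grad phi phix phiy ->
        forall theta : R -> R, test_function `]0, T[%classic theta ->
          - (\int[lebesgue_measure]_(t in `]0, T[%classic)
               (derive1 theta t * L2_dot (f t) phi))
          + \int[lebesgue_measure]_(t in `]0, T[%classic)
               (theta t * (L2_dot (fun p => g (t, p)) phix +
                           L2_dot (fun p => h (t, p)) phiy))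
          = \int[lebesgue_measure]_(t in `]0, T[%classic)
               (theta t * L2_dot (fun p => \1_omega p * u (t, p)) phi)].

Definition null_controllable (omega : set (R * R)) (T : R) : Prop :=
  forall f0 : R * R -> R, f0 \in Lfun mu_Omega 2%:E ->
  exists u : R * (R * R) -> R, u \in Lfun (mu_cylinder T) 2%:E /\
  exists f : R -> R * R -> R,
    weak_solution omega T f0 u f /\ f T = cst 0 %[ae mu_Omega].

End grushin.

(* Main.v *)
(** Non-controllability. The functions [exp (- n x ^ 2 / 2) K x sin (n y)], with [K] a cutoff equal to 1 for
    [|x| < c] where [c ^ 2 / 2 > T], are eigenfunctions for the eigenvalue [n] up to [O (n exp (- n c ^ 2 / 2))].
    If [f] vanishes at time [T], the moments of [f 0] against them, times [cos (n y0)], are up to a small error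
    [c_n = \int v Im (z ^ n)] with [z = exp (t - x ^ 2 / 2 + i (y - y0))], [v] supported in the control region. Near
    [y = y0] that region lies in [|x| > b > c], so [z] stays away from [1, +oo[; the same holds for [y + y0].
    Hence the second derivative of [\sum c_n s ^ n] remains bounded as [s -> 1]. For [f 0 = x] on
    [(0, c) * (0, y0)], [n ^ 2 c_n] is close to [(1 - cos (n y0)) cos (n y0)], of mean [- 1 / 2]: it does not.

    Controllability. A mode [e] with eigenvalue [l], in the separated basis, is multiplied by [X t exp (- l t)],
    [X] a Gevrey cutoff between times [t1 > b ^ 2 / 2] and [T], and the error is corrected by the series of
    [X^(i) t exp (- l t) psi_i], [psi_i'' = (m ^ 2 x ^ 2 - l) psi_i + psi_(i-1)], with [psi_i] flat at one end
    of (-1, 1); solutions flat at the left and right ends are glued by a cutoff varying only inside [omega],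
    which produces the control. Agmon estimates for [e] and a WKB majorant bound [psi_i] in the corridor
    by [exp (l b ^ 2 / 2)], beaten by [exp (- l t1)], so the sum over the modes converges. *)
Require Import Defs.
From mathcomp Require Import measurable_realfun.
From mathcomp Require Import ring lra zify.

Set Implicit Arguments.
Unset Strict Implicit.
Unset Printing Implicit Defensive.

(** The threshold comes from the oscillator [- d^2/dx^2 + m^2 x^2]: its eigenvalues are at least
    [m], so a time [t] gains [exp (- m t)], while solutions can grow by [exp (m a^2 / 2)] from 0 to
    [a]. For the lower bound the obstacle is that [|z|] can reach [exp T]: the integral of
    [v / (1 - s z)] cannot be expanded along all of [0, 1). The power series and the integral share
    their derivatives at [s = 0], and are identified on [0, 1) by uniqueness under Cauchy estimates.
    The factor [cos (n y0)] splits [sin (n y)] into sines of [n (y - y0)] and [n (y + y0)], hence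
    two integrals; two derivatives in [s] compensate the decay [n^-2] of the moments of [f 0]. For
    the control, cutting a mode off in time leaves an error that is not supported in [omega]; each
    [psi_i] trades it for one with the next derivative of [X]. A chain flat at one end misses the
    boundary condition at the other, which forces the gluing. As [psi_i] is of size [8^i / (2 i)!]
    up to exponentials, [X] has to be of Gevrey order below 2: [exp (- 1 / t^2)] has order 3/2,
    [exp (- 1 / t)] exactly 2. *)

Section grushin_control.
Context {R : realType}.

(** * Square-integrable functions *)

Lemma eq_leW d (T : porderType d) (x y : T) : x = y -> (x <= y)%O.
Proof. by move=> ->. Qed.

Section l2.
Context d (T : measurableType d).
Variable mu : {measure set T -> \bar R}.

Definition L2 (f : T -> R) : Prop := f \in Lfun mu 2%:E.

Definition dot (f g : T -> R) : R := \int[mu]_x (f x * g x).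

(** Kept real so that ordinary arithmetic applies; [Lnorm2E] identifies it with the extended-real
    norm on square-integrable functions. *)
Definition nrm (f : T -> R) : R := Num.sqrt (dot f f).

Lemma L2_measurable f : L2 f -> measurable_fun setT f.
Proof. by rewrite /L2 inE => /andP[/[!inE]]. Qed.

Lemma L2_integrable f g : L2 f -> L2 g ->
  mu.-integrable setT (EFin \o (fun x => f x * g x)).
Proof. by move=> lf lg; exact/Lfun1_integrable/Lfun2_mul_Lfun1. Qed.

Lemma L2P (f : T -> R) : measurable_fun setT f ->
  mu.-integrable setT (EFin \o (fun x => f x ^+ 2)) -> L2 f.
Proof.
move=> mf /integrableP[_ fi]; rewrite /L2 inE/=; apply/andP; split; first by rewrite inE.
rewrite inE/= /finite_norm unlock poweR_lty//.
apply: le_lt_trans fi; apply: ge0_le_integral => //.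
- by move=> x _; rewrite poweR_ge0.
- have -> : (fun x => `|(EFin \o f) x| `^ 2)%E = (fun x => (`|f x| `^ 2)%:E).
    by apply/funext => x.
  apply/measurable_EFinP; apply: (measurableT_comp (measurable_powR 2)) => //.
  exact: measurableT_comp.
- apply: measurableT_comp => //; apply/measurable_EFinP; exact: measurable_funX.
by move=> x _ /=; rewrite lee_fin powR_mulrn// normrX.
Qed.

Lemma L2D (f g : T -> R) : L2 f -> L2 g -> L2 (fun x => f x + g x).
Proof. by move=> lf lg; apply: (Lfun_addr_closed mu (lee1n 2)).2. Qed.

Lemma L2Z a f : L2 f -> L2 (fun x => a * f x).
Proof.
move=> lf; have : L2 (fun x => f x * a) by apply: Lfun_scale lf; rewrite ler1n.
by congr L2; apply/funext => x; rewrite mulrC.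
Qed.

Lemma L2N f : L2 f -> L2 (fun x => - f x).
Proof. by move=> /(L2Z (-1)); congr L2; apply/funext => x; rewrite mulN1r. Qed.

Lemma L2B f g : L2 f -> L2 g -> L2 (fun x => f x - g x).
Proof. by move=> lf lg; apply: L2D => //; exact: L2N. Qed.

Lemma L20 : L2 (fun=> 0).
Proof. exact: (Lfun_addr_closed mu (lee1n 2)).1. Qed.

Lemma L2_sum (I : Type) (r : seq I) (P : pred I) (F : I -> T -> R) :
  (forall i, P i -> L2 (F i)) -> L2 (fun x => \sum_(i <- r | P i) F i x).
Proof.
move=> h; elim: r => [|i r IH].
  by move: L20; congr L2; apply/funext => x; rewrite big_nil.
case Pi : (P i).
  have := L2D (h _ Pi) IH; congr L2; apply/funext => x.
  by rewrite big_cons Pi.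
by move: IH; congr L2; apply/funext => x; rewrite big_cons Pi.
Qed.

Lemma dotC f g : dot f g = dot g f.
Proof. by apply: eq_Rintegral => x _; rewrite mulrC. Qed.

Lemma dotDl f g h : L2 f -> L2 g -> L2 h ->
  dot (fun x => f x + g x) h = dot f h + dot g h.
Proof.
move=> lf lg lh; rewrite /dot -RintegralD//; try exact: L2_integrable.
by apply: eq_Rintegral => x _; rewrite mulrDl.
Qed.

Lemma dotZl a f h : L2 f -> L2 h -> dot (fun x => a * f x) h = a * dot f h.
Proof.
move=> lf lh; rewrite /dot -RintegralZl//; last exact: L2_integrable.
by apply: eq_Rintegral => x _; rewrite mulrA.
Qed.

Lemma dotBl f g h : L2 f -> L2 g -> L2 h ->
  dot (fun x => f x - g x) h = dot f h - dot g h.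
Proof.
move=> lf lg lh; rewrite /dot -RintegralB//; try exact: L2_integrable.
by apply: eq_Rintegral => x _; rewrite mulrBl.
Qed.

Lemma dotDr f g h : L2 f -> L2 g -> L2 h ->
  dot h (fun x => f x + g x) = dot h f + dot h g.
Proof. by move=> *; rewrite !(dotC h); exact: dotDl. Qed.

Lemma dotBr f g h : L2 f -> L2 g -> L2 h ->
  dot h (fun x => f x - g x) = dot h f - dot h g.
Proof. by move=> *; rewrite !(dotC h); exact: dotBl. Qed.

Lemma dotZr a f h : L2 f -> L2 h -> dot h (fun x => a * f x) = a * dot h f.
Proof. by move=> *; rewrite !(dotC h); exact: dotZl. Qed.

Lemma dot0l h : dot (fun=> 0) h = 0.
Proof.
rewrite /dot (_ : (fun x => _) = (fun=> 0)); first by rewrite /Rintegral integral0.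
by apply/funext => x; rewrite mul0r.
Qed.

Lemma dot_suml (I : Type) (r : seq I) (P : pred I) (F : I -> T -> R) h :
  (forall i, P i -> L2 (F i)) -> L2 h ->
  dot (fun x => \sum_(i <- r | P i) F i x) h = \sum_(i <- r | P i) dot (F i) h.
Proof.
move=> lF lh; elim: r => [|i r IH].
  by rewrite big_nil -[RHS](dot0l h); congr dot; apply/funext => x; rewrite big_nil.
rewrite big_cons; case Pi : (P i); last first.
  by rewrite -IH; congr dot; apply/funext => x; rewrite big_cons Pi.
rewrite -IH -dotDl//; [|exact: lF|exact: L2_sum].
by congr dot; apply/funext => x; rewrite big_cons Pi.
Qed.

Lemma dot_ge0 f : 0 <= dot f f.
Proof. by apply: Rintegral_ge0 => x _; rewrite -expr2 sqr_ge0. Qed.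

Lemma nrm_ge0 f : 0 <= nrm f. Proof. exact: sqrtr_ge0. Qed.

Lemma nrm_sqr f : nrm f ^+ 2 = dot f f.
Proof. by rewrite sqr_sqrtr// dot_ge0. Qed.

Lemma dot_lin f g a b : L2 f -> L2 g ->
  dot (fun x => a * f x + b * g x) (fun x => a * f x + b * g x) =
  a ^+ 2 * dot f f + (a * b) *+ 2 * dot f g + b ^+ 2 * dot g g.
Proof.
move=> lf lg; have [la lb] := (L2Z a lf, L2Z b lg).
rewrite dotDl ?dotDr ?dotZl ?dotZr ?(dotC g f)//; try exact: L2D.
by ring.
Qed.

Lemma CauchySchwarz f g : L2 f -> L2 g -> `|dot f g| <= nrm f * nrm g.
Proof.
move=> lf lg; rewrite -sqrtrM ?dot_ge0// -sqrtr_sqr ler_wsqrtr//.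
have [gg0|gg0] := eqVneq (dot g g) 0.
  rewrite gg0 mulr0.
  have [->|fg0] := eqVneq (dot f g) 0; first by rewrite expr0n.
  (* With [dot g g = 0] the quadratic form is affine in the coefficient of [g]; this coefficient
     makes it equal to -1. *)
  have := dot_ge0 (fun x => 1 * f x + (- (dot f f + 1) / (dot f g *+ 2)) * g x).
  rewrite dot_lin// gg0 mulr0 addr0 expr1n !mul1r.
  have -> : (- (dot f f + 1) / (dot f g *+ 2)) *+ 2 * dot f g = - (dot f f + 1).
    by field.
  by lra.
have gg1 : 0 < dot g g by rewrite lt0r gg0 dot_ge0.
have := dot_ge0 (fun x => dot g g * f x + (- dot f g) * g x).
rewrite dot_lin//.
rewrite (_ : _ + _ = dot g g * (dot f f * dot g g - dot f g ^+ 2)); last by ring.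
by rewrite pmulr_rge0// subr_ge0.
Qed.

Lemma nrmD f g : L2 f -> L2 g -> nrm (fun x => f x + g x) <= nrm f + nrm g.
Proof.
move=> lf lg; rewrite -(@ler_pXn2r _ 2)// ?nnegrE ?addr_ge0 ?nrm_ge0//.
rewrite nrm_sqr.
have -> : (fun x => f x + g x) = (fun x => 1 * f x + 1 * g x).
  by apply/funext => x; rewrite !mul1r.
rewrite dot_lin// sqrrD !nrm_sqr.
have := CauchySchwarz lf lg; have := ler_norm (dot f g).
rewrite -mulr_natl; lra.
Qed.

Lemma nrmZ a f : L2 f -> nrm (fun x => a * f x) = `|a| * nrm f.
Proof.
move=> lf; rewrite /nrm dotZl//; last exact: L2Z.
by rewrite dotZr// mulrA -expr2 sqrtrM ?sqr_ge0// sqrtr_sqr.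
Qed.

Lemma nrmN f : nrm (fun x => - f x) = nrm f.
Proof.
by rewrite /nrm; congr Num.sqrt; apply: eq_Rintegral => x _; rewrite mulrNN.
Qed.

Lemma nrmBC f g : nrm (fun x => f x - g x) = nrm (fun x => g x - f x).
Proof. by rewrite -nrmN; congr nrm; apply/funext => x; rewrite opprB. Qed.

Lemma nrm_triangle f g h : L2 f -> L2 g -> L2 h ->
  nrm (fun x => f x - h x) <= nrm (fun x => f x - g x) + nrm (fun x => g x - h x).
Proof.
move=> lf lg lh; rewrite (_ : (fun x => f x - h x) =
  (fun x => (f x - g x) + (g x - h x))); last by apply/funext => x; ring.
by apply: nrmD; exact: L2B.
Qed.

Lemma nrm_sum (I : Type) (r : seq I) (P : pred I) (F : I -> T -> R) :
  (forall i, P i -> L2 (F i)) ->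
  nrm (fun x => \sum_(i <- r | P i) F i x) <= \sum_(i <- r | P i) nrm (F i).
Proof.
move=> lF; elim: r => [|i r IH].
  rewrite big_nil (_ : (fun x => _) = (fun=> 0)).
    by rewrite /nrm dot0l sqrtr0.
  by apply/funext => x; rewrite big_nil.
rewrite big_cons; case Pi : (P i); last first.
  by apply: le_trans IH; apply: eq_leW; congr nrm;
     apply/funext => x; rewrite big_cons Pi.
apply: le_trans (lerD (lexx _) IH).
rewrite (_ : (fun x => _) = (fun x => F i x + \sum_(j <- r | P j) F j x)).
  by apply: nrmD; [exact: lF|exact: L2_sum].
by apply/funext => x; rewrite big_cons Pi.
Qed.

Lemma Lnorm2E f : L2 f -> 'N[mu]_2%:E[EFin \o f]%E = (nrm f)%:E.
Proof.
move=> lf; rewrite unlock.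
have -> : (\int[mu]_x `|(EFin \o f) x| `^ 2 = (dot f f)%:E)%E.
  rewrite /dot /Rintegral fineK//.
    by apply: eq_integral => x _ /=; rewrite powR_mulrn// -normrX ger0_norm ?sqr_ge0// expr2.
  by apply: integrable_fin_num => //; exact: L2_integrable.
by rewrite poweR_EFin powR12_sqrt// dot_ge0.
Qed.

Lemma eq_dot f f' g g' : f =1 f' -> g =1 g' -> dot f g = dot f' g'.
Proof. by move=> /funext -> /funext ->. Qed.

Section finite.
Hypothesis mufin : (mu setT < +oo)%E.

Lemma bounded_integrable (f : T -> R) (C : R) : measurable_fun setT f -> (forall x, `|f x| <= C) ->
  mu.-integrable setT (EFin \o f).
Proof.
move=> mf fC; have C0 : 0 <= C by exact: le_trans (fC point).
apply: (@le_integrable _ _ _ _ _ _ _ (EFin \o cst C)) => //.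
- exact/measurable_EFinP.
- by move=> x _ /=; rewrite lee_fin [leRHS]ger0_norm.
- apply/integrableP; split; first exact/measurable_EFinP.
  rewrite (_ : (fun x => _) = (fun=> C%:E)); last first.
    by apply/funext => x /=; rewrite ger0_norm.
  by rewrite integral_cst// lte_mul_pinfty.
Qed.

Lemma L2_bounded (f : T -> R) (C : R) : measurable_fun setT f -> (forall x, `|f x| <= C) -> L2 f.
Proof.
move=> mf fC; apply: L2P => //; apply: (@bounded_integrable _ (C ^+ 2)).
  exact: measurable_funX.
by move=> x; rewrite normrX lerXn2r ?nnegrE// (le_trans _ (fC x)).
Qed.

End finite.

End l2.

Lemma cvgn_bounded_variation (a : R^nat) :
  (\sum_(0 <= k <oo) (`|a k.+1 - a k|)%:E < +oo)%E -> cvgn a.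
Proof.
move=> S; set s := (X in (X < _)%E) in S.
have s0 : (0 <= s)%E by apply: nneseries_ge0 => k _ _; rewrite lee_fin.
have sfin : s \is a fin_num by rewrite ge0_fin_numE.
have : cvgn [normed series (fun k => a k.+1 - a k)].
  apply: nondecreasing_is_cvgn.
    by apply/nondecreasing_seqP => n; rewrite /normed_series_of !seriesEnat/= big_nat_recr//= lerDl.
  exists (fine s) => _ [n _ <-]; rewrite -lee_fin fineK// /normed_series_of seriesEnat /= -sumEFin.
  by apply: nneseries_lim_ge => k _; rewrite lee_fin.
move/normed_cvg; rewrite (_ : series _ = (fun n => a n - a 0%N)); last first.
  by apply/funext => n; rewrite /series /= telescope_sumr.
move=> h; rewrite (_ : a = (fun n => (a n - a 0%N) + a 0%N)).
  by apply: is_cvgD => //; exact: is_cvg_cst.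
by apply/funext => n; rewrite subrK.
Qed.

Lemma geometric_lty (c : R) : (\sum_(0 <= k <oo) (c / 2 ^+ k)%:E < +oo)%E.
Proof.
have := @cvg_geometric_eseries_half R (2 * c) 0%N; rewrite eseriesEnat => /(cvg_lim (@ereal_hausdorff _)).
rewrite (eq_eseriesr (g := fun k => (c / 2 ^+ k)%:E)) => [->|k _]; first exact: ltry.
by rewrite natrX addn1 exprS; congr _%:E; field; rewrite expf_neq0.
Qed.

Lemma half_pow_le (c : R) m n : 0 <= c -> (m <= n)%N -> c / 2 ^+ n <= c / 2 ^+ m.
Proof. by move=> c0 mn; rewrite ler_wpM2l// lef_pV2 ?posrE ?exprn_gt0// ler_weXn2l// ler1n. Qed.

Section summable.
Context d (T : measurableType d) (mu : {measure set T -> \bar R}) (D : set T) (mD : measurable D).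

(** By monotone convergence the sum has a finite integral, hence is finite almost everywhere. With
    geometric rates this makes the extraction of subsequences unnecessary. *)
Lemma summable_ae (a : nat -> T -> R) (c : R) : (forall k, measurable_fun D (EFin \o a k)) -> (forall k x, 0 <= a k x) ->
  (forall k, \int[mu]_(x in D) (a k x)%:E <= (c / 2 ^+ k)%:E)%E ->
  {ae mu, forall x, D x -> (\sum_(0 <= k <oo) (a k x)%:E < +oo)%E}.
Proof.
move=> ma a0 ac; pose S x := (\sum_(0 <= k <oo) (a k x)%:E)%E.
have Sfin : (\int[mu]_(x in D) S x < +oo)%E.
  rewrite /S integral_nneseries//; last by move=> k x _; rewrite lee_fin.
  apply: le_lt_trans (geometric_lty c); apply: lee_nneseries => k _; last exact: ac.
  by move=> _; apply: integral_ge0 => x _; rewrite lee_fin.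
have : {ae mu, forall x, D x -> S x \is a fin_num}.
  apply: integrable_ae => //; apply/integrableP; split.
    by apply: (@ge0_emeasurable_sum _ _ _ _ (fun k x => (a k x)%:E) xpredT) => [k x _ _|k _]; [rewrite lee_fin; exact: a0|exact: ma].
  apply: le_lt_trans Sfin; apply/eq_leW/eq_integral => x _.
  by rewrite gee0_abs// /S nneseries_ge0// => k _ _; rewrite lee_fin.
by apply: filterS => x h /h; rewrite fin_numE -ltey => /andP[].
Qed.

End summable.

Section complete.
Context d (T : measurableType d).
Variable mu : {measure set T -> \bar R}.
Hypothesis mufin : (mu setT < +oo)%E.
Local Notation L2 := (L2 mu).
Local Notation nrm := (nrm mu).
Local Notation dot := (dot mu).

(** Cauchy-Schwarz against the constant 1; this is where finiteness of the measure enters the proof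
    of completeness. *)
Lemma L2_int_abs (f : T -> R) : L2 f ->
  (\int[mu]_x (`|f x|)%:E <= (nrm f * Num.sqrt (fine (mu setT)))%:E)%E.
Proof.
move=> lf; have labs : L2 (fun x => `|f x|).
  apply: L2P; first by apply: measurableT_comp => //; exact: L2_measurable lf.
  by rewrite (_ : (fun x => _ ^+ 2) = (fun x => f x ^+ 2));
    [exact: Lfun2_integrable_sqr|apply/funext => x; rewrite real_normK ?num_real].
have l1 : L2 (cst 1) by apply: (@L2_bounded _ _ _ mufin _ 1) => // x; rewrite normr1.
have -> : nrm f = nrm (fun x => `|f x|).
  rewrite /nrm; congr Num.sqrt; apply: eq_Rintegral => x _.
  by rewrite -!expr2 real_normK ?num_real.
have -> : Num.sqrt (fine (mu setT)) = nrm (cst 1).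
  rewrite /nrm; congr Num.sqrt; rewrite /dot.
  by rewrite (_ : (fun x => _) = (fun=> 1)) ?Rintegral_cst// ?mul1r//; apply/funext => x; rewrite /= mulr1.
apply: le_trans (_ : (dot (fun x => `|f x|) (cst 1))%:E <= _)%E; last first.
  by rewrite lee_fin (le_trans (ler_norm _))//; exact: CauchySchwarz.
rewrite /dot /Rintegral fineK.
  by apply: eq_leW; apply: eq_integral => x _; rewrite /= mulr1.
by apply: integrable_fin_num => //; exact: (@L2_integrable _ _ _ _ (cst 1)).
Qed.

Lemma nrm_le (f : T -> R) (C : R) : 0 <= C -> measurable_fun setT f ->
  (\int[mu]_x (f x ^+ 2)%:E <= (C ^+ 2)%:E)%E -> L2 f /\ nrm f <= C.
Proof.
move=> C0 mf fC.
have i0 : (0 <= \int[mu]_x (f x ^+ 2)%:E)%E.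
  by apply: integral_ge0 => x _; rewrite lee_fin sqr_ge0.
have lf : L2 f.
  apply: L2P => //; apply/integrableP; split.
    by apply/measurable_EFinP; exact: measurable_funX.
  apply: le_lt_trans (ltry (C ^+ 2)); apply: le_trans fC; rewrite le_eqVlt; apply/orP; left.
  by apply/eqP/eq_integral => x _; rewrite /= ger0_norm ?sqr_ge0.
split=> //; rewrite -(@ler_pXn2r _ 2)// ?nnegrE ?nrm_ge0// nrm_sqr.
rewrite -lee_fin /dot /Rintegral fineK.
  by apply: le_trans fC; apply/eq_leW/eq_integral => x _; rewrite expr2.
by apply: integrable_fin_num => //; exact: L2_integrable.
Qed.

Lemma nrm_dom (f g : T -> R) : L2 g -> measurable_fun setT f -> (forall x, `|f x| <= `|g x|) ->
  L2 f /\ nrm f <= nrm g.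
Proof.
move=> lg mf fg; apply: nrm_le => //; first exact: nrm_ge0.
rewrite nrm_sqr /dot /Rintegral fineK; last by apply: integrable_fin_num => //; exact: L2_integrable.
apply: ge0_le_integral => //.
- by move=> x _; rewrite lee_fin sqr_ge0.
- by apply/measurable_EFinP; exact: measurable_funX.
- by apply/measurable_EFinP; apply: measurable_funM; exact: L2_measurable lg.
by move=> x _; rewrite /= lee_fin -expr2 -(real_normK (num_real (f x))) -(real_normK (num_real (g x))) lerXn2r ?nnegrE.
Qed.

Lemma cauchy_half (u : nat -> T -> R) (C : R) : (forall m, L2 (u m)) -> 0 <= C ->
  (forall m, nrm (fun x => u m.+1 x - u m x) <= C / 2 ^+ m) ->
  forall m k, (m <= k)%N -> nrm (fun x => u m x - u k x) <= 2 * C / 2 ^+ m.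
Proof.
move=> lu C0 uC m k mk; rewrite -(subnKC mk); move: (k - m)%N => {mk} {}k.
suff : nrm (fun x => u m x - u (m + k)%N x) <= 2 * C / 2 ^+ m - 2 * C / 2 ^+ (m + k).
  by move=> h; apply: (le_trans h); rewrite gerBl divr_ge0// ?exprn_ge0// mulr_ge0.
elim: k => [|k IH].
  rewrite addn0 subrr (_ : (fun x => _) = (fun=> 0)) /nrm ?dot0l ?sqrtr0//.
  by apply/funext => x; rewrite subrr.
apply: (le_trans (nrm_triangle (lu m) (lu (m + k)%N) (lu _))).
apply: (le_trans (lerD IH _)).
  by rewrite addnS nrmBC; exact: uC.
rewrite addnS exprS; apply: eq_leW; field.
by rewrite !expf_neq0.
Qed.

(** Riesz-Fischer with a rate: the increments are summable almost everywhere, which gives a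
    pointwise limit, and Fatou's lemma turns the Cauchy bound into a bound on the distance to that
    limit. *)
Lemma L2_complete (u : nat -> T -> R) (C : R) : (forall m, L2 (u m)) -> 0 <= C ->
  (forall m, nrm (fun x => u m.+1 x - u m x) <= C / 2 ^+ m) ->
  exists f, L2 f /\ forall m, nrm (fun x => u m x - f x) <= 2 * C / 2 ^+ m.
Proof.
move=> lu C0 uC.
have mu_ n : measurable_fun setT (u n) by exact: L2_measurable (lu n).
(* The upper limit exists at every point and is measurable; it is the limit wherever the sequence
   converges. *)
pose f x := fine (limn_esup (fun n => (u n x)%:E)).
have mf : measurable_fun setT f.
  apply: measurableT_comp => //.
  by apply: measurable_fun_limn_esup => n; exact/measurable_EFinP.
have aeS : {ae mu, forall x, setT x -> (\sum_(0 <= k <oo) (`|u k.+1 x - u k x|)%:E < +oo)%E}.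
  apply: (@summable_ae _ _ mu setT measurableT (fun k x => `|u k.+1 x - u k x|) (C * Num.sqrt (fine (mu setT)))) => // k.
    by apply/measurable_EFinP; apply: measurableT_comp => //; exact: measurable_funB.
  apply: (le_trans (L2_int_abs (L2B (lu _) (lu _)))).
  by rewrite lee_fin mulrAC ler_wpM2r// sqrtr_ge0.
have aef : {ae mu, forall x, u n x @[n --> \oo] --> f x}.
  apply: filterS aeS => x /(_ I) Sx.
  have cu : cvgn (fun n => u n x) by exact: cvgn_bounded_variation Sx.
  have h : (u n x)%:E @[n --> \oo] --> (limn (fun n => u n x))%:E.
    by apply: cvg_comp cu _; exact: cvg_refl.
  by rewrite /f (cvg_limn_einf_sup h).
exists f; suff main m : L2 (fun x => u m x - f x) /\
    nrm (fun x => u m x - f x) <= 2 * C / 2 ^+ m.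
  split; last by move=> m; exact: (main m).2.
  move: (L2B (lu 0%N) (main 0%N).1); congr L2; apply/funext => x; ring.
have E0 : 0 <= 2 * C / 2 ^+ m by rewrite divr_ge0// ?exprn_ge0// mulr_ge0.
apply: nrm_le => //; first exact: measurable_funB.
apply: (@le_trans _ _ (\int[mu]_x limn_einf (fun k => ((u m x - u k x) ^+ 2)%:E))%E).
  apply: eq_leW; apply: ae_eq_integral => //.
  - by apply/measurable_EFinP; apply: measurable_funX; exact: measurable_funB.
  - rewrite (_ : (fun x => _) = (fun x => - limn_esup (fun k => - ((u m x - u k x) ^+ 2)%:E))%E); last first.
      by apply/funext => x; rewrite (limn_esupN (fun k => ((u m x - u k x) ^+ 2)%:E)) oppeK.
    apply: measurableT_comp => //; apply: measurable_fun_limn_esup => k.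
    apply: measurableT_comp => //.
    by apply/measurable_EFinP; apply: measurable_funX; exact: measurable_funB.
  apply: filterS aef => x ux _.
  have h : ((u m x - u k x) ^+ 2)%:E @[k --> \oo] --> ((u m x - f x) ^+ 2)%:E.
    apply: cvg_EFin; first exact: nearW.
    have h1 : (u m x - u k x) @[k --> \oo] --> u m x - f x by apply: cvgB => //; exact: cvg_cst.
    exact: (cvgM h1 h1).
  by rewrite (cvg_limn_einf_sup h).
apply: le_trans (fatou _ _ _ _) _ => //.
- by move=> k; apply/measurable_EFinP; apply: measurable_funX; exact: measurable_funB.
- by move=> k x _; rewrite lee_fin sqr_ge0.
rewrite limn_einf_lim; apply: lime_le; first exact: is_cvg_einfs.
exists m => // k /= mk; apply: le_trans (_ : _ <= \int[mu]_x ((u m x - u k x) ^+ 2)%:E)%E _.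
  by apply: ereal_inf_lbound; exists k => //=.
have lD := L2B (lu m) (lu k).
have -> : (\int[mu]_x ((u m x - u k x) ^+ 2)%:E = (nrm (fun x => u m x - u k x) ^+ 2)%:E)%E.
  rewrite nrm_sqr /dot /Rintegral fineK.
    by apply: eq_integral => x _; rewrite expr2.
  by apply: integrable_fin_num => //; exact: L2_integrable.
by rewrite lee_fin lerXn2r ?nnegrE ?nrm_ge0// cauchy_half.
Qed.

End complete.

Section mrestr_integral.
Context d (T : measurableType d).
Variable mu : {measure set T -> \bar R}.
Variables (D : set T) (mD : measurable D).

Lemma ge0_integral_mrestr (f : T -> \bar R) : measurable_fun setT f ->
  (forall x, 0 <= f x)%E ->
  (\int[mrestr mu mD]_x f x = \int[mu]_(x in D) f x)%E.
Proof.
move=> mf f0.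
have mDc : measurable (~` D) by exact: measurableC.
rewrite -(setUv D) ge0_integral_setU//; last 2 first.
- by rewrite setUv.
- by apply/disj_set2P; rewrite setICr.
rewrite [X in (_ + X)%E]null_set_integral//; last 2 first.
- exact: measurable_funS mf.
- by change (mu (~` D `&` D) = 0%E); rewrite setICl measure0.
rewrite adde0; apply: (eq_measure_integral mu) => A mA AD.
by rewrite /mrestr /=; congr (mu _); apply: setIidl.
Qed.

Lemma integral_mrestr (f : T -> \bar R) : measurable_fun setT f ->
  (\int[mrestr mu mD]_x f x = \int[mu]_(x in D) f x)%E.
Proof.
move=> mf; rewrite [LHS]integralE [RHS]integralE; congr (_ - _)%E.
  by apply: ge0_integral_mrestr => //; exact: measurable_funepos.
by apply: ge0_integral_mrestr => //; exact: measurable_funeneg.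
Qed.

Lemma Rintegral_mrestr (f : T -> R) : measurable_fun setT f ->
  \int[mrestr mu mD]_x f x = \int[mu]_(x in D) f x.
Proof. by move=> mf; congr fine; apply: integral_mrestr; exact/measurable_EFinP. Qed.

Lemma integrable_mrestr (f : T -> \bar R) : measurable_fun setT f ->
  (mrestr mu mD).-integrable setT f <-> mu.-integrable D f.
Proof.
move=> mf; have ma : measurable_fun setT (fun x => `|f x|)%E by exact: measurableT_comp.
split=> /integrableP[mf' h]; apply/integrableP; split=> //.
- exact: measurable_funS mf.
- by rewrite -integral_mrestr.
- by rewrite integral_mrestr.
Qed.

Lemma mrestr_bounded (f : T -> R) (C : R) : (mrestr mu mD setT < +oo)%E -> measurable_fun setT f -> 0 <= C ->
  (forall x, D x -> `|f x| <= C) ->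
  L2 (mrestr mu mD) f /\ nrm (mrestr mu mD) f <= C * Num.sqrt (fine (mrestr mu mD setT)).
Proof.
move=> fin mf C0 fC; have S0 := sqrtr_ge0 (fine (mrestr mu mD setT)).
apply: nrm_le; [exact: mulr_ge0|exact: mf|].
have m2 : measurable_fun setT (fun x => (f x ^+ 2)%:E) by apply/measurable_EFinP; exact: measurable_funX.
rewrite ge0_integral_mrestr//; last by move=> x; rewrite lee_fin sqr_ge0.
apply: (@le_trans _ _ (\int[mu]_(x in D) (C ^+ 2)%:E)%E).
  apply: ge0_le_integral => //; first by move=> x _; rewrite lee_fin sqr_ge0.
  - exact: measurable_funS m2.
  - by move=> x Dx; rewrite lee_fin -[leLHS]real_normK ?num_real// lerXn2r ?nnegrE ?fC.
rewrite integral_cst// exprMn sqr_sqrtr ?fine_ge0// [(_ * fine _)%:E]EFinM fineK ?ge0_fin_numE//.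
by apply: eq_leW; rewrite /mrestr setTI.
Qed.

End mrestr_integral.

(** * Smooth functions *)

Local Notation P := (R * R)%type.
Local Notation plane := (measurableTypeR R * measurableTypeR R)%type.
Local Notation space := (measurableTypeR R * plane)%type.
Local Notation mu := (@lebesgue_measure R).
Local Notation mO := (@mu_Omega R).

(** A directional derivative depends only on the restriction of the function to a line. This carries
    the chain rule from the real line to [V] and partial derivatives from the plane to slices. *)
Lemma is_derive_line {V W : normedModType R} (f : V -> R) (g : W -> R)
    x v y w (d : R) :
  (forall t : R, f (t *: v + x) = g (t *: w + y)) -> f x = g y ->
  is_derive x v f d -> is_derive y w g d.
Proof.
move=> e e0 [df E].
have E1 : (fun t : R => t^-1 *: ((f \o shift x) (t *: v) - f x)) =
          (fun t : R => t^-1 *: ((g \o shift y) (t *: w) - g y)).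
  by apply/funext => t; rewrite /= e e0.
split; first by move: df; rewrite /derivable E1.
by move: E; rewrite /derive E1.
Qed.

Section continuity.
Context {T : topologicalType}.
Implicit Types f g : T -> R.

Lemma cmul f g : continuous f -> continuous g -> continuous (fun x => f x * g x).
Proof. by move=> cf cg x; apply: cvgM; [exact: cf|exact: cg]. Qed.

Lemma cadd f g : continuous f -> continuous g -> continuous (fun x => f x + g x).
Proof. by move=> cf cg x; apply: cvgD; [exact: cf|exact: cg]. Qed.

Lemma csub f g : continuous f -> continuous g -> continuous (fun x => f x - g x).
Proof. by move=> cf cg x; apply: cvgB; [exact: cf|exact: cg]. Qed.

Lemma cscale (c : R) f : continuous f -> continuous (fun x => c * f x).
Proof. by move=> cf x; apply: cvgM; [exact: cvg_cst|exact: cf]. Qed.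

End continuity.

Lemma ctensor (a b : R -> R) : continuous a -> continuous b ->
  continuous (fun p : R * R => a p.1 * b p.2).
Proof.
move=> ca cb p; apply: cvgM; first by apply: continuous_comp; [exact: cvg_fst|exact: ca].
by apply: continuous_comp; [exact: cvg_snd|exact: cb].
Qed.

Section hasD.
Context {V : normedModType R}.
Implicit Types (f g : V -> R) (v : V).

(** A relation instead of the operator ['D_v]: derivability and the value of the derivative travel
    together, and the rules compose without side conditions. *)
Definition hasD v f g : Prop := forall x, is_derive x v f (g x).

Lemma hasD_ext v f g f' g' : f =1 f' -> g =1 g' -> hasD v f g -> hasD v f' g'.
Proof. by move=> /funext -> /funext ->. Qed.

Lemma hasDE v f g x : hasD v f g -> 'D_v f x = g x.
Proof. by move=> h; have [_] := h x. Qed.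

Lemma hasD_derivable v f g x : hasD v f g -> derivable f x v.
Proof. by move=> h; have [] := h x. Qed.

Lemma hasD_cst v (c : R) : hasD v (fun=> c) (fun=> 0).
Proof. by move=> x; exact: is_derive_cst. Qed.

Lemma hasD_add v f f' g g' : hasD v f f' -> hasD v g g' ->
  hasD v (fun x => f x + g x) (fun x => f' x + g' x).
Proof. by move=> hf hg x; have ? := hf x; have ? := hg x; exact: is_deriveD. Qed.

Lemma hasD_opp v f f' : hasD v f f' -> hasD v (fun x => - f x) (fun x => - f' x).
Proof. by move=> hf x; have ? := hf x; exact: is_deriveN. Qed.

Lemma hasD_sub v f f' g g' : hasD v f f' -> hasD v g g' ->
  hasD v (fun x => f x - g x) (fun x => f' x - g' x).
Proof. by move=> hf hg; apply: hasD_add => //; exact: hasD_opp. Qed.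

Lemma hasD_mul v f f' g g' : hasD v f f' -> hasD v g g' ->
  hasD v (fun x => f x * g x) (fun x => f' x * g x + f x * g' x).
Proof.
move=> hf hg x; have h1 := hf x; have h2 := hg x.
have h := is_deriveM h1 h2.
by apply: is_derive_eq h _; rewrite !/GRing.scale/=; ring.
Qed.

Lemma hasD_scale v f f' (c : R) : hasD v f f' ->
  hasD v (fun x => c * f x) (fun x => c * f' x).
Proof.
move=> /(hasD_mul (hasD_cst v c)); apply: hasD_ext => // x; by rewrite mul0r add0r.
Qed.

Lemma hasD_sum (I : Type) (r : seq I) (P : pred I) v (F F' : I -> V -> R) :
  (forall i, P i -> hasD v (F i) (F' i)) ->
  hasD v (fun x => \sum_(i <- r | P i) F i x) (fun x => \sum_(i <- r | P i) F' i x).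
Proof.
move=> h; elim: r => [|i r IH].
  by apply: hasD_ext (hasD_cst v 0) => x; rewrite big_nil.
case Pi : (P i).
  by apply: hasD_ext (hasD_add (h _ Pi) IH) => x; rewrite big_cons Pi.
by apply: hasD_ext IH => x; rewrite big_cons Pi.
Qed.

Lemma hasD_comp v f f' (h h' : R -> R) : hasD v f f' ->
  (forall x : R, is_derive x (1:R) h (h' x)) ->
  hasD v (fun x => h (f x)) (fun x => h' (f x) * f' x).
Proof.
move=> hf hh x.
have df1 : is_derive (0 : R) (1:R) (fun t : R => f (t *: v + x)) (f' x).
  apply: is_derive_line (hf x) => [t|]; last by rewrite scale0r add0r.
  by rewrite [_%:A]mulr1 addr0.
have hx : is_derive (f ((0:R) *: v + x)) (1:R) h (h' (f x)).
  by rewrite scale0r add0r.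
apply: is_derive_line (is_derive1_comp hx df1) => [t|] /=; last by rewrite scale0r add0r.
by rewrite [_%:A]mulr1 addr0.
Qed.

End hasD.

Local Notation D := (hasD (1:R)).

Section Cn.
Context {V : normedModType R}.
Implicit Types (f g : V -> R) (v : V).

(** The class C^n by recursion on the order. Products and compositions are then treated by induction
    on [n]; [smoothP] relates this to the sequences of directions in [smooth]. *)
Fixpoint Cn n f : Prop :=
  continuous f /\
  if n is m.+1 then forall v, exists2 g, hasD v f g & Cn m g else True.

Lemma Cn_cont n f : Cn n f -> continuous f.
Proof. by case: n => [|n] []. Qed.

Lemma CnS n f : Cn n.+1 f -> Cn n f.
Proof.
elim: n f => [|n IH] f [cf df]; split => // v.
by have [g fg /IH] := df v; exists g.
Qed.

Lemma Cn_cst n (c : R) : Cn n (fun=> c).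
Proof.
elim: n c => [|n IH] c; split => //; try exact: cst_continuous.
by move=> v; exists (fun=> 0) => //; exact: hasD_cst.
Qed.

Lemma Cn_add n f g : Cn n f -> Cn n g -> Cn n (fun x => f x + g x).
Proof.
elim: n f g => [|n IH] f g [cf df] [cg dg]; split => //.
- by move=> x; apply: cvgD; [exact: cf|exact: cg].
- by move=> x; apply: cvgD; [exact: cf|exact: cg].
move=> v; have [f' hf cf'] := df v; have [g' hg cg'] := dg v.
by exists (fun x => f' x + g' x); [exact: hasD_add|exact: IH].
Qed.

Lemma Cn_mul n f g : Cn n f -> Cn n g -> Cn n (fun x => f x * g x).
Proof.
elim: n f g => [|n IH] f g Cf Cg; move: (Cf) (Cg) => [cf df] [cg dg]; split => //.
- by move=> x; apply: cvgM; [exact: cf|exact: cg].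
- by move=> x; apply: cvgM; [exact: cf|exact: cg].
move=> v; have [f' hf cf'] := df v; have [g' hg cg'] := dg v.
exists (fun x => f' x * g x + f x * g' x); first exact: hasD_mul.
by apply: Cn_add; apply: IH => //; exact: CnS.
Qed.

Lemma Cn_sum n (I : Type) (r : seq I) (P : pred I) (F : I -> V -> R) :
  (forall i, P i -> Cn n (F i)) -> Cn n (fun x => \sum_(i <- r | P i) F i x).
Proof.
move=> h; elim: r => [|i r IH].
  by rewrite (_ : (fun x => _) = (fun=> 0)); [exact: Cn_cst|apply/funext => x; rewrite big_nil].
case Pi : (P i); rewrite (_ : (fun x => _) = (fun x => (if P i then F i x else 0) + \sum_(j <- r | P j) F j x)).
- by rewrite Pi; apply: Cn_add => //; exact: h.
- by apply/funext => x; rewrite big_cons Pi.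
- by apply: Cn_add => //; rewrite Pi; exact: Cn_cst.
- by apply/funext => x; rewrite big_cons Pi add0r.
Qed.

Lemma smoothP f : smooth f <-> forall n, Cn n f.
Proof.
split=> [sf n|Cf s].
  elim: n f sf => [|n IH] f sf; split => //; try exact: (sf [::]).1.
  move=> v; exists ('D_v f); first by move=> x; apply/derivableP/((sf [::]).2).
  apply: IH => s; have := sf (rcons s v); rewrite foldr_rcons.
  by [].
(* [foldr] differentiates first along the last direction of the sequence, hence an induction from
   that end. *)
elim/last_ind: s f Cf => [|s v IH] f Cf /=.
  split; first exact: Cn_cont (Cf 0%N).
  by move=> x v; have [_ /(_ v)[g fg _]] := Cf 1%N; exact: hasD_derivable fg.
rewrite foldr_rcons; apply: IH => n.
have [_ /(_ v)[g fg Cg]] := Cf n.+1.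
by rewrite (_ : (fun x => 'D_v f x) = g)//; apply/funext => x; exact: hasDE.
Qed.

Lemma smooth_cont f : smooth f -> continuous f.
Proof. by move=> /smoothP/(_ 0%N)/Cn_cont. Qed.

Lemma smooth_cst (c : R) : smooth (fun _ : V => c).
Proof. by apply/smoothP => n; exact: Cn_cst. Qed.

Lemma smoothD f g : smooth f -> smooth g -> smooth (fun x => f x + g x).
Proof. by move=> /smoothP sf /smoothP sg; apply/smoothP => n; exact: Cn_add. Qed.

Lemma smoothM f g : smooth f -> smooth g -> smooth (fun x => f x * g x).
Proof. by move=> /smoothP sf /smoothP sg; apply/smoothP => n; exact: Cn_mul. Qed.

Lemma smoothZ (c : R) f : smooth f -> smooth (fun x => c * f x).
Proof. by move=> sf; exact: (smoothM (smooth_cst c) sf). Qed.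

Lemma smoothN f : smooth f -> smooth (fun x => - f x).
Proof.
by move=> /(smoothZ (-1)); congr smooth; apply/funext => x; rewrite mulN1r.
Qed.

Lemma smoothB f g : smooth f -> smooth g -> smooth (fun x => f x - g x).
Proof. by move=> sf sg; exact: (smoothD sf (smoothN sg)). Qed.

Lemma smooth_sum (I : Type) (r : seq I) (P : pred I) (F : I -> V -> R) :
  (forall i, P i -> smooth (F i)) -> smooth (fun x => \sum_(i <- r | P i) F i x).
Proof. by move=> h; apply/smoothP => n; apply: Cn_sum => i /h/smoothP. Qed.

Lemma smooth_derive f v : smooth f -> smooth ('D_v f).
Proof.
move=> sf s; have := sf (rcons s v); rewrite foldr_rcons; exact.
Qed.

Lemma smooth_hasD f v : smooth f -> hasD v f ('D_v f).
Proof. by move=> sf x; apply/derivableP; exact: (sf [::]).2. Qed.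

Lemma hasD_smooth f g v : smooth f -> hasD v f g -> smooth g.
Proof.
move=> sf h; rewrite (_ : g = 'D_v f); first exact: smooth_derive.
by apply/funext => x; rewrite (hasDE _ h).
Qed.

End Cn.

Section smooth1.
Implicit Types (f g : R -> R).

Lemma D_dir f g (v : R) : D f g -> hasD v f (fun x => v * g x).
Proof.
move=> h x; have [d E] := h x.
have dif : differentiable f x by apply/derivable1_diffP.
split; first exact: diff_derivable.
by rewrite deriveE// deriv1E// derive1E E.
Qed.

Lemma Cn_seq n (F : nat -> R -> R) : (forall k, D (F k) (F k.+1)) -> forall k, Cn n (F k).
Proof.
move=> h; elim: n => [|n IH] k; split => //.
- by move=> x; apply/differentiable_continuous/derivable1_diffP; exact: hasD_derivable (h k).
- by move=> x; apply/differentiable_continuous/derivable1_diffP; exact: hasD_derivable (h k).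
move=> v; exists (fun x => v * F k.+1 x); first exact: D_dir.
by apply: Cn_mul => //; exact: Cn_cst.
Qed.

Lemma smooth_seq (F : nat -> R -> R) : (forall k, D (F k) (F k.+1)) -> smooth (F 0%N).
Proof. by move=> h; apply/smoothP => n; exact: Cn_seq. Qed.

Lemma D_cont f g : D f g -> continuous f.
Proof.
by move=> h x; apply/differentiable_continuous/derivable1_diffP; exact: hasD_derivable h.
Qed.

Lemma Cn_D n f g : D f g -> Cn n g -> Cn n.+1 f.
Proof.
move=> h Cg; split; first exact: D_cont h.
by move=> v; exists (fun x => v * g x); [exact: D_dir|apply: Cn_mul => //; exact: Cn_cst].
Qed.

Lemma D_id : D id (fun=> 1). Proof. by move=> x; exact: is_derive_id. Qed.

Lemma smooth_id : smooth (id : R -> R).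
Proof.
apply/smoothP => -[|n]; first by split=> // x.
by apply: Cn_D D_id _; exact: Cn_cst.
Qed.

Lemma smooth_exp : smooth (@expR R).
Proof. by apply: (@smooth_seq (fun=> expR)) => _ x; exact: is_derive_expR. Qed.

Lemma D_exp : D (@expR R) expR. Proof. by move=> x; exact: is_derive_expR. Qed.

Lemma D_sin : D (@sin R) cos. Proof. by move=> x; exact: is_derive_sin. Qed.

Lemma D_cos : D (@cos R) (fun x => - sin x). Proof. by move=> x; exact: is_derive_cos. Qed.

Lemma smooth_sincos : smooth (@sin R) /\ smooth (@cos R).
Proof.
suff h n : Cn n (@sin R) /\ Cn n (@cos R).
  by split; apply/smoothP => n; have [] := h n.
elim: n => [|n [IHs IHc]].
  by split; split => //; [exact: continuous_sin|exact: continuous_cos].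
split; first exact: Cn_D D_sin _.
apply: Cn_D D_cos _.
rewrite (_ : (fun x => _) = (fun x => -1 * sin x)); last by apply/funext => x; rewrite mulN1r.
by apply: Cn_mul => //; exact: Cn_cst.
Qed.

End smooth1.

Section smooth_comp.
Context {V : normedModType R}.

Lemma smooth_comp (f : V -> R) (h : R -> R) : smooth f -> smooth h ->
  smooth (fun x => h (f x)).
Proof.
move=> /smoothP sf /smoothP sh; apply/smoothP => n.
elim: n h sh => [|n IH] h sh; split => //.
- by move=> x; apply: continuous_comp; [exact: Cn_cont (sf 0%N) _|exact: Cn_cont (sh 0%N) _].
- by move=> x; apply: continuous_comp; [exact: Cn_cont (sf 0%N) _|exact: Cn_cont (sh 0%N) _].
have [_ /(_ 1)[h' hh' _]] := sh 1%N.
move=> v; have [_ /(_ v)[f' ff' Cf']] := sf n.+1.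
exists (fun x => h' (f x) * f' x); first exact: hasD_comp.
apply: Cn_mul => //; apply: IH => m.
by have /smoothP := hasD_smooth (iffRL (smoothP _) sh) hh'.
Qed.

Lemma smooth_lin (f : V -> R) (c : V -> R) : continuous f ->
  (forall v, hasD v f (fun=> c v)) -> smooth f.
Proof.
move=> cf h; apply/smoothP => -[|n]; split=> // v; exists (fun=> c v) => //.
exact: Cn_cst.
Qed.

End smooth_comp.

Lemma hasD_linear {V : normedModType R} (f : V -> R) v : (forall (t : R) x, f (t *: v + x) = t * f v + f x) -> hasD v f (fun=> f v).
Proof.
move=> lf x; have h : (fun t : R => t^-1 *: ((f \o shift x) (t *: v) - f x)) t @[t --> 0^'] --> f v.
  apply: cvg_near_cst; near=> t; rewrite /= lf addrK scalerA mulVf ?scale1r//.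
  by near: t; exact: nbhs_dnbhs_neq.
by split; [apply/cvg_ex; exists (f v)|exact: (cvg_lim (@Rhausdorff R))].
Unshelve. all: by end_near. Qed.

Lemma hasD_fst (v : P) : hasD v (fst : P -> R) (fun=> v.1).
Proof. exact: hasD_linear. Qed.

Lemma hasD_snd (v : P) : hasD v (snd : P -> R) (fun=> v.2).
Proof. exact: hasD_linear. Qed.

Lemma smooth_fst : smooth (fst : P -> R).
Proof. by apply: smooth_lin hasD_fst => x; exact: cvg_fst. Qed.

Lemma smooth_snd : smooth (snd : P -> R).
Proof. by apply: smooth_lin hasD_snd => x; exact: cvg_snd. Qed.

Definition Dx (f g : P -> R) := hasD ((1, 0) : P) f g.

Definition Dy (f g : P -> R) := hasD ((0, 1) : P) f g.

Lemma Dx_fst (f f' : R -> R) : D f f' -> Dx (fun p => f p.1) (fun p => f' p.1).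
Proof.
move=> h; apply: hasD_ext (hasD_comp (hasD_fst (1, 0)) h) => //= p; by rewrite mulr1.
Qed.

Lemma Dx_snd (f f' : R -> R) : D f f' -> Dx (fun p => f p.2) (fun=> 0).
Proof.
move=> h; apply: hasD_ext (hasD_comp (hasD_snd (1, 0)) h) => //= p; by rewrite mulr0.
Qed.

Lemma Dy_snd (f f' : R -> R) : D f f' -> Dy (fun p => f p.2) (fun p => f' p.2).
Proof.
move=> h; apply: hasD_ext (hasD_comp (hasD_snd (0, 1)) h) => //= p; by rewrite mulr1.
Qed.

Lemma Dy_fst (f f' : R -> R) : D f f' -> Dy (fun p => f p.1) (fun=> 0).
Proof.
move=> h; apply: hasD_ext (hasD_comp (hasD_fst (0, 1)) h) => //= p; by rewrite mulr0.
Qed.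

Lemma Dx_slice (F G : P -> R) y : Dx F G -> D (fun x => F (x, y)) (fun x => G (x, y)).
Proof.
move=> h x; apply: is_derive_line (h (x, y)) => // t.
have -> : t *: ((1, 0) : P) + (x, y) = (t * 1 + x, t * 0 + y) by [].
by rewrite mulr0 add0r.
Qed.

Lemma Dy_slice (F G : P -> R) x : Dy F G -> D (fun y => F (x, y)) (fun y => G (x, y)).
Proof.
move=> h y; apply: is_derive_line (h (x, y)) => // t.
have -> : t *: ((0, 1) : P) + (x, y) = (t * 0 + x, t * 1 + y) by [].
by rewrite mulr0 add0r.
Qed.

(** * Integrals *)

(** The sigma-algebra of [plane] is generated by rectangles, so an open set is written as the
    countable union of the rational boxes that it contains. *)
Lemma open_measurable_plane (A : set (R * R)) : open A -> measurable (A : set plane).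
Proof.
move=> oA.
pose box (q : (rat * rat) * (rat * rat)) : set (R * R) :=
  `]ratr q.1.1, ratr q.1.2[%classic `*` `]ratr q.2.1, ratr q.2.2[%classic.
have -> : A = \bigcup_(q in [set q | box q `<=` A]) box q.
  apply/seteqP; split=> [[x y] Axy|p [q /= qA /qA//]].
  have [e /= e0 eA] : exists2 e : R, 0 < e & ball (x, y) e `<=` A.
    by move: oA; rewrite openE => /(_ _ Axy)/nbhs_ballP.
  have lx : x - e < x by rewrite gtrBl.
  have rx : x < x + e by rewrite ltrDl.
  have ly : y - e < y by rewrite gtrBl.
  have ry : y < y + e by rewrite ltrDl.
  have [a /[!in_itv]/= /andP[a1 a2]] := rat_in_itvoo lx.
  have [b /[!in_itv]/= /andP[b1 b2]] := rat_in_itvoo rx.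
  have [c /[!in_itv]/= /andP[c1 c2]] := rat_in_itvoo ly.
  have [d /[!in_itv]/= /andP[d1 d2]] := rat_in_itvoo ry.
  exists ((a, b), (c, d)); last first.
    by split; rewrite /= in_itv/=; apply/andP.
  move=> [u v] [/= /[!in_itv]/= /andP[u1 u2] /andP[v1 v2]].
  apply: eA; split; rewrite /ball/= ltr_distl; lra.
have -> : \bigcup_(q in [set q | box q `<=` A]) box q =
    \bigcup_q (if `[< box q `<=` A >] then box q else set0).
  apply/seteqP; split=> [p [q /= qA qp]|p [q _]].
    by exists q => //; rewrite asboolT.
  by case: asboolP => // qA qp; exists q.
apply: countable_bigcupT_measurable; first exact: countableP.
move=> q; case: ifP => _; last exact: measurable0.
by apply: measurableX; exact: measurable_itv.
Qed.

Lemma continuous_measurable_plane (F : R * R -> R) : continuous F ->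
  measurable_fun setT (F : plane -> R).
Proof.
move=> cF; apply: (measurability _ (RGenOInfty.measurableE R)) => //= _ [_ [r ->] <-].
rewrite setTI; apply: open_measurable_plane.
by apply: open_comp; [move=> x _; exact: cF|exact: interval_open].
Qed.

Lemma continuous_measurable_R (f : R -> R) : continuous f ->
  measurable_fun setT (f : measurableTypeR R -> R).
Proof. by move=> cf; exact: continuous_measurable_fun. Qed.

Section Int.
Implicit Types (a b c : R) (f g F : R -> R).

(** Not an oriented integral: the interval is empty for [b < a]. Hence the hypotheses [a <= b] below
    and the two cases in [primitive]. *)
Definition Int a b f : R := \int[mu]_(x in `[a, b]) f x.

Lemma Int_integrable a b f : continuous f -> mu.-integrable `[a, b] (EFin \o f).
Proof.
move=> cf; apply: continuous_compact_integrable; first exact: segment_compact.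
exact: continuous_subspaceT.
Qed.

Lemma IntD a b f g : continuous f -> continuous g ->
  Int a b (fun x => f x + g x) = Int a b f + Int a b g.
Proof. by move=> cf cg; rewrite /Int RintegralD//; exact: Int_integrable. Qed.

Lemma IntB a b f g : continuous f -> continuous g ->
  Int a b (fun x => f x - g x) = Int a b f - Int a b g.
Proof. by move=> cf cg; rewrite /Int RintegralB//; exact: Int_integrable. Qed.

Lemma IntZ a b c f : continuous f -> Int a b (fun x => c * f x) = c * Int a b f.
Proof. by move=> cf; rewrite /Int RintegralZl//; exact: Int_integrable. Qed.

Lemma Int_le a b f g : continuous f -> continuous g ->
  (forall x, a <= x <= b -> f x <= g x) -> Int a b f <= Int a b g.
Proof.
move=> cf cg fg; apply: le_Rintegral; try exact: Int_integrable; first by [].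
by move=> x /=; rewrite in_itv/=; exact: fg.
Qed.

Lemma Int_ge0 a b f : (forall x, a <= x <= b -> 0 <= f x) -> 0 <= Int a b f.
Proof. by move=> f0; apply: Rintegral_ge0 => x /=; rewrite in_itv/=; exact: f0. Qed.

Lemma eq_Int a b f g : (forall x, a <= x <= b -> f x = g x) -> Int a b f = Int a b g.
Proof. by move=> fg; apply: eq_Rintegral => x; rewrite inE/= in_itv/=; exact: fg. Qed.

Lemma FTC a b F f : a <= b -> D F f -> continuous f -> Int a b f = F b - F a.
Proof.
rewrite le_eqVlt => /predU1P[<-|ab] h cf.
  by rewrite /Int set_itv1 Rintegral_set1 subrr.
rewrite /Int /Rintegral (continuous_FTC2 ab (F := F))//.
- exact: continuous_subspaceT.
- split.
  + by move=> x _; exact: hasD_derivable h.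
  + by apply: cvg_at_right_filter; exact: (D_cont h).
  + by apply: cvg_at_left_filter; exact: (D_cont h).
- by move=> x _; rewrite derive1E (hasDE _ h).
Qed.

Lemma Int_cst a b c : a <= b -> Int a b (fun=> c) = c * (b - a).
Proof.
move=> ab; rewrite (FTC (F := fun x => c * x) ab); [ring| |exact: cst_continuous].
by apply: hasD_ext (hasD_scale c D_id) => // x; rewrite mulr1.
Qed.

Lemma Int_abs a b f (C : R) : a <= b -> continuous f ->
  (forall x, a <= x <= b -> `|f x| <= C) -> `|Int a b f| <= C * (b - a).
Proof.
move=> ab cf fC; rewrite ler_norml; apply/andP; split.
  rewrite -mulNr -Int_cst//; apply: Int_le => //; first exact: cst_continuous.
  by move=> x /fC; rewrite ler_norml => /andP[].
rewrite -Int_cst//; apply: Int_le => //; first exact: cst_continuous.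
by move=> x /fC; rewrite ler_norml => /andP[].
Qed.

Lemma primitive_right a f x : continuous f -> a < x ->
  is_derive x (1:R) (fun y => Int a y f) (f x).
Proof.
move=> cf ax; have xx : x < x + 1 by rewrite ltrDl.
have [d E] := continuous_FTC1_closed xx (Int_integrable _ _ cf) ax (cf x).
by split; [exact: d|rewrite -derive1E; exact: E].
Qed.

Lemma Int_chasles a b c f : continuous f -> a <= b <= c ->
  Int a c f = Int a b f + Int b c f.
Proof.
move=> cf /andP[ab bc].
have h : Int a c f - Int a b f = \int[mu]_(x in `]b, c]) f x.
  rewrite /Int; apply: Rintegral_itvB => //.
  exact: Int_integrable.
have i : mu.-integrable `]b, c] (EFin \o f).
  apply: integrableS (Int_integrable b c cf) => //.
  by move=> x /=; rewrite !in_itv/= => /andP[/ltW-> ->].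
by rewrite -(subrK (Int a b f) (Int a c f)) h addrC /Int Rintegral_itv_obnd_cbnd.
Qed.

Lemma primitive c f : continuous f -> exists F, D F f /\ F c = 0.
Proof.
move=> cf.
exists (fun x => if c <= x then Int c x f else - Int x c f); split; last first.
  by rewrite lexx /Int set_itv1 Rintegral_set1.
(* A base point strictly to the left of both [c] and [x], so that the derivative of the integral is
   taken at an interior point. *)
move=> x; set a := Num.min c x - 1.
have ac : a < c by rewrite ltrBlDr (le_lt_trans (_ : _ <= c)) ?ltrDl// ge_min lexx.
have ax : a < x by rewrite ltrBlDr (le_lt_trans (_ : _ <= x)) ?ltrDl// ge_min lexx orbT.
have h : is_derive x (1:R) (fun y => Int a y f - Int a c f) (f x - 0).
  by apply: is_deriveB; [exact: primitive_right].
rewrite subr0 in h; apply: near_eq_is_derive h.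
near=> y.
have ay : a <= y by apply: ltW; near: y; exact: lt_nbhsr.
case: leP => cy.
  by rewrite (@Int_chasles a c y)// ?cy ?(ltW ac)// addrC addKr.
by rewrite (@Int_chasles a y c)// ?ay ?(ltW cy)// opprD addrA subrr add0r.
Unshelve. all: by end_near. Qed.

Lemma Int_reflect a b f : a <= b -> continuous f -> Int a b (fun x => f (a + b - x)) = Int a b f.
Proof.
move=> ab cf; have [F [dF _]] := primitive 0 cf.
have dN := hasD_sub (hasD_cst (1:R) (a + b)) (@D_id).
have d2 : D (fun x => - F (a + b - x)) (fun x => f (a + b - x)).
  by apply: hasD_ext (hasD_opp (hasD_comp dN dF)) => // x; rewrite sub0r mulrN1 opprK.
rewrite (FTC ab dF cf) (FTC ab d2); first by rewrite opprK addrK [RHS]addrC [a + b]addrC addrK addrC.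
by move=> x; apply: (continuous_comp (f := fun x => a + b - x)); [exact: D_cont dN _|exact: cf].
Qed.

Lemma Int_parts a b u u' v v' : a <= b -> D u u' -> D v v' ->
  continuous u' -> continuous v' ->
  Int a b (fun x => u x * v' x) = u b * v b - u a * v a - Int a b (fun x => u' x * v x).
Proof.
move=> ab hu hv cu cv.
rewrite -(FTC ab (hasD_mul hu hv)).
  rewrite IntD; [|exact: cmul _ (D_cont hv)|exact: cmul (D_cont hu) _].
  by rewrite addrC addKr.
exact: cadd (cmul cu (D_cont hv)) (cmul (D_cont hu) cv).
Qed.

Lemma continuous_bound (F : R -> R) (a b : R) : continuous F ->
  exists2 C, 0 <= C & forall x, a <= x <= b -> `|F x| <= C.
Proof.
move=> cF; have := continuous_compact (continuous_subspaceT cF) (@segment_compact R a b).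
move=> /compact_bounded[M [_ MP]]; exists (Num.max 0 (M + 1)); first by rewrite le_max lexx.
move=> x xab; rewrite le_max; apply/orP; right.
by apply: (MP (M + 1)); [rewrite ltrDl|exists x => //=; rewrite in_itv].
Qed.

End Int.

Section Omega.
Implicit Types F G : R * R -> R.

Lemma mu_Omega_fin : (mO setT < +oo)%E.
Proof.
rewrite /mu_Omega /= /mrestr setTI /Omega /lebesgue2 product_measure1E; try exact: measurable_itv.
change (lebesgue_measure (`](-1)%R, 1%R[%classic : set R) *
  lebesgue_measure (`]0%R, pi[%classic : set R) < +oo)%E.
rewrite !lebesgue_measure_itv /= !lte_fin.
by case: ifP => _; case: ifP => _; rewrite -?EFinB ?mule0 ?mul0e ?ltry// -EFinM ltry.
Qed.

Lemma continuous_bounded_Omega F : continuous F ->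
  exists2 C, 0 <= C & forall p, -1 <= p.1 <= 1 -> 0 <= p.2 <= pi -> `|F p| <= C.
Proof.
move=> cF; have K : compact (`[-1, 1]%classic `*` `[0, pi]%classic : set (R * R)).
  by apply: compact_setX; exact: segment_compact.
have := continuous_compact (continuous_subspaceT cF) K.
move=> /compact_bounded[M [_ MP]].
exists (`|M| + 1); first by rewrite addr_ge0.
move=> p p1 p2; apply: (MP (`|M| + 1)); first by rewrite (le_lt_trans (ler_norm _))// ltrDl.
by exists p => //; split; rewrite /= in_itv.
Qed.

Lemma Omega_itv (p : R * R) : Omega p -> (-1 <= p.1 <= 1) /\ (0 <= p.2 <= pi).
Proof.
by move=> [/= /[!in_itv]/= /andP[a b] /andP[c e]]; split; apply/andP; split; exact: ltW.
Qed.

Definition bounded_on_Omega F := exists C : R, forall p, Omega p -> `|F p| <= C.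

Lemma cont_bO F : continuous F -> bounded_on_Omega F.
Proof.
move=> /continuous_bounded_Omega[C _ h]; exists C => p /Omega_itv[]; exact: h.
Qed.

Lemma L2_Omega F : measurable_fun setT (F : plane -> R) -> bounded_on_Omega F -> L2 mO F.
Proof.
move=> mF [C FC]; have [|//] := mrestr_bounded mu_Omega_fin mF (normr_ge0 C).
by move=> p /FC h; rewrite (le_trans h)// ler_norm.
Qed.

Lemma integrable_Omega F : measurable_fun setT (F : plane -> R) -> bounded_on_Omega F ->
  mO.-integrable setT (EFin \o (F : plane -> R)).
Proof.
move=> mF bF; have l1 : L2 mO (fun=> 1) by apply: L2_Omega; [exact: measurable_cst|exists 1 => p _; rewrite normr1].
have := L2_integrable (L2_Omega mF bF) l1; congr (_.-integrable _ _).
by apply/funext => p /=; rewrite mulr1.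
Qed.

Lemma L2_cont F : continuous F -> L2 mO F.
Proof. by move=> cF; apply: L2_Omega; [exact: continuous_measurable_plane|exact: cont_bO]. Qed.

Lemma nrm_Omega F C : measurable_fun setT (F : plane -> R) -> 0 <= C ->
  (forall p, Omega p -> `|F p| <= C) -> nrm mO F <= C * Num.sqrt (fine (mO setT)).
Proof. by move=> mF C0 FC; have [] := mrestr_bounded mu_Omega_fin mF C0 FC. Qed.

Lemma integral_restr_itv a b (g : R -> R) (h : R -> \bar R) C : measurable_fun setT (g : measurableTypeR R -> R) ->
  (forall x, a < x < b -> `|g x| <= C) -> (forall x, h x = if x \in (`]a, b[%classic : set R) then (g x)%:E else 0%E) ->
  (\int[mu]_x h x)%E = (\int[mu]_(x in `]a, b[) g x)%:E.
Proof.
move=> mg gC hE; rewrite fineK.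
  rewrite [RHS]integral_mkcond; by apply: eq_integral => x _; rewrite hE.
apply: integrable_fin_num; first exact: measurable_itv.
apply: measurable_bounded_integrable; first exact: measurable_itv.
- rewrite [ltLHS](_ : _ = lebesgue_measure (`]a, b[%classic : set R))//.
  by rewrite lebesgue_measure_itv/= lte_fin; case: ifP => _; rewrite ?ltry// -EFinD ltry.
- exact: measurable_funS mg.
- exists C; split; first by rewrite num_real.
  by move=> M CM x /=; rewrite in_itv/= => /gC h'; rewrite (le_trans h')// ltW.
Qed.

Lemma Omega_restr_integrable F : measurable_fun setT (F : plane -> R) -> bounded_on_Omega F ->
  lebesgue2.-integrable setT (EFin \o ((F : plane -> R) \_ Omega)).
Proof.
move=> mF bF; rewrite -restrict_EFin; apply/integrable_restrict; [exact: measurable_Omega|exact: measurableT|].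
rewrite setTI; apply/(integrable_mrestr _ measurable_Omega); first exact/measurable_EFinP.
exact: integrable_Omega.
Qed.

Lemma int_Omega_yx F : measurable_fun setT (F : plane -> R) -> bounded_on_Omega F ->
  \int[mO]_p F p = \int[mu]_(y in `]0, pi[) \int[mu]_(x in `]-1, 1[) F (x, y).
Proof.
move=> mF bF; rewrite Rintegral_mrestr// Rintegral_mkcond /Rintegral.
rewrite -(integral21_prod_meas1 (Omega_restr_integrable mF bF)) [in RHS]integral_mkcond.
congr fine; apply: eq_integral => y _; rewrite /fubini_G [RHS]/patch; case: ifPn => yO; last first.
  rewrite integral0_eq// => x _; rewrite /= /patch; case: ifPn => //; rewrite inE => -[/= _ yO'].
  by move/negP: yO; case; rewrite inE.
rewrite inE in yO; have [C FC] := bF.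
rewrite (@integral_restr_itv (-1) 1 (fun x => F (x, y)) _ C)//.
- by apply: (measurableT_comp (f := (F : plane -> R))) => //; exact: measurable_pair2.
- by move=> x xI; apply: FC; split => //=; rewrite in_itv.
move=> x; rewrite /= /patch; have -> : ((x, y) \in (Omega : set (R * R))) = (x \in (`](-1)%R, 1%R[%classic : set R)).
  by apply/idP/idP; rewrite !inE; [case|split].
by case: ifP.
Qed.

Lemma int_Omega_xy F : measurable_fun setT (F : plane -> R) -> bounded_on_Omega F ->
  \int[mO]_p F p = \int[mu]_(x in `]-1, 1[) \int[mu]_(y in `]0, pi[) F (x, y).
Proof.
move=> mF bF; rewrite Rintegral_mrestr// Rintegral_mkcond /Rintegral.
rewrite -(integral12_prod_meas1 (Omega_restr_integrable mF bF)) [in RHS]integral_mkcond.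
congr fine; apply: eq_integral => x _; rewrite /fubini_F [RHS]/patch; case: ifPn => xO; last first.
  rewrite integral0_eq// => y _; rewrite /= /patch; case: ifPn => //; rewrite inE => -[/= xO' _].
  by move/negP: xO; case; rewrite inE.
rewrite inE in xO; have [C FC] := bF.
rewrite (@integral_restr_itv 0 pi (fun y => F (x, y)) _ C)//.
- by apply: (measurableT_comp (f := (F : plane -> R))) => //; exact: measurable_pair1.
- by move=> y yI; apply: FC; split => //=; rewrite in_itv.
move=> y; rewrite /= /patch; have -> : ((x, y) \in (Omega : set (R * R))) = (y \in (`]0%R, pi[%classic : set R)).
  by apply/idP/idP; rewrite !inE; [case|split].
by case: ifP.
Qed.

Lemma Int_oo a b (f : R -> R) : continuous f -> \int[mu]_(x in `]a, b[) f x = Int a b f.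
Proof.
move=> cf; rewrite /Int.
have i : mu.-integrable `]a, b[ (EFin \o f).
  apply: integrableS (Int_integrable a b cf) => //.
  by move=> x /=; rewrite !in_itv/= => /andP[/ltW-> /ltW->].
have i' : mu.-integrable `]a, b] (EFin \o f).
  apply: integrableS (Int_integrable a b cf) => //.
  by move=> x /=; rewrite !in_itv/= => /andP[/ltW-> ->].
by rewrite Rintegral_itv_bndo_bndc// Rintegral_itv_obnd_cbnd.
Qed.

Lemma cont_slice_x F y : continuous F -> continuous (fun x => F (x, y)).
Proof.
move=> cF x; apply: (@continuous_comp _ _ _ (fun x => (x, y)) F); last exact: cF.
move=> A /= [[U V] [/= xU yV] UVA]; apply: filterS xU => z Uz; apply: UVA; split => //.
exact: nbhs_singleton.
Qed.

Lemma cont_slice_y F x : continuous F -> continuous (fun y => F (x, y)).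
Proof.
move=> cF y; apply: (@continuous_comp _ _ _ (fun y => (x, y)) F); last exact: cF.
move=> A /= [[U V] [/= xU yV] UVA]; apply: filterS yV => z Vz; apply: UVA; split => //.
exact: nbhs_singleton.
Qed.

Lemma int_Dx0 F G : Dx F G -> continuous G ->
  (forall y, 0 <= y <= pi -> F (-1, y) = 0 /\ F (1, y) = 0) -> \int[mO]_p G p = 0.
Proof.
move=> FG cG F0; rewrite int_Omega_yx; [|exact: continuous_measurable_plane|exact: cont_bO].
rewrite (@eq_Rintegral _ _ _ mu _ (fun=> 0)); first by rewrite /Rintegral integral0.
move=> y; rewrite inE/= in_itv/= => /andP[/ltW y0 /ltW y1].
rewrite Int_oo; last exact: cont_slice_x.
rewrite (FTC (F := fun x => F (x, y))); last 3 first.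
- by lra.
- exact: Dx_slice.
- exact: cont_slice_x.
by have [-> ->] := F0 y (introT andP (conj y0 y1)); rewrite subrr.
Qed.

Lemma int_Dy0 F G : Dy F G -> continuous G ->
  (forall x, -1 <= x <= 1 -> F (x, 0) = 0 /\ F (x, pi) = 0) -> \int[mO]_p G p = 0.
Proof.
move=> FG cG F0; rewrite int_Omega_xy; [|exact: continuous_measurable_plane|exact: cont_bO].
rewrite (@eq_Rintegral _ _ _ mu _ (fun=> 0)); first by rewrite /Rintegral integral0.
move=> x; rewrite inE/= in_itv/= => /andP[/ltW x0 /ltW x1].
rewrite Int_oo; last exact: cont_slice_y.
rewrite (FTC (F := fun y => F (x, y))); last 3 first.
- exact: pi_ge0.
- exact: Dy_slice.
- exact: cont_slice_y.
by have [-> ->] := F0 x (introT andP (conj x0 x1)); rewrite subrr.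
Qed.

Lemma int_prod (a b : R -> R) : continuous a -> continuous b ->
  \int[mO]_p (a p.1 * b p.2) = Int (-1) 1 a * Int 0 pi b.
Proof.
move=> ca cb.
have cab := ctensor ca cb.
rewrite int_Omega_yx; [|exact: continuous_measurable_plane|exact: cont_bO].
rewrite -(Int_oo _ _ cb) -RintegralZl//; last first.
  apply: integrableS (Int_integrable 0 pi cb) => //.
  by move=> x /=; rewrite !in_itv/= => /andP[/ltW-> /ltW->].
apply: eq_Rintegral => y _ /=; rewrite Int_oo; last exact: (@cont_slice_x _ y cab).
rewrite mulrC -IntZ//; apply: eq_Int => x _; exact: mulrC.
Qed.

End Omega.

(** * Gevrey cutoff functions *)

Lemma pow_expR (s : R) n : 0 <= s -> s ^+ n * expR (- s) <= n`!%:R.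
Proof.
move=> s0; rewrite expRN -ler_pdivlMr ?invr_gt0 ?expR_gt0// invrK.
case: n => [|n].
  by rewrite expr0 mul1r -expR0 ler_expR.
rewrite -ler_pdivrMl ?ltr0n ?fact_gt0// mulrC.
by apply: le_trans (expR_ge1Dxn n s0); rewrite lerDr.
Qed.

Lemma pow_expR2 (s : R) i : 0 <= s -> s ^+ i * expR (- s ^+ 2) <= 2 * (uphalf i)`!%:R.
Proof.
move=> s0; have f1 : (1 : R) <= (uphalf i)`!%:R by rewrite ler1n fact_gt0.
have e1 : expR (- s ^+ 2) <= 1 by rewrite -expR0 ler_expR oppr_le0 sqr_ge0.
have [s1|/ltW s1] := leP s 1.
  apply: (@le_trans _ _ 1); last lra.
  by rewrite -[leRHS]mulr1 ler_pM ?exprn_ge0 ?expR_ge0// exprn_ile1.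
apply: (@le_trans _ _ ((s ^+ 2) ^+ (uphalf i) * expR (- s ^+ 2))).
  rewrite ler_wpM2r ?expR_ge0// -exprM ler_weXn2l//; lia.
by apply: le_trans (pow_expR _ (sqr_ge0 s)) _; lra.
Qed.

(** The weights are those of [pow_expR2]: [s ^ i * exp (- s ^ 2)] is at most [2 * (uphalf i)!] for
    [s >= 0]. *)
Definition wsum m (p : {poly R}) : R := \sum_(i < m) `|p`_i| * (2 * (uphalf i)`!%:R).

Lemma wsum_ge0 m p : 0 <= wsum m p.
Proof. by apply: sumr_ge0 => i _; rewrite mulr_ge0// mulr_ge0. Qed.

Lemma poly_expR (p : {poly R}) s m : 0 <= s -> (size p <= m)%N ->
  `|p.[s]| * expR (- s ^+ 2) <= wsum m p.
Proof.
move=> s0 pm; rewrite (horner_coef_wide _ pm).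
apply: (@le_trans _ _ ((\sum_(i < m) `|p`_i * s ^+ i|) * expR (- s ^+ 2))).
  by rewrite ler_wpM2r ?expR_ge0// ler_norm_sum.
rewrite mulr_suml; apply: ler_sum => i _.
by rewrite normrM (ger0_norm (exprn_ge0 _ s0)) -mulrA ler_wpM2l// pow_expR2.
Qed.

(** The functions [p (1 / t) exp (- 1 / t ^ 2)] are stable under differentiation, [flat_next] acting
    on [p]. The square in the exponent brings the Gevrey order down to 3/2. *)
Definition flat (p : {poly R}) (t : R) : R :=
  if 0 < t then p.[t^-1] * expR (- (t^-1) ^+ 2) else 0.

Definition flat_next (p : {poly R}) : {poly R} := (p * 'X^3) *+ 2 - p^`() * 'X^2.

Lemma flat_bound (p : {poly R}) m t : (size p <= m)%N -> `|flat p t| <= wsum m p.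
Proof.
move=> pm; rewrite /flat; case: ifP => t0.
  by rewrite normrM (ger0_norm (expR_ge0 _)) poly_expR// invr_ge0 ltW.
by rewrite normr0 wsum_ge0.
Qed.

Lemma flat_small (p : {poly R}) t : `|flat p t| <= wsum (size (p * 'X^2)%R) (p * 'X^2) * t ^+ 2.
Proof.
have [t0|t0] := ltP 0 t; last first.
  by rewrite /flat ltNge t0/= normr0 mulr_ge0 ?sqr_ge0// wsum_ge0.
have h := @flat_bound (p * 'X^2) _ t (leqnn _).
rewrite -ler_pdivrMr ?exprn_gt0//; apply: le_trans h.
have a0 : 0 <= t^-1 ^+ 2 by rewrite exprn_ge0// invr_ge0 ltW.
by rewrite /flat t0 hornerM hornerXn mulrAC [in leRHS]normrM (ger0_norm a0) exprVn.
Qed.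

Lemma flat_D (p : {poly R}) : D (flat p) (flat (flat_next p)).
Proof.
move=> t; have [t0|t0|<-] := ltgtP 0 t.
- have h : is_derive t (1:R) (fun t => p.[t^-1] * expR (- (t^-1) ^+ 2)) (flat (flat_next p) t).
    have dV : is_derive t (1:R) (fun y => y^-1) (- t ^- 2).
      have h1 : is_derive t (1:R) (id : R -> R) 1 by exact: is_derive_id.
      have h0 : id t != 0 by rewrite gt_eqF.
      by apply: is_derive_eq (is_deriveV h0 h1) _; rewrite /GRing.scale/= mulr1.
    have dp := is_derive1_comp (is_derive_poly p t^-1) dV.
    have dX : is_derive t^-1 (1:R) (fun s => - s ^+ 2) (- (t^-1 *+ 2)).
      have h2 := hasD_opp (hasD_mul (@D_id) (@D_id)).
      have h3 : is_derive t^-1 (1:R) (fun s : R => - s ^+ 2) (- (1 * t^-1 + t^-1 * 1)) := h2 t^-1.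
      apply: is_derive_eq h3 _.
      by rewrite mul1r mulr1 -mulr2n.
    have de := is_derive1_comp (is_derive_expR _) (is_derive1_comp dX dV).
    have h4 : is_derive t (1:R) (fun t => p.[t^-1] * expR (- (t^-1) ^+ 2)) _ := is_deriveM dp de.
    apply: is_derive_eq h4 _.
    rewrite /flat t0 /flat_next hornerD hornerN hornerMn (hornerM p) (hornerM p^`()) !hornerXn /GRing.scale/=.
    by rewrite !exprVn /=; field; rewrite gt_eqF.
  apply: near_eq_is_derive h; near=> s; rewrite /flat ifT//.
  by near: s; exact: lt_nbhsr.
- have h : is_derive t (1:R) (fun=> 0:R) (flat (flat_next p) t).
    by rewrite /flat ltNge (ltW t0)/=; exact: is_derive_cst.
  apply: near_eq_is_derive h; near=> s; rewrite /flat ltNge ifF//.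
  by apply/negbTE; rewrite negbK ltW//; near: s; exact: lt_nbhsl.
have e0 : flat p 0 = 0 by rewrite /flat ltxx.
set C := wsum (size (p * 'X^2)%R) (p * 'X^2).
have C0 : 0 <= C by exact: wsum_ge0.
(* At 0 the quadratic bound [flat_small] makes the difference quotient at most [C * |s|]. *)
have h : (fun s : R => s^-1 *: ((flat p \o shift 0) (s *: (1:R)) - flat p 0)) s @[s --> 0^'] --> (flat (flat_next p) 0).
  rewrite [X in _ --> X](_ : _ = 0); last by rewrite /flat ltxx.
  apply/cvgrPdist_le => e e1; near=> s.
  have s0 : s != 0 by near: s; exact: nbhs_dnbhs_neq.
  rewrite sub0r normrN /= addr0 [_ *: 1]mulr1 e0 subr0 normrM normfV.
  rewrite ler_pdivrMl ?normr_gt0//.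
  apply: (le_trans (flat_small p s)); rewrite -/C -real_normK ?num_real// expr2 mulrCA.
  rewrite ler_wpM2l//.
  have se : `|s| <= e / (C + 1).
    near: s; apply: dnbhs0_le.
    by rewrite divr_gt0// ltr_wpDl.
  apply: (le_trans (ler_wpM2l C0 se)).
  by rewrite mulrCA ler_piMr ?(ltW e1)// ler_pdivrMr ?ltr_wpDl// mul1r lerDl.
by split; [apply/cvg_ex; exists (flat (flat_next p) 0)|exact: (cvg_lim (@Rhausdorff R))].
Unshelve. all: by end_near. Qed.

Definition flat_poly n : {poly R} := iter n flat_next 1.

(** [flat_next] raises the degree by 3 with factor 2, or by 1 with the old degree, at most [3 n], as
    factor. With [j] half of the excess degree, the induction closes because
    [2 j + 3 n <= 5 (n + 1)]. *)
Definition cbound n i : R :=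
  if (n <= i <= 3 * n)%N then 5 ^+ n * n`!%:R / ((i - n)./2)`!%:R else 0.

Lemma flat_poly_coef n i : `|(flat_poly n)`_i| <= cbound n i.
Proof.
elim: n i => [|n IH] i.
  rewrite /flat_poly /= coef1 /cbound muln0 leqn0 leq0n/= subn0.
  by case: eqP => [->|_] /=; rewrite ?normr0// normr1 expr0 !fact0 divr1 mul1r.
rewrite /flat_poly iterS -/(flat_poly n) /flat_next coefB coefMn !coefMXn.
apply: (le_trans (ler_normB _ _)).
have cb0 j : (0 : R) <= cbound n j.
  by rewrite /cbound; case: ifP => // _; rewrite divr_ge0// mulr_ge0// exprn_ge0.
have T1 : `|(if (i < 3)%N then 0 else (flat_poly n)`_(i - 3)) *+ 2| <=
    (if (i < 3)%N then 0 else cbound n (i - 3)) *+ 2.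
  rewrite normrMn lerMn2r/=; case: ifP => _; first by rewrite normr0.
  exact: IH.
have T2 : `|if (i < 2)%N then 0 else (flat_poly n)^`()`_(i - 2)| <=
    (if (i < 2)%N then 0 else cbound n (i - 1) *+ (i - 1)).
  case: ifPn => i2; first by rewrite normr0.
  rewrite coef_deriv (_ : (i - 2).+1 = (i - 1)%N); last lia.
  by rewrite normrMn lerMn2r IH orbT.
apply: (le_trans (lerD T1 T2)); rewrite /cbound.
have [out|inn] := boolP ((n.+1 <= i <= 3 * n.+1)%N); last first.
  case: (ltnP i 3) => i3; case: (ltnP i 2) => i2; rewrite ?mul0rn ?addr0 ?add0r//; try lia.
    by rewrite ifF ?mul0rn//; lia.
  by rewrite [X in X *+ 2 + _]ifF ?ifF ?mul0rn ?addr0//; lia.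
set j := ((i - n.+1)./2)%N.
have E1 : (if (i < 3)%N then 0 else if (n <= i - 3 <= 3 * n)%N then
     5 ^+ n * n`!%:R / ((i - 3 - n)./2)`!%:R else 0) *+ 2 <=
     5 ^+ n * n`!%:R / j`!%:R * (2 * j)%:R :> R.
  have A0 : (0 : R) <= 5 ^+ n * n`!%:R / j`!%:R * (2 * j)%:R.
    by rewrite mulr_ge0// divr_ge0// mulr_ge0// exprn_ge0.
  case: ifPn => i3; first by rewrite mul0rn.
  case: ifPn => ii; last by rewrite mul0rn.
  have j0 : (0 < j)%N by rewrite /j; lia.
  have -> : (i - 3 - n)./2 = j.-1 by rewrite /j; lia.
  rewrite -(prednK j0) factS /= natrM invfM -[X in X *+ 2]mulr1 -mulr_natr natrM.
  apply: eq_leW; field.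
  by rewrite nat1r !pnatr_eq0 -lt0n fact_gt0.
have E2 : (if (i < 2)%N then 0 else (if (n <= i - 1 <= 3 * n)%N then
     5 ^+ n * n`!%:R / ((i - 1 - n)./2)`!%:R else 0) *+ (i - 1)) <=
     5 ^+ n * n`!%:R / j`!%:R * (3 * n)%:R :> R.
  have A0 : (0 : R) <= 5 ^+ n * n`!%:R / j`!%:R.
    by rewrite divr_ge0// mulr_ge0// exprn_ge0.
  case: ifPn => i3; first by rewrite mulr_ge0.
  case: ifPn => ii; last by rewrite mul0rn mulr_ge0.
  have -> : (i - 1 - n)./2 = j by rewrite /j; lia.
  by rewrite -mulr_natr ler_wpM2l// ler_nat; lia.
apply: (le_trans (lerD E1 E2)); rewrite -mulrDr -natrD.
rewrite factS exprS natrM -!mulrA [leRHS]mulrC -!mulrA ler_wpM2l ?exprn_ge0//.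
rewrite [leLHS]mulrCA [leRHS](_ : _ = n`!%:R * ((j`!%:R)^-1 * (5 * n.+1%:R))); last by ring.
rewrite mulrC -!mulrA ler_wpM2l// mulrC ler_wpM2l ?invr_ge0// -(natrM _ 5) ler_nat.
by rewrite /j; lia.
Qed.

Lemma flat_poly_size n : (size (flat_poly n) <= (3 * n).+1)%N.
Proof.
apply/leq_sizeP => i ni; apply/eqP; rewrite -normr_le0; apply: le_trans (flat_poly_coef _ _) _.
by rewrite /cbound ifF//; lia.
Qed.

Lemma fact_le m n : (m <= n)%N -> (m`! <= n`!)%N.
Proof.
move=> /subnK <-; elim: (n - m)%N => // k IH.
by rewrite addSn factS (leq_trans IH)// leq_pmull.
Qed.

Lemma fact_add a b : ((a + b)`! <= 2 ^ (a + b) * (a`! * b`!))%N.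
Proof.
have h := bin_fact (leq_addr b a); rewrite addKn in h.
rewrite -h leq_mul2r; apply/orP; right.
apply: leq_trans (_ : \sum_(i < (a + b).+1) 'C(a + b, i) <= _)%N.
  by rewrite (bigD1 (inord a))//= inordK ?leq_addr// ltnS leq_addr.
have := expnDn 1 1 (a + b); under eq_bigr do rewrite !exp1n muln1 muln1.
by move=> <-.
Qed.

Definition flatD n : R -> R := flat (flat_poly n).

(** The factor [80 ^ n] collects [5 ^ n] from [cbound], [4 ^ n] from splitting [(uphalf i)!] into
    [j!] and [((uphalf n).+1)!], and [4 ^ n] for the [3 n + 1] coefficients. The growth
    [n! (n / 2)!] is Gevrey of order 3/2. *)
Lemma flatD_bound n t :
  `|flatD n t| <= 4 * 80 ^+ n * n`!%:R * ((uphalf n).+1)`!%:R.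
Proof.
apply: (le_trans (flat_bound _ (flat_poly_size n))); rewrite /wsum.
apply: (@le_trans _ _ (\sum_(i < (3 * n).+1) 4 * 20 ^+ n * n`!%:R * ((uphalf n).+1)`!%:R)); last first.
  rewrite sumr_const card_ord -[leLHS]mulr_natr.
  have h : ((3 * n).+1%:R <= 4 ^+ n :> R).
    rewrite -natrX ler_nat; elim: n => // n IH; rewrite expnS; lia.
  rewrite (_ : (80 : R) = 4 * 20); last by ring.
  rewrite exprMn [leRHS](_ : _ = 4 * 20 ^+ n * n`!%:R * (uphalf n).+1`!%:R * 4 ^+ n); last by ring.
  by rewrite ler_wpM2l// !mulr_ge0// exprn_ge0.
apply: ler_sum => i _.
apply: (le_trans (ler_wpM2r _ (flat_poly_coef n i))); first by rewrite mulr_ge0.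
rewrite /cbound; case: ifPn => [ni|_]; last first.
  by rewrite mul0r !mulr_ge0// exprn_ge0.
set j := ((i - n)./2)%N.
have h : ((uphalf i)`!%:R <= 2 * 4 ^+ n * (j`!%:R * ((uphalf n).+1)`!%:R) :> R).
  apply: (@le_trans _ _ ((j + (uphalf n).+1)`!%:R)).
    by rewrite ler_nat; apply: fact_le; rewrite /j; lia.
  apply: (@le_trans _ _ ((2 ^ (j + (uphalf n).+1) * (j`! * ((uphalf n).+1)`!))%:R)).
    by rewrite ler_nat fact_add.
  rewrite natrM natrM ler_wpM2r//.
  rewrite (_ : (2 * 4 ^+ n : R) = (2 ^ (2 * n).+1)%:R); last first.
    by rewrite expnS expnM natrM natrX.
  rewrite ler_nat leq_exp2l//.
  by rewrite /j; have := ltn_ord i; lia.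
have A : (0 : R) <= 5 ^+ n * n`!%:R / j`!%:R * 2.
  by rewrite mulr_ge0// divr_ge0// mulr_ge0// exprn_ge0.
rewrite mulrA; apply: (le_trans (ler_wpM2l A h)).
rewrite (_ : (20 : R) = 5 * 4); last by ring.
rewrite exprMn; apply: eq_leW; field.
by rewrite pnatr_eq0 -lt0n fact_gt0.
Qed.

Lemma flatD_D n : D (flatD n) (flatD n.+1). Proof. exact: flat_D. Qed.

Lemma flatD0_gt0 t : 0 < t -> 0 < flatD 0 t.
Proof. by move=> t0; rewrite /flatD /flat t0 /= hornerC mul1r expR_gt0. Qed.

Lemma flatD_le0 n t : t <= 0 -> flatD n t = 0.
Proof. by move=> t0; rewrite /flatD /flat ltNge t0. Qed.

Lemma leibniz (F G : nat -> R -> R) : (forall n, D (F n) (F n.+1)) ->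
  (forall n, D (G n) (G n.+1)) -> forall n,
  D (fun t => \sum_(k < n.+1) 'C(n, k)%:R * (F k t * G (n - k)%N t))
    (fun t => \sum_(k < n.+2) 'C(n.+1, k)%:R * (F k t * G (n.+1 - k)%N t)).
Proof.
move=> hF hG n.
have h (k : 'I_n.+1) : D (fun t => 'C(n, k)%:R * (F k t * G (n - k)%N t))
   (fun t => 'C(n, k)%:R * (F k.+1 t * G (n - k)%N t + F k t * G (n - k).+1 t)).
  by apply: hasD_scale; apply: hasD_mul.
have hs := @hasD_sum _ _ (index_enum 'I_n.+1) xpredT _ _ _ (fun k _ => h k).
apply: hasD_ext hs => // t.
under eq_bigr do rewrite mulrDr.
rewrite big_split /= [RHS]big_ord_recl /= bin0 subn0.
under [in RHS]eq_bigr => k _ do rewrite /bump /= add1n subSS binS natrD mulrDl.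
rewrite big_split /= addrA addrC; congr (_ + _).
rewrite [in RHS]big_ord_recr /= bin_small// mul0r addr0 big_ord_recl /= bin0 subn0.
congr (_ + _); apply: eq_bigr => k _; rewrite /bump /= add1n.
by rewrite subnSK.
Qed.

(** The ratio of two terms with indices [n + 2] and [n] is of order [L ^ 2 / n], hence at most 1
    from some [N] on. Steps of two are natural, since [uphalf] increases once every two steps. *)
Lemma fact_growth (L : R) : 0 <= L ->
  exists C : R, forall n, (uphalf n + 3)`!%:R * L ^+ n <= C * n`!%:R.
Proof.
move=> L0; pose r n : R := (uphalf n + 3)`!%:R * L ^+ n / n`!%:R.
have r0 n : 0 <= r n by rewrite divr_ge0// mulr_ge0// exprn_ge0.
pose N := Num.bound (5 * L ^+ 2).
have NL : 5 * L ^+ 2 < N%:R.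
  by apply: archi_boundP; rewrite mulr_ge0// sqr_ge0.
have step n : (N <= n)%N -> r n.+2 <= r n.
  move=> Nn; rewrite /r /= (_ : ((uphalf n).+1 + 3)%N = (uphalf n + 3).+1)//.
  rewrite factS (factS n.+1) (factS n) !natrM !exprS.
  rewrite (_ : _ * _ / _ = ((uphalf n + 3)`!%:R * L ^+ n / n`!%:R) *
     ((uphalf n + 3).+1%:R * L ^+ 2 / (n.+2%:R * n.+1%:R))); last first.
    by rewrite !invfM; ring.
  rewrite ler_piMr ?r0// ler_pdivrMr ?mulr_gt0// mul1r.
  have h : (uphalf n + 3).+1%:R <= 5 * n.+2%:R / 2 :> R.
    by rewrite ler_pdivlMr// -!natrM ler_nat; lia.
  apply: (le_trans (ler_wpM2r (sqr_ge0 L) h)).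
  have h2 : 5 * L ^+ 2 <= n.+1%:R.
    by rewrite (le_trans (ltW NL))// ler_nat (leq_trans Nn).
  have n0 : (0 : R) <= n.+2%:R by [].
  nra.
pose C := \sum_(i < N.+2) r i.
exists C => n; rewrite -ler_pdivrMr ?ltr0n ?fact_gt0// -/(r n).
elim/ltn_ind: n => n IH; have [nN|Nn] := ltnP n N.+2.
  by rewrite /C (bigD1 (Ordinal nN))//= lerDl sumr_ge0.
case: n Nn IH => [|[|n]]// Nn IH.
by apply: (le_trans (step n _)); [lia|apply: IH].
Qed.

(** The normalized primitive of the bump [flat (t - t1) * flat (t2 - t)], whose derivatives are
    estimated by the Leibniz formula. The last clause, with every [L], says that the Gevrey order is
    below 2 as the correction series requires. *)
Lemma gevrey_cutoff (t1 t2 : R) : t1 < t2 -> exists X : nat -> R -> R,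
  [/\ forall n, D (X n) (X n.+1), forall t, t <= t1 -> X 0%N t = 1,
      forall t, t2 <= t -> X 0%N t = 0, forall t, 0 <= X 0%N t <= 1 &
  (forall n t, (t <= t1) || (t2 <= t) -> X n.+1 t = 0) /\
  exists M : nat -> R, (forall n t, `|X n t| <= M n) /\
    forall L : R, 0 <= L -> exists C : R, forall n, M n * L ^+ n <= C * (2 * n)`!%:R].
Proof.
move=> t12.
pose F n t := flatD n (t - t1).
pose G n t := (-1) ^+ n * flatD n (t2 - t).
have hF n : D (F n) (F n.+1).
  have h := hasD_comp (hasD_sub (@D_id) (hasD_cst (1:R) t1)) (flatD_D n).
  by apply: hasD_ext h => // t; rewrite subr0 mulr1.
have hG n : D (G n) (G n.+1).
  have h := hasD_scale ((-1) ^+ n) (hasD_comp (hasD_sub (hasD_cst (1:R) t2) (@D_id)) (flatD_D n)).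
  by apply: hasD_ext h => // t; rewrite sub0r /G exprS; ring.
pose B n t := \sum_(k < n.+1) 'C(n, k)%:R * (F k t * G (n - k)%N t).
have hB n : D (B n) (B n.+1) by exact: leibniz.
have B0 n t : (t <= t1) || (t2 <= t) -> B n t = 0.
  move=> /orP[h|h]; apply: big1 => k _.
    by rewrite /F flatD_le0 ?mul0r ?mulr0// subr_le0.
  by rewrite /G flatD_le0 ?mulr0// subr_le0.
have [P [hP _]] := primitive t1 (D_cont (hB 0%N)).
have B0ge t : 0 <= B 0%N t.
  rewrite /B big_ord1 bin0 mul1r /F /G expr0 mul1r.
  by rewrite mulr_ge0// /flatD /flat; case: ifP => // ?; rewrite mulr_ge0 ?expR_ge0//= hornerC.
have mono x y : x <= y -> P x <= P y.
  by move=> xy; rewrite -subr_ge0 -(FTC xy hP (D_cont (hB 0%N))) Int_ge0.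
have left t : t <= t1 -> P t = P t1.
  move=> h; apply/eqP; rewrite eq_sym -subr_eq0 -(FTC h hP (D_cont (hB 0%N))).
  by rewrite (@eq_Int _ _ _ (fun=> 0)) ?Int_cst ?mul0r// => x /andP[_ xt]; rewrite B0// xt.
have right t : t2 <= t -> P t = P t2.
  move=> h; apply/eqP; rewrite -subr_eq0 -(FTC h hP (D_cont (hB 0%N))).
  by rewrite (@eq_Int _ _ _ (fun=> 0)) ?Int_cst ?mul0r// => x /andP[xt _]; rewrite B0// xt orbT.
pose c := P t2 - P t1.
have c0 : 0 < c.
  have [||x /[!in_itv]/= /andP[x1 x2] E] := @MVT _ P (B 0%N) t1 t2 t12.
  - by move=> x _; exact: hP.
  - by apply: continuous_subspaceT; exact: D_cont hP.
  rewrite /c E mulr_gt0 ?subr_gt0// /B big_ord1 bin0 mul1r /F /G expr0 mul1r.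
  by rewrite mulr_gt0// flatD0_gt0// subr_gt0.
pose X n t := if n is m.+1 then - c^-1 * B m t else c^-1 * (P t2 - P t).
pose M n := if n is m.+1 then c^-1 * (16 * 80 ^+ m * (m.+1)%:R * m`!%:R * (uphalf m + 3)`!%:R) else 1.
have X01 t : 0 <= X 0%N t <= 1.
  rewrite /X mulrC; apply/andP; split; last first.
    rewrite ler_pdivrMr// mul1r /c lerD2l lerN2.
    by have [/left->//|/ltW/mono//] := leP t t1.
  rewrite divr_ge0 ?(ltW c0)// subr_ge0.
  by have [/right->//|/ltW/mono//] := leP t2 t.
exists X; split => //.
- case=> [|n] /=.
    apply: hasD_ext (hasD_scale c^-1 (hasD_sub (hasD_cst (1:R) (P t2)) hP)) => // t.
    by rewrite sub0r /X mulrN mulNr.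
  exact: hasD_scale.
- by move=> t /left; rewrite /X => ->; rewrite mulVf// gt_eqF.
- by move=> t /right; rewrite /X => ->; rewrite subrr mulr0.
split; first by move=> n t h; rewrite /X B0// mulr0.
exists M; split.
  case=> [|m] t; first by have /andP[? ?] := X01 t; rewrite ger0_norm.
  rewrite /X /M normrM normrN (ger0_norm (_ : 0 <= c^-1)) ?invr_ge0 ?(ltW c0)//.
  rewrite ler_wpM2l ?invr_ge0 ?(ltW c0)//.
  apply: (le_trans (ler_norm_sum _ _ _)).
  apply: (@le_trans _ _ (\sum_(k < m.+1) 16 * 80 ^+ m * m`!%:R * (uphalf m + 3)`!%:R)); last first.
    rewrite sumr_const card_ord -[leLHS]mulr_natr; apply: eq_leW; ring.
  apply: ler_sum => k _.
  have km : (k <= m)%N by rewrite -ltnS.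
  rewrite normrM normr_nat normrM.
  have G1 : `|G (m - k)%N t| <= 4 * 80 ^+ (m - k) * (m - k)`!%:R * ((uphalf (m - k)).+1)`!%:R.
    by rewrite /G normrM normrX normrN1 expr1n mul1r flatD_bound.
  apply: (@le_trans _ _ ('C(m, k)%:R * ((4 * 80 ^+ k * k`!%:R * ((uphalf k).+1)`!%:R) *
    (4 * 80 ^+ (m - k) * (m - k)`!%:R * ((uphalf (m - k)).+1)`!%:R)))).
    by rewrite ler_wpM2l// ler_pM// flatD_bound.
  have -> : (80 : R) ^+ m = 80 ^+ k * 80 ^+ (m - k) by rewrite -exprD subnKC.
  have -> : m`!%:R = 'C(m, k)%:R * (k`!%:R * (m - k)`!%:R) :> R.
    by rewrite -!natrM bin_fact.
  have h : (((uphalf k).+1)`! * ((uphalf (m - k)).+1)`! <= (uphalf m + 3)`!)%N.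
    apply: (@leq_trans ((uphalf k).+1 + (uphalf (m - k)).+1)`!); last by apply: fact_le; lia.
    have hh := bin_fact (leq_addr (uphalf (m - k)).+1 (uphalf k).+1); rewrite addKn in hh.
    by rewrite -hh leq_pmull// bin_gt0 leq_addr.
  have h' : ((uphalf k).+1)`!%:R * ((uphalf (m - k)).+1)`!%:R <= (uphalf m + 3)`!%:R :> R.
    by rewrite -natrM ler_nat.
  set A := 'C(m, k)%:R; set a := 80 ^+ k; set b := 80 ^+ (m - k).
  rewrite (_ : _ * _ = (16 * (a * b) * (A * (k`!%:R * (m - k)`!%:R))) *
     (((uphalf k).+1)`!%:R * ((uphalf (m - k)).+1)`!%:R)); last by ring.
  by rewrite ler_wpM2l// !mulr_ge0// exprn_ge0.
move=> L L0.
have [C HC] := @fact_growth (160 * L) (mulr_ge0 (ler0n _ _) L0).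
have C0 : 0 <= C.
  by have := HC 0%N; rewrite expr0 !mulr1; apply: le_trans.
exists (1 + c^-1 * 16 * L * C); case=> [|m].
  rewrite /M expr0 muln0 fact0 !mulr1 lerDl !mulr_ge0// invr_ge0 ltW//.
apply: (@le_trans _ _ (c^-1 * 16 * L * C * (2 * m.+1)`!%:R)); last first.
  by rewrite ler_wpM2r// lerDr.
have E : M m.+1 * L ^+ m.+1 <= c^-1 * 16 * L * m`!%:R * (m.+1)%:R * ((uphalf m + 3)`!%:R * (160 * L) ^+ m).
  rewrite /M exprS exprMn.
  have h80 : (80 : R) ^+ m <= 160 ^+ m by rewrite lerXn2r ?nnegrE ?ler0n// ler_nat.
  rewrite [leLHS](_ : _ = c^-1 * 16 * L * m`!%:R * m.+1%:R * ((uphalf m + 3)`!%:R * L ^+ m) * 80 ^+ m); last by ring.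
  rewrite [leRHS](_ : _ = c^-1 * 16 * L * m`!%:R * m.+1%:R * ((uphalf m + 3)`!%:R * L ^+ m) * 160 ^+ m); last by ring.
  by rewrite ler_wpM2l// !mulr_ge0 ?exprn_ge0// invr_ge0 ltW.
apply: (le_trans E).
have c1 : 0 <= c^-1 * 16 * L * m`!%:R * m.+1%:R by rewrite !mulr_ge0// invr_ge0 ltW.
apply: (le_trans (ler_wpM2l c1 (HC m))).
rewrite [leLHS](_ : _ = c^-1 * 16 * L * C * (m`! * (m.+1 * m`!))%:R); last by rewrite !natrM; ring.
rewrite ler_wpM2l; [by []|by rewrite !mulr_ge0// invr_ge0 ltW|].
rewrite ler_nat -factS; apply: (@leq_trans (m + m.+1)`!); last by apply: fact_le; lia.
have hh := bin_fact (leq_addr m.+1 m); rewrite addKn in hh.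
by rewrite -hh leq_pmull// bin_gt0 leq_addr.
Qed.

Lemma smooth_step : exists S S' : R -> R, [/\ smooth S, D S S', forall t, t <= 1 -> S t = 0,
   forall t, 2 <= t -> S t = 1 & (forall t, 0 <= S t <= 1) /\
   ((forall t, (t <= 1) || (2 <= t) -> S' t = 0) /\ exists C : R, forall t, `|S' t| <= C)].
Proof.
have h12 : (1 : R) < 2 by rewrite ltr1n.
have [X [hX X1 X0 X01 [Xn [M [XM _]]]]] := gevrey_cutoff h12.
exists (fun t => 1 - X 0%N t), (fun t => - X 1%N t); split.
- apply: smoothB; first exact: smooth_cst.
  exact: smooth_seq.
- by apply: hasD_ext (hasD_sub (hasD_cst (1:R) (1:R)) (hX 0%N)) => // t; rewrite sub0r.
- by move=> t /X1 ->; rewrite subrr.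
- by move=> t /X0 ->; rewrite subr0.
split; first by move=> t; have := X01 t; lra.
split; first by move=> t /Xn ->; rewrite oppr0.
by exists (M 1%N) => t; rewrite normrN.
Qed.

(** * The energy space *)

Section V.
Implicit Types (F f g h w : P -> R).

Lemma smooth_dx F : smooth F -> Dx F (dx F).
Proof. by move=> sF; exact: smooth_hasD. Qed.

Lemma smooth_dy F : smooth F -> Dy F ('D_((0, 1) : P) F).
Proof. by move=> sF; exact: smooth_hasD. Qed.

Lemma L2_dist_nrm f g : L2 mO f -> L2 mO g -> L2_dist f g = (nrm mO (fun p => f p - g p))%:E.
Proof. by move=> lf lg; exact: (Lnorm2E (L2B lf lg)). Qed.

Lemma L2_dist_cvg (T : Type) (U : set_system T) {FU : Filter U} (F : T -> P -> R) f :
  L2 mO f -> (\forall t \near U, L2 mO (F t)) ->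
  (L2_dist (F t) f @[t --> U] --> 0%E <-> nrm mO (fun p => F t p - f p) @[t --> U] --> 0).
Proof.
move=> lf lF; split=> h.
  have : fine (L2_dist (F t) f) @[t --> U] --> 0 by exact: fine_cvg h.
  apply: cvg_trans; apply: near_eq_cvg; near=> t.
  by rewrite L2_dist_nrm//; near: t.
have : (nrm mO (fun p => F t p - f p))%:E @[t --> U] --> 0%E by apply: cvg_EFin => //; exact: nearW.
apply: cvg_trans; apply: near_eq_cvg; near=> t.
by rewrite L2_dist_nrm//; near: t.
Unshelve. all: by end_near. Qed.

Lemma dominated_nrm (F : nat -> P -> R) f (C : R) :
  (forall n, measurable_fun setT (F n : plane -> R)) -> measurable_fun setT (f : plane -> R) ->
  (forall n p, Omega p -> `|F n p - f p| <= C) ->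
  (forall p, Omega p -> F n p @[n --> \oo] --> f p) ->
  nrm mO (fun p => F n p - f p) @[n --> \oo] --> 0.
Proof.
move=> mF mf bF cF.
have mD n : measurable_fun setT ((fun p => F n p - f p) : plane -> R) by exact: measurable_funB.
have mD2 n : measurable_fun setT ((fun p => (F n p - f p) * (F n p - f p)) : plane -> R).
  exact: measurable_funM.
suff : dot mO (fun p => F n p - f p) (fun p => F n p - f p) @[n --> \oo] --> 0.
  move=> h; rewrite -(@sqrtr0 R) /nrm.
  by apply: (cvg_comp _ _ h); exact: sqrt_continuous.
rewrite /dot; under eq_fun do rewrite Rintegral_mrestr//.
rewrite /Rintegral.
apply: fine_cvg; rewrite (_ : 0%:E = \int[lebesgue2]_(p in (Omega : set plane)) 0%E)%E; last first.
  by rewrite integral0.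
apply: (@dominated_cvg _ _ _ lebesgue2 (Omega : set plane) (measurable_Omega (R := R)) _ _ (fun=> (C ^+ 2)%:E)) => //.
- by move=> n; apply/measurable_EFinP; exact: measurable_funS (mD2 n).
- move=> p Op; apply: cvg_EFin; first exact: nearW.
  have h1 : F n p - f p @[n --> \oo] --> f p - f p by apply: cvgB; [exact: cF|exact: cvg_cst].
  by rewrite subrr in h1; have := cvgM h1 h1; rewrite mulr0; exact.
- apply/(integrable_mrestr (lebesgue2 (R := R)) (measurable_Omega (R := R))) => //.
  by apply: (@integrable_Omega (fun=> C ^+ 2)) => //; exists `|C ^+ 2|.
- move=> n p Op; rewrite /= lee_fin -expr2 normrX.
  by rewrite lerXn2r ?nnegrE ?bF// (le_trans _ (bF n _ Op)).
Qed.

Lemma V_grad_L2 f g h : V_grad f g h -> [/\ L2 mO f, L2 mO g & L2 mO h].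
Proof. by case. Qed.

Lemma test_function_out (D : set P) F p : test_function D F -> ~ D p -> F p = 0.
Proof.
move=> [_ _ sD] nD; apply: contrapT => Fp; apply: nD; apply: sD.
by apply: subset_closure; apply/eqP.
Qed.

Lemma dot_cvg (T : Type) (U : set_system T) {FU : Filter U} (F : T -> P -> R) f w :
  (forall t, L2 mO (F t)) -> L2 mO f -> L2 mO w ->
  nrm mO (fun p => F t p - f p) @[t --> U] --> 0 ->
  dot mO (F t) w @[t --> U] --> dot mO f w.
Proof.
move=> lF lf lw h; apply/cvgrPdist_le => e e0.
have e1 : 0 < e / (nrm mO w + 1) by rewrite divr_gt0// ltr_wpDl ?nrm_ge0.
move/cvgrPdist_le : h => /(_ _ e1); apply: filterS => t.
rewrite sub0r normrN (ger0_norm (nrm_ge0 _ _)) => h.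
rewrite distrC -dotBl//.
apply: (le_trans (CauchySchwarz (L2B (lF t) lf) lw)).
apply: (le_trans (ler_wpM2r (nrm_ge0 _ _) h)).
by rewrite mulrAC ler_pdivrMr ?ltr_wpDl ?nrm_ge0// ler_wpM2l ?(ltW e0)// lerDl.
Qed.

(** The parts formula is proved for the test functions approximating [f], which kill the boundary
    terms, and all three pairings pass to the limit. *)
Lemma V_parts f g h w wx wxx wy wyy : V_grad f g h ->
  Dx w wx -> Dx wx wxx -> Dy w wy -> Dy wy wyy ->
  continuous wx -> continuous wxx -> continuous wy -> continuous wyy ->
  dot mO g wx + dot mO h (fun p => p.1 * wy p) =
  dot mO f (fun p => - (wxx p + p.1 ^+ 2 * wyy p)).
Proof.
move=> [lf lg lh [phi [tphi cf cg ch]]] h1 h2 h3 h4 c1 c2 c3 c4.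
have cfst : continuous (fst : P -> R) by move=> p; exact: cvg_fst.
have sphi n : smooth (phi n) by case: (tphi n).
have cphi n : continuous (phi n) by exact: smooth_cont.
have cdx n : continuous (dx (phi n)) by apply: smooth_cont; exact: smooth_derive.
have cdy n : continuous ('D_((0, 1) : P) (phi n)) by apply: smooth_cont; exact: smooth_derive.
have cxdy n : continuous (xdy (phi n)) by apply: cmul.
have cxwy : continuous (fun p : P => p.1 * wy p) by exact: cmul.
have cx2 : continuous (fun p : P => p.1 ^+ 2 * wyy p).
  by apply: cmul => //; exact: cmul.
have cL : continuous (fun p : P => - (wxx p + p.1 ^+ 2 * wyy p)).
  by move=> p; apply: cvgN; exact: (cadd c2 cx2).
have main n : dot mO (dx (phi n)) wx + dot mO (xdy (phi n)) (fun p => p.1 * wy p) =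
    dot mO (phi n) (fun p => - (wxx p + p.1 ^+ 2 * wyy p)).
  have out p : ~ Omega p -> phi n p = 0 by exact: test_function_out.
  have ex : dot mO (dx (phi n)) wx = - dot mO (phi n) wxx.
    apply/eqP; rewrite -addr_eq0 /dot -RintegralD//; try by apply: L2_integrable; exact: L2_cont.
    apply/eqP; apply: (int_Dx0 (hasD_mul (smooth_dx (sphi n)) h2)).
      by apply: cadd; apply: cmul.
    by move=> y _; rewrite !out ?mul0r// => -[/=]; rewrite in_itv/= ?ltxx ?andbF.
  have ey : dot mO (xdy (phi n)) (fun p => p.1 * wy p) = - dot mO (phi n) (fun p => p.1 ^+ 2 * wyy p).
    apply/eqP; rewrite -addr_eq0 /dot -RintegralD//; try by apply: L2_integrable; exact: L2_cont.
    have hy : Dy (fun p : P => p.1 ^+ 2) (fun=> 0).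
      by apply: (@Dy_fst (fun x => x ^+ 2) (fun x => 1 * x + x * 1)); exact: hasD_mul (@D_id) (@D_id).
    have H := hasD_mul (smooth_dy (sphi n)) (hasD_mul hy h4).
    apply/eqP; rewrite -[RHS](int_Dy0 H).
    - by apply: eq_Rintegral => p _; rewrite /xdy; ring.
    - apply: cadd; first by apply: cmul => //; apply: cmul => //; exact: cmul.
      apply: cmul => //; apply: cadd => //.
      by apply: cmul => // p; exact: cvg_cst.
    - by move=> x _; rewrite !out ?mul0r// => -[_ /=]; rewrite in_itv/= ?ltxx ?andbF.
  rewrite ex ey -opprD -dotDr//; try exact: L2_cont.
  rewrite -[LHS]mulN1r -dotZr; try exact: L2_cont; last first.
    by apply: L2_cont; exact: cadd.
  by apply: eq_dot => // p; rewrite mulN1r.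
have nn (F : nat -> P -> R) f' : (forall n, continuous (F n)) -> L2 mO f' ->
    L2_dist (F n) f' @[n --> \oo] --> 0%E -> nrm mO (fun p => F n p - f' p) @[n --> \oo] --> 0.
  by move=> cF lf' H; apply/L2_dist_cvg => //; apply: nearW => n; exact: L2_cont.
have FF : Filter (\oo : set_system nat) by exact: _.
have l1 := @dot_cvg _ _ FF (fun n => dx (phi n)) g wx (fun n => L2_cont (cdx n)) lg (L2_cont c1) (nn _ _ cdx lg cg).
have l2 := @dot_cvg _ _ FF (fun n => xdy (phi n)) h _ (fun n => L2_cont (cxdy n)) lh (L2_cont cxwy) (nn _ _ cxdy lh ch).
have l3 := @dot_cvg _ _ FF phi f _ (fun n => L2_cont (cphi n)) lf (L2_cont cL) (nn _ _ cphi lf cf).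
have l12 := @cvgD _ _ _ _ FF _ _ _ _ l1 l2.
have l3' : (fun n => dot mO (dx (phi n)) wx + dot mO (xdy (phi n)) (fun p => p.1 * wy p)) n @[n --> \oo] -->
    dot mO f (fun p => - (wxx p + p.1 ^+ 2 * wyy p)).
  by under eq_fun do rewrite main; exact: l3.
have E1 := cvg_lim (@Rhausdorff R) l12.
have E2 := cvg_lim (@Rhausdorff R) l3'.
by rewrite -E1 -[RHS]E2.
Qed.

Lemma compact_test {W : normedModType R} (D K : set W) (F : W -> R) : smooth F -> compact K -> K `<=` D ->
  (forall x, F x != 0 -> K x) -> test_function D F.
Proof.
move=> sF cK KD out; have sK : closure [set x | F x != 0] `<=` K.
  have := closure_subset (A := [set x | F x != 0]) (B := K) out.
  by rewrite -((closure_id _).1 (compact_closed (@norm_hausdorff _ _) cK)).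
by split=> //; [exact: subclosed_compact (@closed_closure _ _) cK sK|exact: subset_trans sK KD].
Qed.

(** The derivative of [E n] is of size [n], but lives where the distance to an end is at most
    [2 / (n + 1)]. Multiplied by a function that is controlled by that distance it stays bounded
    uniformly in [n]. *)
Lemma interval_cutoff (a b : R) : a < b -> exists E E' : nat -> R -> R,
  [/\ forall n, smooth (E n), forall n, D (E n) (E' n), forall n x, 0 <= E n x <= 1,
     forall n, exists2 d, 0 < d & forall x, E n x != 0 -> a + d <= x <= b - d &
   (forall x, a < x < b -> \forall n \near \oo, E n x = 1 /\ E' n x = 0) /\
   exists2 C, 0 <= C & forall n x v L, 0 <= L -> a < x < b ->
     `|v| <= L * (x - a) -> `|v| <= L * (b - x) -> `|E' n x * v| <= C * L].
Proof.
move=> ab; have [S [S' [sS hS S0 S1 [S01 [S'0 [C SC]]]]]] := @smooth_step.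
have C0 : 0 <= C by exact: le_trans (SC 0).
pose k n : R := n.+1%:R.
have k0 n : 0 < k n by [].
have Da n : D (fun x => S (k n * (x - a))) (fun x => S' (k n * (x - a)) * k n).
  have h := hasD_comp (hasD_scale (k n) (hasD_sub (@D_id) (hasD_cst (1:R) a))) hS.
  by apply: hasD_ext h => // x; rewrite subr0 mulr1.
have Db n : D (fun x => S (k n * (b - x))) (fun x => - (S' (k n * (b - x)) * k n)).
  have h := hasD_comp (hasD_scale (k n) (hasD_sub (hasD_cst (1:R) b) (@D_id))) hS.
  by apply: hasD_ext h => // x; rewrite sub0r mulrN1 mulrN.
have sm n c (u : R -> R) : smooth u -> smooth (fun x => S (k n * (u x - c))).
  by move=> su; exact: (smooth_comp (smoothZ (k n) (smoothB su (smooth_cst c))) sS).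
exists (fun n x => S (k n * (x - a)) * S (k n * (b - x))).
exists (fun n x => S' (k n * (x - a)) * k n * S (k n * (b - x)) +
  S (k n * (x - a)) * - (S' (k n * (b - x)) * k n)); split.
- move=> n; apply: smoothM; first exact/sm/smooth_id.
  by apply: smooth_comp sS; apply: smoothZ; apply: smoothB; [exact: smooth_cst|exact: smooth_id].
- by move=> n; exact: hasD_mul.
- move=> n x; have /andP[u0 u1] := S01 (k n * (x - a)); have /andP[v0 v1] := S01 (k n * (b - x)).
  by rewrite mulr_ge0//= mulr_ile1.
- move=> n; exists (k n)^-1; first by rewrite invr_gt0.
  move=> x; rewrite mulf_eq0 negb_or => /andP[h1 h2].
  have {}h1 : 1 < k n * (x - a) by rewrite ltNge; apply: contra h1 => /S0 ->.
  have {}h2 : 1 < k n * (b - x) by rewrite ltNge; apply: contra h2 => /S0 ->.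
  have h1' : (k n)^-1 < x - a by rewrite -[X in X < _]mulr1 ltr_pdivrMl.
  have h2' : (k n)^-1 < b - x by rewrite -[X in X < _]mulr1 ltr_pdivrMl.
  rewrite -lerBrDl (ltW h1') /= lerBrDl addrC -lerBrDl; exact: ltW.
split.
  move=> x /andP[ax xb]; pose d := Num.min (x - a) (b - x).
  have d0 : 0 < d by rewrite lt_min !subr_gt0 ax.
  near=> n.
  have kd : 2 <= k n * d.
    rewrite -ler_pdivrMr// /k; apply: (@le_trans _ _ n%:R); last by rewrite ler_nat.
    by near: n; exact: nbhs_infty_ger.
  have ka : 2 <= k n * (x - a) by rewrite (le_trans kd)// ler_wpM2l// ge_min lexx.
  have kb : 2 <= k n * (b - x) by rewrite (le_trans kd)// ler_wpM2l// ge_min lexx orbT.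
  by rewrite !S1// !S'0 ?ka ?kb ?orbT// !mul0r oppr0 mulr0 addr0 mulr1.
exists (4 * C); first by rewrite mulr_ge0.
move=> n x v L L0 /andP[ax xb] va vb.
have T c : 0 < c -> `|v| <= L * c -> `|S' (k n * c) * k n * v| <= 2 * C * L.
  move=> c0 vc; have [h|h] := leP 2 (k n * c).
    by rewrite S'0 ?h ?orbT// !mul0r normr0 !mulr_ge0.
  rewrite -mulrA normrM (mulrC 2) -mulrA; apply: ler_pM => //.
  rewrite normrM (ger0_norm (ltW (k0 n))); apply: (le_trans (ler_wpM2l (ltW (k0 n)) vc)).
  by rewrite mulrCA mulrC ler_wpM2r// ltW.
rewrite mulrDl; apply: (le_trans (ler_normD _ _)).
rewrite (_ : 4 * C * L = 2 * C * L + 2 * C * L); last by ring.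
have CL : 0 <= 2 * C * L by rewrite !mulr_ge0.
apply: lerD.
  rewrite mulrAC normrM -[leRHS]mulr1 ler_pM//; first by apply: T => //; rewrite subr_gt0.
  by have /andP[? ?] := S01 (k n * (b - x)); rewrite ger0_norm.
rewrite mulrN mulNr normrN -mulrA normrM -[leRHS]mul1r ler_pM//.
  by have /andP[? ?] := S01 (k n * (x - a)); rewrite ger0_norm.
by apply: T => //; rewrite subr_gt0.
Unshelve. all: by end_near. Qed.

Lemma dominated_L2_dist (F : nat -> P -> R) f (C : R) : (forall n, continuous (F n)) -> continuous f ->
  (forall n p, Omega p -> `|F n p - f p| <= C) -> (forall p, Omega p -> \forall n \near \oo, F n p = f p) ->
  L2_dist (F n) f @[n --> \oo] --> 0%E.
Proof.
move=> cF cf Fb Fe; have nL : \forall n \near \oo, L2 mO (F n) by apply: nearW => n; exact: L2_cont (cF n).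
apply/(L2_dist_cvg (L2_cont cf) nL); apply: (@dominated_nrm F f C) => [n||n p Op|p Op].
- exact: continuous_measurable_plane (cF n).
- exact: continuous_measurable_plane cf.
- exact: Fb.
- by apply: cvg_near_cst; exact: Fe.
Qed.

Lemma vanishing_bound (f f' : R -> R) (a b L : R) : D f f' -> continuous f' -> f a = 0 -> f b = 0 ->
  (forall x, a <= x <= b -> `|f' x| <= L) ->
  forall x, a <= x <= b -> `|f x| <= L * (x - a) /\ `|f x| <= L * (b - x).
Proof.
move=> df cf' fa fb fL x /andP[ax xb]; split.
  rewrite -[f x]subr0 -fa -(FTC ax df cf'); apply: Int_abs => // z /andP[z0 z1].
  by apply: fL; rewrite z0 (le_trans z1).
rewrite -normrN -[- f x]add0r -fb -(FTC xb df cf'); apply: Int_abs => // z /andP[z0 z1].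
by apply: fL; rewrite z1 (le_trans ax).
Qed.

(** [F] is multiplied by cutoffs in each variable. As [F] vanishes on the boundary it is bounded by
    the distance to it, so the terms with differentiated cutoffs are bounded and tend to 0
    pointwise: dominated convergence applies. *)
Lemma V_smooth F : smooth F ->
  (forall y, 0 <= y <= pi -> F (-1, y) = 0 /\ F (1, y) = 0) ->
  (forall x, -1 <= x <= 1 -> F (x, 0) = 0 /\ F (x, pi) = 0) ->
  V_grad F (dx F) (xdy F).
Proof.
move=> sF Fx0 Fy0.
have cfst : continuous (fst : P -> R) by move=> p; exact: cvg_fst.
have cF := smooth_cont sF.
pose Fx := dx F; pose Fy := 'D_((0, 1) : P) F.
have hx : Dx F Fx by exact: smooth_dx.
have hy : Dy F Fy by exact: smooth_dy.
have cFx : continuous Fx := smooth_cont (smooth_derive _ sF).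
have cFy : continuous Fy := smooth_cont (smooth_derive _ sF).
have cxFy : continuous (xdy F) by apply: cmul.
split; [exact: L2_cont cF|exact: L2_cont cFx|exact: L2_cont cxFy|].
have lt11 : (-1 : R) < 1 by lra.
have [E [E' [sE hE E01 suppE [E1 [CE CE0 bE]]]]] := interval_cutoff lt11.
have [G [G' [sG hG G01 suppG [G1 [CG CG0 bG]]]]] := interval_cutoff (pi_gt0 R).
pose phi n (p : P) := E n p.1 * G n p.2 * F p.
have sphi n : smooth (phi n).
  exact: (smoothM (smoothM (smooth_comp smooth_fst (sE n)) (smooth_comp smooth_snd (sG n))) sF).
have dxphi n p : dx (phi n) p = E' n p.1 * G n p.2 * F p + E n p.1 * G n p.2 * Fx p.
  rewrite /dx; have h := hasD_mul (hasD_mul (Dx_fst (hE n)) (Dx_snd (hG n))) hx.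
  by rewrite (hasDE p h) mulr0 addr0.
have xdyphi n p : xdy (phi n) p = p.1 * (E n p.1 * G' n p.2 * F p + E n p.1 * G n p.2 * Fy p).
  rewrite /xdy; have h := hasD_mul (hasD_mul (Dy_fst (hE n)) (Dy_snd (hG n))) hy.
  by rewrite (hasDE p h) mul0r add0r.
have [Lx Lx0 bFx] := continuous_bounded_Omega cFx.
have [Ly Ly0 bFy] := continuous_bounded_Omega cFy.
have [LF LF0 bF] := continuous_bounded_Omega cF.
have EG n p : 0 <= E n p.1 * G n p.2 <= 1.
  have /andP[u0 u1] := E01 n p.1; have /andP[v0 v1] := G01 n p.2.
  by rewrite mulr_ge0//= mulr_ile1.
have FL p : Omega p -> `|F p| <= Lx * (p.1 - -1) /\ `|F p| <= Lx * (1 - p.1).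
  move: p => [x y] /Omega_itv[/= x01 y01]; have [Fl Fr] := Fx0 _ y01.
  apply: (vanishing_bound (Dx_slice y hx) (cont_slice_x (y := y) cFx) Fl Fr _ x01) => z z01; exact: bFx.
have FLy p : Omega p -> `|F p| <= Ly * (p.2 - 0) /\ `|F p| <= Ly * (pi - p.2).
  move: p => [x y] /Omega_itv[/= x01 y01]; have [Fl Fr] := Fy0 _ x01.
  apply: (vanishing_bound (Dy_slice x hy) (cont_slice_y (x := x) cFy) Fl Fr _ y01) => z z01; exact: bFy.
have b1 n p : Omega p -> `|E' n p.1 * F p| <= CE * Lx.
  move=> Op; have [h1 h2] := FL _ Op; apply: bE => //.
  by case: Op => /= /[!in_itv].
have b2 n p : Omega p -> `|G' n p.2 * F p| <= CG * Ly.
  move=> Op; have [h1 h2] := FLy _ Op; apply: bG => //.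
  by case: Op => /= _ /[!in_itv].
have mphi n : continuous (phi n) := smooth_cont (sphi n).
have mdx n : continuous (dx (phi n)) := smooth_cont (smooth_derive _ (sphi n)).
have mxdy n : continuous (xdy (phi n)).
  exact: (cmul cfst (smooth_cont (smooth_derive _ (sphi n)))).
have dif n p (v M : R) : `|v| <= M -> `|E n p.1 * G n p.2 * v - v| <= M.
  move=> vM; rewrite (_ : _ - v = - ((1 - E n p.1 * G n p.2) * v)); last by ring.
  have /andP[e0 e1] := EG n p.
  rewrite normrN normrM; apply: le_trans vM; by rewrite ler_piMl// ger0_norm ?gerBl ?subr_ge0.
have ev p : Omega p -> \forall n \near \oo, [/\ E n p.1 = 1, E' n p.1 = 0, G n p.2 = 1 & G' n p.2 = 0].
  move=> [/= /[!in_itv] p1 p2]; near=> n.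
  have [-> ->] : E n p.1 = 1 /\ E' n p.1 = 0 by near: n; exact: E1.
  have [-> ->] : G n p.2 = 1 /\ G' n p.2 = 0 by near: n; exact: G1.
  by [].
exists phi; split.
- move=> n; have [d1 d10 h1] := suppE n; have [d2 d20 h2] := suppG n.
  apply: (compact_test (K := `[-1 + d1, 1 - d1]%classic `*` `[0 + d2, pi - d2]%classic) (sphi n)).
  + by apply: compact_setX; exact: segment_compact.
  + move=> p [/= /[!in_itv]/= /andP[x0 x1] /andP[y0 y1]].
    by clear - d10 d20 x0 x1 y0 y1; split; rewrite /= in_itv/=; lra.
  + by move=> p; rewrite !mulf_eq0 !negb_or => /andP[/andP[/h1 ? /h2 ?] _]; split; rewrite /= in_itv.
- apply: (dominated_L2_dist (C := LF) mphi cF) => [n p Op|p Op].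
    by apply: dif; have [? ?] := Omega_itv Op; exact: bF.
  by apply: filterS (ev p Op) => n [e1 _ g1 _]; rewrite /phi e1 g1 !mul1r.
- apply: (dominated_L2_dist (C := CE * Lx + Lx) mdx cFx) => [n p Op|p Op]; last first.
    by apply: filterS (ev p Op) => n [e1 e2 g1 _]; rewrite dxphi e1 e2 g1 !mul0r add0r !mul1r.
  rewrite dxphi -addrA; apply: (le_trans (ler_normD _ _)); apply: lerD.
    rewrite mulrAC normrM -[leRHS]mulr1 ler_pM//; first exact: b1.
    by have /andP[? ?] := G01 n p.2; rewrite ger0_norm.
  by apply: dif; have [? ?] := Omega_itv Op; exact: bFx.
- apply: (dominated_L2_dist (C := CG * Ly + Ly) mxdy cxFy) => [n p Op|p Op]; last first.
    by apply: filterS (ev p Op) => n [e1 _ g1 g2]; rewrite xdyphi e1 g1 g2 mulr0 !mul0r add0r !mul1r.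
  have [/andP[x0 x1] y01] := Omega_itv Op.
  have px : `|p.1| <= 1 by rewrite ler_norml x0.
  rewrite xdyphi /xdy -/Fy -mulrBr normrM -[leRHS]mul1r ler_pM// -addrA.
  apply: (le_trans (ler_normD _ _)); apply: lerD.
    rewrite -mulrA normrM -[leRHS]mul1r ler_pM//; last exact: b2.
    by have /andP[? ?] := E01 n p.1; rewrite ger0_norm.
  by apply: dif; apply: bFy => //; rewrite x0.
Unshelve. all: by end_near. Qed.

End V.

(** * Weak solutions *)

Section fineint.
Context d (T : measurableType d) (mu : {measure set T -> \bar R}).
Variables (D : set T) (mD : measurable D).

Lemma integrable_fine (X : T -> \bar R) : mu.-integrable D X ->
  mu.-integrable D (EFin \o (fine \o X)) /\
  (\int[mu]_(x in D) (fine (X x))%:E = \int[mu]_(x in D) X x)%E.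
Proof.
move=> iX; have mX := measurable_int _ iX.
have mfX : measurable_fun D (EFin \o (fine \o X)).
  by apply/measurable_EFinP; apply: (measurableT_comp (f := fine)).
split.
  apply: le_integrable iX => // x _ /=.
  by case: (X x) => [r||] //=; rewrite normr0 ?leey.
apply: ae_eq_integral => //.
by apply: filterS (integrable_ae mD iX) => x h Dx; rewrite fineK// h.
Qed.

Lemma ae_eq_Rintegral (f g : T -> R) : measurable_fun D f -> measurable_fun D g ->
  {ae mu, forall x, D x -> f x = g x} ->
  \int[mu]_(x in D) f x = \int[mu]_(x in D) g x.
Proof.
move=> mf mg fg; congr fine; apply: ae_eq_integral => //; try exact/measurable_EFinP.
by apply: filterS fg => x h Dx; rewrite h.
Qed.

Lemma ae_eq_integrable (f g : T -> \bar R) : measurable_fun D g ->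
  {ae mu, forall x, D x -> f x = g x} -> mu.-integrable D f -> mu.-integrable D g.
Proof.
move=> mg fg /integrableP[mf h]; apply/integrableP; split => //.
rewrite -(@ge0_ae_eq_integral _ _ _ mu D (fun x => `|f x|)%E)//.
- exact: measurableT_comp.
- exact: measurableT_comp.
by apply: filterS fg => x e Dx; rewrite e.
Qed.

End fineint.

Section cyl.
Variable T : R.
Hypothesis T0 : 0 < T.
Local Notation mC := (@mu_cylinder R T).
Local Notation I := (`]0, T[%classic : set R).

Lemma muI : mu I = T%:E.
Proof. by rewrite lebesgue_measure_itv /= lte_fin T0 sube0. Qed.

Lemma mu_cyl_fin : (mC setT < +oo)%E.
Proof.
rewrite /mu_cylinder /= /mrestr setTI /cylinder /lebesgue3 /= product_measure1E.
- change (mu I * lebesgue2 (Omega : set plane) < +oo)%E.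
  rewrite muI lte_mul_pinfty//; first by rewrite lee_fin ltW.
  by have := @mu_Omega_fin; rewrite /mu_Omega /= /mrestr setTI.
- exact: measurable_itv.
- exact: measurable_Omega.
Qed.

Lemma slice_measurable (H : space -> R) t : measurable_fun setT H ->
  measurable_fun setT (fun p : plane => H (t, p)).
Proof. by move=> mH; apply: (measurableT_comp mH); exact: measurable_pair1. Qed.

Lemma cyl_fubini_ereal (H : space -> \bar R) : measurable_fun setT H ->
  mC.-integrable setT H ->
  [/\ mu.-integrable I (fun t => \int[mO]_p H (t, p))%E,
     (\int[mC]_z H z = \int[mu]_(t in I) \int[mO]_p H (t, p))%E &
     {ae mu, forall t, I t -> mO.-integrable setT (fun p => H (t, p))}].
Proof.
move=> mH iH.
have mI : measurable (I : set (measurableTypeR R)) by exact: measurable_itv.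
have msl t : measurable_fun setT (fun p : plane => H (t, p)).
  by apply: (measurableT_comp mH); exact: measurable_pair1.
have iH' : (@lebesgue3 R).-integrable setT (H \_ (cylinder T)).
  apply/integrable_restrict => //; first exact: measurable_cylinder.
  by rewrite setTI; apply/(integrable_mrestr _ (measurable_cylinder T)).
have E t : fubini_F (@lebesgue2 R) (H \_ (cylinder T)) t =
    ((fun t => \int[mO]_p H (t, p)) \_ I)%E t.
  rewrite /fubini_F /patch; case: ifPn => tI.
    rewrite integral_mrestr// [RHS]integral_mkcond; apply: eq_integral => p _; rewrite /patch.
    congr (if _ then _ else _); apply/idP/idP; rewrite !inE; first by case.
    by split => //; rewrite inE in tI.
  rewrite integral0_eq// => p _; case: ifPn => //; rewrite inE => -[tI' _].
  by move/negP: tI; case; rewrite inE.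
split.
- have i2 : mu.-integrable setT ((fun t => \int[mO]_p H (t, p)) \_ I)%E.
    by have := integrable_fubini_F iH'; congr (_.-integrable _ _); apply/funext => t; exact: E.
  by move: i2 => /(integrable_restrict _ _ _ _); rewrite setTI; apply.
- rewrite integral_mrestr// [in LHS]integral_mkcond -(integral12_prod_meas1 iH').
  by rewrite [RHS]integral_mkcond; apply: eq_integral => t _; exact: E.
have := ae_integrable1 iH'; apply: filterS => t it tI.
apply/(integrable_mrestr _ (measurable_Omega (R := R))) => //.
have : (@lebesgue2 R).-integrable setT ((fun p => H (t, p)) \_ Omega).
  move: it; congr (_.-integrable _ _); apply/funext => p; rewrite /patch.
  congr (if _ then _ else _); apply/idP/idP; rewrite !inE; first by case.
  by split.
by move/(integrable_restrict _ _ _ _); rewrite setTI; apply => //; exact: measurable_Omega.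
Qed.

Lemma cyl_fubini (H : space -> R) : mC.-integrable setT (EFin \o H) -> measurable_fun setT H ->
  [/\ mu.-integrable I (EFin \o (fun t => \int[mO]_p H (t, p))),
     \int[mC]_z H z = \int[mu]_(t in I) \int[mO]_p H (t, p) &
     {ae mu, forall t, I t -> mO.-integrable setT (EFin \o (fun p => H (t, p)))}].
Proof.
move=> iH mH; have mH' : measurable_fun setT (EFin \o H) by exact/measurable_EFinP.
have [h1 h2 h3] := cyl_fubini_ereal mH' iH.
have mI : measurable (I : set (measurableTypeR R)) by exact: measurable_itv.
have [i1 i2] := integrable_fine mI h1.
by split => //; rewrite /Rintegral h2 -i2.
Qed.

Lemma L2_tensor (th : R -> R) (phi : R * R -> R) (C : R) : 0 <= C ->
  measurable_fun setT (th : measurableTypeR R -> R) -> (forall t, I t -> `|th t| <= C) ->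
  L2 mO phi ->
  L2 mC (fun z => th z.1 * phi z.2) /\
  nrm mC (fun z => th z.1 * phi z.2) <= C * Num.sqrt T * nrm mO phi.
Proof.
move=> C0 mth thC lphi.
have mphi : measurable_fun setT (phi : plane -> R) by exact: L2_measurable lphi.
have mF : measurable_fun setT (fun z : space => th z.1 * phi z.2).
  apply: measurable_funM.
    by apply: (measurableT_comp mth); exact: measurable_fst.
  by apply: (measurableT_comp mphi); exact: measurable_snd.
apply: nrm_le => //.
  by rewrite !mulr_ge0 ?sqrtr_ge0 ?nrm_ge0.
have mF2 : measurable_fun setT (fun z : space => ((th z.1 * phi z.2) ^+ 2)%:E).
  by apply/measurable_EFinP; exact: measurable_funX.
rewrite ge0_integral_mrestr//; last by move=> z; rewrite lee_fin sqr_ge0.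
have mP2 : measurable_fun setT (fun z : space => (C ^+ 2 * phi z.2 ^+ 2)%:E).
  apply/measurable_EFinP; apply: measurable_funM => //; apply: measurable_funX.
  by apply: (measurableT_comp mphi); exact: measurable_snd.
apply: (@le_trans _ _ (\int[lebesgue3]_(z in cylinder T) (C ^+ 2 * phi z.2 ^+ 2)%:E)%E).
  apply: ge0_le_integral => //; first exact: measurable_cylinder.
  - by move=> z _; rewrite lee_fin sqr_ge0.
  - exact: measurable_funS mF2.
  - exact: measurable_funS mP2.
  move=> z [zI _]; rewrite lee_fin exprMn ler_wpM2r ?sqr_ge0//.
  by rewrite -[leLHS]real_normK ?num_real// lerXn2r ?nnegrE// thC.
rewrite integral_mkcond /lebesgue3 fubini_tonelli1; last 2 first.
- apply/(measurable_restrictT _ _).1; first exact: measurable_cylinder.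
  exact: measurable_funS mP2.
- by move=> z; rewrite erestrict_ge0// => ? _; rewrite lee_fin mulr_ge0 ?sqr_ge0.
suff E : forall t, fubini_F (@lebesgue2 R) ((fun z : space => (C ^+ 2 * phi z.2 ^+ 2)%:E) \_ (cylinder T)) t =
    ((fun=> (C ^+ 2 * nrm mO phi ^+ 2)%:E) \_ I)%E t.
  apply: (@le_trans _ _ (\int[mu]_t ((fun=> (C ^+ 2 * nrm mO phi ^+ 2)%:E) \_ I) t)%E).
    by apply: eq_leW; apply: eq_integral => t _; exact: E.
  rewrite -integral_mkcond integral_cst; last exact: measurable_itv.
  change ((C ^+ 2 * nrm mO phi ^+ 2)%:E * mu I <= ((C * Num.sqrt T * nrm mO phi) ^+ 2)%:E)%E.
  rewrite muI -EFinM lee_fin !exprMn (sqr_sqrtr (ltW T0)).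
  by apply: eq_leW; ring.
move=> t.
rewrite /fubini_F /patch; case: ifPn => tI.
  transitivity (\int[mO]_p (C ^+ 2 * phi p ^+ 2)%:E)%E.
    rewrite ge0_integral_mrestr//; last 2 first.
    - apply/measurable_EFinP; apply: measurable_funM => //; exact: measurable_funX.
    - by move=> p; rewrite lee_fin mulr_ge0 ?sqr_ge0.
    rewrite [RHS]integral_mkcond; apply: eq_integral => p _; rewrite /patch.
    congr (if _ then _ else _); apply/idP/idP; rewrite !inE; first by case.
    by split => //; rewrite inE in tI.
  have ip : mO.-integrable setT (EFin \o (fun p => phi p * phi p)) by exact: L2_integrable.
  under eq_integral do rewrite EFinM (expr2 (phi _)).
  rewrite integralZl// nrm_sqr [RHS]EFinM; congr (_ * _)%E.
  by rewrite /dot /Rintegral fineK//; exact: integrable_fin_num.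
rewrite integral0_eq// => p _; case: ifPn => //; rewrite inE => -[tI' _].
by move/negP: tI; case; rewrite inE.
Qed.

Lemma cyl_dot (G : space -> R) (phi : R * R -> R) (th : R -> R) (C : R) :
  measurable_fun setT (th : measurableTypeR R -> R) -> (forall t, I t -> `|th t| <= C) ->
  L2 mC G -> L2 mO phi ->
  mu.-integrable I (EFin \o (fun t => th t * dot mO (fun p => G (t, p)) phi)) /\
  \int[mu]_(t in I) (th t * dot mO (fun p => G (t, p)) phi) =
  dot mC G (fun z => th z.1 * phi z.2).
Proof.
move=> mth thC lG lphi.
have thC' t : I t -> `|th t| <= `|C| by move=> /thC h; rewrite (le_trans h)// ler_norm.
have [lT _] := L2_tensor (normr_ge0 C) mth thC' lphi.
(* Integrability of the slices of [G * phi] is derived from the constant time factor 1, because [th]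
   may vanish. *)
have le1 t : I t -> `|(fun=> 1 : R) t| <= 1 by rewrite normr1.
have [l1 _] := L2_tensor ler01 (measurable_cst _) le1 lphi.
have mG := L2_measurable lG.
have i1 := L2_integrable lG l1; have m1 := measurable_funM mG (L2_measurable l1).
have i2 := L2_integrable lG lT; have m2 := measurable_funM mG (L2_measurable lT).
have [_ _ a1] := cyl_fubini i1 m1.
have [j2 e2 _] := cyl_fubini i2 m2.
have [j1 _ _] := cyl_fubini i1 m1.
have E : {ae mu, forall t : measurableTypeR R, I t -> \int[mO]_p (G (t, p) * (th t * phi p)) =
    th t * dot mO (fun p => G (t, p)) phi}.
  apply: negligibleS a1 => t; apply: contra_not => h tI; rewrite /dot -RintegralZl//; last first.
    by move: (h tI); congr (_.-integrable _ _); apply/funext => p /=; rewrite mul1r.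
  by apply: eq_Rintegral => p _; ring.
have mI : measurable (I : set (measurableTypeR R)) by exact: measurable_itv.
have mt : measurable_fun I (fun t => th t * dot mO (fun p => G (t, p)) phi).
  apply: measurable_funM; first exact: measurable_funS mth.
  have /measurable_EFinP := measurable_int _ j1.
  congr (measurable_fun _ _); apply/funext => t; apply: eq_Rintegral => p _ /=.
  by rewrite mul1r.
have mt2 : measurable_fun I (fun t => \int[mO]_p (G (t, p) * (th t * phi p))).
  by have /measurable_EFinP := measurable_int _ j2.
split.
  apply: (ae_eq_integrable mI _ _ j2); first exact/measurable_EFinP.
  by apply: filterS E => t h tI; rewrite /= h.
by rewrite /dot e2; apply: ae_eq_Rintegral => //; apply: filterS E => t h tI; rewrite h.
Qed.

(** [u'] acts as an approximate Dirac mass of weight [u d - u c] near the place where [G] is close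
    to [g0]. *)
Lemma Int_concentrate (u u' G : R -> R) c d g0 K M e : c <= d -> D u u' ->
  continuous u' -> continuous G -> (forall t, c <= t <= d -> `|u' t| <= K) ->
  K * (d - c) <= M -> 0 <= e -> (forall t, c <= t <= d -> `|G t - g0| <= e) ->
  `|Int c d (fun t => u' t * G t) - g0 * (u d - u c)| <= M * e.
Proof.
move=> cd hu cu cG uK KM e0 Ge.
rewrite -(FTC cd hu cu) -IntZ// -IntB; [|exact: cmul|by apply: cmul => // x; exact: cvg_cst].
rewrite (@eq_Int _ _ _ (fun t => u' t * (G t - g0))); last by move=> x _; ring.
apply: (@le_trans _ _ (K * e * (d - c))).
  apply: Int_abs => //.
    by apply: cmul => // x; apply: cvgB; [exact: cG|exact: cvg_cst].
  by move=> t tcd; rewrite normrM ler_pM// ?uK ?Ge.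
by rewrite mulrAC ler_wpM2r.
Qed.

(** The test functions rise from 0 to 1 in a thin layer at 0 and fall in a thin layer at [T]: they
    tend to 1, and their derivatives to the difference of the Dirac masses at 0 and [T]. The layer
    at [T] is the reflection of the other one. *)
Lemma distribution_FTC (G W : R -> R) : continuous G ->
  mu.-integrable I (EFin \o W) ->
  (forall th : R -> R, test_function I th ->
     - (\int[mu]_(t in I) (derive1 th t * G t)) = \int[mu]_(t in I) (th t * W t)) ->
  G T - G 0 = \int[mu]_(t in I) W t.
Proof.
move=> cG iW h.
have [S [S' [sS hS S0 S1 [S01 [S'0 [C SC]]]]]] := @smooth_step.
have C0 : 0 <= C by exact: le_trans (SC 0).
have cS' : continuous S' by exact: smooth_cont (hasD_smooth sS hS).
(* The layers have width at most [2 / k n]; as [k n >= 4 / T] they stay in separate halves of the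
   interval. *)
pose k (n : nat) : R := n.+1%:R * (4 / T).
have k0 n : 0 < k n by rewrite mulr_gt0// divr_gt0.
have kT n : 4 <= k n * T.
  by rewrite /k -mulrA divfK ?gt_eqF// ler_peMl// ler1n.
pose u n t := S (k n * t); pose u' n t := S' (k n * t) * k n.
pose v n t := u n (T - t); pose v' n t := - u' n (T - t).
have hu n : D (u n) (u' n).
  have H := hasD_comp (hasD_scale (k n) (@D_id)) hS.
  by apply: hasD_ext H => // x; rewrite mulr1.
have hv n : D (v n) (v' n).
  have H := hasD_comp (hasD_sub (hasD_cst (1:R) T) (@D_id)) (hu n).
  by apply: hasD_ext H => // x; rewrite sub0r mulrN1.
have su n : smooth (u n) := smooth_comp (smoothZ (k n) smooth_id) sS.
have sv n : smooth (v n) := smooth_comp (smoothB (smooth_cst T) smooth_id) (su n).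
have cu' n : continuous (u' n) := smooth_cont (hasD_smooth (su n) (hu n)).
have cv' n : continuous (v' n) := smooth_cont (hasD_smooth (sv n) (hv n)).
pose th n t := u n t * v n t.
have tth n : test_function I (th n).
  have K0 : 0 < (k n)^-1 by rewrite invr_gt0.
  apply: (compact_test (K := `[(k n)^-1, T - (k n)^-1]%classic)); [exact: (smoothM (su n) (sv n))|exact: segment_compact| |].
  - by move=> t /=; rewrite !in_itv/= => ?; lra.
  - move=> t; rewrite mulf_eq0 negb_or => /andP[h1 h2]; rewrite /= in_itv/=.
    have {}h1 : 1 < k n * t by rewrite ltNge; apply: contra h1 => /S0; rewrite /u => ->.
    have {}h2 : 1 < k n * (T - t) by rewrite ltNge; apply: contra h2 => /S0; rewrite /v /u => ->.
    have h1' : (k n)^-1 <= t by rewrite ltW// -[X in X < _]mulr1 ltr_pdivrMl.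
    have h2' : (k n)^-1 <= T - t by rewrite ltW// -[X in X < _]mulr1 ltr_pdivrMl.
    by rewrite h1' lerBrDr -lerBrDl.
have dth n t : derive1 (th n) t = u' n t + v' n t.
  rewrite derive1E (hasDE t (hasD_mul (hu n) (hv n))) /v' /v /u' /u.
  have [tT|tT] := leP (2 * t) T.
    have H : 2 <= k n * (T - t) by have := kT n; have := k0 n; nra.
    by rewrite (S1 _ H) (S'0 _ (introT orP (or_intror H))) mul0r oppr0 mulr0 mulr1.
  have H : 2 <= k n * t by have := kT n; have := k0 n; nra.
  by rewrite (S1 _ H) (S'0 _ (introT orP (or_intror H))) !mul0r add0r mul1r add0r.
have mI : measurable (I : set (measurableTypeR R)) by exact: measurable_itv.
have mW : measurable_fun I W by have /measurable_EFinP := measurable_int _ iW.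
have lim1 : \int[mu]_(t in I) (th n t * W t) @[n --> \oo] --> \int[mu]_(t in I) W t.
  apply: fine_cvg; rewrite fineK; last exact: integrable_fin_num.
  apply: (@dominated_cvg _ _ _ mu I mI _ _ (fun t => (`|W t|)%:E)) => //.
  - move=> n; apply/measurable_EFinP; apply: measurable_funM => //.
    apply: measurable_funS (continuous_measurable_R _) => //.
    exact: smooth_cont (smoothM (su n) (sv n)).
  - move=> t /=; rewrite in_itv/= => /andP[t0 tT]; apply: cvg_near_cst; near=> n.
    have kn : 2 / t + 2 / (T - t) <= k n.
      rewrite /k -ler_pdivrMr ?divr_gt0//; apply: (@le_trans _ _ n%:R); last by rewrite ler_nat.
      by near: n; exact: nbhs_infty_ger.
    have a1 : 0 <= 2 / t by rewrite divr_ge0 ?ltW.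
    have a2 : 0 <= 2 / (T - t) by rewrite divr_ge0// subr_ge0 ltW.
    rewrite /th /v /u !S1 ?mul1r//.
      by rewrite -ler_pdivrMr ?subr_gt0// (le_trans _ kn)// lerDr.
    by rewrite -ler_pdivrMr// (le_trans _ kn)// lerDl.
  - exact: integrable_abse iW.
  - move=> n t tI /=; rewrite lee_fin normrM ler_piMl//.
    rewrite /th normrM mulr_ile1//.
      by have /andP[? ?] := S01 (k n * t); rewrite ger0_norm.
    by have /andP[? ?] := S01 (k n * (T - t)); rewrite ger0_norm.
have layer (H : R -> R) : continuous H -> Int 0 T (fun t => u' n t * H t) @[n --> \oo] --> H 0.
  move=> cH; apply/cvgrPdist_le => e e0.
  have e'0 : 0 < e / (2 * (C + 1)) by rewrite divr_gt0// mulr_gt0// ltr_wpDl.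
  have /cvgrPdist_le/(_ _ e'0) : H x @[x --> (0 : R)] --> H 0 by exact: cH.
  move=> /nbhs_norm0P[d1 /= d10 H0]; near=> n.
  pose d := 2 / k n.
  have d0 : 0 < d by rewrite divr_gt0.
  have dT : d <= T / 2 by rewrite /d ler_pdivrMr// mulrAC ler_pdivlMr//; have := kT n; lra.
  have dd : d < d1.
    rewrite /d ltr_pdivrMr// -ltr_pdivrMl// /k -ltr_pdivrMr ?divr_gt0//.
    apply: (@lt_le_trans _ _ n%:R); last by rewrite ler_nat.
    by near: n; exact: nbhs_infty_gtr.
  have kd : k n * d = 2 by rewrite /d mulrC divfK// gt_eqF.
  have Cd : C * k n * (d - 0) <= 2 * C by rewrite subr0 -mulrA kd mulrC.
  rewrite (@Int_chasles 0 d T); [|exact: cmul|lra].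
  rewrite [Int d T _](@eq_Int _ _ _ (fun=> 0)) ?Int_cst ?mul0r ?addr0; first last.
  - move=> t /andP[td _]; rewrite /u' S'0 ?mul0r//; apply/orP; right.
    by rewrite -kd ler_wpM2l// ltW.
  - lra.
  have := @Int_concentrate _ _ H 0 d (H 0) _ _ _ (ltW d0) (hu n) (cu' n) cH _ Cd (ltW e'0).
  rewrite /u kd mulr0 (S1 2)// (S0 0)// subr0 mulr1 distrC => /(_ _ _)/le_trans; apply.
  - by move=> t _; rewrite /u' normrM (ger0_norm (ltW (k0 n))) ler_wpM2r ?(ltW (k0 n)).
  - by move=> t /andP[t0 td]; rewrite distrC; apply: H0; rewrite /= ger0_norm// (le_lt_trans td).
  by rewrite mulrCA ler_piMr ?(ltW e0)// ler_pdivrMr ?mulr_gt0 ?ltr_wpDl// mul1r ler_wpM2l// lerDl.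
have cT (H : R -> R) : continuous H -> continuous (fun t => H (T - t)).
  move=> cH t; apply: (continuous_comp (f := fun t : R => T - t)); last exact: cH.
  by apply: cvgB; [exact: cvg_cst|exact: cvg_id].
have key n : \int[mu]_(t in I) (th n t * W t) =
    Int 0 T (fun t => u' n t * G (T - t)) - Int 0 T (fun t => u' n t * G t).
  rewrite -(h _ (tth n)) -[RHS]opprB -[X in _ - X](Int_reflect (ltW T0)); last exact: cmul (cu' n) (cT _ cG).
  rewrite [X in _ - X](@eq_Int _ _ _ (fun t => u' n (T - t) * G t)); last by move=> t _; rewrite add0r subKr.
  have cA := cmul (cu' n) cG; have cB := cmul (cT _ (cu' n)) cG.
  rewrite -IntB// -Int_oo; last by move=> t; apply: cvgB; [exact: cA|exact: cB].
  by congr (- _); apply: eq_Rintegral => t _; rewrite dth mulrDl mulNr.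
have := cvgB (layer _ (cT _ cG)) (layer _ cG); rewrite subr0 => lim2.
have E1 := cvg_lim (@Rhausdorff R) lim1.
have lim2' : (\int[mu]_(t in I) (th n t * W t)) @[n --> \oo] --> G T - G 0 by under eq_fun do rewrite key; exact: lim2.
have E2 := cvg_lim (@Rhausdorff R) lim2'.
by rewrite -(E1 _) -(E2 _).
Unshelve. all: by end_near. Qed.

Lemma L2_indic (om : set (R * R)) (v : space -> R) : measurable (om : set plane) -> L2 mC v ->
  L2 mC (fun z => \1_om z.2 * v z) /\ nrm mC (fun z => \1_om z.2 * v z) <= nrm mC v.
Proof.
move=> mom lv; apply: nrm_dom => //.
  apply: measurable_funM; last exact: L2_measurable lv.
  by apply: (measurableT_comp (f := \1_om : plane -> R)); [exact: measurable_indic|exact: measurable_snd].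
by move=> z; rewrite normrM ler_piMl// indicE; case: (_ \in _); rewrite ?normr1 ?normr0.
Qed.

End cyl.

(** * Uniqueness of analytic continuation; power series *)

(** It is one term of the expansion of [(x + (1 - x)) ^ (j + k) = 1]. It yields both the Cauchy
    estimates of power series and the decay of Taylor remainders. *)
Lemma binomial_le j k (x : R) : 0 <= x <= 1 ->
  'C(j + k, j)%:R * (x ^+ k * (1 - x) ^+ j) <= 1.
Proof.
move=> /andP[x0 x1]; have h := exprDn x (1 - x) (j + k).
rewrite addrCA subrr addr0 expr1n in h; rewrite [leRHS]h.
have jk : (j < (j + k).+1)%N by rewrite ltnS leq_addr.
rewrite (bigD1 (Ordinal jk))//= addKn mulr_natl.
rewrite lerDl sumr_ge0// => i _.
by rewrite mulrn_wge0// mulr_ge0// exprn_ge0// subr_ge0.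
Qed.

Lemma is_derive_pow (f : R -> R) n t df : is_derive t (1:R) f df ->
  is_derive t (1:R) (fun t => f t ^+ n.+1) (n.+1%:R * f t ^+ n * df).
Proof.
move=> h; have -> : (fun t => f t ^+ n.+1) = f ^+ n.+1.
  by apply/funext => x; rewrite exprfctE.
exact: is_deriveX.
Qed.

(** The sequence [f j] plays the part of the successive derivatives of an analytic function, with
    Cauchy estimates of radius [r]. All of them vanish at [s0], so only Taylor remainders are left,
    and these tend to 0 within half the radius. *)
Lemma derive_chain_local (f : nat -> R -> R) (s0 s1 M r : R) : 0 < r -> 0 <= M ->
  (forall j s, s0 <= s <= s1 -> is_derive s (1:R) (f j) (f j.+1 s)) ->
  (forall j s, s0 <= s <= s1 -> `|f j s| <= M * j`!%:R / r ^+ j) ->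
  (forall j, f j s0 = 0) ->
  forall j s, s0 <= s <= s1 -> s <= s0 + r / 2 -> f j s = 0.
Proof.
move=> r0 M0 df bf f0.
have key k : forall j s, s0 <= s <= s1 ->
    `|f j s| <= M * (j + k)`!%:R / k`!%:R / r ^+ (j + k) * (s - s0) ^+ k.
  elim: k => [|k IH] j s /andP[ss s1s].
    by rewrite addn0 expr0 fact0 divr1 mulr1 bf ?ss.
  pose K := M * (j + k.+1)`!%:R / (k.+1)`!%:R / r ^+ (j + k.+1).
  (* One integration of the bound at order [k], in the form of a monotonicity argument:
     [K (t - s0) ^ k.+1 + e f j t] has a nonnegative derivative for both signs [e]. *)
  have mono (e : R) : `|e| = 1 -> 0 <= K * (s - s0) ^+ k.+1 + e * f j s.
    move=> e1; move: ss; rewrite le_eqVlt => /predU1P[<-|ss].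
      by rewrite f0 subrr expr0n/= !mulr0 addr0.
    pose g t := K * (t - s0) ^+ k.+1 + e * f j t.
    pose g' t := K * ((t - s0) ^+ k *+ k.+1) + e * f j.+1 t.
    have dg t : s0 <= t <= s -> is_derive t (1:R) g (g' t).
      move=> /andP[t0 t1]; have ts : s0 <= t <= s1 by rewrite t0 (le_trans t1).
      have h1 : is_derive t (1:R) (fun t => t - s0) 1.
        have h0 : is_derive t (1:R) (fun t : R => t - s0) (1 - 0) := hasD_sub (@D_id) (hasD_cst (1:R) s0) t.
        by apply: is_derive_eq h0 _; rewrite subr0.
      have h2 := is_derive_pow k h1.
      have h3 := is_deriveD (is_deriveZ K h2) (is_deriveZ e (df j t ts)).
      by apply: is_derive_eq h3 _; rewrite /g' /GRing.scale/= mulr1 -mulr_natl; ring.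
    have [||c /[!in_itv]/= /andP[c0 c1] E] := @MVT _ g g' s0 s ss.
    - by move=> t /[!in_itv]/= /andP[/ltW t0 /ltW t1]; apply: dg; rewrite t0.
    - apply: derivable_within_continuous => t; rewrite in_itv/= => t01.
      by have [] := dg t t01.
    have g0 : g s0 = 0 by rewrite /g f0 subrr expr0n/= !mulr0 addr0.
    rewrite g0 subr0 in E; change (0 <= g s).
    rewrite E mulr_ge0 ?subr_ge0 ?(ltW ss)//.
    have cs : s0 <= c <= s1 by rewrite (ltW c0) (le_trans (ltW c1)).
    have := IH j.+1 c cs.
    have -> : `|f j.+1 c| = `|e * f j.+1 c| by rewrite normrM e1 mul1r.
    rewrite ler_norml => /andP[h _]; rewrite /g' -lerBlDl sub0r; apply: le_trans h.
    rewrite lerN2 -mulr_natr /K addSnnS factS natrM invfM.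
    apply: eq_leW.
    by field; rewrite expf_neq0 ?gt_eqF// nat1r !pnatr_eq0/= -lt0n fact_gt0.
  have p1 := mono 1 (normr1 R); have p2 := mono (-1) (normrN1 R).
  rewrite -/K ler_norml; lra.
move=> j s ss sr; apply/eqP; rewrite -normr_le0; apply/ler_addgt0Pr => e e0; rewrite add0r.
have h2 : `|2 / 3 : R| < 1 by rewrite ger0_norm; lra.
have := @cvg_geometric R (M * j`!%:R / r ^+ j * 4 ^+ j) _ h2.
move=> /cvgrPdist_le/(_ _ e0)[k _ /(_ k (leqnn k))] /=; rewrite sub0r normrN => hk.
apply: le_trans hk; rewrite [leRHS]ger0_norm; last first.
  by rewrite !mulr_ge0// ?exprn_ge0// ?invr_ge0 ?exprn_ge0// ltW.
apply: (le_trans (key k j s ss)).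
have s0s : 0 <= s - s0 by rewrite subr_ge0; case/andP: ss.
apply: (@le_trans _ _ (M * (j + k)`!%:R / k`!%:R / r ^+ (j + k) * (r / 2) ^+ k)).
    apply: ler_wpM2l; first by rewrite !mulr_ge0 ?invr_ge0// exprn_ge0// ltW.
  by apply: lerXn2r; rewrite ?nnegrE ?divr_ge0 ?(ltW r0)//; lra.
(* At half the radius the remainder carries [C(j + k, j) / 2 ^ k]; since
   [C(j + k, j) <= 4 ^ j (4 / 3) ^ k], it decays like [(2 / 3) ^ k]. *)
have bj := @binomial_le j k (3 / 4) _.
have {}bj : 'C(j + k, j)%:R * ((3 / 4) ^+ k * (1 / 4) ^+ j) <= 1 :> R.
  have -> : (1 / 4 : R) = 1 - 3 / 4 by lra.
  by apply: bj; lra.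
rewrite (_ : _ * _ = M * j`!%:R / r ^+ j * 4 ^+ j * (2 / 3) ^+ k *
   ('C(j + k, j)%:R * ((3 / 4) ^+ k * (1 / 4) ^+ j))); last first.
  have E : (j + k)`!%:R = 'C(j + k, j)%:R * (j`!%:R * k`!%:R) :> R.
    by rewrite -!natrM -(bin_fact (leq_addr k j)) addKn.
  rewrite E exprD !exprMn !exprVn expr1n.
  rewrite (_ : (4 : R) ^+ k = 2 ^+ k * 2 ^+ k); last by rewrite -exprMn; congr (_ ^+ _); ring.
  field; rewrite !expf_neq0 ?gt_eqF//= ?pnatr_eq0 -?lt0n ?fact_gt0//.
by rewrite ler_piMr// !mulr_ge0// ?invr_ge0 ?exprn_ge0 ?(ltW r0)// divr_ge0.
Qed.

(** The radius is the same at all points, so finitely many steps of length [r / 2] reach any [s]. *)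
Lemma derive_chain (f : nat -> R -> R) (s1 M r : R) : 0 < r -> 0 <= M ->
  (forall j s, 0 <= s <= s1 -> is_derive s (1:R) (f j) (f j.+1 s)) ->
  (forall j s, 0 <= s <= s1 -> `|f j s| <= M * j`!%:R / r ^+ j) ->
  (forall j, f j 0 = 0) ->
  forall j s, 0 <= s <= s1 -> f j s = 0.
Proof.
move=> r0 M0 df bf f0.
have key m : forall j s, 0 <= s <= s1 -> s <= m%:R * (r / 2) -> f j s = 0.
  elim: m => [|m IH] j s /andP[s0 ss1] sm.
    by rewrite mul0r in sm; have -> : s = 0 by apply/eqP; rewrite eq_le sm.
  have [h|/ltW h] := leP s (m%:R * (r / 2)); first by apply: IH => //; rewrite s0.
  have m0 : 0 <= m%:R * (r / 2) by rewrite mulr_ge0// divr_ge0// ltW.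
  apply: (@derive_chain_local f (m%:R * (r / 2)) s1 M r) => //.
  - by move=> i t /andP[t0 t1]; apply: df; rewrite t1 (le_trans m0).
  - by move=> i t /andP[t0 t1]; apply: bf; rewrite t1 (le_trans m0).
  - by move=> i; apply: IH => //; rewrite m0 (le_trans h).
  - by rewrite h.
  - by rewrite -natr1 mulrDl mul1r in sm.
move=> j s ss; apply: (key (Num.bound (s / (r / 2)))) => //.
rewrite -ler_pdivrMr ?divr_gt0//; apply/ltW/archi_boundP.
by case/andP: ss => s0 _; rewrite divr_ge0// divr_ge0// ltW.
Qed.

(** The [j]-th derivative of the power series with coefficients [c], obtained by formal
    differentiation of its coefficients. *)
Definition power_sum (c : nat -> R) j s : R := limn (pseries (iter j (@pseries_diffs R) c) s).

Lemma iter_diffs (c : nat -> R) j n :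
  iter j (@pseries_diffs R) c n = j`!%:R * 'C(n + j, j)%:R * c (n + j)%N.
Proof.
elim: j n => [|j IH] n; first by rewrite addn0 /= bin0 fact0 !mul1r.
rewrite iterS /pseries_diffs IH addSnnS !mulrA; congr (_ * _).
rewrite -!natrM; congr _%:R.
have := mul_bin_left (n + j.+1) j; rewrite addnS -addSn addnK => h.
by rewrite factS mulnAC -h; ring.
Qed.

Lemma power_sum_term_bound (c : nat -> R) C j n x s : (forall n, `|c n| <= C) -> 0 < x < 1 ->
  `|iter j (@pseries_diffs R) c n * s ^+ n| <= C * j`!%:R / (1 - x) ^+ j * (`|s| / x) ^+ n.
Proof.
move=> cC /andP[x0 x1]; have C0 : 0 <= C by exact: le_trans (cC 0%N).
have y0 : 0 < 1 - x by rewrite subr_gt0.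
rewrite iter_diffs !normrM normrX !normr_nat.
apply: (@le_trans _ _ (j`!%:R * 'C(n + j, j)%:R * C * `|s| ^+ n)).
  by rewrite ler_wpM2r ?exprn_ge0// ler_wpM2l// mulr_ge0.
have := @binomial_le j n x; rewrite addnC => h.
have {}h : 'C(n + j, j)%:R * (x ^+ n * (1 - x) ^+ j) <= 1 by apply: h; rewrite !ltW.
rewrite [leRHS](_ : _ = j`!%:R * (C * `|s| ^+ n / (x ^+ n * (1 - x) ^+ j))); last first.
  by rewrite expr_div_n invfM; ring.
rewrite [leLHS](_ : _ = j`!%:R * (C * `|s| ^+ n * 'C(n + j, j)%:R)); last by ring.
rewrite ler_wpM2l// ler_wpM2l ?mulr_ge0 ?exprn_ge0//.
by rewrite -[leRHS]mul1r ler_pdivlMr// mulr_gt0 ?exprn_gt0.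
Qed.

Lemma power_sum_cvg (c : nat -> R) C j s : (forall n, `|c n| <= C) -> `|s| < 1 ->
  cvgn [normed (pseries (iter j (@pseries_diffs R) c) s)].
Proof.
move=> cC s1; pose x := (1 + `|s|) / 2.
have x01 : 0 < x < 1 by have := normr_ge0 s; rewrite /x => ?; lra.
have C0 : 0 <= C by exact: le_trans (cC 0%N).
have [x0 x1] := andP x01.
apply: (@series_le_cvg _ _ (geometric (C * j`!%:R / (1 - x) ^+ j) (`|s| / x))) => //.
- by move=> n; exact: normr_ge0.
- by move=> n; rewrite /= !mulr_ge0 ?invr_ge0 ?exprn_ge0 ?subr_ge0 ?divr_ge0// ltW.
- by move=> n; exact: power_sum_term_bound.
apply: is_cvg_geometric_series; rewrite ger0_norm ?divr_ge0 ?(ltW x0)//.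
by rewrite ltr_pdivrMr// mul1r /x; lra.
Qed.

Lemma power_sum_bound (c : nat -> R) C s1 : (forall n, `|c n| <= C) -> 0 <= s1 < 1 ->
  exists2 M, 0 <= M & exists2 r, 0 < r & forall j s, `|s| <= s1 -> `|power_sum c j s| <= M * j`!%:R / r ^+ j.
Proof.
(* Any [x] between [s1] and 1 does: [s1 / x < 1] sums a geometric series, and [1 - x] is the radius
   in the Cauchy estimates. *)
move=> cC /andP[s10 s11]; pose x := (1 + s1) / 2.
have x0 : 0 < x by rewrite /x; lra.
have x1 : x < 1 by rewrite /x; lra.
have sx : s1 / x < 1 by rewrite ltr_pdivrMr// mul1r /x; lra.
have sx0 : 0 <= s1 / x by rewrite divr_ge0// ltW.
have C0 : 0 <= C by exact: le_trans (cC 0%N).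
exists (C / (1 - s1 / x)); first by rewrite divr_ge0// subr_ge0 ltW.
exists (1 - x); first by rewrite subr_gt0.
move=> j s ss1.
have sl : `|s| < 1 by exact: le_lt_trans s11.
have cN := @power_sum_cvg c C j s cC sl.
apply: (le_trans (lim_series_norm cN)).
have sx' : `|s1 / x| < 1 by rewrite ger0_norm.
have cG := @cvg_geometric_series R (C * j`!%:R / (1 - x) ^+ j) _ sx'.
have -> : C / (1 - s1 / x) * j`!%:R / (1 - x) ^+ j =
   limn (series (geometric (C * j`!%:R / (1 - x) ^+ j) (s1 / x))).
  by rewrite (cvg_lim (@Rhausdorff R) cG); ring.
apply: lim_series_le => //; first by apply/cvg_ex; eexists; exact: cG.
move=> n; apply: (le_trans (power_sum_term_bound j n s cC (introT andP (conj x0 x1)))).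
rewrite /= ler_wpM2l ?mulr_ge0 ?invr_ge0 ?exprn_ge0 ?subr_ge0 ?(ltW x1)//.
have ss : `|s| / x <= s1 / x by rewrite ler_pM2r ?invr_gt0.
by apply: lerXn2r => //; rewrite nnegrE// divr_ge0// ltW.
Qed.

Lemma power_sum_der (c : nat -> R) C j s : (forall n, `|c n| <= C) -> `|s| < 1 ->
  is_derive s (1:R) (power_sum c j) (power_sum c j.+1 s).
Proof.
move=> cC s1; pose K := (1 + `|s|) / 2.
have K0 : 0 < K by have := normr_ge0 s; rewrite /K; lra.
have K1 : `|K| < 1 by rewrite (ger0_norm (ltW K0)) /K; lra.
have cv i : cvgn (pseries (iter i (@pseries_diffs R) c) K).
  by apply: normed_cvg; exact: power_sum_cvg cC K1.
apply: (@pseries_snd_diffs R (iter j (@pseries_diffs R) c) K s (cv j) (cv j.+1) (cv j.+2)).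
by rewrite (ger0_norm (ltW K0)) /K; lra.
Qed.

Lemma power_sum0 (c : nat -> R) j : power_sum c j 0 = j`!%:R * c j.
Proof.
rewrite /power_sum; apply: (cvg_lim (@Rhausdorff R)); apply: cvg_near_cst; near=> n.
have n0 : (0 < n)%N by near: n; exact: nbhs_infty_gt.
rewrite /pseries seriesEord/= -(prednK n0) big_ord_recl expr0 mulr1 big1 ?addr0.
  by rewrite iter_diffs add0n binn mulr1.
by move=> i _; rewrite expr0n/= mulr0.
Unshelve. all: by end_near. Qed.

(** * Lower bound on the control time *)

Section kernel.
Implicit Types a b s : R.

(** For [z = a + i b], [kq] is [|1 - s z| ^ 2]; [kr] and [ki] are the real and imaginary parts of
    [1 / (1 - s z)], [ku] and [kw] those of [z / (1 - s z)]. Differentiating in [s] multiplies by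
    the latter. *)
Definition kq a b s := (1 - s * a) ^+ 2 + (s * b) ^+ 2.

Definition kr a b s := (1 - s * a) / kq a b s.

Definition ki a b s := s * b / kq a b s.

Definition ku a b s := a * kr a b s - b * ki a b s.

Definition kw a b s := a * ki a b s + b * kr a b s.

(* [z ^ j / (1 - s z) ^ j.+1] for [z = a + i b], as a pair of reals *)
Fixpoint kpow a b j s : R * R :=
  if j is i.+1 then
    ((kpow a b i s).1 * ku a b s - (kpow a b i s).2 * kw a b s,
     (kpow a b i s).1 * kw a b s + (kpow a b i s).2 * ku a b s)
  else (kr a b s, ki a b s).

Lemma kr_der a b s : kq a b s != 0 ->
  is_derive s (1:R) (kr a b) (kr a b s * ku a b s - ki a b s * kw a b s) /\
  is_derive s (1:R) (ki a b) (kr a b s * kw a b s + ki a b s * ku a b s).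
Proof.
move=> q0.
have h1 : is_derive s (1:R) (fun s => 1 - s * a) (- a).
  have h0 : is_derive s (1:R) (fun s => 1 - s * a) (0 - (1 * a + s * 0)) :=
    hasD_sub (hasD_cst (1:R) 1) (hasD_mul (@D_id) (hasD_cst (1:R) a)) s.
  by apply: is_derive_eq h0 _; ring.
have h2 : is_derive s (1:R) (fun s => s * b) b.
  have h0 : is_derive s (1:R) (fun s => s * b) (1 * b + s * 0) :=
    hasD_mul (@D_id) (hasD_cst (1:R) b) s.
  by apply: is_derive_eq h0 _; ring.
have h3 : is_derive s (1:R) (kq a b) (2 * (s * b ^+ 2 - a * (1 - s * a))).
  have h0 : is_derive s (1:R) (kq a b) _ := is_deriveD (is_derive_pow 1 h1) (is_derive_pow 1 h2).
  by apply: is_derive_eq h0 _; rewrite /GRing.scale/=; ring.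
have h4 : is_derive s (1:R) (fun s => (kq a b s)^-1) _ := is_deriveV q0 h3.
split.
  have h0 : is_derive s (1:R) (kr a b) _ := is_deriveM h1 h4.
  apply: is_derive_eq h0 _; rewrite /kr /ki /ku /kw /kr /ki /GRing.scale/=.
  by rewrite /kq in q0 *; field.
have h0 : is_derive s (1:R) (ki a b) _ := is_deriveM h2 h4.
apply: is_derive_eq h0 _; rewrite /kr /ki /ku /kw /kr /ki /GRing.scale/=.
by rewrite /kq in q0 *; field.
Qed.

Lemma kpow_der a b j s : kq a b s != 0 ->
  is_derive s (1:R) (fun s => (kpow a b j s).1) (j.+1%:R * (kpow a b j.+1 s).1) /\
  is_derive s (1:R) (fun s => (kpow a b j s).2) (j.+1%:R * (kpow a b j.+1 s).2).
Proof.
move=> q0; have [hr hi] := kr_der q0.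
elim: j => [|j [IH1 IH2]]; first by rewrite /= !mul1r.
have hu : is_derive s (1:R) (ku a b) (ku a b s ^+ 2 - kw a b s ^+ 2).
  have h0 : is_derive s (1:R) (ku a b) _ := is_deriveB (is_deriveZ a hr) (is_deriveZ b hi).
  by apply: is_derive_eq h0 _; rewrite /GRing.scale/= /kw /ku; ring.
have hw : is_derive s (1:R) (kw a b) (2 * ku a b s * kw a b s).
  have h0 : is_derive s (1:R) (kw a b) _ := is_deriveD (is_deriveZ a hi) (is_deriveZ b hr).
  by apply: is_derive_eq h0 _; rewrite /GRing.scale/= /kw /ku; ring.
split.
  have h0 : is_derive s (1:R) (fun s => (kpow a b j.+1 s).1) _ :=
    is_deriveB (is_deriveM IH1 hu) (is_deriveM IH2 hw).
  by apply: is_derive_eq h0 _; rewrite /GRing.scale/= -!natr1; ring.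
have h0 : is_derive s (1:R) (fun s => (kpow a b j.+1 s).2) _ :=
  is_deriveD (is_deriveM IH1 hw) (is_deriveM IH2 hu).
by apply: is_derive_eq h0 _; rewrite /GRing.scale/= -!natr1; ring.
Qed.

Lemma kpow_norm a b j s : kq a b s != 0 ->
  (kpow a b j s).1 ^+ 2 + (kpow a b j s).2 ^+ 2 = (kq a b s)^-1 * ((a ^+ 2 + b ^+ 2) / kq a b s) ^+ j.
Proof.
move=> q0; elim: j => [|j IH].
  by rewrite expr0 mulr1 /= /kr /ki; rewrite /kq in q0 *; field.
rewrite [in RHS]exprSr [RHS]mulrA -IH /=.
have -> : (a ^+ 2 + b ^+ 2) / kq a b s = ku a b s ^+ 2 + kw a b s ^+ 2.
  by rewrite /ku /kw /kr /ki; rewrite /kq in q0 *; field.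
by ring.
Qed.

Lemma kpow_bound a b j s (d r : R) : 0 < d -> 0 <= r -> d ^+ 2 <= kq a b s -> a ^+ 2 + b ^+ 2 <= r ^+ 2 ->
  `|(kpow a b j s).2| <= d^-1 * (r / d) ^+ j.
Proof.
move=> d0 r0 dq rz.
have d20 : 0 < d ^+ 2 by rewrite exprn_gt0.
have q0 : 0 < kq a b s by exact: lt_le_trans dq.
have rd : 0 <= r / d by rewrite divr_ge0// ltW.
have y0 : 0 <= d^-1 * (r / d) ^+ j by rewrite mulr_ge0 ?exprn_ge0// invr_ge0 ltW.
rewrite -[leRHS]ger0_norm// -ler_sqr ?nnegrE// !real_normK ?num_real//.
apply: (@le_trans _ _ ((kpow a b j s).1 ^+ 2 + (kpow a b j s).2 ^+ 2)).
  by rewrite lerDr sqr_ge0.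
rewrite kpow_norm ?gt_eqF// [leRHS]exprMn exprVn -[in leRHS]exprM mulnC exprM.
have qd : (kq a b s)^-1 <= (d ^+ 2)^-1 by rewrite lef_pV2 ?posrE.
have z0 : 0 <= a ^+ 2 + b ^+ 2 by rewrite addr_ge0 ?sqr_ge0.
apply: ler_pM => //; rewrite ?invr_ge0 ?exprn_ge0 ?divr_ge0 ?(ltW q0)//.
apply: lerXn2r; rewrite ?nnegrE ?divr_ge0 ?(ltW q0) ?sqr_ge0//.
by rewrite exprMn exprVn; apply: ler_pM => //; rewrite invr_ge0 ltW.
Qed.

Lemma kpow_polar (t th : R) j :
  kpow (expR t * cos th) (expR t * sin th) j 0 =
  (expR (j%:R * t) * cos (j%:R * th), expR (j%:R * t) * sin (j%:R * th)).
Proof.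
have q1 a b : kq a b 0 = 1 by rewrite /kq !mul0r subr0 expr0n/= addr0 expr1n.
elim: j => [|j /= ->]; first by rewrite /= /kr /ki q1 !mul0r expR0 cos0 sin0 subr0 !divr1 mulr1 mulr0.
have Eu a b : ku a b 0 = a by rewrite /ku /kr /ki q1; field.
have Ew a b : kw a b 0 = b by rewrite /kw /kr /ki q1; field.
rewrite /= Eu Ew -(natr1 j)  !mulrDl !mul1r expRD cosD sinD.
by congr pair; ring.
Qed.

Section moments.
Context d (Y : measurableType d) (mu : {measure set Y -> \bar R}).
Variables (v a b : Y -> R) (dl eta r : R).
Hypothesis (iv : mu.-integrable setT (EFin \o v)).
Hypothesis (ma : measurable_fun setT a) (mb : measurable_fun setT b).
Hypothesis (dl0 : 0 < dl) (eta0 : 0 < eta) (r0 : 0 < r).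
Hypothesis rab : forall y, a y ^+ 2 + b y ^+ 2 <= r ^+ 2.
Hypothesis qab : forall s y, - eta < s < 1 -> dl ^+ 2 <= kq (a y) (b y) s.

Lemma kq_measurable s : - eta < s < 1 ->
  measurable_fun setT (fun y => (kq (a y) (b y) s)^-1).
Proof.
move=> ss; have mq : measurable_fun setT (fun y => kq (a y) (b y) s).
  apply: measurable_funD; apply: measurable_funX.
    by apply: measurable_funB; [exact: measurable_cst|exact: measurable_funM].
  exact: measurable_funM.
(* The truncation at the lower bound [dl ^ 2] of [kq] makes the inverse continuous everywhere. *)
have ci : continuous (fun x : R => (Num.max x (dl ^+ 2))^-1).
  move=> x; apply: cvgV; last by apply: (@continuous_max _ R id (cst (dl ^+ 2))) => //; exact: cvg_cst.
  by rewrite gt_eqF// lt_max exprn_gt0// orbT.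
have := measurableT_comp (continuous_measurable_fun ci) mq.
apply: eq_measurable_fun => y _ /=; congr (_^-1).
by apply/max_idPl; exact: qab.
Qed.

Lemma kpow_measurable j s : - eta < s < 1 ->
  measurable_fun setT (fun y => (kpow (a y) (b y) j s).1) /\
  measurable_fun setT (fun y => (kpow (a y) (b y) j s).2).
Proof.
move=> ss; have mq := kq_measurable ss.
have m1 : measurable_fun setT (fun y => kr (a y) (b y) s).
  apply: measurable_funM => //.
  by apply: measurable_funB; [exact: measurable_cst|exact: measurable_funM].
have m2 : measurable_fun setT (fun y => ki (a y) (b y) s).
  by apply: measurable_funM => //; exact: measurable_funM.
have m3 : measurable_fun setT (fun y => ku (a y) (b y) s).
  by apply: measurable_funB; apply: measurable_funM.
have m4 : measurable_fun setT (fun y => kw (a y) (b y) s).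
  by apply: measurable_funD; apply: measurable_funM.
elim: j => [//|j [I1 I2]]; split.
  by apply: measurable_funB; apply: measurable_funM.
by apply: measurable_funD; apply: measurable_funM.
Qed.

Let B j s := \int[mu]_y (v y * (j`!%:R * (kpow (a y) (b y) j s).2)).
Let bd j := j`!%:R * (dl^-1 * (r / dl) ^+ j).

Lemma kterm_bound j s y : - eta < s < 1 ->
  `|v y * (j`!%:R * (kpow (a y) (b y) j s).2)| <= bd j * `|v y|.
Proof.
move=> ss; rewrite normrM mulrC ler_wpM2r// normrM normr_nat ler_wpM2l//.
by apply: kpow_bound => //; [exact: ltW|exact: qab].
Qed.

Lemma kbound_integrable (C : R) : mu.-integrable setT (EFin \o (fun y => C * `|v y|)).
Proof.
have := integrableZl measurableT C (integrable_abse iv).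
by apply: eq_integrable => // y _ /=.
Qed.

Lemma kterm_integrable j s : - eta < s < 1 ->
  mu.-integrable setT (EFin \o (fun y => v y * (j`!%:R * (kpow (a y) (b y) j s).2))).
Proof.
move=> ss; apply: (le_integrable measurableT _ _ (kbound_integrable (bd j))).
  apply/measurable_EFinP; apply: measurable_funM.
    by apply/measurable_EFinP; exact: measurable_int iv.
  by apply: measurable_funM => //; have [] := kpow_measurable j ss.
move=> y _ /=; rewrite lee_fin (le_trans (kterm_bound _ _ ss))//.
exact: ler_norm.
Qed.

Lemma kB_der j s : - eta < s < 1 -> is_derive s (1:R) (B j) (B j.+1 s).
Proof.
move=> ss; have Is : `]- eta, 1[%classic s by rewrite /= in_itv.
pose f s y := v y * (j`!%:R * (kpow (a y) (b y) j s).2).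
have df x y : - eta < x < 1 -> is_derive x (1:R) (f^~ y) (v y * ((j.+1)`!%:R * (kpow (a y) (b y) j.+1 x).2)).
  move=> xx; have q0 : kq (a y) (b y) x != 0.
    by rewrite gt_eqF// (lt_le_trans _ (qab y xx))// exprn_gt0.
  have [_ h] := kpow_der j q0.
  have h0 : is_derive x (1:R) (f^~ y) _ := is_deriveZ (v y) (is_deriveZ j`!%:R h).
  by apply: is_derive_eq h0 _; rewrite /GRing.scale/= factS natrM; ring.
have i1 x : `]- eta, 1[%classic x -> mu.-integrable setT (EFin \o f x).
  by rewrite /= in_itv => xx; exact: kterm_integrable.
have d1 x y : `]- eta, 1[%classic x -> setT y -> derivable (f^~ y) x 1.
  by rewrite /= in_itv => xx _; have [] := df x y xx.
have G0 y : 0 <= bd j.+1 * `|v y|.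
  by rewrite mulr_ge0// mulr_ge0// mulr_ge0 ?exprn_ge0 ?invr_ge0 ?divr_ge0 ?ltW.
have Gb x y : `]- eta, 1[%classic x -> setT y -> `|partial1of2 f x y| <= bd j.+1 * `|v y|.
  rewrite /= in_itv => xx _; rewrite /partial1of2 derive1E.
  by have [_ ->] := df x y xx; exact: kterm_bound.
have iG := kbound_integrable (bd j.+1).
have D := derivable_under_integral measurableT Is i1 d1 G0 iG Gb.
have E := differentiation_under_integral measurableT Is i1 d1 G0 iG Gb.
apply: DeriveDef; first exact: D.
rewrite -derive1E [LHS]E; apply: eq_Rintegral => y _.
by rewrite /partial1of2 derive1E; have [_ ->] := df s y ss.
Qed.

Lemma kB_bound j s : - eta < s < 1 -> `|B j s| <= bd j * \int[mu]_y `|v y|.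
Proof.
move=> ss; apply: (le_trans (le_normr_Rintegral measurableT (kterm_integrable j ss))).
rewrite -RintegralZl//; last exact: integrable_norm.
apply: le_Rintegral => //.
- by apply: integrable_norm; exact: kterm_integrable.
- exact: kbound_integrable.
- by move=> y _; exact: kterm_bound.
Qed.

(** [B j] is the [j]-th derivative of the integral of [v Im (1 / (1 - s z))], differentiated under
    the integral sign. The lower bound [dl] on [|1 - s z|] makes the Cauchy estimates uniform up to
    [s = 1], and [eta] puts [s = 0] inside the interval. *)
Lemma moment_family : exists2 B : nat -> R -> R,
  forall j s, - eta < s < 1 -> is_derive s (1:R) (B j) (B j.+1 s) &
  (exists2 V, 0 <= V & forall j s, - eta < s < 1 -> `|B j s| <= V * j`!%:R / (dl / r) ^+ j) /\
  forall j, B j 0 = j`!%:R * \int[mu]_y (v y * (kpow (a y) (b y) j 0).2).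
Proof.
exists B; first exact: kB_der.
pose V := \int[mu]_y `|v y|.
have V0 : 0 <= V by apply: Rintegral_ge0.
split.
  exists (dl^-1 * V); first by rewrite mulr_ge0// invr_ge0 ltW.
  move=> i s ss; apply: (le_trans (kB_bound _ ss)); rewrite /bd -/V -exprVn invf_div.
  by apply: eq_leW; ring.
move=> i; have e0 : - eta < (0 : R) < 1 by rewrite oppr_lt0 eta0 /= ltr01.
rewrite -RintegralZl//; first by apply: eq_Rintegral => y _; ring.
have := integrableZl measurableT (i`!%:R^-1) (kterm_integrable i e0).
apply: eq_integrable => // y _ /=; rewrite -EFinM; congr EFin.
by field; rewrite pnatr_eq0 -lt0n fact_gt0.
Qed.

End moments.

(** The Cauchy estimates of the series degenerate as [s] tends to 1, those of [B] do not. For each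
    [s1 < 1] the difference obeys estimates on [[0, s1]] with the smaller of the two radii, and all
    its derivatives vanish at 0. *)
Lemma power_sum_extension (c : nat -> R) (C eta V rho : R) (B : nat -> R -> R) :
  (forall n, `|c n| <= C) -> 0 < eta -> 0 < rho ->
  (forall j s, - eta < s < 1 -> is_derive s (1:R) (B j) (B j.+1 s)) ->
  0 <= V -> (forall j s, - eta < s < 1 -> `|B j s| <= V * j`!%:R / rho ^+ j) ->
  (forall j, B j 0 = j`!%:R * c j) ->
  forall j s, 0 <= s < 1 -> power_sum c j s = B j s.
Proof.
move=> cC eta0 rho0 dB V0 bB B0 j s1 /andP[s10 s11].
apply/eqP; rewrite -subr_eq0; apply/eqP.
have s101 : 0 <= s1 < 1 by rewrite s10.
have [M M0 [r1 r10 hM]] := power_sum_bound cC s101.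
pose r2 := Num.min r1 rho.
have r20 : 0 < r2 by rewrite lt_min r10.
have se s : 0 <= s <= s1 -> - eta < s < 1.
  by move=> /andP[sa sb]; rewrite (le_lt_trans sb)// (lt_le_trans _ sa)// oppr_lt0.
have mono W i x : 0 <= W -> 0 < x -> r2 <= x -> W * i`!%:R / x ^+ i <= W * i`!%:R / r2 ^+ i.
  move=> W0 x0 rx; apply: ler_wpM2l; first by rewrite mulr_ge0.
  by rewrite lef_pV2 ?posrE ?exprn_gt0// lerXn2r ?nnegrE ?(ltW x0) ?(ltW r20).
apply: (@derive_chain (fun j s => power_sum c j s - B j s) s1 (M + V) r2) => //.
- by rewrite addr_ge0.
- move=> i s ss; apply: is_deriveB; last by apply: dB; exact: se.
  apply: power_sum_der cC _; case/andP: ss => sa sb.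
  by rewrite ger0_norm// (le_lt_trans sb).
- move=> i s ss; apply: (le_trans (ler_normB _ _)).
  rewrite !mulrDl; apply: lerD.
    apply: (le_trans (hM i s _)); first by case/andP: ss => sa sb; rewrite ger0_norm.
    by apply: mono => //; rewrite ge_min lexx.
  apply: (le_trans (bB i s (se s ss))).
  by apply: mono => //; rewrite ge_min lexx orbT.
- by move=> i; rewrite power_sum0 B0 subrr.
- by rewrite s10 lexx.
Qed.

(** Summation by parts: bounded partial sums of [a] against weights of bounded variation. *)
Lemma abel_bound (w a : nat -> R) (P : R) N : (forall n, `|\sum_(i < n) a i| <= P) ->
  `|\sum_(n < N) w n * a n| <= P * (`|w N| + \sum_(n < N) `|w n.+1 - w n|).
Proof.
move=> aP; have -> : \sum_(n < N) w n * a n =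
    w N * \sum_(i < N) a i - \sum_(n < N) (w n.+1 - w n) * \sum_(i < n.+1) a i.
  elim: N => [|N IH]; first by rewrite !big_ord0 mulr0 subr0.
  by rewrite !big_ord_recr /= IH; ring.
apply: (le_trans (ler_normB _ _)); rewrite mulrDr normrM; apply: lerD.
  by rewrite mulrC ler_wpM2r.
rewrite mulr_sumr; apply: (le_trans (ler_norm_sum _ _ _)); apply: ler_sum => n _.
by rewrite normrM mulrC ler_wpM2r.
Qed.

(** Multiplication by [2 sin (th / 2)] makes the sum telescope. *)
Lemma cos_sum_bound (th : R) n : sin (th / 2) != 0 ->
  `|\sum_(i < n) cos ((i + 2)%:R * th)| <= `|sin (th / 2)|^-1.
Proof.
move=> s0; have E : \sum_(i < n) cos ((i + 2)%:R * th) =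
    (sin ((n%:R + 3 / 2) * th) - sin (3 / 2 * th)) / (2 * sin (th / 2)).
  elim: n => [|n IH]; first by rewrite big_ord0 add0r subrr mul0r.
  rewrite big_ord_recr /= IH -(natr1 n).
  rewrite (_ : (n%:R + 1 + 3 / 2) * th = (n + 2)%:R * th + th / 2); last by rewrite natrD; field.
  rewrite (_ : (n%:R + 3 / 2) * th = (n + 2)%:R * th - th / 2); last by rewrite natrD; field.
  by rewrite sinB sinD; field; rewrite s0.
rewrite E normrM normfV normrM [ `|2|]ger0_norm// invfM mulrA ler_piMl//.
rewrite ler_pdivrMr// mul1r (le_trans (ler_normB _ _))//.
rewrite (_ : 2 = 1 + 1 :> R)//; apply: lerD; rewrite ler_norml; apply/andP; split.
- exact: sin_geN1.
- exact: sin_le1.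
- exact: sin_geN1.
- exact: sin_le1.
Qed.

(** The weight is the product of an increasing and a decreasing sequence in [0, 1], so its variation
    is at most the sum of theirs. The quotient is what remains of [(n + 2) (n + 1)] after division
    by [(n + 2) ^ 2]. *)
Lemma weight_variation s N (w : nat -> R) : 0 <= s <= 1 ->
  w = (fun n => n.+1%:R / n.+2%:R * s ^+ n) ->
  `|w N| + \sum_(n < N) `|w n.+1 - w n| <= 3.
Proof.
move=> /andP[s0 s1] wE; pose rr n : R := n.+1%:R / n.+2%:R.
have {}wE n : w n = rr n * s ^+ n by rewrite wE.
have rE n : rr n = 1 - n.+2%:R^-1.
  have h : n.+2%:R != 0 :> R by rewrite pnatr_eq0.
    apply: (mulIf h); rewrite mulrBl mulVf// /rr mulrVK ?unitfE// mul1r.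
  by rewrite -[n.+2%:R]natr1 addrK.
have r01 n : 0 <= rr n <= 1 by rewrite divr_ge0//= rE lerBlDr lerDl invr_ge0.
have sn n : 0 <= s ^+ n <= 1 by rewrite exprn_ge0// exprn_ile1.
have b n : `|w n.+1 - w n| <= (rr n.+1 - rr n) + (s ^+ n - s ^+ n.+1).
  have rm : rr n <= rr n.+1 by rewrite !rE lerD2l lerN2 lef_pV2 ?posrE// ler_nat.
  have sm : s ^+ n.+1 <= s ^+ n by rewrite exprS ler_piMl// exprn_ge0.
  rewrite (_ : w n.+1 - w n = (rr n.+1 - rr n) * s ^+ n.+1 - rr n * (s ^+ n - s ^+ n.+1)); last by rewrite !wE; ring.
  apply: (le_trans (ler_normB _ _)); apply: lerD.
    by rewrite ger0_norm ?ler_piMr ?mulr_ge0 ?subr_ge0//; case/andP: (sn n.+1).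
  rewrite ger0_norm ?ler_piMl ?mulr_ge0 ?subr_ge0//; by case/andP: (r01 n).
have S : \sum_(n < N) `|w n.+1 - w n| <= (rr N - rr 0%N) + (1 - s ^+ N).
  apply: (@le_trans _ _ (\sum_(n < N) ((rr n.+1 - rr n) + (s ^+ n - s ^+ n.+1)))).
    by apply: ler_sum => n _; exact: b.
    elim: N => [|N IH]; first by rewrite big_ord0 expr0 !subrr addr0.
  rewrite big_ord_recr /=; lra.
have h1 : `|w N| <= 1.
    rewrite wE normrM; have [[a1 a2] [b1 b2]] := (andP (r01 N), andP (sn N)).
  by rewrite !ger0_norm// mulr_ile1.
have [[a1 a2] [b1 b2]] := (andP (r01 N), andP (sn N)); have [c1 c2] := andP (r01 0%N).
lra.
Qed.

(** Since [(1 - cos x) cos x = cos x - 1 / 2 - cos (2 x) / 2], the two oscillating parts have sums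
    bounded by Abel summation, as neither [y0 / 2] nor [y0] is a zero of the sine. The constant
    part, with weights at least 1/2, contributes at most [- 1 / (4 (1 - s))]. *)
Lemma power_sum2_unbounded (c : nat -> R) (C K q y0 : R) : 0 < y0 < pi ->
  (forall n, `|c n| <= C) -> 0 <= q < 1 ->
  (forall n, `|(n.+2 * n.+1)%:R * c n.+2 - n.+1%:R / n.+2%:R *
     ((1 - cos (n.+2%:R * y0)) * cos (n.+2%:R * y0))| <= K * q ^+ n) ->
  ~ exists M, forall s, 0 <= s < 1 -> `|power_sum c 2 s| <= M.
Proof.
move=> /andP[y00 y0pi] cC /andP[q0 q1] cq [M hM].
have sy1 : sin (y0 / 2) != 0 by rewrite gt_eqF// sin_gt0_pi//; lra.
have sy2 : sin (2 * y0 / 2) != 0.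
  have -> : 2 * y0 / 2 = y0 by field.
  by rewrite gt_eqF// sin_gt0_pi// y00.
pose P1 := `|sin (y0 / 2)|^-1; pose P2 := `|sin (2 * y0 / 2)|^-1.
have K0 : 0 <= K by have := cq 0%N; rewrite expr0 mulr1; exact: le_trans.
pose L := K / (1 - q) + P1 * 3 + P2 * 3.
have key s N : 0 <= s < 1 -> series (fun n => iter 2 (@pseries_diffs R) c n * s ^+ n) N <=
    L - 1 / 4 * ((1 - s ^+ N) / (1 - s)).
  move=> /andP[s0 s1]; rewrite seriesEord /=.
  have s01 : 0 <= s <= 1 by rewrite s0 ltW.
  pose w n : R := n.+1%:R / n.+2%:R * s ^+ n.
  pose e n := (n.+2 * n.+1)%:R * c n.+2 - n.+1%:R / n.+2%:R *
     ((1 - cos (n.+2%:R * y0)) * cos (n.+2%:R * y0)).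
  have E n : iter 2 (@pseries_diffs R) c n * s ^+ n =
      e n * s ^+ n + w n * cos ((n + 2)%:R * y0) - 1 / 2 * (w n * cos ((n + 2)%:R * (2 * y0))) - 1 / 2 * w n.
    rewrite iter_diffs addn2 /e /w -natrM.
    rewrite (_ : (2`! * 'C(n.+2, 2))%N = (n.+2 * n.+1)%N); last first.
      by rewrite mulnC bin_ffact !ffactnS ffactn0 muln1.
    rewrite (_ : n.+2%:R * (2 * y0) = (n.+2%:R * y0) *+ 2); last by rewrite mulr2n; ring.
    by rewrite cos_mulr2n mulr2n; field.
  under eq_bigr do rewrite E.
  rewrite !sumrB big_split /=.
  have b1 : \sum_(i < N) e i * s ^+ i <= K / (1 - q).
    apply: (@le_trans _ _ (\sum_(i < N) K * q ^+ i)).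
      apply: ler_sum => n _; apply: (le_trans (ler_norm _)); rewrite normrM.
            rewrite -[leRHS]mulr1; apply: ler_pM => //; first exact: cq.
      by rewrite ger0_norm ?exprn_ge0// exprn_ile1// ltW.
    rewrite -mulr_sumr ler_wpM2l// -div1r ler_pdivlMr ?subr_gt0//.
        have qN : q ^+ N >= 0 by rewrite exprn_ge0.
    move: (subrX1 q N); set S := \sum_(i < N) _; lra.
  have b2 : \sum_(i < N) w i * cos ((i + 2)%:R * y0) <= P1 * 3.
    apply: (le_trans (ler_norm _)); apply: (le_trans (@abel_bound w (fun i => cos ((i + 2)%:R * y0)) P1 N (fun n => cos_sum_bound n sy1))).
    by apply: ler_wpM2l; [rewrite invr_ge0|exact: (weight_variation N s01 erefl)].
  have b3 : - \sum_(i < N) w i * cos ((i + 2)%:R * (2 * y0)) <= P2 * 3.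
    apply: (le_trans (ler_norm _)); rewrite normrN; apply: (le_trans (@abel_bound w (fun i => cos ((i + 2)%:R * (2 * y0))) P2 N (fun n => cos_sum_bound n sy2))).
    by apply: ler_wpM2l; [rewrite invr_ge0|exact: (weight_variation N s01 erefl)].
  have b4 : 1 / 2 * ((1 - s ^+ N) / (1 - s)) <= \sum_(i < N) w i.
    have -> : (1 - s ^+ N) / (1 - s) = \sum_(i < N) s ^+ i.
            have s1' : 1 - s != 0 by rewrite subr_eq0 gt_eqF.
      apply: (mulIf s1'); rewrite divfK//.
      by move: (subrX1 s N); set S := \sum_(i < N) _; lra.
    rewrite mulr_sumr; apply: ler_sum => n _; rewrite /w ler_wpM2r ?exprn_ge0//.
    by rewrite ler_pdivlMr// -[n.+2%:R]natr1 -[n.+1%:R]natr1; have := ler0n R n; lra.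
  have P20 : 0 <= P2 * 3 by rewrite mulr_ge0// invr_ge0.
  rewrite -!mulr_sumr /L; lra.
have lim s : 0 <= s < 1 -> power_sum c 2 s <= L - 1 / 4 * ((1 - 0) / (1 - s)).
  move=> /andP[s0 s1].
  have sl : `|s| < 1 by rewrite ger0_norm.
  have c1 := normed_cvg (@power_sum_cvg c C 2 s cC sl).
  have c2 : L - 1 / 4 * ((1 - s ^+ N) / (1 - s)) @[N --> \oo] --> L - 1 / 4 * ((1 - 0) / (1 - s)).
    apply: cvgB; first exact: cvg_cst.
    apply: cvgMr; apply: cvgMl; apply: cvgB; first exact: cvg_cst.
    exact: cvg_expr.
  apply: ler_cvg_to c1 c2 _; apply: nearW => N; apply: key; by rewrite s0.
have P10 : 0 <= P1 by rewrite invr_ge0.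
have P20 : 0 <= P2 by rewrite invr_ge0.
have L0 : 0 <= L by rewrite !addr_ge0 ?mulr_ge0// invr_ge0 subr_ge0 ltW.
have M0 : 0 <= M by have := hM 0; rewrite lexx ltr01 => /(_ isT); exact: le_trans.
(* For this [s] the upper bound is [L - (L + M + 1)], which is below [- M]. *)
pose s := 1 - (4 * (L + M + 1))^-1.
have D0 : 0 < 4 * (L + M + 1) by lra.
have D1 : (4 * (L + M + 1))^-1 <= 1 by rewrite invf_le1//; lra.
have s01 : 0 <= s < 1 by rewrite subr_ge0 D1 ltrBlDr ltrDl invr_gt0.
have := lim s s01; have := hM s s01; rewrite ler_norml => /andP[h _].
rewrite (_ : 1 - s = (4 * (L + M + 1))^-1); last by rewrite /s; ring.
rewrite invrK subr0 mul1r; lra.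
Qed.

End kernel.

(** * Weak solutions against approximate eigenfunctions *)

Section weak.
Variable T : R.
Hypothesis T0 : 0 < T.
Local Notation mC := (@mu_cylinder R T).
Local Notation I := (`]0, T[%classic : set R).

(** Projection of time onto [0, T]: composing with it turns continuity within the interval into
    continuity on the whole line, as the integration lemmas require. *)
Definition clamp (t : R) := Num.max 0 (Num.min t T).

Lemma clamp_itv t : clamp t \in `[0, T].
Proof. by rewrite in_itv/= /clamp le_max lexx/= ge_max (ltW T0)/= ge_min lexx orbT. Qed.

Lemma clamp_id t : 0 <= t <= T -> clamp t = t.
Proof. by move=> /andP[t0 tT]; rewrite /clamp min_l// max_r. Qed.

Lemma clamp_cont : continuous clamp.
Proof.
move=> t; apply: (@continuous_max _ R (cst 0) (fun t => Num.min t T)); first exact: cvg_cst.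
by apply: (@continuous_min _ R id (cst T)) => //; exact: cvg_cst.
Qed.

Lemma clamp_L2_cont f : continuous_L2 T f -> forall t0,
  nrm mO (fun p => f (clamp t) p - f (clamp t0) p) @[t --> t0] --> 0.
Proof.
move=> [lf cf] t0; have lc t : L2 mO (f (clamp t)) by apply: lf; exact: clamp_itv.
have nr : \forall t \near t0, L2 mO (f (clamp t)) by apply: filterE; exact: lc.
have [+ _] := L2_dist_cvg (lc t0) nr.
apply; have h := cf _ (clamp_itv t0).
apply: (@cvg_comp _ _ _ clamp (fun t => L2_dist (f t) (f (clamp t0))) _ (within `[0, T] (nbhs (clamp t0)))) => //.
move=> A hA; have hA' : nbhs (clamp t0) (fun x => x \in `[0, T] -> A x) by exact: hA.
have hc : nbhs t0 (fun t => clamp t \in `[0, T] -> A (clamp t)) by exact: clamp_cont hA'.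
change (nbhs t0 (fun t => A (clamp t))); apply: filterS hc => t; apply; exact: clamp_itv.
Qed.

Lemma clamp_dot_cont f w : continuous_L2 T f -> L2 mO w ->
  continuous (fun t => dot mO (f (clamp t)) w).
Proof.
move=> cf lw t0; apply: dot_cvg => //; try (by move=> *; apply: cf.1; exact: clamp_itv).
exact: clamp_L2_cont.
Qed.

Lemma integrable_I (F : R -> R) : continuous F -> mu.-integrable I (EFin \o F).
Proof.
move=> cF; apply: integrableS (Int_integrable 0 T cF) => //.
by move=> t /=; rewrite !in_itv/= => /andP[/ltW-> /ltW->].
Qed.

Lemma cancel_common (a b c d : R) : - (a + b) + (a + c) = d -> - b = d - c.
Proof. by move=> <-; ring. Qed.

Lemma continuous_bound_I (F : R -> R) : continuous F -> exists C, forall t, I t -> `|F t| <= C.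
Proof.
move=> cF; have [C _ hC] := continuous_bound 0 T cF; exists C => t; rewrite /= in_itv/= => /andP[t0 t1].
by apply: hC; rewrite !ltW.
Qed.

(** Duality: [exp (lam t) w] solves the backward equation up to the defect [exp (lam t) E]. The
    moment of [f] against it therefore changes only by the control and by [E]. *)
Lemma weak_moment omega f0 u f (lam : R) (w E : P -> R) :
  weak_solution omega T f0 u f ->
  measurable (omega : set plane) -> L2 mC u -> L2 mO f0 ->
  smooth w ->
  (forall y, 0 <= y <= pi -> w (-1, y) = 0 /\ w (1, y) = 0) ->
  (forall x, -1 <= x <= 1 -> w (x, 0) = 0 /\ w (x, pi) = 0) ->
  continuous E ->
  (forall p, - ('D_((1, 0) : P) (dx w) p + p.1 ^+ 2 * 'D_((0, 1) : P) ('D_((0, 1) : P) w) p) = lam * w p + E p) ->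
  expR (lam * T) * dot mO (f T) w - dot mO f0 w =
  dot mC (fun z => \1_omega z.2 * u z) (fun z => expR (lam * z.1) * w z.2) -
  \int[mu]_(t in I) (expR (lam * t) * dot mO (f (clamp t)) E).
Proof.
move=> [cf f00 [g [h [[lg lh Vg] weq]]]] mom lu lf0 sw wx0 wy0 cE wE.
have mI : measurable (I : set (measurableTypeR R)) by exact: measurable_itv.
have Vw := V_smooth sw wx0 wy0.
have lw : L2 mO w by exact: L2_cont (smooth_cont sw).
have lE : L2 mO E by exact: L2_cont.
have [lO _] := L2_indic mom lu.
pose e t := expR (lam * t).
have ce : continuous e by exact: smooth_cont (smooth_comp (smoothZ lam smooth_id) smooth_exp).
have de : D e (fun t => lam * e t).
  have H := hasD_comp (hasD_scale lam (@D_id)) (@D_exp).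
  by apply: hasD_ext H => // t; rewrite mulr1 mulrC.
have [Ce eC] := continuous_bound_I ce.
pose F t := dot mO (f (clamp t)) w.
pose FE t := dot mO (f (clamp t)) E.
have cF : continuous F by exact: clamp_dot_cont.
have cFE : continuous FE by exact: clamp_dot_cont.
have [iU EU] := cyl_dot T0 (continuous_measurable_R ce) eC lO lw.
have iFE : mu.-integrable I (EFin \o (fun t => e t * FE t)) by apply: integrable_I; exact: cmul.
pose W t := e t * dot mO (fun p => \1_omega p * u (t, p)) w - e t * FE t.
have iW : mu.-integrable I (EFin \o W).
  have := integrableB mI iU iFE; apply: eq_integrable => // t _.
have H0 : F 0 = dot mO f0 w.
  rewrite /F clamp_id ?lexx ?(ltW T0)//.
  have l0 : L2 mO (f 0) by apply: cf.1; rewrite in_itv/= lexx ltW.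
  apply: ae_eq_Rintegral => //.
    - exact: (measurable_funM (L2_measurable l0) (L2_measurable lw)).
  - exact: (measurable_funM (L2_measurable lf0) (L2_measurable lw)).
    by apply: negligibleS f00 => p; apply: contra_not => /= h1 _; rewrite h1.
have HT : F T = dot mO (f T) w by rewrite /F clamp_id ?lexx ?(ltW T0).
have := @distribution_FTC T T0 (fun t => e t * F t) W (cmul ce cF) iW.
rewrite HT H0 /e mulr0 expR0 mul1r => ->; first by rewrite /W RintegralB// EU.
move=> th tth; have [sth _ _] := tth.
pose th' := 'D_(1:R) th.
have dth : D th th' by exact: smooth_hasD.
have cth := smooth_cont sth.
have cth' : continuous th' by exact: smooth_cont (smooth_derive _ sth).
(* The exponential is put into the time test function, so that the two terms in [lam] cancel. *)
pose q t := e t * th t.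
have tq : test_function I q.
    have qth : [set x | q x != 0] = [set x | th x != 0].
    by apply/seteqP; split => t /=; rewrite /q mulf_eq0 negb_or (gt_eqF (expR_gt0 _)).
    case: tth => _ t2 t3; split; [|by rewrite qth|by rewrite qth].
  exact: (smoothM (smooth_comp (smoothZ lam smooth_id) smooth_exp) sth).
have cq : continuous q by exact: cmul.
have dq t : derive1 q t = lam * q t + e t * th' t.
  by rewrite derive1E (hasDE t (hasD_mul de dth)) /q; ring.
have thE : derive1 th = th' by apply/funext => t; rewrite derive1E.
have iqF : mu.-integrable I (EFin \o (fun t => lam * (q t * F t))).
  exact: integrable_I (cmul (@cst_continuous R R lam) (cmul cq cF)).
have [Cq qC] := continuous_bound_I cq.
have [lfx lfy lwx lwy] : [/\ True, True, L2 mO (dx w) & L2 mO (xdy w)].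
  by have [_ ? ?] := V_grad_L2 Vw.
have [ig _] := cyl_dot T0 (continuous_measurable_R cq) qC lg lwx.
have [ih _] := cyl_dot T0 (continuous_measurable_R cq) qC lh lwy.
have [iq _] := cyl_dot T0 (continuous_measurable_R cq) qC lO lw.
have := weq _ _ _ Vw q tq.
have E1 : \int[mu]_(t in I) (derive1 q t * L2_dot (f t) w) =
    \int[mu]_(t in I) (lam * (q t * F t)) + \int[mu]_(t in I) (derive1 th t * (e t * F t)).
    rewrite thE.
  rewrite -(RintegralD mI iqF (integrable_I (cmul cth' (cmul ce cF)))).
  apply: eq_Rintegral => t; rewrite inE/= in_itv/= => /andP[t0 t1].
    have -> : L2_dot (f t) w = F t by rewrite /F clamp_id ?(ltW t0) ?(ltW t1).
  by rewrite dq; ring.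
have E2 : \int[mu]_(t in I) (q t * (L2_dot (fun p => g (t, p)) (dx w) + L2_dot (fun p => h (t, p)) (xdy w))) =
    \int[mu]_(t in I) (lam * (q t * F t)) + \int[mu]_(t in I) (q t * FE t).
    rewrite -(RintegralD mI iqF (integrable_I (cmul cq cFE))).
  apply: ae_eq_Rintegral => //.
  - have /measurable_EFinP := measurable_int _ (integrableD mI ig ih).
    by apply: eq_measurable_fun => t _ /=; rewrite -mulrDr.
  - apply: measurable_funS (continuous_measurable_R _) => //.
    move=> t; apply: cvgD; last exact: (cmul cq cFE).
    by apply: cvgM; [exact: cvg_cst|exact: (cmul cq cF)].
    apply: negligibleS Vg => t; apply: contra_not => /= Vt It; have {}Vt := Vt It.
  move: (It); rewrite /= in_itv/= => /andP[t0 t1].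
  have lft : L2 mO (f t) by case: Vt.
  have := V_parts Vt (smooth_dx sw) (smooth_hasD _ (hasD_smooth sw (smooth_dx sw))) (smooth_dy sw)
     (smooth_hasD _ (smooth_derive _ sw)).
  have s1 : smooth (dx w) by exact: hasD_smooth sw (smooth_dx sw).
  have s2 : smooth ('D_((0, 1) : P) w) by exact: smooth_derive.
  move=> /(_ (smooth_cont s1) (smooth_cont (smooth_derive _ s1)) (smooth_cont s2) (smooth_cont (smooth_derive _ s2))).
  rewrite /L2_dot -/(dot mO _ (dx w)) -/(dot mO _ (xdy w)) => h1.
  rewrite [X in q t * X](_ : _ = dot mO (f t) (fun p => lam * w p + E p)).
    rewrite dotDr//; last exact: L2Z.
    by rewrite dotZr// /F /FE clamp_id ?(ltW t0) ?(ltW t1)//; ring.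
  by apply: etrans h1 _; apply: eq_Rintegral => p _; rewrite wE.
have E3 : \int[mu]_(t in I) (th t * W t) =
   \int[mu]_(t in I) (q t * L2_dot (fun p => \1_omega p * u (t, p)) w) - \int[mu]_(t in I) (q t * FE t).
  rewrite -RintegralB//; last by apply: integrable_I; exact: cmul.
  by apply: eq_Rintegral => t _; rewrite /W /q /L2_dot /dot; ring.
rewrite E1 E2 E3; exact: cancel_common.
Qed.

End weak.

Lemma Dx_prod (a a' b b' : R -> R) : D a a' -> D b b' ->
  Dx (fun p => a p.1 * b p.2) (fun p => a' p.1 * b p.2).
Proof.
move=> ha hb; apply: hasD_ext (hasD_mul (Dx_fst ha) (Dx_snd hb)) => // p.
by rewrite mulr0 addr0.
Qed.

Lemma Dy_prod (a a' b b' : R -> R) : D a a' -> D b b' ->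
  Dy (fun p => a p.1 * b p.2) (fun p => a p.1 * b' p.2).
Proof.
move=> ha hb; apply: hasD_ext (hasD_mul (Dy_fst ha) (Dy_snd hb)) => // p.
by rewrite mul0r add0r.
Qed.

Lemma smooth_prod (a b : R -> R) : smooth a -> smooth b -> smooth (fun p : P => a p.1 * b p.2).
Proof. by move=> sa sb; exact: (smoothM (smooth_comp smooth_fst sa) (smooth_comp smooth_snd sb)). Qed.

Lemma hasD_fun (V : normedModType R) (v : V) f g : hasD v f g -> 'D_v f = g.
Proof. by move=> h; apply/funext => x; exact: hasDE. Qed.

Lemma grushin_prod (a a' a'' b b' b'' : R -> R) (p : P) : D a a' -> D a' a'' -> D b b' -> D b' b'' ->
  let w := (fun p : P => a p.1 * b p.2) in
  - ('D_((1, 0) : P) (dx w) p + p.1 ^+ 2 * 'D_((0, 1) : P) ('D_((0, 1) : P) w) p) =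
  - (a'' p.1 * b p.2 + p.1 ^+ 2 * (a p.1 * b'' p.2)).
Proof.
move=> h1 h2 h3 h4 w.
rewrite (_ : dx w = (fun p => a' p.1 * b p.2)); last exact: hasD_fun (Dx_prod h1 h3).
rewrite (_ : 'D_((0, 1) : P) w = (fun p => a p.1 * b' p.2)); last exact: hasD_fun (Dy_prod h1 h3).
by congr (- (_ + _ * _)); [exact: (hasDE p (Dx_prod h2 h3))|exact: (hasDE p (Dy_prod h1 h4))].
Qed.

Lemma D_sinn (n : R) : D (fun y => sin (n * y)) (fun y => n * cos (n * y)).
Proof.
apply: hasD_ext (hasD_comp (hasD_scale n (@D_id)) (@D_sin)) => // y.
by rewrite mulr1 mulrC.
Qed.

Lemma D_cosn (n : R) : D (fun y => n * cos (n * y)) (fun y => - (n ^+ 2 * sin (n * y))).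
Proof.
apply: hasD_ext (hasD_scale n (hasD_comp (hasD_scale n (@D_id)) (@D_cos))) => // y.
by rewrite mulr1; ring.
Qed.

Lemma smooth_sinn (n : R) : smooth (fun y : R => sin (n * y)).
Proof. exact: (smooth_comp (smoothZ n smooth_id) smooth_sincos.1). Qed.

Lemma sin_npi n : sin (n%:R * pi) = 0 :> R.
Proof.
elim: n => [|n IH]; first by rewrite mul0r sin0.
by rewrite -natr1 mulrDl mul1r sinDpi IH oppr0.
Qed.

Lemma smooth_plateau (c c' : R) : 0 < c < c' -> exists K K1 K2 : R -> R,
  [/\ smooth K, D K K1, D K1 K2, forall x, `|x| <= c -> K x = 1 &
      (forall x, `|x| < c -> K1 x = 0 /\ K2 x = 0) /\ forall x, c' <= `|x| -> K x = 0].
Proof.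
move=> /andP[c0 cc]; have [S [S' [sS hS S0 S1 _]]] := @smooth_step.
have d0 : 0 < c' ^+ 2 - c ^+ 2 by rewrite subr_gt0 ltrXn2r// ltW.
pose K x := 1 - S (1 + (x ^+ 2 - c ^+ 2) / (c' ^+ 2 - c ^+ 2)).
have sK : smooth K.
  have s1 : smooth (fun x : R => 1 + (x ^+ 2 - c ^+ 2) / (c' ^+ 2 - c ^+ 2)).
    exact: (smoothD (smooth_cst 1) (smoothM (smoothB (smoothM smooth_id smooth_id) (smooth_cst (c ^+ 2))) (smooth_cst _))).
  exact: (smoothB (smooth_cst 1) (smooth_comp s1 sS)).
have K1 x : `|x| <= c -> K x = 1.
  move=> xc; rewrite /K S0 ?subr0// gerDl pmulr_lle0 ?invr_gt0// subr_le0.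
  by rewrite -real_normK ?num_real// lerXn2r// nnegrE ltW.
have locally_cst (F : R -> R) (e : R) : (forall x, `|x| < c -> F x = e) -> forall x, `|x| < c -> 'D_(1:R) F x = 0.
  move=> Fe x xc; rewrite (_ : 'D_(1:R) F x = 'D_(1:R) (fun=> e) x); last first.
    apply: near_eq_derive.
    near=> y; apply: Fe; near: y.
    have : nbhs (`|x|) (fun t : R => t < c) by exact: lt_nbhsl.
    exact: (@norm_continuous _ R x).
  exact: derive_cst.
exists K, ('D_(1:R) K), ('D_(1:R) ('D_(1:R) K)); split; [exact: sK|exact: smooth_hasD| |exact: K1|split].
- exact: smooth_hasD (smooth_derive _ sK).
- move=> x xc; have h1 y : `|y| < c -> 'D_(1:R) K y = 0.
    by apply: (locally_cst _ 1) => z /ltW; exact: K1.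
  by split; [exact: h1|apply: (locally_cst _ 0) xc].
- move=> x xc; rewrite /K S1 ?subrr// (_ : 2 = 1 + 1 :> R)// lerD2l ler_pdivlMr// mul1r lerD2r.
  by rewrite -[leRHS]real_normK ?num_real// lerXn2r// ?nnegrE// (le_trans _ (ltW cc)) ?ltW.
Unshelve. all: by end_near. Qed.

(** The error is still geometrically small after multiplication by the [n ^ 2] of a second
    derivative, so [power_sum2_unbounded] applies. *)
Lemma moments_unbounded (c : nat -> R) (K0 eta y0 : R) : 0 < y0 < pi -> 0 < eta ->
  c 0%N = 0 ->
  (forall n, (0 < n)%N -> `|c n - (1 - cos (n%:R * y0)) * cos (n%:R * y0) / n%:R ^+ 2| <=
      K0 * n%:R * expR (- (n%:R * eta))) ->
  (exists C, forall n, `|c n| <= C) /\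
  ~ exists M, forall s, 0 <= s < 1 -> `|power_sum c 2 s| <= M.
Proof.
move=> y0pi eta0 c0 cn.
have K00 : 0 <= K0.
  have := le_trans (normr_ge0 _) (cn 1%N isT); rewrite mulr1 pmulr_lge0 ?expR_gt0//.
(* Half of the exponential absorbs the factor [n ^ 3], the other half remains as [q ^ n]. *)
pose q := expR (- (eta / 2)).
have q01 : 0 <= q < 1 by rewrite expR_ge0 /= -expR0 ltr_expR oppr_lt0 divr_gt0.
have eqn n : expR (- (n%:R * (eta / 2))) = q ^+ n by rewrite /q -expRM_natl mulrN.
pose L := 3`!%:R / (eta / 2) ^+ 3.
have h3 n : n%:R ^+ 3 * expR (- (n%:R * (eta / 2))) <= L.
  rewrite ler_pdivlMr ?exprn_gt0 ?divr_gt0// mulrAC -exprMn; apply: pow_expR.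
  by rewrite mulr_ge0// divr_ge0// ltW.
have bd n : n%:R ^+ 3 * expR (- (n%:R * eta)) <= L * q ^+ n.
  rewrite (_ : n%:R * eta = n%:R * (eta / 2) + n%:R * (eta / 2)); last by field.
  rewrite opprD expRD mulrA eqn ler_wpM2r ?exprn_ge0 ?expR_ge0//.
  by rewrite -eqn.
have L0 : 0 <= L by rewrite mulr_ge0// invr_ge0 exprn_ge0// divr_ge0// ltW.
have hb n : `|(1 - cos (n%:R * y0)) * cos (n%:R * y0)| <= 2.
  have := cos_le1 (n%:R * y0); have := cos_geN1 (n%:R * y0); set x := cos _ => x1 x2.
  rewrite normrM -[leRHS]mulr1; apply: ler_pM => //; rewrite ler_norml; lra.
have cC n : `|c n| <= 2 + K0 * L.
  case: (posnP n) => [->|n0]; first by rewrite c0 normr0 addr_ge0// mulr_ge0.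
  rewrite -[c n](subrK ((1 - cos (n%:R * y0)) * cos (n%:R * y0) / n%:R ^+ 2)) addrC.
  have n1 : 1 <= n%:R :> R by rewrite ler1n.
  apply: (le_trans (ler_normD _ _)); apply: lerD.
    rewrite normrM normfV ler_pdivrMr ?normr_gt0 ?expf_neq0 ?gt_eqF ?ltr0n//.
    by rewrite (le_trans (hb n))// ler_peMr// ger0_norm ?exprn_ge0// exprn_ege1.
  apply: (le_trans (cn n n0)); rewrite -mulrA ler_wpM2l//.
  have e1 : q ^+ n <= 1 by case/andP: q01 => ? ?; rewrite exprn_ile1// ltW.
  apply: (@le_trans _ _ (L * q ^+ n)); last by rewrite ler_piMr.
  apply: le_trans (bd n); rewrite ler_wpM2r ?expR_ge0//.
  by rewrite exprSr ler_peMl// exprn_ege1.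
split; first by exists (2 + K0 * L).
apply: (@power_sum2_unbounded c (2 + K0 * L) (K0 * L) q y0) => // n.
set h := (1 - _) * _.
rewrite (_ : _ - _ = (n.+2 * n.+1)%:R * (c n.+2 - h / n.+2%:R ^+ 2)); last first.
  rewrite mulrBr natrM; congr (_ - _).
  by field; rewrite -[2]/(2%:R) -natrD pnatr_eq0.
rewrite normrM normr_nat.
apply: (@le_trans _ _ ((n.+2 ^ 2)%:R * (K0 * n.+2%:R * expR (- (n.+2%:R * eta))))).
  apply: ler_pM => //; last exact: cn.
  by rewrite ler_nat expnS expn1 leq_mul2l leqnSn orbT.
rewrite natrX [leLHS](_ : _ = K0 * (n.+2%:R ^+ 3 * expR (- (n.+2%:R * eta)))); last by ring.
rewrite -mulrA ler_wpM2l//; apply: (le_trans (bd _)); rewrite ler_wpM2l//.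
by case/andP: q01 => q0 q1; apply: ler_wiXn2l => //; [exact: ltW|rewrite ltnW].
Qed.

(* |1 - s z|^2 >= 1 - cos^2 for [z] of argument [th], hence the distance to the
   forbidden ray is controlled by the angle *)
Lemma kq_angle (r th s d eta : R) : 0 <= r <= eta -> - (2 * eta)^-1 < s -> 0 < eta -> 0 <= d <= 1 -> cos th <= d ->
  Num.min (1 / 4) (1 - d ^+ 2) <= kq (r * cos th) (r * sin th) s.
Proof.
move=> /andP[r0 re] se eta0 /andP[d0 d1] cd.
have E : kq (r * cos th) (r * sin th) s = 1 - 2 * (s * r) * cos th + (s * r) ^+ 2.
  rewrite /kq; have := cos2Dsin2 th; set x := cos th; set y := sin th => h.
      transitivity (1 - 2 * (s * r) * x + (s * r) ^+ 2 * (x ^+ 2 + y ^+ 2)); first by ring.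
  by rewrite h mulr1.
rewrite E; have [c1 c2] := (cos_geN1 th, cos_le1 th).
have [s0|s0] := leP 0 s.
  rewrite ge_min; apply/orP; right.
  have sr : 0 <= s * r by rewrite mulr_ge0.
    move: (s * r) sr => t t0; have h1 := sqr_ge0 (t - d).
  have h2 : 0 <= t * (d - cos th) by rewrite mulr_ge0// subr_ge0.
  nra.
rewrite ge_min; apply/orP; left.
have sr1 : - (1 / 2) <= s * r.
  have : s * eta <= s * r by rewrite ler_nM2l.
  have : - (1 / 2) <= s * eta.
        have h1 : - (2 * eta)^-1 * eta <= s * eta by rewrite ler_pM2r// ltW.
    by apply: le_trans h1; apply: eq_leW; field; rewrite gt_eqF.
  lra.
have sr2 : s * r <= 0 by rewrite mulr_le0_ge0// ltW.
move: (s * r) sr1 sr2 => x x1 x2; nra.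
Qed.

Lemma kq_small (a b s r : R) : a ^+ 2 + b ^+ 2 <= r ^+ 2 -> 0 <= r <= 1 -> -1 < s < 1 ->
  (1 - r) ^+ 2 <= kq a b s.
Proof.
move=> ab /andP[r0 r1] /andP[s0 s1].
have ar : `|a| <= r.
  rewrite -ler_sqr ?nnegrE// real_normK ?num_real//.
  by apply: le_trans ab; rewrite lerDl sqr_ge0.
have sa : `|s * a| <= r.
  rewrite normrM (le_trans _ ar)// ler_piMl// ler_norml; lra.
apply: (@le_trans _ _ ((1 - s * a) ^+ 2)); last by rewrite /kq lerDl sqr_ge0.
move: sa; rewrite ler_norml => /andP[h1 h2].
by rewrite lerXn2r ?nnegrE; lra.
Qed.

(** * Geometry of the control region *)

Section geometry.
Lemma clamp_within (T : R) (g : R -> R) : 0 < T -> {within `[0, T], continuous g} ->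
  continuous (fun t => g (clamp T t)).
Proof.
move=> T0 /subspace_continuousP cg t0.
have h := cg _ (clamp_itv T0 t0).
apply: (@cvg_comp _ _ _ (clamp T) g _ (within `[0, T] (nbhs (clamp T t0)))) => // A hA.
have hA' : nbhs (clamp T t0) (fun x => x \in `[0, T] -> A x) by exact: hA.
have hc : nbhs t0 (fun t => clamp T t \in `[0, T] -> A (clamp T t)) by exact: clamp_cont hA'.
change (nbhs t0 (fun t => A (clamp T t))); apply: filterS hc => t; apply; exact: clamp_itv.
Qed.

Variables (g1 g2 : R -> R).
Hypothesis g1_cont : {within `[0, pi], continuous g1}.
Hypothesis g2_cont : {within `[0, pi], continuous g2}.
Hypothesis g1_range : forall y, y \in `[0, pi] -> -1 < g1 y < 1.
Hypothesis g2_range : forall y, y \in `[0, pi] -> -1 < g2 y < 1.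
Let om : set P := [set p | Omega p /\ g1 p.2 < p.1 < g2 p.2].
Let a : R := Num.max (sup (g2^\- @` `[0, pi])) (sup (g1^\+ @` `[0, pi])).

Lemma om_measurable : measurable (om : set plane).
Proof.
have c1 := clamp_within (pi_gt0 R) g1_cont; have c2 := clamp_within (pi_gt0 R) g2_cont.
have cfst : continuous (fst : P -> R) by move=> p; exact: cvg_fst.
have cg (g : R -> R) : continuous g -> continuous (fun p : P => g p.2).
  by move=> h p; apply: (@cvg_comp _ _ _ snd g _ (nbhs p.2)); [exact: cvg_snd|exact: h].
rewrite (_ : om = Omega `&` ([set p | 0 < p.1 - g1 (clamp pi p.2)] `&` [set p | 0 < g2 (clamp pi p.2) - p.1])).
  apply: measurableI; first exact: measurable_Omega.
  apply: measurableI; apply: open_measurable_plane.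
    apply: (@open_comp _ _ (fun p : P => p.1 - g1 (clamp pi p.2)) [set x | 0 < x]); last exact: open_gt.
    by move=> p _; apply: cvgB; [exact: cfst|exact: cg c1 p].
  apply: (@open_comp _ _ (fun p : P => g2 (clamp pi p.2) - p.1) [set x | 0 < x]); last exact: open_gt.
  by move=> p _; apply: cvgB; [exact: cg c2 p|exact: cfst].
apply/seteqP; split => p /= [Op].
  move=> /andP[h1 h2]; have [_ h3] := Omega_itv Op.
  by rewrite !clamp_id// !subr_gt0.
have [_ h3] := Omega_itv Op.
by rewrite !clamp_id// !subr_gt0 => -[h1 h2]; split => //; rewrite h1 h2.
Qed.

Lemma sup_part_ge0 (g : R -> R) : (forall y, y \in `[0, pi] -> 0 <= g y <= 1) ->
  0 <= sup (g @` `[0, pi]) <= 1.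
Proof.
move=> g01; have i0 : (0 : R) \in `[0, pi] by rewrite in_itv/= lexx pi_ge0.
have /andP[h0 h1] := g01 _ i0.
apply/andP; split; last first.
  apply: ge_sup; first by exists (g 0); exists 0.
  by move=> _ [y yy <-]; case/andP: (g01 y yy).
apply: le_trans h0 _; apply: ub_le_sup; last by exists 0.
by exists 1 => _ [y yy <-]; case/andP: (g01 y yy).
Qed.

Lemma part_range (g : R -> R) y : -1 < g y < 1 -> 0 <= g^\- y <= 1 /\ 0 <= g^\+ y <= 1.
Proof.
move=> /andP[h1 h2]; rewrite /funrneg /funrpos !le_max !ge_max !lexx !orbT /=.
by rewrite ler01 !andbT; split; lra.
Qed.

Lemma width_range : 0 <= a <= 1.
Proof.
have /andP[h1 h2] := sup_part_ge0 (fun y yy => (part_range (g2_range yy)).1).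
have /andP[h3 h4] := sup_part_ge0 (fun y yy => (part_range (g1_range yy)).2).
by rewrite /a le_max h1 ge_max h2 h4.
Qed.

(** The extreme value may be approached at the ends 0 or [pi], whereas the argument with [y0] needs
    an interior point; the centre is shifted inside a small interval. *)
Lemma nearby_interior (y1 e : R) : y1 \in `[0, pi] -> 0 < e ->
  exists y0 d, [/\ 0 < y0 < pi, 0 < d & forall y, `|y - y0| < d -> `|y - y1| < e].
Proof.
rewrite in_itv/= => /andP[h0 h1] e0; have p0 := pi_gt0 R.
pose r := Num.min (e / 2) (pi / 4).
have r0 : 0 < r by rewrite lt_min !divr_gt0.
have re : r <= e / 2 by rewrite ge_min lexx.
have rp : r <= pi / 4 by rewrite ge_min lexx orbT.
have [hy|hy] := leP y1 (pi / 2).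
  exists (y1 + r), r; split => //; first by lra.
  move=> y; rewrite !ltr_norml => /andP[u1 u2]; lra.
exists (y1 - r), r; split => //; first by lra.
move=> y; rewrite !ltr_norml => /andP[u1 u2]; lra.
Qed.

(** [a] is attained as a supremum by the negative part of [g2] or by the positive part of [g1]. In
    either case the region lies on one side, beyond [b], near some ordinate, and continuity extends
    this to a strip. *)
Lemma far_strip (T : R) : 0 < T -> T < a ^+ 2 / 2 ->
  exists y0 d b, [/\ 0 < y0 < pi, 0 < d, 0 < b < 1, T < b ^+ 2 / 2 &
    forall p, om p -> `|p.2 - y0| < d -> b < `|p.1|].
Proof.
move=> T0 Ta; have /andP[a0 a1] := width_range.
(* [b ^ 2] is midway between [2 T] and [a ^ 2]. *)
pose b := Num.sqrt ((a ^+ 2 + 2 * T) / 2).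
have b2 : b ^+ 2 = (a ^+ 2 + 2 * T) / 2 by rewrite sqr_sqrtr// divr_ge0// addr_ge0 ?sqr_ge0// mulr_ge0// ltW.
have b0 : 0 < b by rewrite sqrtr_gt0 divr_gt0// ltr_wpDl ?sqr_ge0// mulr_gt0.
have ba : b < a by rewrite -(ltr_pXn2r (n := 2))// ?nnegrE ?(ltW b0)// b2; lra.
have b1 : b < 1 by exact: lt_le_trans a1.
have b00 : (b < 0) = false by rewrite ltNge ltW.
have key (g : R -> R) : {within `[0, pi], continuous g} -> (exists2 y, y \in `[0, pi] & b < g y) ->
    exists y0 d, [/\ 0 < y0 < pi, 0 < d & forall y, y \in `[0, pi] -> `|y - y0| < d -> b < g y].
  move=> cg [y1 y1i by1]; have cgc := clamp_within (pi_gt0 R) cg.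
  have : nbhs y1 (fun y => b < g (clamp pi y)).
    apply: (cgc y1 (fun t => b < t)); apply: lt_nbhsr.
    by rewrite clamp_id//; move: y1i; rewrite in_itv.
  move=> /nbhs_normP[e /= e0 he].
  have [y0 [d [y0p d0 hd]]] := nearby_interior y1i e0.
  exists y0, d; split => // y yi /hd h; have := he y; rewrite /= distrC => /(_ h).
  by rewrite clamp_id//; move: yi; rewrite in_itv.
have in_of p : om p -> p.2 \in `[0, pi].
  by move=> [/Omega_itv[_ h] _]; rewrite in_itv.
have ne (g : R -> R) : g @` `[0, pi] !=set0 by exists (g 0); exists 0 => //=; rewrite in_itv/= lexx pi_ge0.
move: ba; rewrite /a lt_max => /orP[] /(sup_gt (ne _))[_ [y yi <-]];  rewrite ?/funrneg ?/funrpos lt_max b00 orbF => by1.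
  have cN : {within `[0, pi], continuous (fun y => - g2 y)} by move=> x; apply: cvgN; exact: g2_cont.
  have [y0 [d [y0p d0 hd]]] := key _ cN (ex_intro2 _ _ y yi by1).
  exists y0, d, b; split => //; [by rewrite b0|by rewrite b2; lra|].
  move=> p op dp; have := hd _ (in_of _ op) dp; case: op => _ /andP[_ u2] h.
  by rewrite -normrN (lt_le_trans _ (ler_norm _))//; lra.
have [y0 [d [y0p d0 hd]]] := key _ g1_cont (ex_intro2 _ _ y yi by1).
exists y0, d, b; split => //; [by rewrite b0|by rewrite b2; lra|].
move=> p op dp; have := hd _ (in_of _ op) dp; case: op => _ /andP[u1 _] h.
by rewrite (lt_le_trans _ (ler_norm _))//; lra.
Qed.

End geometry.

Lemma Rintegral_indic (X E : set R) (g : R -> R) : E `<=` X ->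
  \int[mu]_(x in X) (\1_E x * g x) = \int[mu]_(x in E) g x.
Proof.
move=> EX; rewrite -[in RHS](setIidr EX) Rintegral_mkcondr.
by apply: eq_Rintegral => x _; rewrite /patch indicE; case: (x \in E); rewrite ?mul1r ?mul0r.
Qed.

Lemma int_rect (a b : R -> R) (c y0 : R) : continuous a -> continuous b -> 0 < c < 1 -> 0 < y0 < pi ->
  \int[mO]_p (\1_(`]0, c[ `*` `]0, y0[) p * (a p.1 * b p.2)) = Int 0 c a * Int 0 y0 b.
Proof.
move=> ca cb /andP[c0 c1] /andP[y00 y0p].
have cab := ctensor ca cb.
have mF : measurable_fun setT ((fun p => \1_(`]0, c[ `*` `]0, y0[) p * (a p.1 * b p.2)) : plane -> R).
  apply: measurable_funM; last exact: continuous_measurable_plane.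
  by apply: measurable_indic; apply: measurableX; exact: measurable_itv.
rewrite int_Omega_yx//; last first.
  have [C hC] := cont_bO cab; exists C => p /hC; apply: le_trans.
  by rewrite normrM ler_piMl// indicE; case: (_ \in _); rewrite ?normr1 ?normr0.
rewrite (@eq_Rintegral _ _ _ mu _ (fun y => \1_(`]0, y0[) y * (Int 0 c a * b y))).
  rewrite Rintegral_indic.
    rewrite Int_oo; last exact: cscale.
    by rewrite IntZ.
  by move=> y /=; rewrite !in_itv/= => /andP[-> h]; rewrite (lt_trans h).
move=> y _; rewrite (@eq_Rintegral _ _ _ mu _ (fun x => \1_(`]0, c[) x * ((\1_(`]0, y0[) y * b y) * a x))); last first.
  by move=> x _; rewrite !indicE in_setX; case: (x \in _); case: (y \in _); rewrite /= ?mul0r ?mul1r// mulrC.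
rewrite Rintegral_indic; last first.
  by move=> x /=; rewrite !in_itv/= => /andP[h1 h2]; lra.
rewrite Int_oo; last exact: cscale.
by rewrite IntZ//; ring.
Qed.

Lemma D_gauss (m : R) : D (fun x => expR (- (m / 2) * x ^+ 2)) (fun x => expR (- (m / 2) * x ^+ 2) * (- (m * x))).
Proof.
apply: hasD_ext (hasD_comp (hasD_scale (- (m / 2)) (hasD_mul (@D_id) (@D_id))) (@D_exp)) => //.
by move=> x /=; rewrite -expr2; congr (_ * _); field.
Qed.

Lemma smooth_gauss (m : R) : smooth (fun x : R => expR (- (m / 2) * x ^+ 2)).
Proof. exact: (smooth_comp (smoothZ (- (m / 2)) (smoothM smooth_id smooth_id)) smooth_exp). Qed.

Lemma gauss_int (m c : R) : 0 < m -> 0 < c ->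
  Int 0 c (fun x => x * expR (- (m / 2) * x ^+ 2)) = (1 - expR (- (m / 2) * c ^+ 2)) / m.
Proof.
move=> m0 c0; rewrite (FTC (F := fun x => - m^-1 * expR (- (m / 2) * x ^+ 2)) (ltW c0)).
- by rewrite expr0n/= mulr0 expR0; ring.
- apply: hasD_ext (hasD_scale (- m^-1) (@D_gauss m)) => // x.
  by field; rewrite gt_eqF.
- exact: smooth_cont (smoothM smooth_id (@smooth_gauss m)).
Qed.

Lemma sin_int (m y0 : R) : 0 < m -> 0 < y0 -> Int 0 y0 (fun y => sin (m * y)) = (1 - cos (m * y0)) / m.
Proof.
move=> m0 c0; rewrite (FTC (F := fun y => - m^-1 * cos (m * y)) (ltW c0)).
- by rewrite mulr0 cos0; ring.
- apply: hasD_ext (hasD_scale (- m^-1) (hasD_comp (hasD_scale m (@D_id)) (@D_cos))) => // x.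
  by field; rewrite gt_eqF.
- exact: smooth_cont (@smooth_sinn m).
Qed.

Lemma cos_away (m th : R) : 0 <= m -> m <= th <= 2 * pi - m -> cos th <= cos m.
Proof.
move=> m0; have p0 := pi_gt0 R.
have key x : m <= x <= pi -> cos x <= cos m.
  move=> /andP[h1 h2]; case: (eqVneq x m) => [->//|ne].
  have mx : m < x by rewrite lt_neqAle eq_sym ne.
  have i1 : x \in `[0, pi] by rewrite in_itv/= (le_trans m0).
  have i2 : m \in `[0, pi] by rewrite in_itv/= m0 (le_trans h1).
  by apply: ltW; rewrite (ltr_cos i2 i1).
move=> /andP[h1 h2]; have [h|h] := leP th pi; first by apply: key; rewrite h1.
have -> : cos th = cos (2 * pi - th).
  by rewrite (_ : 2 * pi - th = - th + pi *+ 2) ?cosD2pi ?cosN// mulr2n; ring.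
by apply: key; lra.
Qed.

Lemma nrm_bound_continuous_L2 (T : R) (f : R -> P -> R) : 0 < T -> continuous_L2 T f ->
  exists2 M, 0 <= M & forall t, 0 <= t <= T -> nrm mO (f (clamp T t)) <= M.
Proof.
move=> T0 cf; have lf t : L2 mO (f (clamp T t)) by apply: cf.1; exact: clamp_itv.
have cn : continuous (fun t => nrm mO (f (clamp T t))).
  move=> t0; apply/cvgrPdist_le => e e0.
  have /cvgrPdist_le/(_ _ e0) := clamp_L2_cont T0 cf t0.
  apply: filterS => t; rewrite sub0r normrN (ger0_norm (nrm_ge0 _ _)) => h.
  apply: le_trans h; have h1 := nrm_triangle (lf t) (lf t0) (L20 mO).
  have h2 := nrm_triangle (lf t0) (lf t) (L20 mO).
  have E0 s : nrm mO (fun p => f (clamp T s) p - 0) = nrm mO (f (clamp T s)).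
    by congr nrm; apply/funext => p; rewrite subr0.
  rewrite !E0 in h1 h2; rewrite nrmBC in h2.
    by rewrite ler_norml lerNl opprB !lerBlDr h2 h1.
have [C C0 hC] := continuous_bound 0 T cn.
by exists C => // t /hC; apply: le_trans; exact: ler_norm.
Qed.

(** * Moments of a controlled solution *)

Section neg5.
Variables (T y0 d b c c' : R) (om : set P).
Hypothesis T0 : 0 < T.
Local Notation mC := (@mu_cylinder R T).
Local Notation I := (`]0, T[%classic : set R).
Hypothesis (y0p : 0 < y0 < pi) (d0 : 0 < d) (b01 : 0 < b < 1) (Tb : T < b ^+ 2 / 2).
Hypothesis (bc : b < c) (c01 : 0 < c < 1) (cc' : c < c' < 1).
Hypothesis mom : measurable (om : set plane).
Hypothesis omO : om `<=` Omega.
Hypothesis far : forall p, om p -> `|p.2 - y0| < d -> b < `|p.1|.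

Section kernel_data.
Variable sg : R.
Hypothesis sg1 : sg = 1 \/ sg = -1.
Let A : set space := [set z | I z.1 /\ om z.2].

(** Real part of the complex number [exp (t - x ^ 2 / 2 + i (y - sg y0))], set to 0 off the control
    cylinder; [ker_b] is its imaginary part. The signs [sg = 1] and [sg = -1] give the two shifts of
    [y]. *)
Definition ker_a (z : space) : R := \1_A z * (expR (z.1 - z.2.1 ^+ 2 / 2) * cos (z.2.2 - sg * y0)).

Definition ker_b (z : space) : R := \1_A z * (expR (z.1 - z.2.1 ^+ 2 / 2) * sin (z.2.2 - sg * y0)).

(** A lower bound for the distance of the angle to the multiples of [2 pi], outside the strip
    [|y - y0| < d] for [sg = 1] and everywhere for [sg = -1]. *)
Let m := Num.min (Num.min y0 (pi - y0)) (Num.min d (pi / 2)).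
Let r1 := expR (T - b ^+ 2 / 2).

(** Lower bound for [|1 - s z|], one entry per situation: [1 / 2] off the control cylinder and for
    negative [s], [sin m] when the angle is at least [m], [1 - r1] in the strip, where
    [|z| <= r1 < 1]. *)
Definition ker_dl := Num.min (1 / 2) (Num.min (sin m) (1 - r1)).

Definition ker_r := expR T.

(** The first bound keeps [|s| < 1] for [kq_small], the second keeps [|s z| <= 1 / 2] for negative
    [s] in [kq_angle]. *)
Definition ker_eta := Num.min 1 (2 * ker_r)^-1.

Lemma ker_A_measurable : measurable (A : set space).
Proof.
rewrite (_ : A = I `*` om); first by apply: measurableX => //; exact: measurable_itv.
by apply/seteqP; split => z.
Qed.

Lemma ker_measurable : measurable_fun setT ker_a /\ measurable_fun setT ker_b.
Proof.
have m1 : measurable_fun setT (fun z : space => z.2.1).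
  exact: (measurableT_comp measurable_fst measurable_snd).
have m2 : measurable_fun setT (fun z : space => z.2.2 - sg * y0).
  apply: measurable_funB => //; exact: (measurableT_comp measurable_snd measurable_snd).
have me : measurable_fun setT (fun z : space => expR (z.1 - z.2.1 ^+ 2 / 2)).
  apply: (measurableT_comp (continuous_measurable_R (smooth_cont smooth_exp))).
  apply: measurable_funB; first exact: measurable_fst.
  by apply: measurable_funM => //; exact: measurable_funX.
have mA : measurable_fun setT (\1_A : space -> R) by apply: measurable_indic; exact: ker_A_measurable.
have [ss sc] := @smooth_sincos.
split; apply: measurable_funM => //; apply: measurable_funM => //.
  exact: (measurableT_comp (continuous_measurable_R (smooth_cont sc)) m2).
exact: (measurableT_comp (continuous_measurable_R (smooth_cont ss)) m2).
Qed.

Lemma ker_in z : A z -> ker_a z = expR (z.1 - z.2.1 ^+ 2 / 2) * cos (z.2.2 - sg * y0) /\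
  ker_b z = expR (z.1 - z.2.1 ^+ 2 / 2) * sin (z.2.2 - sg * y0).
Proof. by move=> Az; rewrite /ker_a /ker_b indicE mem_set// !mul1r. Qed.

Lemma ker_out z : ~ A z -> ker_a z = 0 /\ ker_b z = 0.
Proof. by move=> Az; rewrite /ker_a /ker_b indicE memNset// !mul0r. Qed.

Let m_pos : 0 < m <= pi / 2.
Proof.
have p0 := pi_gt0 R; case/andP: y0p => h1 h2.
by rewrite !lt_min h1 d0 divr_gt0// subr_gt0 h2 /= !ge_min lexx !orbT.
Qed.

Lemma ker_pos : [/\ 0 < ker_dl, 0 < ker_r & 0 < ker_eta].
Proof.
have p0 := pi_gt0 R; case/andP: m_pos => h1 h2.
have sm : 0 < sin m by rewrite sin_gt0_pi// h1; lra.
split; rewrite /ker_eta /ker_dl ?lt_min ?sm ?ltr01 ?invr_gt0 ?mulr_gt0 ?divr_gt0 ?expR_gt0//=.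
by rewrite subr_gt0 /r1 -[ltRHS]expR0 ltr_expR subr_lt0.
Qed.

Lemma ker_radius z : ker_a z ^+ 2 + ker_b z ^+ 2 <= ker_r ^+ 2.
Proof.
have [Az|Az] := pselect (A z); last first.
  by have [-> ->] := ker_out Az; rewrite expr0n/= addr0 sqr_ge0.
have [-> ->] := ker_in Az; rewrite !exprMn -mulrDr cos2Dsin2 mulr1.
apply: lerXn2r; rewrite ?nnegrE ?expR_ge0// ler_expR.
case: Az; rewrite /= in_itv/= => /andP[_ h] _.
have := sqr_ge0 z.2.1; lra.
Qed.

Lemma ker_far s z : - ker_eta < s < 1 -> ker_dl ^+ 2 <= kq (ker_a z) (ker_b z) s.
Proof.
move=> /andP[s0 s1]; have [dl0 rr0 eta0] := ker_pos.
have p0 := pi_gt0 R; case/andP: m_pos => mp1 mp2; case/andP: (y0p) => y01 y02.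
have sq x : ker_dl <= x -> ker_dl ^+ 2 <= x ^+ 2.
  by move=> h; rewrite lerXn2r ?nnegrE ?(ltW dl0)// (le_trans _ h)// ltW.
have d1 : ker_dl ^+ 2 <= (1 / 2) ^+ 2 by apply: sq; rewrite ge_min lexx.
have d2 : ker_dl ^+ 2 <= sin m ^+ 2 by apply: sq; rewrite !ge_min lexx !orbT.
have d3 : ker_dl ^+ 2 <= (1 - r1) ^+ 2 by apply: sq; rewrite !ge_min lexx !orbT.
have se1 : - 1 < s by apply: le_lt_trans s0; rewrite lerN2 ge_min lexx.
have se2 : - (2 * ker_r)^-1 < s by apply: le_lt_trans s0; rewrite lerN2 ge_min lexx orbT.
have [Az|Az] := pselect (A z); last first.
  have [-> ->] := ker_out Az; rewrite /kq !mulr0 subr0 expr1n expr0n/= addr0.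
  by apply: (le_trans d1); lra.
have [Ea Eb] := ker_in Az; rewrite Ea Eb.
case: (Az) => /=; rewrite in_itv/= => /andP[t0 tT] oz.
have /Omega_itv[_ /andP[y1 y2]] := omO oz.
have away : m <= `|z.2.2 - sg * y0| <= 2 * pi - m ->
    ker_dl ^+ 2 <= kq (expR (z.1 - z.2.1 ^+ 2 / 2) * cos (z.2.2 - sg * y0)) (expR (z.1 - z.2.1 ^+ 2 / 2) * sin (z.2.2 - sg * y0)) s.
  move=> h; have h1 := cos_away (ltW mp1) h; rewrite cos_norm in h1.
  have rz : 0 <= expR (z.1 - z.2.1 ^+ 2 / 2) <= ker_r.
    by rewrite expR_ge0 ler_expR; have := sqr_ge0 z.2.1; lra.
  have cm : 0 <= cos m <= 1.
    by rewrite cos_le1 andbT cos_ge0_pihalf//; lra.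
  apply: le_trans (kq_angle rz se2 rr0 cm h1).
  rewrite le_min; apply/andP; split; first by apply: (le_trans d1); lra.
  by apply: (le_trans d2); rewrite -(cos2Dsin2 m); lra.
have mm : [/\ m <= y0, m <= pi - y0, m <= d & m <= pi / 2].
  by rewrite !ge_min !lexx !orbT.
case: mm => mm1 mm2 mm3 mm4.
(* For [sg = -1] the angle [y + y0] lies between [y0] and [pi + y0], away from the multiples of
   [2 pi]. For [sg = 1] the angle [y - y0] is small only in the strip, where [|x| > b] gives
   [|z| < 1] instead. *)
case: sg1 => sgE; rewrite sgE in Ea Eb away *; last first.
  by apply: away; rewrite ger0_norm; lra.
have [near|nn] := ltP `|z.2.2 - y0| d; last first.
  apply: away; rewrite mul1r (le_trans mm3)//=.
  by rewrite ler_norml; lra.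
have bz := far oz near.
apply: (le_trans d3); apply: kq_small; last by rewrite se1.
  rewrite !exprMn -mulrDr cos2Dsin2 mulr1.
  apply: lerXn2r; rewrite ?nnegrE ?expR_ge0// ler_expR.
  have : b ^+ 2 <= z.2.1 ^+ 2.
    rewrite -[leRHS]real_normK ?num_real//; case/andP: b01 => b0 _.
    by rewrite lerXn2r ?nnegrE ?(ltW b0)// ltW.
  lra.
by rewrite expR_ge0 /= -expR0 ler_expR subr_le0 ltW.
Qed.

Variables (K : R -> R) (u : space -> R).
Hypothesis cK : continuous K.
Hypothesis lu : L2 mC (fun z => \1_om z.2 * u z).
(** The factor [- 1 / 2] comes from [- cos (n y0) sin (n y)] written as a sum of two sines; the
    factor 1 is the time factor expected by [L2_tensor]. *)
Let v (z : space) : R := (\1_om z.2 * u z) * (1 * (- (1 / 2) * K z.2.1)).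

Lemma K2_cont : continuous (fun p : P => - (1 / 2) * K p.1).
Proof.
by apply: cscale => p; apply: continuous_comp; [exact: cvg_fst|exact: cK].
Qed.

Lemma ker_v_integrable : mC.-integrable setT (EFin \o v).
Proof.
have le1 t : I t -> `|(fun=> 1 : R) t| <= 1 by rewrite normr1.
have [l1 _] := L2_tensor T0 ler01 (measurable_cst _) le1 (L2_cont K2_cont).
exact: (L2_integrable lu l1).
Qed.

Lemma ker_moment n : \int[mC]_z (v z * (kpow (ker_a z) (ker_b z) n 0).2) =
  dot mC (fun z => \1_om z.2 * u z) (fun z => expR (n%:R * z.1) *
     (- (1 / 2) * (expR (- (n%:R / 2) * z.2.1 ^+ 2) * K z.2.1 * sin (n%:R * (z.2.2 - sg * y0))))).
Proof.
have [ma mb] := ker_measurable; have [dl0 rr0 eta0] := ker_pos.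
have e0 : - ker_eta < (0 : R) < 1 by rewrite oppr_lt0 eta0 /= ltr01.
have [_ mk] := @kpow_measurable _ _ ker_a ker_b ker_dl ker_eta ma mb dl0 ker_far n 0 e0.
have mv : measurable_fun setT v by have /measurable_EFinP := measurable_int _ ker_v_integrable.
have cW : continuous (fun p : P => - (1 / 2) * (expR (- (n%:R / 2) * p.1 ^+ 2) * K p.1 * sin (n%:R * (p.2 - sg * y0)))).
  apply: cscale; apply: (ctensor (a := fun x => expR (- (n%:R / 2) * x ^+ 2) * K x) (b := fun y => sin (n%:R * (y - sg * y0)))).
    exact: cmul (smooth_cont (@smooth_gauss n%:R)) cK.
  exact: (smooth_cont (smooth_comp (smoothB smooth_id (smooth_cst (sg * y0))) (@smooth_sinn n%:R))).
have mexp : measurable_fun setT (fun z : space => expR (n%:R * z.1)).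
  apply: (measurableT_comp (continuous_measurable_R (smooth_cont smooth_exp))).
  by apply: measurable_funM => //; exact: measurable_fst.
rewrite /dot !Rintegral_mrestr.
- apply: eq_Rintegral => z; rewrite inE => -[/= tz Oz].
  rewrite /v indicE; have [oz|oz] := pselect (om z.2); last by rewrite memNset// !mul0r.
  have Az : A z by split.
  have [-> ->] := ker_in Az; rewrite kpow_polar mem_set// !mul1r /=.
  rewrite (_ : expR (n%:R * (z.1 - z.2.1 ^+ 2 / 2)) = expR (n%:R * z.1) * expR (- (n%:R / 2) * z.2.1 ^+ 2)).
    by ring.
  by rewrite -expRD; congr expR; field.
- apply: measurable_funM; first exact: L2_measurable lu.
  by apply: measurable_funM => //; exact: (measurableT_comp (continuous_measurable_plane cW) measurable_snd).
- exact: measurable_funM.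
Qed.

Lemma ker_family : exists2 B : nat -> R -> R,
  forall j s, - ker_eta < s < 1 -> is_derive s (1:R) (B j) (B j.+1 s) &
  (exists2 V, 0 <= V & forall j s, - ker_eta < s < 1 -> `|B j s| <= V * j`!%:R / (ker_dl / ker_r) ^+ j) /\
  forall n, B n 0 = n`!%:R * dot mC (fun z => \1_om z.2 * u z) (fun z => expR (n%:R * z.1) *
     (- (1 / 2) * (expR (- (n%:R / 2) * z.2.1 ^+ 2) * K z.2.1 * sin (n%:R * (z.2.2 - sg * y0))))).
Proof.
have [ma mb] := ker_measurable; have [dl0 rr0 eta0] := ker_pos.
have [B dB [bB B0]] := @moment_family _ _ mC v ker_a ker_b ker_dl ker_eta ker_r ker_v_integrable ma mb dl0 eta0 rr0 ker_radius (fun s y => @ker_far s y).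
by exists B => //; split => // n; rewrite B0 ker_moment.
Qed.

End kernel_data.

(** The same numbers [cc_ n] are computed twice: from the initial datum, where the second derivative
    of their power series is unbounded at 1, and from the control, where it is bounded. *)
Lemma moments_vs_control (K K1 K2 : R -> R) : D K K1 -> D K1 K2 -> smooth K ->
  (forall x, `|x| <= c -> K x = 1) -> (forall x, `|x| < c -> K1 x = 0 /\ K2 x = 0) ->
  (forall x, c' <= `|x| -> K x = 0) ->
  null_controllable om T -> False.
Proof.
move=> hK hK1 sK K_1 K_in K_0 NC.
(* The datum is chosen for explicit moments: [x exp (- n x ^ 2 / 2)] and [sin (n y)] have elementary
   primitives, and the product of the two integrals is close to [(1 - cos (n y0)) / n ^ 2]. *)
pose f0 (p : P) : R := \1_(`]0, c[ `*` `]0, y0[) p * p.1.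
have mbox : measurable (`]0, c[ `*` `]0, y0[ : set plane).
  by apply: measurableX; exact: measurable_itv.
have mf0 : measurable_fun setT (f0 : plane -> R).
  by apply: measurable_funM; [exact: measurable_indic|exact: measurable_fst].
have lf0 : L2 mO f0.
  apply: L2_Omega => //; exists 1 => p [/= /[!in_itv]/= /andP[x1 x2] _].
  rewrite normrM mulr_ile1// ?indicE ?ler_norml; last by rewrite !ltW.
    by case: (_ \in _) => /=; lra.
have [u [lu [f [wk fT]]]] := NC f0 lf0.
have cf : continuous_L2 T f by case: wk.
have [M M0 fM] := nrm_bound_continuous_L2 T0 cf.
have [lO _] := L2_indic mom lu.
have sK1 : smooth K1 by exact: hasD_smooth sK hK.
have sK2 : smooth K2 by exact: hasD_smooth sK1 hK1.
have [C1 C10 K1C] := continuous_bound (-1) 1 (smooth_cont sK1).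
have [C2 C20 K2C] := continuous_bound (-1) 1 (smooth_cont sK2).
pose S := Num.sqrt (fine (mO setT)).
(* Rate of the errors: the cutoff defect has size [exp (- n c ^ 2 / 2)] and is amplified by at most
   [exp (n T)]. *)
pose eta := c ^+ 2 / 2 - T.
have cexp n : continuous (fun t : R => expR (n%:R * t)).
  exact: smooth_cont (smooth_comp (smoothZ n%:R smooth_id) smooth_exp).
have lexp n w : L2 mO w -> L2 mC (fun z => expR (n%:R * z.1) * w z.2).
  move=> lw; have [Ce eC] := continuous_bound_I T (cexp n).
  have eC' t : I t -> `|expR (n%:R * t)| <= `|Ce| by move=> /eC h; rewrite (le_trans h)// ler_norm.
  by have [] := L2_tensor T0 (normr_ge0 Ce) (continuous_measurable_R (cexp n)) eC' lw.
have eta0 : 0 < eta.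
  have h : b ^+ 2 < c ^+ 2 by case/andP: b01 => b0 _; rewrite ltrXn2r// ltW.
  by rewrite subr_gt0; apply: lt_trans Tb _; rewrite ltr_pM2r ?invr_gt0.
have [c0 c1] := andP c01; have [y00 y0pi] := andP y0p; have [cc c1'] := andP cc'.
pose G n x : R := expR (- (n%:R / 2) * x ^+ 2).
pose W n (p : P) : R := G n p.1 * K p.1 * sin (n%:R * p.2).
(* The defect of the truncated Gaussian as an eigenfunction: only terms with derivatives of [K],
   which live in [|x| >= c]. *)
pose E n (p : P) : R := G n p.1 * (2 * n%:R * p.1 * K1 p.1 - K2 p.1) * sin (n%:R * p.2).
have sG n : smooth (G n) by exact: smooth_gauss.
have sA n : smooth (fun x => G n x * K x) by exact: (smoothM (sG n) sK).
have sW n : smooth (W n) := smooth_prod (sA n) (@smooth_sinn n%:R).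
have sE0 n : smooth (fun x => G n x * (2 * n%:R * x * K1 x - K2 x)).
  exact: (smoothM (sG n) (smoothB (smoothM (smoothZ (2 * n%:R) smooth_id) sK1) sK2)).
have cE n : continuous (E n) := smooth_cont (smooth_prod (sE0 n) (@smooth_sinn n%:R)).
have hA n : D (fun x => G n x * K x) (fun x => G n x * (K1 x - n%:R * x * K x)).
  by apply: hasD_ext (hasD_mul (@D_gauss n%:R) hK) => // x; rewrite /G; ring.
have hA1 n : D (fun x => G n x * (K1 x - n%:R * x * K x))
    (fun x => G n x * (K2 x - 2 * n%:R * x * K1 x - n%:R * K x + n%:R ^+ 2 * x ^+ 2 * K x)).
  have h := hasD_mul (@D_gauss n%:R) (hasD_sub hK1 (hasD_mul (hasD_scale n%:R (@D_id)) hK)).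
  by apply: hasD_ext h => // x; rewrite /G; ring.
have wE n p : - ('D_((1, 0) : P) (dx (W n)) p + p.1 ^+ 2 * 'D_((0, 1) : P) ('D_((0, 1) : P) (W n)) p) =
    n%:R * W n p + E n p.
  rewrite (grushin_prod p (hA n) (hA1 n) (@D_sinn n%:R) (@D_cosn n%:R)) /W /E /G; ring.
have Wx0 n y : 0 <= y <= pi -> W n (-1, y) = 0 /\ W n (1, y) = 0.
  by move=> _; rewrite /W /= !K_0 ?normrN ?normr1 ?(ltW c1')// !mulr0 !mul0r.
have Wy0 n x : -1 <= x <= 1 -> W n (x, 0) = 0 /\ W n (x, pi) = 0.
  by move=> _; rewrite /W /= mulr0 sin0 sin_npi !mulr0.
pose U : space -> R := fun z => \1_om z.2 * u z.
pose J n := \int[mu]_(t in I) (expR (n%:R * t) * dot mO (f (clamp T t)) (E n)).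
have lW n : L2 mO (W n) by exact: L2_cont (smooth_cont (sW n)).
have id1 n : dot mC U (fun z => expR (n%:R * z.1) * W n z.2) = J n - dot mO f0 (W n).
  have := weak_moment T0 wk mom lu lf0 (sW n) (Wx0 n) (Wy0 n) (cE n) (wE n).
  rewrite (_ : dot mO (f T) (W n) = 0); last first.
    have lfT : L2 mO (f T) by apply: cf.1; rewrite in_itv/= lexx ltW.
    transitivity (\int[mO]_p (0 : R)); last by rewrite /Rintegral integral0.
    apply: ae_eq_Rintegral => //.
      exact: (measurable_funM (L2_measurable lfT) (L2_measurable (lW n))).
    by apply: negligibleS fT => p; apply: contra_not => h _; change (f T p * W n p = 0); rewrite (h Logic.I : f T p = 0) mul0r.
  by rewrite mulr0 sub0r -/U -/(J n) => h; rewrite addrC h; ring.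
have e_le n x : c <= `|x| -> G n x <= expR (- (n%:R / 2) * c ^+ 2).
  move=> cx; rewrite ler_expR !mulNr lerN2 ler_wpM2l ?divr_ge0//.
  by rewrite -[leRHS]real_normK ?num_real// lerXn2r ?nnegrE ?(ltW c0).
have Eb n p : (0 < n)%N -> Omega p -> `|E n p| <= n%:R * (2 * C1 + C2) * expR (- (n%:R / 2) * c ^+ 2).
  move=> n0 /Omega_itv[px py]; have n1 : 1 <= n%:R :> R by rewrite ler1n.
  have R0 : 0 <= n%:R * (2 * C1 + C2) * expR (- (n%:R / 2) * c ^+ 2).
    by rewrite !mulr_ge0 ?expR_ge0// addr_ge0// mulr_ge0.
  have [xc|cx] := ltP `|p.1| c.
    by rewrite /E; have [-> ->] := K_in _ xc; rewrite mulr0 subrr mulr0 mul0r normr0.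
  rewrite /E normrM -[leRHS]mulr1; apply: ler_pM => //; last first.
    by rewrite ler_norml sin_geN1 sin_le1.
  rewrite normrM [leRHS]mulrC; apply: ler_pM => //.
    by rewrite ger0_norm ?expR_ge0//; exact: e_le.
  apply: (le_trans (ler_normB _ _)); rewrite mulrDr; apply: lerD.
    rewrite !normrM !normr_nat (_ : n%:R * (2 * C1) = 2 * n%:R * 1 * C1); last by ring.
    apply: ler_pM => //; last exact: K1C.
    by rewrite ler_wpM2l// ler_norml.
  by apply: (le_trans (K2C _ px)); rewrite ler_peMl.
have eE n : expR (n%:R * T) * expR (- (n%:R / 2) * c ^+ 2) = expR (- (n%:R * eta)).
  by rewrite -expRD; congr expR; rewrite /eta; field.
have Jb n : (0 < n)%N -> `|J n| <= T * M * (2 * C1 + C2) * S * n%:R * expR (- (n%:R * eta)).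
  move=> n0; have cint := cmul (cexp n) (clamp_dot_cont T0 cf (L2_cont (cE n))).
  rewrite /J (Int_oo _ _ cint).
  pose B := expR (n%:R * T) * (M * (n%:R * (2 * C1 + C2) * expR (- (n%:R / 2) * c ^+ 2) * S)).
  rewrite (_ : _ * expR _ = B * (T - 0)); last by rewrite -eE /B; ring.
  apply: Int_abs => //; first exact: ltW.
  move=> t t01; rewrite normrM; apply: ler_pM => //.
    by rewrite ger0_norm ?expR_ge0// ler_expR ler_wpM2l//; case/andP: t01.
  have lft : L2 mO (f (clamp T t)) by apply: cf.1; exact: clamp_itv.
  apply: (le_trans (CauchySchwarz lft (L2_cont (cE n)))).
  apply: ler_pM => //; [exact: nrm_ge0|exact: nrm_ge0|exact: fM|].
  apply: nrm_Omega; first exact: continuous_measurable_plane.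
    by rewrite !mulr_ge0 ?expR_ge0// addr_ge0// mulr_ge0.
  by move=> p; exact: Eb.
have f0W n : (0 < n)%N -> dot mO f0 (W n) = (1 - expR (- (n%:R / 2) * c ^+ 2)) / n%:R * ((1 - cos (n%:R * y0)) / n%:R).
  move=> n0; have n1 : 0 < n%:R :> R by rewrite ltr0n.
  transitivity (\int[mO]_p (\1_(`]0, c[ `*` `]0, y0[) p * ((p.1 * (G n p.1 * K p.1)) * sin (n%:R * p.2)))).
    by apply: eq_Rintegral => p _; rewrite /f0 /W; ring.
  rewrite (@int_rect (fun x => x * (G n x * K x)) (fun y => sin (n%:R * y)) c y0 _ _ c01 y0p).
  - rewrite sin_int//; congr (_ * _); rewrite -gauss_int//; apply: eq_Int => x /andP[x0 xc].
    by rewrite K_1 ?mulr1// ger0_norm.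
  - exact: smooth_cont (smoothM smooth_id (sA n)).
  - exact: smooth_cont (@smooth_sinn n%:R).
(* Since the final state vanishes, the control moment is minus the initial moment plus the error
   [J n]; the minus sign undoes this. The cosine is what produces the angles [y - y0] and [y + y0]
   below. *)
pose cc_ n := - cos (n%:R * y0) * dot mC U (fun z => expR (n%:R * z.1) * W n z.2).
have ck0 : cc_ 0%N = 0.
  have E0 : (fun z : space => expR (0%:R * z.1) * W 0%N z.2) = (fun=> 0).
    by apply/funext => z; rewrite /W (mul0r z.2.2) sin0 !mulr0.
  by rewrite /cc_ E0 dotC dot0l mulr0.
have ckn n : (0 < n)%N -> `|cc_ n - (1 - cos (n%:R * y0)) * cos (n%:R * y0) / n%:R ^+ 2| <=
      (2 + T * M * (2 * C1 + C2) * S) * n%:R * expR (- (n%:R * eta)).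
  move=> n0; have n1 : 1 <= n%:R :> R by rewrite ler1n.
  have nn0 : n%:R != 0 :> R by rewrite pnatr_eq0 -lt0n.
  rewrite /cc_ id1 f0W//; set q := cos _; set g := expR (- (n%:R / 2) * c ^+ 2).
  rewrite (_ : _ - _ = - (g * ((1 - q) * q / n%:R ^+ 2)) - q * J n); last by field.
  have q1 : `|q| <= 1 by rewrite ler_norml cos_geN1 cos_le1.
  apply: (le_trans (ler_normB _ _)); rewrite normrN.
  move: (Jb n n0); set L := T * M * _ * _; set X := expR (- (n%:R * eta)) => JbL.
  rewrite (_ : (2 + L) * n%:R * X = 2 * n%:R * X + L * n%:R * X); last by ring.
  apply: lerD; last first.
    by rewrite normrM; apply: le_trans JbL; rewrite ler_piMl.
  rewrite normrM ger0_norm ?expR_ge0// mulrC; apply: ler_pM => //; first exact: expR_ge0.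
    rewrite normrM normfV ler_pdivrMr ?normr_gt0 ?expf_neq0//.
    rewrite [ `|n%:R ^+ 2|]ger0_norm ?exprn_ge0//.
    apply: (@le_trans _ _ 2).
      rewrite normrM -[leRHS]mulr1; apply: ler_pM => //.
      by apply: (le_trans (ler_normB _ _)); rewrite normr1 lerD2l.
    by rewrite -mulrA ler_peMr// -exprS exprn_ege1.
  rewrite ler_expR /eta mulNr lerN2.
  rewrite (_ : n%:R / 2 * c ^+ 2 = n%:R * (c ^+ 2 / 2 - T) + n%:R * T); last by ring.
  by rewrite lerDl mulr_ge0// ltW.
have [[C cC] nb] := moments_unbounded y0p eta0 ck0 ckn.
apply: nb.
have [B1 dB1 [[V1 V10 bB1] B10]] := ker_family (or_introl erefl : (1 : R) = 1 \/ (1 : R) = -1) (smooth_cont sK) lO.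
have [B2 dB2 [[V2 V20 bB2] B20]] := ker_family (or_intror erefl : (-1 : R) = 1 \/ (-1 : R) = -1) (smooth_cont sK) lO.
have [dl0 rr0 et0] := ker_pos.
have rho0 : 0 < ker_dl / ker_r by rewrite divr_gt0.
pose B j s := B1 j s + B2 j s.
have dB j s : - ker_eta < s < 1 -> is_derive s (1:R) (B j) (B j.+1 s).
  by move=> ss; exact: is_deriveD (dB1 j s ss) (dB2 j s ss).
have bB j s : - ker_eta < s < 1 -> `|B j s| <= (V1 + V2) * j`!%:R / (ker_dl / ker_r) ^+ j.
  move=> ss; apply: (le_trans (ler_normD _ _)); rewrite !mulrDl.
  by apply: lerD; [exact: bB1|exact: bB2].
have B0 n : B n 0 = n`!%:R * cc_ n.
  rewrite /B B10 B20 -mulrDr; congr (_ * _).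
  pose g (sg : R) (z : space) := expR (n%:R * z.1) * (- (1 / 2) * (G n z.2.1 * K z.2.1 * sin (n%:R * (z.2.2 - sg * y0)))).
  have lg sg : L2 mC (g sg).
    have ss : smooth (fun y : R => sin (n%:R * (y - sg * y0))).
      exact: (smooth_comp (smoothB smooth_id (smooth_cst (sg * y0))) (@smooth_sinn n%:R)).
    exact: (lexp n _ (L2_cont (smooth_cont (smoothZ (- (1 / 2)) (smooth_prod (sA n) ss))))).
  rewrite -(dotDr (lg 1) (lg (-1)) lO) /cc_.
  rewrite -(dotZr (- cos (n%:R * y0)) (lexp n _ (lW n)) lO); congr (dot mC U _); apply/funext => z.
  rewrite /g /W (_ : n%:R * (z.2.2 - 1 * y0) = n%:R * z.2.2 - n%:R * y0); last by ring.
  rewrite (_ : n%:R * (z.2.2 - -1 * y0) = n%:R * z.2.2 + n%:R * y0); last by ring.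
  by rewrite sinB sinD; field.
have PE := power_sum_extension cC et0 rho0 dB (addr_ge0 V10 V20) bB B0.
exists ((V1 + V2) * 2`!%:R / (ker_dl / ker_r) ^+ 2) => s /andP[s0 s1].
rewrite PE ?s0// bB// s1 andbT (lt_le_trans _ s0)// oppr_lt0//.
Qed.

End neg5.

Theorem not_null_controllable (g1 g2 : R -> R) (T : R) :
  {within `[0, pi], continuous g1} -> {within `[0, pi], continuous g2} ->
  (forall y, y \in `[0, pi] -> -1 < g1 y < 1) -> (forall y, y \in `[0, pi] -> -1 < g2 y < 1) ->
  0 < T ->
  T < (Num.max (sup (g2^\- @` `[0, pi])) (sup (g1^\+ @` `[0, pi]))) ^+ 2 / 2 ->
  ~ null_controllable [set p | Omega p /\ g1 p.2 < p.1 < g2 p.2] T.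
Proof.
move=> cg1 cg2 r1 r2 T0 Ta.
have [y0 [d [b [y0p d0 b01 Tb far]]]] := far_strip cg1 cg2 r1 r2 T0 Ta.
have [b0 b1] := andP b01.
pose c := (b + 1) / 2; pose c' := (c + 1) / 2.
have bc : b < c by rewrite /c; lra.
have c01 : 0 < c < 1 by rewrite /c; lra.
have cc' : c < c' < 1 by rewrite /c'; lra.
have cc0 : 0 < c < c' by case/andP: c01 => -> _; case/andP: cc' => ->.
have [K [K1 [K2 [sK hK hK1 K_1 [K_in K_0]]]]] := smooth_plateau cc0.
apply: (moments_vs_control T0 y0p d0 b01 Tb bc c01 cc' (om_measurable cg1 cg2) _ far hK hK1 sK K_1 K_in K_0).
by move=> p [].
Qed.

(** * Sturm-Liouville theory *)

Lemma pow2_small (C e : R) : 0 <= C -> 0 < e -> exists k, C / 2 ^+ k <= e.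
Proof.
move=> C0 e0; exists (Num.bound (C / e)).
rewrite ler_pdivrMr ?exprn_gt0// mulrC -ler_pdivrMr//.
apply: (le_trans (ltW (archi_boundP _))); first by rewrite divr_ge0// ltW.
by rewrite -natrX ler_nat ltnW// ltn_expl.
Qed.

Lemma pow2_eq (C a b : R) : 0 <= C -> (forall k, `|a - b| <= C / 2 ^+ k) -> a = b.
Proof.
move=> C0 h; apply/eqP; rewrite -subr_eq0 -normr_le0; apply/ler_addgt0Pr => e e0; rewrite add0r.
by have [k hk] := pow2_small C0 e0; exact: le_trans (h k) hk.
Qed.

Lemma geometric_limit (u : nat -> R) (C : R) : (forall k, `|u k.+1 - u k| <= C / 2 ^+ k) ->
  exists l, forall k, `|u k - l| <= 2 * C / 2 ^+ k.
Proof.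
move=> h; have p2 k : 0 < 2 ^+ k :> R by rewrite exprn_gt0.
have S k m : `|u (k + m)%N - u k| <= 2 * C / 2 ^+ k - 2 * C / 2 ^+ (k + m).
  elim: m => [|m IH]; first by rewrite addn0 !subrr normr0.
  rewrite addnS; have := h (k + m)%N.
  rewrite (_ : 2 * C / 2 ^+ (k + m).+1 = C / 2 ^+ (k + m)); last by rewrite exprS; field; rewrite gt_eqF.
  move=> h1; rewrite (_ : u _ - u k = (u (k + m).+1 - u (k + m)%N) + (u (k + m)%N - u k)); last by ring.
  apply: (le_trans (ler_normD _ _)); move: IH h1.
  rewrite (_ : 2 * C / 2 ^+ (k + m) = C / 2 ^+ (k + m) + C / 2 ^+ (k + m)); last by ring.
  lra.
have C0 : 0 <= C by have := le_trans (normr_ge0 _) (h 0%N); rewrite expr0 divr1.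
have S' k m : `|u (k + m)%N - u k| <= 2 * C / 2 ^+ k.
  by apply: (le_trans (S k m)); rewrite gerBl divr_ge0 ?mulr_ge0// ltW.
have cu : cvgn u.
  apply: cvgn_bounded_variation; apply: le_lt_trans (geometric_lty C).
  by apply: lee_nneseries => k _; rewrite lee_fin.
exists (limn u) => k; rewrite distrC.
have cn : `|u (k + m)%N - u k| @[m --> \oo] --> `|limn u - u k|.
  apply: cvg_norm; apply: cvgB; last exact: cvg_cst.
  by apply: (@cvg_comp _ _ _ (fun m => (k + m)%N) u _ \oo); [exact: cvg_addnl|exact: cu].
by apply: (ler_cvg_to cn (cvg_cst (2 * C / 2 ^+ k))); apply: nearW => m; exact: S'.
Qed.

(** * Linear second-order equations by Picard iteration *)

(** A chosen primitive vanishing at [A], total in [f], so that the Picard map can be iterated as a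
    function. *)
Definition pr (A : R) (f : R -> R) : R -> R := get [set F | D F f /\ F A = 0].

Lemma prP A f : continuous f -> D (pr A f) f /\ pr A f A = 0.
Proof.
move=> cf; have [F hF] := primitive A cf.
by have := @getPex _ [set F | D F f /\ F A = 0] (ex_intro _ F hF).
Qed.

Lemma pr_cont A f : continuous f -> continuous (pr A f).
Proof. by move=> cf; exact: D_cont (prP A cf).1. Qed.

(** In the sup norm weighted by [exp (L t)] integration gains a factor [1 / L], whatever the length
    of the interval. The sign [e] treats both sides of [A] at once. *)
Lemma prim_exp_bound A r L c e F f : e = 1 \/ e = -1 -> 0 < L -> 0 <= c ->
  D F f -> F A = 0 -> continuous f ->
  (forall t, 0 <= t <= r -> `|f (A + e * t)| <= c * expR (L * t)) ->
  forall t, 0 <= t <= r -> `|F (A + e * t)| <= c / L * expR (L * t).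
Proof.
move=> e1 L0 c0 hF FA cf fb t /andP[t0 tr].
have hl : D (fun t => A + e * t) (fun=> e).
  by apply: hasD_ext (hasD_add (hasD_cst (1:R) A) (hasD_scale e (@D_id))) => // x; rewrite add0r mulr1.
have hFe := hasD_comp hl hF.
have cle : continuous (fun t : R => A + e * t) := D_cont hl.
have cfe : continuous (fun t => f (A + e * t) * e).
  by apply: cmul (@cst_continuous _ _ _) => x; apply: continuous_comp; [exact: cle|exact: cf].
have ce : continuous (fun t : R => c * expR (L * t)) := smooth_cont (smoothZ c (smooth_comp (smoothZ L smooth_id) smooth_exp)).
have hE : D (fun t => c / L * expR (L * t)) (fun t => c * expR (L * t)).
  apply: hasD_ext (hasD_scale (c / L) (hasD_comp (hasD_scale L (@D_id)) (@D_exp))) => // x.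
  by field; rewrite gt_eqF.
have E1 := FTC t0 hFe cfe; have E2 := FTC t0 hE ce.
rewrite !mulr0 !addr0 FA subr0 expR0 mulr1 in E1 E2.
have cL : 0 <= c / L by rewrite divr_ge0// ltW.
have en : `|e| = 1 by case: e1 => ->; rewrite ?normrN normr1.
have b s : 0 <= s <= t -> `|f (A + e * s) * e| <= c * expR (L * s).
  by move=> /andP[s0 st]; rewrite normrM en mulr1 fb// s0 (le_trans st).
have h1 : Int 0 t (fun s => f (A + e * s) * e) <= Int 0 t (fun s => c * expR (L * s)).
  by apply: Int_le => // s /b; apply: le_trans; exact: ler_norm.
have h2 : Int 0 t (fun s => - (c * expR (L * s))) <= Int 0 t (fun s => f (A + e * s) * e).
  apply: Int_le => //; first by move=> x; apply: cvgN; exact: ce.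
  by move=> s /b; rewrite ler_norml => /andP[].
have E3 : Int 0 t (fun s => - (c * expR (L * s))) = - Int 0 t (fun s => c * expR (L * s)).
  by rewrite -mulN1r -IntZ//; apply: eq_Int => s _; rewrite mulN1r.
rewrite -E1 ler_norml; lra.
Qed.

Lemma prim_mono A B F f G g : D F f -> F A = 0 -> D G g -> 0 <= G A ->
  continuous f -> continuous g -> (forall x, A <= x <= B -> `|f x| <= g x) ->
  forall x, A <= x <= B -> `|F x| <= G x.
Proof.
move=> hF FA hG GA cf cg fg x /andP[Ax xB].
have E1 := FTC Ax hF cf; have E2 := FTC Ax hG cg; rewrite FA subr0 in E1.
have b s : A <= s <= x -> `|f s| <= g s by move=> /andP[s0 st]; rewrite fg// s0 (le_trans st).
have h1 : Int A x f <= Int A x g by apply: Int_le => // s /b; apply: le_trans; exact: ler_norm.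
have h2 : Int A x (fun s => - g s) <= Int A x f.
  apply: Int_le => //; first by move=> y; apply: cvgN; exact: cg.
  by move=> s /b; rewrite ler_norml => /andP[].
have E3 : Int A x (fun s => - g s) = - Int A x g.
  by rewrite -mulN1r -IntZ//; apply: eq_Int => s _; rewrite mulN1r.
rewrite -E1 ler_norml; lra.
Qed.

Lemma bounded_around (f : R -> R) (A r : R) : continuous f ->
  exists2 K, 0 <= K & forall e t, e = 1 \/ e = -1 -> 0 <= t <= r -> `|f (A + e * t)| <= K.
Proof.
move=> cf; have [K K0 hK] := continuous_bound (A - r) (A + r) cf; exists K => // e t e1 /andP[t0 tr].
by apply: hK; case: e1 => ->; lra.
Qed.

Section picard.
Variables (q h : R -> R) (A al be : R).
Hypothesis (cq : continuous q) (ch : continuous h).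
Let inner f := pr A (fun x => q x * f x + h x).
Let step f x := al + be * (x - A) + pr A (inner f) x.

Lemma rhs_cont f : continuous f -> continuous (fun x => q x * f x + h x).
Proof. by move=> cf; exact: cadd (cmul cq cf) ch. Qed.

Lemma step_cont f : continuous f -> continuous (step f).
Proof.
move=> cf x; apply: cvgD; last exact: pr_cont (pr_cont (A:=A) (rhs_cont cf)) x.
by apply: cvgD; [exact: cvg_cst|apply: cvgM; [exact: cvg_cst|apply: cvgB; [exact: cvg_id|exact: cvg_cst]]].
Qed.

(** Two integrations with the weight exponent [K + 2] multiply the distance by at most
    [K / (K + 2) ^ 2], which is below 1/2. *)
Lemma step_contraction f g (K C r e : R) : continuous f -> continuous g -> 0 <= C -> 0 <= K ->
  e = 1 \/ e = -1 ->
  (forall t, 0 <= t <= r -> `|q (A + e * t)| <= K) ->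
  (forall t, 0 <= t <= r -> `|f (A + e * t) - g (A + e * t)| <= C * expR ((K + 2) * t)) ->
  forall t, 0 <= t <= r -> `|step f (A + e * t) - step g (A + e * t)| <= C / 2 * expR ((K + 2) * t).
Proof.
move=> cf cg C0 K0 e1 qK fg t tr; have L0 : 0 < K + 2 by lra.
rewrite /step opprD addrACA subrr add0r.
have [d1 z1] := prP A (rhs_cont cf); have [d2 z2] := prP A (rhs_cont cg).
have [d3 z3] := prP A (pr_cont (A:=A) (rhs_cont cf)); have [d4 z4] := prP A (pr_cont (A:=A) (rhs_cont cg)).
have cd : continuous (fun x => inner f x - inner g x).
  by move=> x; apply: cvgB; [exact: (pr_cont (A:=A) (rhs_cont cf))|exact: (pr_cont (A:=A) (rhs_cont cg))].
have cd2 : continuous (fun x => (q x * f x + h x) - (q x * g x + h x)).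
  by move=> x; apply: cvgB; [exact: rhs_cont cf x|exact: rhs_cont cg x].
have b1 := @prim_exp_bound A r (K + 2) (K * C) e _ _ e1 L0 (mulr_ge0 K0 C0) (hasD_sub d1 d2) _ cd2 _.
have b2 := @prim_exp_bound A r (K + 2) (K * C / (K + 2)) e _ _ e1 L0 _ (hasD_sub d3 d4) _ cd _.
apply: (le_trans (b2 _ _ _ t tr)).
- by rewrite divr_ge0 ?mulr_ge0// ltW.
- by rewrite z3 z4 subrr.
- apply: b1; first by rewrite z1 z2 subrr.
  move=> s sr; rewrite (_ : _ - _ = q (A + e * s) * (f (A + e * s) - g (A + e * s))); last by ring.
  by rewrite normrM -mulrA; apply: ler_pM => //; [exact: qK|exact: fg].
rewrite ler_wpM2r ?expR_ge0// (_ : K * C / (K + 2) / (K + 2) = C * (K / (K + 2) ^+ 2)); last by field; rewrite gt_eqF.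
rewrite ler_wpM2l// ler_pdivrMr ?exprn_gt0//; nra.
Qed.

Lemma norm_sign (x : R) : exists2 e : R, e = 1 \/ e = -1 & x = A + e * `|x - A|.
Proof.
have [h1|h1] := leP 0 (x - A).
  by exists 1; [left|rewrite ger0_norm//; ring].
by exists (-1); [right|rewrite ltr0_norm//; ring].
Qed.

Lemma ode_exists : exists y y', [/\ D y y', D y' (fun x => q x * y x + h x), y A = al & y' A = be].
Proof.
pose Y k := iter k step (fun x => al + be * (x - A)).
have c0 : continuous (fun x : R => al + be * (x - A)).
  by move=> x; apply: cvgD; [exact: cvg_cst|apply: cvgM; [exact: cvg_cst|apply: cvgB; [exact: cvg_id|exact: cvg_cst]]].
have cY k : continuous (Y k) by elim: k => [//|k IH]; exact: step_cont.
have bnd r : 0 <= r -> exists2 C, 0 <= C & forall k x, `|x - A| <= r -> `|Y k.+1 x - Y k x| <= C / 2 ^+ k.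
  move=> r0; have [K K0 qK] := bounded_around A r cq.
  have cd : continuous (fun x => Y 1%N x - Y 0%N x) by move=> x; apply: cvgB; exact: cY.
  have [C C0 hC] := bounded_around A r cd.
  have key k e t : e = 1 \/ e = -1 -> 0 <= t <= r ->
      `|Y k.+1 (A + e * t) - Y k (A + e * t)| <= C / 2 ^+ k * expR ((K + 2) * t).
    move=> e1; elim: k t => [|k IH] t tr.
      have /andP[t0 t1] := tr; rewrite expr0 divr1 (le_trans (hC _ _ e1 tr))//.
      rewrite ler_peMr// -[leLHS]expR0 ler_expR mulr_ge0//; lra.
    rewrite (_ : C / 2 ^+ k.+1 = C / 2 ^+ k / 2); last by rewrite exprS invfM; ring.
    apply: (@step_contraction (Y k.+1) (Y k) K (C / 2 ^+ k) r e) => //.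
      by rewrite divr_ge0// exprn_ge0.
    by move=> s sr; exact: qK.
  exists (C * expR ((K + 2) * r)); first by rewrite mulr_ge0// expR_ge0.
  move=> k x xr; have [e e1 ->] := norm_sign x.
  apply: (le_trans (key k e _ e1 _)); first by rewrite normr_ge0.
  rewrite mulrAC ler_wpM2r ?invr_ge0 ?exprn_ge0// ler_wpM2l// ler_expR ler_wpM2l//; lra.
have [y hy] : exists y : R -> R, forall r, 0 <= r -> exists2 C, 0 <= C & forall k x, `|x - A| <= r -> `|Y k x - y x| <= C / 2 ^+ k.
  pose y x := get [set l | exists C, forall k, `|Y k x - l| <= C / 2 ^+ k].
  have yP x : exists C, forall k, `|Y k x - y x| <= C / 2 ^+ k.
    have [C C0 hC] := bnd _ (normr_ge0 (x - A)).
    have [l hl] := @geometric_limit (fun k => Y k x) C (fun k => hC k x (lexx _)).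
    apply: (@getPex _ [set l | exists C, forall k, `|Y k x - l| <= C / 2 ^+ k]).
    by exists l, (2 * C).
  exists y => r r0; have [C C0 hC] := bnd r r0; exists (2 * C); first by rewrite mulr_ge0.
  move=> k x xr; have [l hl] := @geometric_limit (fun k => Y k x) C (fun k => hC k x xr).
  suff -> : y x = l by exact: hl.
  have [C' hC'] := yP x; apply/eqP; rewrite -subr_eq0 -normr_le0; apply/ler_addgt0Pr => e e0; rewrite add0r.
  have CC0 : 0 <= 2 * C + C'.
    have := le_trans (normr_ge0 _) (hC' 0%N); rewrite expr0 divr1; lra.
  have [N hN] := pow2_small CC0 e0.
  apply: le_trans hN; rewrite mulrDl.
  rewrite (_ : y x - l = (Y N x - l) - (Y N x - y x)); last by ring.
  by apply: (le_trans (ler_normB _ _)); apply: lerD; [exact: hl|exact: hC'].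
have cy : continuous y.
  move=> x; apply/cvgrPdist_le => e e0.
  have r0 : 0 <= `|x - A| + 1 by rewrite addr_ge0.
  have [C C0 hC] := hy _ r0; have e4 : 0 < e / 4 by rewrite divr_gt0.
  have [N hN] := pow2_small C0 e4.
  have e2 : 0 < e / 2 by rewrite divr_gt0.
  have /cvgrPdist_le/(_ _ e2) h1 := cY N x.
  have h2 : nbhs x (fun z => `|x - z| < 1) by apply/nbhs_normP; exists 1 => //= z; rewrite /ball_/=.
  apply: filterS2 h1 h2 => z h1 h2.
  have zx : `|z - A| <= `|x - A| + 1.
    rewrite (_ : z - A = (x - A) - (x - z)); last by ring.
    by apply: (le_trans (ler_normB _ _)); rewrite lerD2l ltW.
  have g1 := hC N x (_ : `|x - A| <= `|x - A| + 1); have g2 := hC N z zx.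
  rewrite (_ : y x - y z = (Y N x - Y N z) - (Y N x - y x) + (Y N z - y z)); last by ring.
  apply: (le_trans (ler_normD _ _)); apply: (le_trans (lerD (ler_normB _ _) (lexx _))).
  have {}g1 : `|Y N x - y x| <= C / 2 ^+ N by apply: g1; rewrite lerDl.
  lra.
have fix_y x : y x = step y x.
  have [C C0 hC] := hy _ (normr_ge0 (x - A)).
  have [K K0 qK] := bounded_around A `|x - A| cq.
  have [e e1 xe] := norm_sign x.
  apply: (pow2_eq (C := C / 2 + C / 2 * expR ((K + 2) * `|x - A|))).
    by rewrite addr_ge0 ?mulr_ge0 ?divr_ge0 ?expR_ge0.
  move=> k; rewrite (_ : y x - step y x = (Y k.+1 x - step y x) - (Y k.+1 x - y x)); last by ring.
  apply: (le_trans (ler_normB _ _)); rewrite mulrDl addrC; apply: lerD.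
    by apply: (le_trans (hC _ _ (lexx _))); rewrite exprS invfM mulrA.
  rewrite {1 2}xe (_ : C / 2 * _ / 2 ^+ k = C / 2 ^+ k / 2 * expR ((K + 2) * `|x - A|)); last by ring.
  apply: (le_trans (@step_contraction (Y k) y K (C / 2 ^+ k) `|x - A| e _ _ _ _ _ _ _ `|x - A| _)) => //.
  - by rewrite divr_ge0// exprn_ge0.
  - by move=> t tr; exact: qK.
  - move=> t /andP[t0 tr]; apply: (@le_trans _ _ (C / 2 ^+ k)).
      apply: hC; rewrite addrAC subrr add0r normrM (ger0_norm t0).
      by case: e1 => ->; rewrite ?normrN normr1 mul1r.
    rewrite ler_peMr ?divr_ge0 ?exprn_ge0// -[leLHS]expR0 ler_expR mulr_ge0//; lra.
  - by rewrite normr_ge0 lexx.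
have [d1 z1] := prP A (rhs_cont cy); have [d2 z2] := prP A (pr_cont (A:=A) (rhs_cont cy)).
exists y, (fun x => be + inner y x); split.
- have h1 := hasD_add (hasD_add (hasD_cst (1:R) al) (hasD_scale be (hasD_sub (@D_id) (hasD_cst (1:R) A)))) d2.
  apply: hasD_ext h1 => x; first by rewrite [RHS]fix_y.
  by rewrite add0r subr0 mulr1.
- by apply: hasD_ext (hasD_add (hasD_cst (1:R) be) d1) => // x; rewrite add0r.
- by rewrite fix_y /step z2 subrr mulr0 !addr0.
- by rewrite /inner z1 addr0.
Qed.

End picard.

(** The supersolution [Y] dominates every Picard iterate started from 0, by induction, and [y] is
    the limit of these iterates. Absolute values on [q] and [h] make the comparison insensitive to
    the signs of the coefficients. *)
Lemma ode_comparison (q h : R -> R) A B y y' Y Y' Y'' : continuous q -> continuous h ->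
  D y y' -> D y' (fun x => q x * y x + h x) -> y A = 0 -> y' A = 0 ->
  D Y Y' -> D Y' Y'' -> continuous Y'' -> (forall x, A <= x <= B -> 0 <= Y x) -> 0 <= Y' A ->
  (forall x, A <= x <= B -> `|q x| * Y x + `|h x| <= Y'' x) ->
  forall x, A <= x <= B -> `|y x| <= Y x /\ `|y' x| <= Y' x.
Proof.
move=> cq ch hy hy' yA y'A hY hY' cY'' YA Y'A sup.
have cy := D_cont hy; have cY' := D_cont hY'.
pose step f := pr A (pr A (fun x => q x * f x + h x)).
have [K K0 qK] := bounded_around A (B - A) cq.
pose w k := iter k step (fun=> 0).
have cw k : continuous (w k).
  elim: k => [|k IH]; first exact: cst_continuous.
  exact: pr_cont (pr_cont (A:=A) (rhs_cont cq ch IH)).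
have key f : continuous f -> (forall x, A <= x <= B -> `|f x| <= Y x) ->
    (forall x, A <= x <= B -> `|pr A (fun x => q x * f x + h x) x| <= Y' x).
  move=> cf fY; have [d1 z1] := prP A (rhs_cont cq ch cf).
  apply: (prim_mono d1 z1 hY' Y'A (rhs_cont cq ch cf) cY'') => x xAB.
  apply: le_trans (sup x xAB); apply: (le_trans (ler_normD _ _)).
  by rewrite lerD2r normrM ler_wpM2l// fY.
have [BA|AB] := ltP B A; first by move=> x /andP[h1 h2]; have := le_lt_trans (le_trans h1 h2) BA; rewrite ltxx.
have YA0 : 0 <= Y A by apply: YA; rewrite lexx.
have wY k x : A <= x <= B -> `|w k x| <= Y x.
  elim: k x => [|k IH] x xAB; first by rewrite normr0 YA.
  have [d2 z2] := prP A (pr_cont (A:=A) (rhs_cont cq ch (cw k))).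
  exact: (prim_mono d2 z2 hY YA0 (pr_cont (A:=A) (rhs_cont cq ch (cw k))) cY' (key _ (cw k) IH)) xAB.
have fix_y x : A <= x -> y x = 0 + 0 * (x - A) + step y x.
  move=> Ax; rewrite mul0r !add0r.
  have [d1 z1] := prP A (rhs_cont cq ch cy); have [d2 z2] := prP A (pr_cont (A:=A) (rhs_cont cq ch cy)).
  have c0 : continuous (fun _ : R => 0 : R) by exact: cst_continuous.
  have E1 z : A <= z -> y' z - pr A (fun x => q x * y x + h x) z = 0.
    move=> Az; have hd : D (fun x => y' x - pr A (fun x => q x * y x + h x) x) (fun=> 0).
      by apply: hasD_ext (hasD_sub hy' d1) => // t; rewrite subrr.
    by have := FTC Az hd c0; rewrite y'A z1 subrr subr0 Int_cst// mul0r.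
  have hd := hasD_sub hy d2.
  have cd : continuous (fun x => y' x - pr A (fun x => q x * y x + h x) x).
    by move=> t; apply: cvgB; [exact: D_cont hy' t|exact: pr_cont (rhs_cont cq ch cy) t].
  have := FTC Ax hd cd; rewrite yA z2 subrr subr0 (@eq_Int _ _ _ (fun=> 0)).
    by rewrite Int_cst// mul0r => /esym/eqP; rewrite subr_eq0 => /eqP.
  by move=> z /andP[Az _]; exact: E1.
have [C0 C00 yC] : exists2 C, 0 <= C & forall x, A <= x <= B -> `|y x| <= C.
  have [C hC0 hC] := bounded_around A (B - A) cy; exists C => // x xAB.
  have := hC 1 (x - A) (or_introl erefl); rewrite (_ : A + 1 * (x - A) = x); [apply|ring].
  by lra.
have dy k x : A <= x <= B -> `|y x - w k x| <= C0 / 2 ^+ k * expR ((K + 2) * (x - A)).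
  move=> xAB; have [t tx] : exists t, x = A + 1 * t by exists (x - A); ring.
  have {xAB} : 0 <= t <= B - A by move: xAB; rewrite tx => ?; lra.
  rewrite (_ : x - A = t); last by rewrite tx; ring.
  rewrite tx; elim: k t {x tx} => [|k IH] t tr.
    have /andP[t0 t1] := tr; rewrite subr0 expr0 divr1.
    apply: (@le_trans _ _ C0); first by apply: yC; lra.
    rewrite ler_peMr// -[leLHS]expR0 ler_expR mulr_ge0//; lra.
  rewrite (_ : C0 / 2 ^+ k.+1 = C0 / 2 ^+ k / 2); last by rewrite exprS invfM; ring.
  have /andP[t0 t1] := tr.
  rewrite fix_y; last lra.
  rewrite (_ : w k.+1 _ = 0 + 0 * (A + 1 * t - A) + step (w k) (A + 1 * t)); last by rewrite mul0r !add0r.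
  apply: (@step_contraction q h A 0 0 cq ch y (w k) K (C0 / 2 ^+ k) (B - A) 1 cy (cw k) _ K0 (or_introl erefl) _ IH) => //.
    by rewrite divr_ge0// exprn_ge0.
  by move=> s sr; apply: qK => //; left.
have yY x : A <= x <= B -> `|y x| <= Y x.
  move=> xAB; apply/ler_addgt0Pr => e e0.
  have C1 : 0 <= C0 * expR ((K + 2) * (x - A)) by rewrite mulr_ge0// expR_ge0.
  have [k hk] := pow2_small C1 e0.
  rewrite -[y x](subrK (w k x)) addrC; apply: (le_trans (ler_normD _ _)); apply: lerD; first exact: wY.
  by apply: le_trans (dy k x xAB) _; rewrite mulrAC.
move=> x xAB; split; first exact: yY.
apply: (prim_mono hy' y'A hY' Y'A (rhs_cont cq ch cy) cY'' _ xAB) => z zAB.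
apply: le_trans (sup z zAB); apply: (le_trans (ler_normD _ _)).
by rewrite lerD2r normrM ler_wpM2l// yY.
Qed.

Lemma ode_smooth (q h y y' : R -> R) : smooth q -> smooth h -> D y y' ->
  D y' (fun x => q x * y x + h x) -> smooth y.
Proof.
move=> /smoothP sq /smoothP sh hy hy'; apply/smoothP => n.
suff : Cn n y /\ Cn n y' by case.
elim: n => [|n [IH1 IH2]].
  by split; split=> //; [exact: D_cont hy|exact: D_cont hy'].
split; first exact: Cn_D hy IH2.
by apply: Cn_D hy' _; apply: Cn_add => //; exact: Cn_mul.
Qed.

Lemma discriminant (a b c : R) : 0 <= c -> (forall t, 0 <= a + 2 * t * b + t ^+ 2 * c) -> b ^+ 2 <= a * c.
Proof.
rewrite le_eqVlt => /predU1P[<-|c0] h.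
  rewrite mulr0; case: (eqVneq b 0) => [->|b0]; first by rewrite expr0n.
  have := h (- (a + 1) / (2 * b)); rewrite (_ : _ + _ + _ = -1); last by field.
  by rewrite lerNr oppr0 ler10.
have := h (- b / c); rewrite (_ : _ + _ + _ = (a * c - b ^+ 2) / c); last by field; rewrite gt_eqF.
by rewrite pmulr_lge0 ?invr_gt0// subr_ge0.
Qed.

Lemma le0_small (x C : R) : (forall e, 0 < e -> e <= 1 -> x <= C * e) -> x <= 0.
Proof.
move=> h; apply/ler_addgt0Pr => d d0; rewrite add0r; have C0 : 0 < `|C| + 1 by rewrite ltr_wpDl.
pose e := Num.min 1 (d / (`|C| + 1)); have e0 : 0 < e by rewrite lt_min ltr01 divr_gt0.
have ed : e * (`|C| + 1) <= d by rewrite -ler_pdivlMr// ge_min lexx orbT.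
have e1 : e <= 1 by rewrite ge_min lexx.
have := ler_wpM2r (ltW e0) (ler_norm C); have := h e e0 e1; lra.
Qed.

Lemma csum (n : nat) (f : nat -> R -> R) : (forall i, continuous (f i)) -> continuous (fun x => \sum_(i < n) f i x).
Proof.
move=> cf; elim: n => [|n IH].
  by rewrite (_ : (fun x => _) = (fun=> 0)); [exact: cst_continuous|apply/funext => x; rewrite big_ord0].
rewrite (_ : (fun x => _) = (fun x => \sum_(i < n) f i x + f n x)); first exact: cadd.
by apply/funext => x; rewrite big_ord_recr.
Qed.

Definition inn (A B : R) (f g : R -> R) : R := Int A B (fun x => f x * g x).

Section ip.
Variables A B : R.
Implicit Types (f g h : R -> R) (c t : R).
Local Notation ip := (inn A B).

Lemma ipC f g : ip f g = ip g f.
Proof. by apply: eq_Int => x _; rewrite mulrC. Qed.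

Lemma ipDl f g h : continuous f -> continuous g -> continuous h ->
  ip (fun x => f x + g x) h = ip f h + ip g h.
Proof. by move=> cf cg ch; rewrite /inn -IntD; [apply: eq_Int => x _; rewrite mulrDl|exact: cmul|exact: cmul]. Qed.

Lemma ipBl f g h : continuous f -> continuous g -> continuous h ->
  ip (fun x => f x - g x) h = ip f h - ip g h.
Proof. by move=> cf cg ch; rewrite /inn -IntB; [apply: eq_Int => x _; rewrite mulrBl|exact: cmul|exact: cmul]. Qed.

Lemma ipZl c f h : continuous f -> continuous h -> ip (fun x => c * f x) h = c * ip f h.
Proof. by move=> cf ch; rewrite /inn -IntZ; [apply: eq_Int => x _; rewrite mulrA|exact: cmul]. Qed.

Lemma ip_suml n (f : nat -> R -> R) h : (forall i, continuous (f i)) -> continuous h ->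
  ip (fun x => \sum_(i < n) f i x) h = \sum_(i < n) ip (f i) h.
Proof.
move=> cf ch; elim: n => [|n IH].
  rewrite big_ord0 /ip (@eq_Int _ _ _ (fun=> 0 * 0)); last by move=> x _; rewrite big_ord0 !mul0r.
  by rewrite (IntZ _ _ 0 (@cst_continuous R R 0)) mul0r.
rewrite big_ord_recr /= -IH -ipDl//; last exact: csum.
by apply: eq_Int => x _; rewrite big_ord_recr.
Qed.

Lemma eq_ip f f' g g' : (forall x, A <= x <= B -> f x = f' x) -> (forall x, A <= x <= B -> g x = g' x) ->
  ip f g = ip f' g'.
Proof. by move=> hf hg; apply: eq_Int => x xAB; rewrite hf ?hg. Qed.

Lemma ip_ge0 f : 0 <= ip f f.
Proof. by apply: Int_ge0 => x _; rewrite -expr2 sqr_ge0. Qed.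

Lemma ip_quad f g t : continuous f -> continuous g ->
  ip (fun x => f x + t * g x) (fun x => f x + t * g x) = ip f f + 2 * t * ip f g + t ^+ 2 * ip g g.
Proof.
move=> cf cg; have ct := cscale (c := t) cg; have cs := cadd cf ct.
have e1 h : continuous h -> ip (fun x => f x + t * g x) h = ip f h + t * ip g h.
  by move=> ch; rewrite ipDl// ipZl.
by rewrite (e1 _ cs) [ip f _]ipC [ip g _]ipC (e1 _ cf) (e1 _ cg) [ip g f]ipC; ring.
Qed.

Lemma ip_CS f g : continuous f -> continuous g -> ip f g ^+ 2 <= ip f f * ip g g.
Proof.
by move=> cf cg; apply: discriminant => [|t]; [exact: ip_ge0|rewrite -ip_quad//; exact: ip_ge0].
Qed.

End ip.

(** * Dirichlet problem, Green operator and eigenfunctions *)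

Section BVP.
Variables (A B : R) (q : R -> R).
Hypothesis (AB : A < B) (cq : continuous q) (q0 : forall x, A <= x <= B -> 0 <= q x).
Local Notation ip := (inn A B).
Let L := B - A.
Let L0 : 0 < L. Proof. by rewrite subr_gt0. Qed.
Let AB' := ltW AB.

Lemma sobolev u u' x y : D u u' -> continuous u' -> A <= x -> x <= y -> y <= B ->
  (u y - u x) ^+ 2 <= (y - x) * ip u' u'.
Proof.
move=> hu cu' Ax xy yB; have cc : continuous (fun _ : R => 1 : R) by exact: cst_continuous.
have c2 := cmul cu' cu'.
have h := ip_CS x y cc cu'; rewrite {1}/inn in h.
have E : Int x y (fun x0 => 1 * u' x0) = u y - u x.
  by rewrite -(FTC xy hu cu'); apply: eq_Int => z _; rewrite mul1r.
rewrite E in h; apply: (le_trans h).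
have -> : inn x y (fun=> 1) (fun=> 1) = y - x.
  by rewrite /inn (@eq_Int _ _ _ (fun=> 1)) ?Int_cst ?mul1r// => z _; rewrite mulr1.
rewrite ler_wpM2l ?subr_ge0// /inn (@Int_chasles A x B)//; last by rewrite Ax (le_trans xy).
rewrite (@Int_chasles x y B) ?xy//.
have h1 : 0 <= Int A x (fun x0 => u' x0 * u' x0) by apply: Int_ge0 => z _; rewrite -expr2 sqr_ge0.
have h2 : 0 <= Int y B (fun x0 => u' x0 * u' x0) by apply: Int_ge0 => z _; rewrite -expr2 sqr_ge0.
lra.
Qed.

(** The problem [- u'' + q u = f] with Dirichlet conditions, that is [u = G f] for the Green
    operator [G], with the derivative [u'] carried along. *)
Definition BVP (u u' f : R -> R) :=
  [/\ D u u', D u' (fun x => q x * u x - f x), u A = 0 & u B = 0].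

Lemma BVP_cont u u' f : BVP u u' f -> continuous u /\ continuous u'.
Proof. by move=> [h1 h2 _ _]; split; [exact: D_cont h1|exact: D_cont h2]. Qed.

Lemma BVP_lin c u u' f v v' g : BVP u u' f -> BVP v v' g ->
  BVP (fun x => u x + c * v x) (fun x => u' x + c * v' x) (fun x => f x + c * g x).
Proof.
move=> [h1 h2 h3 h4] [g1 g2 g3 g4]; split.
- exact: hasD_add h1 (hasD_scale c g1).
- by apply: hasD_ext (hasD_add h2 (hasD_scale c g2)) => // x; ring.
- by rewrite h3 g3 mulr0 addr0.
- by rewrite h4 g4 mulr0 addr0.
Qed.

Lemma BVP0 : BVP (fun=> 0) (fun=> 0) (fun=> 0).
Proof.
split => //; first exact: (hasD_cst (1:R) 0).
by apply: hasD_ext (hasD_cst (1:R) 0) => // x; rewrite mulr0 subr0.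
Qed.

Lemma BVP_sum n (u u' f : nat -> R -> R) : (forall i, BVP (u i) (u' i) (f i)) ->
  BVP (fun x => \sum_(i < n) u i x) (fun x => \sum_(i < n) u' i x) (fun x => \sum_(i < n) f i x).
Proof.
move=> h; elim: n => [|n IH].
  have := BVP0; congr BVP; apply/funext => x; by rewrite big_ord0.
have := BVP_lin 1 IH (h n); congr BVP; apply/funext => x; by rewrite mul1r big_ord_recr.
Qed.

Lemma BVP_energy u u' f w w' : BVP u u' f -> continuous f -> D w w' -> continuous w' -> w A = 0 -> w B = 0 ->
  ip u' w' + ip (fun x => q x * u x) w = ip f w.
Proof.
move=> hB cf hw cw' wA wB; have [cu cu'] := BVP_cont hB; case: hB => h1 h2 _ _.
have cw := D_cont hw; have cqu := cmul cq cu.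
have E := Int_parts AB' h2 hw (csub cqu cf) cw'.
rewrite {1}/inn E wA wB !mulr0 subrr sub0r -/(inn A B (fun x => q x * u x - f x) w) ipBl//; ring.
Qed.

Lemma BVP_sym u u' f w w' g : BVP u u' f -> BVP w w' g -> continuous f -> continuous g ->
  ip u g = ip f w.
Proof.
move=> h1 h2 cf cg; have [cu cu'] := BVP_cont h1; have [cw cw'] := BVP_cont h2.
case: (h1) => [a1 a2 a3 a4]; case: (h2) => [b1 b2 b3 b4].
rewrite -(BVP_energy h1 cf b1 cw' b3 b4) ipC -(BVP_energy h2 cg a1 cu' a3 a4) ipC.
by congr (_ + _); apply: eq_Int => x _; ring.
Qed.

Lemma BVP_pos u u' f : BVP u u' f -> continuous f -> ip u' u' <= ip f u.
Proof.
move=> h1 cf; have [cu cu'] := BVP_cont h1; case: (h1) => [a1 a2 a3 a4].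
rewrite -(BVP_energy h1 cf a1 cu' a3 a4) lerDl; apply: Int_ge0 => x xAB.
by rewrite -mulrA -expr2 mulr_ge0 ?sqr_ge0 ?q0.
Qed.

Lemma BVP_energy_bound u u' f : BVP u u' f -> continuous f -> ip u' u' <= L ^+ 2 * ip f f.
Proof.
move=> h1 cf; have [cu cu'] := BVP_cont h1; case: (h1) => [a1 a2 a3 a4].
set e := ip u' u'; have e0 : 0 <= e by exact: ip_ge0.
have pt x : A <= x <= B -> u x * u x <= L * e.
  move=> /andP[Ax xB]; have := sobolev a1 cu' (lexx A) Ax xB; rewrite a3 subr0 expr2 => h.
  by apply: (le_trans h); rewrite ler_wpM2r// /L lerD2r.
have uu : ip u u <= L * e * L.
  rewrite -[X in _ * X]/(B - A) -Int_cst//; apply: Int_le => //; first exact: cmul.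
  exact: cst_continuous.
have h2 := BVP_pos h1 cf; have h3 := ip_CS A B cf cu.
have h4 : e ^+ 2 <= ip f f * (L * e * L).
  apply: (@le_trans _ _ (ip f u ^+ 2)); first by rewrite lerXn2r ?nnegrE// (le_trans e0).
  by apply: (le_trans h3); rewrite ler_wpM2l// ip_ge0.
have [->|en] := eqVneq e 0; first by rewrite mulr_ge0 ?sqr_ge0 ?ip_ge0.
have e1 : 0 < e by rewrite lt_neqAle eq_sym en.
by rewrite -(ler_pM2r e1) -expr2; apply: (le_trans h4); apply: eq_leW; ring.
Qed.

Lemma BVP_sup u u' f x : BVP u u' f -> continuous f -> A <= x <= B -> u x ^+ 2 <= L ^+ 3 * ip f f.
Proof.
move=> h1 cf /andP[Ax xB]; have [cu cu'] := BVP_cont h1; case: (h1) => [a1 a2 a3 a4].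
have := sobolev a1 cu' (lexx A) Ax xB; rewrite a3 subr0 => h.
apply: (le_trans h); apply: (@le_trans _ _ (L * ip u' u')).
  by rewrite ler_wpM2r ?ip_ge0// /L lerD2r.
by rewrite exprS -mulrA ler_wpM2l ?(ltW L0)//; exact: BVP_energy_bound h1 cf.
Qed.

Lemma BVP_norm u u' f : BVP u u' f -> continuous f -> ip u u <= L ^+ 4 * ip f f.
Proof.
move=> h1 cf; have [cu cu'] := BVP_cont h1.
rewrite (_ : L ^+ 4 * ip f f = L ^+ 3 * ip f f * (B - A)); last by rewrite /L; ring.
rewrite -Int_cst//; apply: Int_le; [exact: cmul|exact: cst_continuous|].
by move=> x xAB; rewrite -expr2; exact: BVP_sup h1 cf xAB.
Qed.

Lemma BVP_holder u u' f x y : BVP u u' f -> continuous f -> A <= x <= B -> A <= y <= B ->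
  (u x - u y) ^+ 2 <= `|x - y| * (L ^+ 2 * ip f f).
Proof.
move=> h1 cf; wlog xy : x y / x <= y.
  move=> H; have [h|h] := leP x y; first exact: H.
  move=> xAB yAB; rewrite distrC (_ : u x - u y = - (u y - u x)); last by ring.
  by rewrite sqrrN; apply: H => //; exact: ltW.
move=> /andP[Ax xB] /andP[Ay yB]; have [cu cu'] := BVP_cont h1; case: (h1) => [a1 a2 a3 a4].
rewrite (_ : u x - u y = - (u y - u x)); last by ring.
rewrite sqrrN; apply: (le_trans (sobolev a1 cu' Ax xy yB)).
rewrite distrC ger0_norm ?subr_ge0// ler_wpM2l ?subr_ge0//; exact: BVP_energy_bound h1 cf.
Qed.

(** Shooting: a solution with zero data at [A] is corrected by a multiple of the homogeneous
    solution [v] of slope 1. If [v B = 0], the energy bound would force [v = 0] on the interval,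
    against its slope. *)
Lemma BVP_exists f : continuous f -> exists u u', BVP u u' f.
Proof.
move=> cf; have cNf : continuous (fun x => - f x) by move=> x; apply: cvgN; exact: cf.
have c0 : continuous (fun _ : R => 0 : R) by exact: cst_continuous.
have [y [y' [h1 h2 h3 h4]]] := ode_exists A 0 0 cq cNf.
have [v [v' [g1 g2 g3 g4]]] := ode_exists A 0 1 cq c0.
have cv' := D_cont g2; have cv := D_cont g1.
have vB : v B != 0.
  apply/eqP => vB; have hv : BVP v v' (fun=> 0).
    by split => //; apply: hasD_ext g2 => // x; rewrite addr0 subr0.
  have e0 : ip v' v' <= 0.
    apply: (le_trans (BVP_energy_bound hv c0)); rewrite /inn (@eq_Int _ _ _ (fun=> 0)) ?Int_cst ?mul0r ?mulr0//.
  have v0 x : A <= x <= B -> v x = 0.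
    move=> /andP[Ax xB]; have := sobolev g1 cv' (lexx A) Ax xB; rewrite g3 subr0 => h.
    apply/eqP; rewrite -sqrf_eq0 eq_le sqr_ge0 andbT (le_trans h)//.
    by rewrite mulr_ge0_le0// subr_ge0.
  have v'1 x : A <= x <= B -> v' x = 1.
    move=> /andP[Ax xB]; have := FTC Ax g2 (rhs_cont cq c0 cv); rewrite g4.
    rewrite (@eq_Int _ _ _ (fun=> 0)) ?Int_cst ?mul0r//; first by move/esym/eqP; rewrite subr_eq0 => /eqP.
    by move=> z /andP[Az zx]; rewrite v0 ?mulr0 ?addr0// Az (le_trans zx).
  have := FTC AB' g1 cv'; rewrite (@eq_Int _ _ _ (fun=> 1)) ?Int_cst ?mul1r//.
  rewrite vB g3 subrr => /eqP; rewrite subr_eq0 => /eqP h; by move: AB; rewrite h ltxx.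
exists (fun x => y x + (- y B / v B) * v x), (fun x => y' x + (- y B / v B) * v' x); split.
- exact: hasD_add h1 (hasD_scale _ g1).
- by apply: hasD_ext (hasD_add h2 (hasD_scale (- y B / v B) g2)) => // x; ring.
- by rewrite h3 g3 mulr0 addr0.
- by rewrite mulfVK// subrr.
Qed.

Let clampAB (x : R) := Num.max A (Num.min x B).

Lemma clampAB_in x : A <= clampAB x <= B.
Proof. by rewrite /clampAB le_max lexx/= ge_max AB'/= ge_min lexx orbT. Qed.

Lemma clampAB_id x : A <= x <= B -> clampAB x = x.
Proof. by move=> /andP[h1 h2]; rewrite /clampAB min_l// max_r. Qed.

Lemma clampAB_lip x y : `|clampAB x - clampAB y| <= `|x - y|.
Proof.
rewrite /clampAB; have h z : [\/ z <= A /\ Num.max A (Num.min z B) = A, B <= z /\ Num.max A (Num.min z B) = B |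
    (A <= z <= B) /\ Num.max A (Num.min z B) = z].
  have [h1|h1] := leP z A.
    by constructor 1; split=> //; rewrite max_l// ge_min h1.
  have [h2|h2] := leP B z.
    by constructor 2; split=> //; rewrite ?min_r// max_r.
  by constructor 3; rewrite (ltW h1) (ltW h2)/= max_r// ltW.
have [[h1 ->]|[h1 ->]|[/andP[h1 h1'] ->]] := h x;
  have [[h2 ->]|[h2 ->]|[/andP[h2 h2'] ->]] := h y;
  rewrite ?subrr ?normr0//; have := AB'; case: (ler0P (x - y)); rewrite ?ler_norml => *; try (apply/andP; split); lra.
Qed.

Lemma sqr_le_norm (x e : R) : 0 <= e -> x ^+ 2 <= e ^+ 2 -> `|x| <= e.
Proof. by move=> e0; rewrite -(real_normK (num_real x)) ler_sqr ?nnegrE. Qed.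

(* Arzela-Ascoli, with an ultrafilter instead of a subsequence *)
Lemma equi_limit (u u' f : nat -> R -> R) : (forall j, continuous (f j)) ->
  (forall j, BVP (u j) (u' j) (f j)) -> (forall j, ip (f j) (f j) <= 1) ->
  exists2 v : R -> R, continuous v &
  forall e N, 0 < e -> exists2 j, (N <= j)%N & forall x, A <= x <= B -> `|u j x - v x| <= e.
Proof.
move=> cf hB f1; pose w j x := u j (clampAB x).
have bw j x : `|w j x| <= L ^+ 3 + 1.
  apply: sqr_le_norm; first by rewrite addr_ge0// exprn_ge0// ltW.
  apply: (le_trans (BVP_sup (hB j) (cf j) (clampAB_in x))).
  apply: (@le_trans _ _ (L ^+ 3 * 1)); first by rewrite ler_wpM2l// exprn_ge0// ltW.
  by have : 0 <= L ^+ 3 by [rewrite exprn_ge0// ltW]; nra.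
have hw j x y : (w j x - w j y) ^+ 2 <= `|x - y| * L ^+ 2.
  apply: (le_trans (BVP_holder (hB j) (cf j) (clampAB_in x) (clampAB_in y))).
  apply: ler_pM => //; first by rewrite mulr_ge0 ?sqr_ge0 ?ip_ge0.
    exact: clampAB_lip.
  by rewrite ler_piMr ?sqr_ge0.
have [U [uU oU]] := @ultraFilterLemma nat \oo _.
pose M := L ^+ 3 + 1.
have pU : ProperFilter U by exact: ultra_proper.
have vP x : exists l : R, w j x @[j --> U] --> l.
  have [|l [_ hl]] := @segment_compact R (- M) M ((fun j => w j x) @ U) _.
    change (U (fun j => `[- M, M]%classic (w j x))); apply: filterE => j.
    by rewrite /= in_itv/= -ler_norml; exact: bw.
  exists l => N hN; have [//|hC] := in_ultra_setVsetC [set j | N (w j x)] uU.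
  by have [z [hz hz']] := hl (~` N) N hC hN.
have [v hv] := choice vP.
have hold x y : (v x - v y) ^+ 2 <= `|x - y| * L ^+ 2.
  have c1 : (w j x - w j y) ^+ 2 @[j --> U] --> (v x - v y) ^+ 2.
    by rewrite expr2; under eq_fun do rewrite expr2; apply: cvgM; apply: cvgB.
  by apply: (ler_cvg_to c1 (cvg_cst (`|x - y| * L ^+ 2))); apply: filterE => j; exact: hw.
have small (e x : R) : 0 < e -> \forall y \near x, `|x - y| * L ^+ 2 <= e ^+ 2.
  move=> e0; have r0 : 0 < e ^+ 2 / L ^+ 2 by rewrite divr_gt0// exprn_gt0.
  apply/nbhs_normP; exists (e ^+ 2 / L ^+ 2) => //= y; rewrite /ball_/= => h.
  by rewrite -ler_pdivlMr ?exprn_gt0// ltW.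
exists v.
  move=> x; apply/cvgrPdist_le => e e0; apply: filterS (small e x e0) => y h.
  by apply: sqr_le_norm; [exact: ltW|exact: le_trans (hold x y) h].
move=> e N e0; have e3 : 0 < e / 3 by rewrite divr_gt0.
have : \forall j \near U, `[A, B]%classic `<=` [set x | `|w j x - v x| <= e].
  have /compact_near_coveringP := @segment_compact R A B.
  apply => x _; have h1 : \forall j \near U, `|v x - w j x| <= e / 3.
    by have /cvgrPdist_le := hv x; apply.
  exists ([set y | `|x - y| * L ^+ 2 <= (e / 3) ^+ 2], [set j | `|v x - w j x| <= e / 3]).
    by split; [exact: small|exact: h1].
  move=> [y j] /= [hy hj].
  have g1 : `|w j x - w j y| <= e / 3 by apply: sqr_le_norm; [exact: ltW|exact: le_trans (hw j x y) hy].
  have g2 : `|v x - v y| <= e / 3 by apply: sqr_le_norm; [exact: ltW|exact: le_trans (hold x y) hy].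
  rewrite (_ : w j y - v y = - (w j x - w j y) - (v x - w j x) + (v x - v y)); last by ring.
  apply: (le_trans (ler_normD _ _)); apply: (le_trans (lerD (ler_normB _ _) (lexx _))).
  rewrite normrN; lra.
have hN : \forall j \near U, (N <= j)%N by apply: oU; exists N.
move=> h; have [j [h1 h2]] := filter_ex (filterI hN h).
by exists j => // x xAB; have := h2 x; rewrite /= in_itv/= /w clampAB_id//; apply.
Qed.

(** [m] is an eigenvalue of [G], hence the inverse of one of [- u'' + q u]. The pair of zeros is a
    filler for the case where the supremum defining the next eigenvalue vanishes; it spares a proof
    that the family is infinite. *)
Definition eigen (e : R -> R) (m : R) :=
  (m = 0 /\ e = (fun=> 0)) \/
  [/\ 0 < m, ip e e = 1 & exists e', [/\ D e e', D e' (fun x => (q x - m^-1) * e x), e A = 0 & e B = 0]].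

Lemma eigen_BVP e m : eigen e m -> exists u', BVP (fun x => m * e x) u' e.
Proof.
move=> [[-> ->]|[m0 _ [e' [h1 h2 h3 h4]]]].
  by exists (fun=> 0); have := BVP0; congr BVP; apply/funext => x; rewrite mulr0.
exists (fun x => m * e' x); split; [exact: hasD_scale h1| |by rewrite h3 mulr0|by rewrite h4 mulr0].
by apply: hasD_ext (hasD_scale m h2) => // x; field; rewrite gt_eqF.
Qed.

Lemma eigen_cont e m : eigen e m -> continuous e.
Proof. by move=> [[_ ->]|[_ _ [e' [h1 _ _ _]]]]; [exact: cst_continuous|exact: D_cont h1]. Qed.

Lemma eigen_orth e m u u' f : eigen e m -> continuous f -> BVP u u' f -> ip u e = m * ip f e.
Proof.
move=> he cf hu; have [w' hw] := eigen_BVP he; have ce := eigen_cont he.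
by rewrite (BVP_sym hu hw cf ce) ipC ipZl// ipC.
Qed.

(** Cauchy-Schwarz for the positive form [<G f, g>], applied to [f] and [u = G f]:
    [|u| ^ 4 <= <G f, f> <G u, u>], and the last factor is at most [m |u| ^ 2]. Orthogonality enters
    through its invariance under [G]. *)
Lemma max_bound (orth : (R -> R) -> Prop) m :
  (forall f g, orth f -> orth g -> forall c, orth (fun x => f x + c * g x)) ->
  (forall f u u', continuous f -> BVP u u' f -> orth f -> orth u) ->
  (forall f u u', continuous f -> orth f -> BVP u u' f -> ip u f <= m * ip f f) ->
  forall f u u', continuous f -> orth f -> BVP u u' f -> ip u u <= m * ip u f.
Proof.
move=> olin oG hm f u u' cf of_ hu; have [cu cu'] := BVP_cont hu.
have [w [w' hw]] := BVP_exists cu; have [cw cw'] := BVP_cont hw.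
have ou : orth u by exact: oG hu of_.
have p1 : 0 <= ip u f by rewrite ipC; apply: le_trans (BVP_pos hu cf); exact: ip_ge0.
have p2 : 0 <= ip w u by rewrite ipC; apply: le_trans (BVP_pos hw cu); exact: ip_ge0.
have CS : ip u u ^+ 2 <= ip u f * ip w u.
  apply: discriminant => // t.
  have h := BVP_lin t hu hw; have cft := cadd cf (cscale (c := t) cu).
  have := BVP_pos h cft; have := ip_ge0 A B (fun x => u' x + t * w' x) => h1 h2.
  have := le_trans h1 h2; rewrite ipDl//; [|exact: cscale|exact: cadd (cscale _)].
  rewrite ipZl//; last exact: cadd (cscale _).
  rewrite ![ip _ (fun x => u x + _)]ipC !ipDl//; try exact: cscale.
  rewrite !ipZl// (_ : ip w f = ip u u); last by rewrite (BVP_sym hw hu cu cf).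
  congr (_ <= _); ring.
have [u0|u0] := eqVneq (ip u u) 0.
  rewrite u0; have [f0|f0] := eqVneq (ip f f) 0.
    have := ip_CS A B cu cf; rewrite f0 mulr0 => h.
    have -> : ip u f = 0 by apply/eqP; rewrite -sqrf_eq0 eq_le h sqr_ge0.
    by rewrite mulr0.
  have ff : 0 < ip f f by rewrite lt_neqAle eq_sym f0 ip_ge0.
  rewrite mulr_ge0//; have := hm f u u' cf of_ hu => h.
  by rewrite -(pmulr_lge0 _ ff); exact: le_trans h.
have uu : 0 < ip u u by rewrite lt_neqAle eq_sym u0 ip_ge0.
rewrite -(ler_pM2r uu) -expr2; apply: (le_trans CS).
rewrite [m * _]mulrC -mulrA ler_wpM2l//; exact: hm hw.
Qed.

Definition orth_to (es : seq ((R -> R) * R)) (f : R -> R) :=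
  forall i, (i < size es)%N -> ip f (nth (fun=> 0, 0) es i).1 = 0.

(** Rayleigh's principle: [m] is the supremum of [<G f, f>] over the unit ball of the orthogonal
    complement. Along a maximizing sequence the functions [u = G f] have a uniform limit [v] by
    compactness, and [v] is the eigenfunction. *)
Lemma max_step (es : seq ((R -> R) * R)) :
  (forall i, (i < size es)%N -> eigen (nth (fun=> 0, 0) es i).1 (nth (fun=> 0, 0) es i).2) ->
  exists em : (R -> R) * R, [/\ eigen em.1 em.2, orth_to es em.1 &
    forall f u u', continuous f -> orth_to es f -> BVP u u' f -> ip u u <= em.2 ^+ 2 * ip f f].
Proof.
move=> hes; have ces i : (i < size es)%N -> continuous (nth (fun=> 0, 0) es i).1 by move=> h; exact: eigen_cont (hes i h).
pose S := [set r | exists f u u', [/\ continuous f, orth_to es f, ip f f <= 1, BVP u u' f & r = ip u f]].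
have c0 : continuous (fun _ : R => 0 : R) by exact: cst_continuous.
have ip0 g : ip (fun=> 0) g = 0.
  rewrite /inn (@eq_Int _ _ _ (fun=> 0)) ?Int_cst ?mul0r// => x _; by rewrite mul0r.
have S0 : S 0.
  exists (fun=> 0), (fun=> 0), (fun=> 0); split => //; rewrite ?ip0//; last exact: BVP0.
have Sub : forall r, S r -> r <= L ^+ 2.
  move=> r [f [u [u' [cf of_ f1 hu ->]]]]; have [cu cu'] := BVP_cont hu.
  apply: le_trans (ler_norm _) _; apply: sqr_le_norm; first exact: sqr_ge0.
  apply: (le_trans (ip_CS A B cu cf)); rewrite -[leRHS]mulr1; apply: ler_pM; rewrite ?ip_ge0//.
  apply: (le_trans (BVP_norm hu cf)); rewrite -exprM -[leRHS]mulr1 ler_wpM2l// exprn_ge0// ltW//.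
pose m := sup S.
have hsS : has_sup S by split; [exists 0|exists (L ^+ 2)].
have m0 : 0 <= m by apply: ub_le_sup => //; exists (L ^+ 2).
have olin f g : orth_to es f -> orth_to es g -> continuous f -> continuous g -> forall c, orth_to es (fun x => f x + c * g x).
  move=> of_ og cf cg c i ilt; rewrite ipDl; [|exact: cf|exact: cscale|exact: ces].
  by rewrite ipZl ?of_ ?og ?mulr0 ?addr0//; exact: ces.
have oG f u u' : continuous f -> BVP u u' f -> orth_to es f -> orth_to es u.
  by move=> cf hu of_ i ilt; rewrite (eigen_orth (hes i ilt) cf hu) of_// mulr0.
have hm f u u' : continuous f -> orth_to es f -> BVP u u' f -> ip u f <= m * ip f f.
  move=> cf of_ hu; have [cu cu'] := BVP_cont hu.
  have [f0|f0] := eqVneq (ip f f) 0.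
    have := ip_CS A B cu cf; rewrite f0 !mulr0 => h.
    by rewrite le_eqVlt -sqrf_eq0 eq_le h sqr_ge0.
  have ff : 0 < ip f f by rewrite lt_neqAle eq_sym f0 ip_ge0.
  pose s := (Num.sqrt (ip f f))^-1.
  have s2 : s ^+ 2 = (ip f f)^-1 by rewrite exprVn sqr_sqrtr// ip_ge0.
  have : S (s ^+ 2 * ip u f).
    exists (fun x => s * f x), (fun x => s * u x), (fun x => s * u' x); split.
    - exact: cscale.
    - by move=> i ilt; rewrite ipZl ?of_ ?mulr0//; exact: ces.
    - by rewrite ipZl ?(ipC _ _ f) ?ipZl ?mulrA -?expr2 ?s2 ?mulVf//; exact: cscale.
    - have := BVP_lin s BVP0 hu; congr BVP; apply/funext => x; by rewrite add0r.
    - by rewrite ipZl ?(ipC _ _ u) ?ipZl// ?(ipC _ _ f) ?mulrA -?expr2//; exact: cscale.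
  move=> h; have := ub_le_sup (ex_intro _ _ Sub) h; rewrite -/m s2 mulrC ler_pdivrMr//.
have oP : forall f u u', continuous f -> orth_to es f -> BVP u u' f -> ip u u <= m * ip u f.
  move=> f u u' cf of_ hu.
  apply: (@max_bound (fun g => continuous g /\ orth_to es g) m) hu => //.
  - by move=> g1 g2 [cg1 og1] [cg2 og2] c; split; [exact: cadd (cscale _)|exact: olin].
  - by move=> g w w' cg hw [_ og]; split; [case: (BVP_cont hw)|exact: oG hw og].
  - by move=> g w w' cg [_ og]; exact: hm.
have final : forall f u u', continuous f -> orth_to es f -> BVP u u' f -> ip u u <= m ^+ 2 * ip f f.
  move=> f u u' cf of_ hu; apply: (le_trans (oP f u u' cf of_ hu)).
  by rewrite expr2 -mulrA ler_wpM2l//; exact: hm hu.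
have [mz|mn] := eqVneq m 0.
  exists (fun=> 0, 0); split => //=; first by left.
  by rewrite -mz.
have mp : 0 < m by rewrite lt_neqAle eq_sym mn.
have seqP j : exists fu : (R -> R) * ((R -> R) * (R -> R)), [/\ continuous fu.1, orth_to es fu.1, ip fu.1 fu.1 <= 1,
    BVP fu.2.1 fu.2.2 fu.1 & m - j.+1%:R^-1 < ip fu.2.1 fu.1].
  have j0 : 0 < j.+1%:R^-1 :> R by rewrite invr_gt0.
  have [r [f [u [u' [h1 h2 h3 h4 ->]]]] hr] := sup_adherent j0 hsS.
  by exists (f, (u, u')).
have [F hF] := choice seqP.
have [v cv hv] := @equi_limit (fun j => (F j).2.1) (fun j => (F j).2.2) (fun j => (F j).1)
  (fun j => let: And5 a _ _ _ _ := hF j in a) (fun j => let: And5 _ _ _ d _ := hF j in d) (fun j => let: And5 _ _ c _ _ := hF j in c).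
have appr e : 0 < e -> exists f u u', [/\ continuous f, orth_to es f, ip f f <= 1 & BVP u u' f] /\
    [/\ (forall x, A <= x <= B -> `|u x - v x| <= e), m - e <= ip u f & ip u f <= m].
  move=> e0; have [j hj hu] := hv e (Num.bound e^-1) e0.
  have [cf of_ f1 hB hm'] := hF j.
  exists (F j).1, (F j).2.1, (F j).2.2; split => //; split => //.
    apply: ltW; apply: le_lt_trans hm'; rewrite lerD2l lerN2 -[leRHS]invrK lef_pV2 ?posrE ?invr_gt0//.
    apply: (le_trans (ltW (archi_boundP _))); first by rewrite invr_ge0 ltW.
    by rewrite ler_nat (leq_trans hj).
  apply: (le_trans (hm _ _ _ cf of_ hB)); by rewrite ler_piMr.
have [w [w' hw]] := BVP_exists cv; have [cw cw'] := BVP_cont hw.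
have ipsq (g : R -> R) e : continuous g -> 0 <= e -> (forall x, A <= x <= B -> `|g x| <= e) -> ip g g <= e ^+ 2 * L.
  move=> cg e0 ge; rewrite -Int_cst//; apply: Int_le; [exact: cmul|exact: cst_continuous|].
  by move=> x /ge h; rewrite -expr2 -real_normK ?num_real// lerXn2r ?nnegrE.
have usq (u : R -> R) e : continuous u -> 0 < e -> e <= 1 -> (forall x, A <= x <= B -> `|u x - v x| <= e) ->
    ip (fun x => u x - v x) (fun x => u x - v x) <= e * L.
  move=> cu e0 e1 uv; apply: (le_trans (ipsq _ _ (csub cu cv) (ltW e0) uv)).
  by rewrite ler_wpM2r ?(ltW L0)// expr2 ler_piMr// ltW.
(* Pass to the limit in w - m v = G (v - u) + G (u - m f) + m (u - v), where u = G f is close to v. *)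
have wv x : A <= x <= B -> w x = m * v x.
  move=> xAB; apply/eqP; rewrite -subr_eq0 -sqrf_eq0 eq_le sqr_ge0 andbT.
  apply: (@le0_small _ (3 * (L ^+ 4 + L ^+ 3 * m + m ^+ 2))) => e e0 e1.
  have L3 : 0 <= L ^+ 3 by rewrite exprn_ge0// ltW.
  have [f [u [u' [[cf of_ f1 hB] [uv um1 um2]]]]] := appr e e0.
  have [cu cu'] := BVP_cont hB; have [z [z' hz]] := BVP_exists cu.
  have b1 : (w x + -1 * z x) ^+ 2 <= L ^+ 3 * (e * L).
    apply: (le_trans (BVP_sup (BVP_lin (-1) hw hz) (cadd cv (cscale (c := -1) cu)) xAB)).
    rewrite ler_wpM2l//; apply: le_trans (usq u e cu e0 e1 uv); apply: eq_leW.
    by apply: eq_Int => y _; ring.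
  have b2 : (z x + - m * u x) ^+ 2 <= L ^+ 3 * (m * e).
    apply: (le_trans (BVP_sup (BVP_lin (- m) hz hB) (cadd cu (cscale (c := - m) cf)) xAB)).
    rewrite ler_wpM2l// ip_quad//; have h2 := oP f u u' cf of_ hB.
    have h3 : m ^+ 2 * ip f f <= m ^+ 2 by rewrite ler_piMr ?sqr_ge0.
    by rewrite sqrrN; have : m * ip u f >= m * (m - e) by [rewrite ler_wpM2l]; nra.
  have b3 : (m * (u x - v x)) ^+ 2 <= m ^+ 2 * e.
    rewrite exprMn ler_wpM2l ?sqr_ge0//; apply: (@le_trans _ _ (e ^+ 2)); last by rewrite expr2 ler_piMr// ltW.
    by rewrite -[leLHS]real_normK ?num_real// lerXn2r ?nnegrE ?(ltW e0)//; exact: uv.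
  rewrite (_ : w x - m * v x = (w x + -1 * z x) + (z x + - m * u x) + m * (u x - v x)); last by ring.
  move: b1 b2 b3; move: (w x + _) (z x + _) (m * (u x - _)) => a b c b1 b2 b3.
  have := sqr_ge0 (a - b); have := sqr_ge0 (b - c); have := sqr_ge0 (a - c); lra.
(* A zero limit would make [<u, f>] arbitrarily small along the sequence, against [m > 0]. *)
have vv : 0 < ip v v.
  rewrite ltNge; apply/negP => v0; have {}v0 : ip v v = 0 by apply/eqP; rewrite eq_le v0 ip_ge0.
  move: mp; rewrite ltNge => /negP; apply; apply: (@le0_small _ (L + 2)) => e e0 e1.
  have [f [u [u' [[cf of_ f1 hB] [uv um1 um2]]]]] := appr e e0.
  have [cu cu'] := BVP_cont hB; have h2 := ip_CS A B (csub cu cv) cf.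
  have h3 : ip v f = 0.
    have := ip_CS A B cv cf; rewrite v0 mul0r => h; apply/eqP; by rewrite -sqrf_eq0 eq_le h sqr_ge0.
  rewrite ipBl// h3 subr0 in h2; have l0 := ltW L0.
  have : ip u f <= e * (L + 1).
    apply: le_trans (ler_norm _) _; apply: sqr_le_norm; first by rewrite mulr_ge0 ?(ltW e0)// addr_ge0.
    apply: (le_trans h2); rewrite -[leRHS]mulr1; apply: ler_pM; rewrite ?ip_ge0//.
    apply: (le_trans (ipsq _ _ (csub cu cv) (ltW e0) uv)); rewrite exprMn ler_wpM2l ?sqr_ge0//.
    by have := sqr_ge0 L; lra.
  lra.
have ov : orth_to es v.
  move=> i ilt; have ce := ces i ilt; set ei := (nth _ es i).1 in ce *.
  apply/eqP; rewrite -sqrf_eq0 eq_le sqr_ge0 andbT; apply: (@le0_small _ (L * ip ei ei)) => e e0 e1.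
  have [f [u [u' [[cf of_ f1 hB] [uv um1 um2]]]]] := appr e e0; have [cu cu'] := BVP_cont hB.
  have h2 := ip_CS A B (csub cu cv) ce; rewrite ipBl// (oG f u u' cf hB of_ i ilt) sub0r sqrrN in h2.
  by apply: (le_trans h2); rewrite mulrAC [L * e]mulrC ler_wpM2r ?ip_ge0//; exact: usq.
pose s := (Num.sqrt (ip v v))^-1.
have s2 : s ^+ 2 = (ip v v)^-1 by rewrite exprVn sqr_sqrtr// ltW.
have c1 : continuous (fun x => q x - m^-1) by move=> x; apply: cvgB; [exact: cq|exact: cvg_cst].
have [a1 a2 a3 a4] := hw.
(* The relation [w = m v] holds only on [A, B], whereas [eigen] asks for an equation on the whole
   line: the homogeneous equation is solved globally and its solution identified with [v] on
   [A, B]. *)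
have [y [y' [h1 h2 h3 h4]]] := ode_exists A 0 (m^-1 * w' A) c1 c0.
have yw x : A <= x <= B -> y x = m^-1 * w x.
  move=> xAB; have hd := hasD_sub h1 (hasD_scale m^-1 a1).
  have hd2 := hasD_sub h2 (hasD_scale m^-1 a2).
  pose h x := m^-1 * (v x - m^-1 * w x).
  have ch : continuous h by apply: cscale; apply: csub => //; exact: cscale.
  have hd3 : D (fun x => y' x - m^-1 * w' x) (fun x => (q x - m^-1) * (y x - m^-1 * w x) + h x).
    by apply: hasD_ext hd2 => // z; rewrite /h; ring.
  have hz : D (fun _ : R => 0 : R) (fun=> 0) by exact: (hasD_cst (1:R) 0).
  have i1 : y A - m^-1 * w A = 0 by rewrite h3 a3 mulr0 subr0.
  have i2 : y' A - m^-1 * w' A = 0 by rewrite h4 subrr.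
  have i3 x1 : A <= x1 <= B -> `|q x1 - m^-1| * 0 + `|h x1| <= 0.
    by move=> x1AB; rewrite mulr0 add0r /h wv// mulrA mulVf// mul1r subrr mulr0 normr0.
  have [+ _] := ode_comparison c1 ch hd hd3 i1 i2 hz hz c0 (fun _ _ => lexx _) (lexx _) i3 xAB.
  by rewrite normr_le0 subr_eq0 => /eqP.
have yv x : A <= x <= B -> y x = v x by move=> xAB; rewrite yw// wv// mulrA mulVf// mul1r.
have cy := D_cont h1.
exists (fun x => s * y x, m); split => //=.
  right; split => //.
    rewrite ipZl ?(ipC _ _ y) ?ipZl//; try exact: cscale.
    by rewrite (eq_ip yv yv) mulrA -expr2 s2 mulVf// gt_eqF.
  exists (fun x => s * y' x); split; [exact: hasD_scale h1| |by rewrite h3 mulr0|].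
    by apply: hasD_ext (hasD_scale s h2) => // x; ring.
  by rewrite yw ?AB' ?lexx// a4 !mulr0.
by move=> i ilt; rewrite ipZl//; [rewrite (eq_ip yv (fun _ _ => erefl)) ov ?mulr0|exact: ces].
Qed.

Lemma spectral : exists (e : nat -> R -> R) (m : nat -> R),
  [/\ forall k, eigen (e k) (m k), forall i k, (i < k)%N -> ip (e k) (e i) = 0 &
  forall k f u u', continuous f -> BVP u u' f -> (forall i, (i < k)%N -> ip f (e i) = 0) ->
    ip u u <= m k ^+ 2 * ip f f].
Proof.
pose d : (R -> R) * R := (fun=> 0, 0).
have step es : exists em : (R -> R) * R, (forall i, (i < size es)%N -> eigen (nth d es i).1 (nth d es i).2) ->
  [/\ eigen em.1 em.2, orth_to es em.1 &
    forall f u u', continuous f -> orth_to es f -> BVP u u' f -> ip u u <= em.2 ^+ 2 * ip f f].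
  have [h|h] := pselect (forall i, (i < size es)%N -> eigen (nth d es i).1 (nth d es i).2).
    by have [em hem] := max_step h; exists em.
  by exists d => h'.
have [F hF] := choice step.
pose S k := iter k (fun s => rcons s (F s)) [::].
have sS k : size (S k) = k by elim: k => [//|k IH]; rewrite /= size_rcons IH.
have nS k i : (i < k)%N -> nth d (S k) i = F (S i).
  elim: k => [//|k IH]; rewrite ltnS leq_eqVlt => /predU1P[->|ik] /=.
    by rewrite nth_rcons sS ltnn eqxx.
  by rewrite nth_rcons sS ik IH.
have eS k : eigen (F (S k)).1 (F (S k)).2.
  elim/ltn_ind: k => k IH; have [|//] := hF (S k).
  by move=> i; rewrite sS => ik; rewrite nS//; exact: IH.
exists (fun k => (F (S k)).1), (fun k => (F (S k)).2); split => //.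
  move=> i k ik; have [|_ h _] := hF (S k); first by move=> l; rewrite sS => lk; rewrite nS//; exact: eS.
  by have := h i; rewrite sS nS//; apply.
move=> k f u u' cf hu hf; have [|_ _ h] := hF (S k); first by move=> l; rewrite sS => lk; rewrite nS//; exact: eS.
by apply: (h f u u') => // i; rewrite sS => ik; rewrite nS//; exact: hf.
Qed.

Section family.
Variables (e : nat -> R -> R) (m : nat -> R).
Hypothesis he : forall k, eigen (e k) (m k).
Hypothesis oe : forall i k, (i < k)%N -> ip (e k) (e i) = 0.

Lemma family_cont k : continuous (e k). Proof. exact: eigen_cont (he k). Qed.

Lemma family_orth i k : i != k -> ip (e i) (e k) = 0.
Proof. by case: ltngtP => // h _; rewrite ?(oe h)// ipC oe. Qed.

Lemma family_norm k : ip (e k) (e k) <= 1 /\ m k ^+ 2 * ip (e k) (e k) = m k ^+ 2.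
Proof.
case: (he k) => [[-> ->]|[_ -> _]]; last by rewrite mulr1.
by rewrite expr0n/= mul0r; split=> //; rewrite /inn (@eq_Int _ _ _ (fun=> 0)) ?Int_cst ?mul0r// => x _; rewrite mul0r.
Qed.

Lemma comb_cont n (c : nat -> R) : continuous (fun x => \sum_(i < n) c i * e i x).
Proof. by apply: (@csum n (fun i x => c i * e i x)) => i; apply: cscale; exact: family_cont. Qed.

Lemma comb_coef n (c : nat -> R) j : (j < n)%N -> ip (fun x => \sum_(i < n) c i * e i x) (e j) = c j * ip (e j) (e j).
Proof.
move=> jn; rewrite (@ip_suml A B n (fun i x => c i * e i x)); last 2 first.
- by move=> i; apply: cscale; exact: family_cont.
- exact: family_cont.
rewrite (bigD1 (Ordinal jn))//= ipZl ?big1 ?addr0//; try exact: family_cont.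
move=> i ij; rewrite ipZl; [|exact: family_cont|exact: family_cont].
by rewrite family_orth ?mulr0//; apply: contra ij => /eqP ij; apply/eqP/val_inj.
Qed.

Lemma comb_norm n (c : nat -> R) :
  ip (fun x => \sum_(i < n) c i * e i x) (fun x => \sum_(i < n) c i * e i x) = \sum_(i < n) c i ^+ 2 * ip (e i) (e i).
Proof.
rewrite (@ip_suml A B n (fun i x => c i * e i x)); last 2 first.
- by move=> i; apply: cscale; exact: family_cont.
- exact: comb_cont.
apply: eq_bigr => i _; rewrite ipZl; [|exact: family_cont|exact: comb_cont].
by rewrite ipC comb_coef//; ring.
Qed.

Lemma family_BVP n (c : nat -> R) : exists u', BVP (fun x => \sum_(i < n) c i * m i * e i x) u' (fun x => \sum_(i < n) c i * e i x).
Proof.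
have [w hw] := choice (fun k => eigen_BVP (he k)).
exists (fun x => \sum_(i < n) c i * w i x).
have := @BVP_sum n (fun i x => c i * (m i * e i x)) (fun i x => c i * w i x) (fun i x => c i * e i x).
have E : (fun x => \sum_(i < n) c i * (m i * e i x)) = (fun x => \sum_(i < n) c i * m i * e i x).
  by apply/funext => x; apply: eq_bigr => i _; rewrite mulrA.
rewrite E; apply=> i; have := BVP_lin (c i) BVP0 (hw i); congr BVP; apply/funext => x; by rewrite add0r.
Qed.

(** At a fixed [x], the sup bound for [G] applied to the combination with coefficients [m i * e i x]
    gives [t ^ 2 <= L ^ 3 t] for [t] the sum of the [(m i * e i x) ^ 2]. Integrating in [x] bounds
    the Hilbert-Schmidt norm of [G]. *)
Lemma family_sum n : \sum_(i < n) m i ^+ 2 <= L ^+ 4.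
Proof.
have L3 : 0 <= L ^+ 3 by rewrite exprn_ge0// ltW.
have pt x : A <= x <= B -> \sum_(i < n) (m i * e i x) ^+ 2 <= L ^+ 3.
  move=> xAB; set t := \sum_(i < n) _.
  have t0 : 0 <= t by apply: sumr_ge0 => i _; exact: sqr_ge0.
  have [u' hB] := family_BVP n (fun i => m i * e i x).
  have := BVP_sup hB (comb_cont (n:=n) (c:=fun i => m i * e i x)) xAB.
  rewrite (comb_norm n (fun i => m i * e i x)) (_ : \sum_(i < n) (m i * e i x) * m i * e i x = t); last by apply: eq_bigr => i _; ring.
  move=> h; have {}h : t ^+ 2 <= L ^+ 3 * t.
    apply: (le_trans h); rewrite ler_wpM2l//; apply: ler_sum => i _.
    by rewrite ler_piMr ?sqr_ge0//; case: (family_norm i).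
  have [t00|tn] := eqVneq t 0; first by rewrite t00.
  have tp : 0 < t by rewrite lt_neqAle eq_sym tn.
  by rewrite -(ler_pM2r tp) -expr2.
have cs i : continuous (fun x => (m i * e i x) * (m i * e i x)).
  by apply: cmul; apply: cscale; exact: family_cont.
have -> : \sum_(i < n) m i ^+ 2 = Int A B (fun x => \sum_(i < n) (m i * e i x) * (m i * e i x)).
  rewrite (_ : Int _ _ _ = ip (fun x => \sum_(i < n) (m i * e i x) * (m i * e i x)) (fun=> 1)); last first.
    by apply: eq_Int => x _; rewrite mulr1.
  rewrite (@ip_suml A B n (fun i x => (m i * e i x) * (m i * e i x)))//; last exact: cst_continuous.
  apply: eq_bigr => i _; have [_ <-] := family_norm i; rewrite {2}/inn -IntZ; last by apply: cmul; exact: family_cont.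
  by apply: eq_Int => x _; ring.
rewrite (_ : L ^+ 4 = L ^+ 3 * (B - A)); last by rewrite /L; ring.
rewrite -Int_cst//; apply: Int_le; [exact: (@csum n (fun i x => (m i * e i x) * (m i * e i x)))|exact: cst_continuous|].
by move=> x xAB; apply: le_trans (pt x xAB); apply: ler_sum => i _; rewrite expr2.
Qed.

Lemma family_small d : 0 < d -> exists k, m k ^+ 2 <= d.
Proof.
move=> d0; apply: contrapT => /forallNP h.
have {}h k : d <= m k ^+ 2 by have /negP := h k; rewrite -ltNge => /ltW.
pose N := Num.bound (L ^+ 4 / d).
have := family_sum N; rewrite leNgt => /negP; apply.
have L4 : 0 <= L ^+ 4 by rewrite exprn_ge0// ltW.
apply: (@lt_le_trans _ _ (N%:R * d)).
  by rewrite -ltr_pdivrMr//; apply: archi_boundP; rewrite divr_ge0// ltW.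
rewrite -[N in N%:R]card_ord -sum1_card natr_sum mulr_suml; apply: ler_sum => i _.
by rewrite mul1r.
Qed.

(** The remainder of [a = G f] is [G] applied to the remainder of [f], which is orthogonal to the
    first [k] eigenfunctions; the factor [m k ^ 2] can be made arbitrarily small by
    [family_small]. *)
Lemma family_complete : (forall k f u u', continuous f -> BVP u u' f -> (forall i, (i < k)%N -> ip f (e i) = 0) ->
    ip u u <= m k ^+ 2 * ip f f) ->
  forall a a' f, continuous f -> BVP a a' f -> forall d, 0 < d -> exists n,
  let r := (fun x => a x - \sum_(i < n) ip a (e i) * e i x) in ip r r <= d.
Proof.
move=> hm a a' f cf ha d d0; have [ca ca'] := BVP_cont ha.
have D0 : 0 < ip f f + 1 by rewrite ltr_wpDl// ip_ge0.
have [k hk] := family_small (divr_gt0 d0 D0); exists k => r.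
pose c i := ip f (e i).
have ac i : ip a (e i) = c i * m i by rewrite (eigen_orth (he i) cf ha) mulrC.
have [w hw] := family_BVP k c; have h := BVP_lin (-1) ha hw.
have cc := @comb_cont k c.
have z i : (i < k)%N -> ip (fun x => f x + -1 * \sum_(i < k) c i * e i x) (e i) = 0.
  move=> ik; rewrite ipDl; [|exact: cf|exact: cscale|exact: family_cont].
  rewrite ipZl; [|exact: cc|exact: family_cont]; rewrite comb_coef//.
  case: (he i) => [[_ ei]|[_ -> _]]; last by rewrite mulr1 mulN1r subrr.
  rewrite /c ei (_ : ip f _ = 0); first by rewrite mul0r mulr0 addr0.
  by rewrite /inn (@eq_Int _ _ _ (fun=> 0)) ?Int_cst ?mul0r// => x _; rewrite mulr0.
have := hm k _ _ _ (cadd cf (cscale (c := -1) cc)) h z.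
have -> : (fun x => a x + -1 * \sum_(i < k) c i * m i * e i x) = r.
  by apply/funext => x; rewrite mulN1r; congr (_ - _); apply: eq_bigr => i _; rewrite ac.
move=> /le_trans; apply.
apply: (@le_trans _ _ (d / (ip f f + 1) * ip f f)); last first.
  by rewrite mulrAC ler_pdivrMr// ler_wpM2l ?(ltW d0)// lerDl.
apply: ler_pM => //; [exact: sqr_ge0|exact: ip_ge0|].
have E : ip (fun x => f x + -1 * \sum_(i < k) c i * e i x) (fun x => f x + -1 * \sum_(i < k) c i * e i x) =
    ip f f - \sum_(i < k) c i ^+ 2.
  rewrite (ip_quad A B (-1) cf cc) (comb_norm k c) mulrN1 mulNr (ipC _ _ f) (@ip_suml A B k (fun i x => c i * e i x))//; last first.
    by move=> i; apply: cscale; exact: family_cont.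
  rewrite sqrrN expr1n mul1r.
  have -> : \sum_(i < k) ip (fun x => c i * e i x) f = \sum_(i < k) c i ^+ 2.
    by apply: eq_bigr => i _; rewrite ipZl ?(ipC _ _ (e i))//; exact: family_cont.
  have -> : \sum_(i < k) c i ^+ 2 * ip (e i) (e i) = \sum_(i < k) c i ^+ 2; last by ring.
  apply: eq_bigr => i _; case: (he i) => [[_ ei]|[_ -> _]]; last by rewrite mulr1.
  rewrite /c ei (_ : ip f _ = 0); first by rewrite expr0n/= mul0r.
  by rewrite /inn (@eq_Int _ _ _ (fun=> 0)) ?Int_cst ?mul0r// => x _; rewrite mulr0.
by rewrite E gerBl sumr_ge0// => i _; exact: sqr_ge0.
Qed.

End family.

End BVP.

(** * Energy estimate and limits of weak solutions *)

Definition gop (w : P -> R) (p : P) : R :=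
  - (dx (dx w) p + p.1 ^+ 2 * 'D_((0, 1) : P) ('D_((0, 1) : P) w) p).

Definition vanishing (w : P -> R) : Prop :=
  (forall y, 0 <= y <= pi -> w (-1, y) = 0 /\ w (1, y) = 0) /\
  (forall x, -1 <= x <= 1 -> w (x, 0) = 0 /\ w (x, pi) = 0).

Lemma smooth_dx2 (w : P -> R) : smooth w -> smooth (dx w).
Proof. by move=> sw; exact: hasD_smooth sw (smooth_dx sw). Qed.

Lemma smooth_gop w : smooth w -> smooth (gop w).
Proof.
move=> sw; rewrite /gop; apply: (smoothN (f := fun p => dx (dx w) p + p.1 ^+ 2 * 'D_((0, 1) : P) ('D_((0, 1) : P) w) p)).
apply: smoothD; first exact/smooth_dx2/smooth_dx2.
apply: (smoothM (f := fun p : P => p.1 ^+ 2)); last exact/smooth_derive/smooth_derive.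
have := smoothM (@smooth_fst) (@smooth_fst).
by rewrite (_ : (fun x => _) = (fun p : P => p.1 ^+ 2))//; apply/funext => p; rewrite expr2.
Qed.

Lemma smooth_xdy (w : P -> R) : smooth w -> smooth (xdy w).
Proof. by move=> sw; exact: (smoothM (@smooth_fst) (smooth_derive _ sw)). Qed.

Lemma V_gop f g h w : V_grad f g h -> smooth w ->
  dot mO g (dx w) + dot mO h (xdy w) = dot mO f (gop w).
Proof.
move=> Vf sw; have s1 := smooth_dx2 sw; have s2 := smooth_derive ((0, 1) : P) sw.
exact: (V_parts Vf (smooth_dx sw) (smooth_hasD _ s1) (smooth_dy sw) (smooth_hasD _ s2)
  (smooth_cont s1) (smooth_cont (smooth_derive _ s1)) (smooth_cont s2) (smooth_cont (smooth_derive _ s2))).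
Qed.

(** All approximate solutions have this form: finite sums of products of a function of time and a
    smooth function of space, so that calculus in time reduces to that of the factors [tau]. *)
Definition sepf (I : finType) (tau : I -> R -> R) (w : I -> P -> R) (t : R) (p : P) : R := \sum_i tau i t * w i p.

Section sepsum.
Variables (I : finType) (tau : I -> R -> R) (w : I -> P -> R).
Hypothesis sw : forall i, smooth (w i).

Lemma sepf_smooth t : smooth (sepf tau w t).
Proof. by apply: smooth_sum => i _; exact: smoothZ. Qed.

Lemma sepf_vanishing t : (forall i, vanishing (w i)) -> vanishing (sepf tau w t).
Proof.
move=> bw; split=> z zi; split; apply: big1 => i _; have [h1 h2] := bw i;
  by rewrite ?(h1 _ zi).1 ?(h1 _ zi).2 ?(h2 _ zi).1 ?(h2 _ zi).2 mulr0.
Qed.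

Lemma sepf_derive v t p : 'D_v (sepf tau w t) p = sepf tau (fun i => 'D_v (w i)) t p.
Proof.
apply: hasDE; apply: (@hasD_sum _ I (index_enum I) xpredT v (fun i p => tau i t * w i p) (fun i p => tau i t * 'D_v (w i) p)) => i _.
exact/hasD_scale/smooth_hasD.
Qed.

Lemma sepf_dx t p : dx (sepf tau w t) p = sepf tau (fun i => dx (w i)) t p.
Proof. exact: sepf_derive. Qed.

Lemma sepf_xdy t p : xdy (sepf tau w t) p = sepf tau (fun i => xdy (w i)) t p.
Proof. by rewrite /xdy sepf_derive mulr_sumr; apply: eq_bigr => i _; rewrite mulrCA. Qed.

End sepsum.

Lemma sepf_gop (I : finType) (tau : I -> R -> R) (w : I -> P -> R) t p : (forall i, smooth (w i)) ->
  gop (sepf tau w t) p = sepf tau (fun i => gop (w i)) t p.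
Proof.
move=> sw.
have e1 : dx (sepf tau w t) = sepf tau (fun i => dx (w i)) t by apply/funext => q; exact: sepf_dx.
have e2 : 'D_((0, 1) : P) (sepf tau w t) = sepf tau (fun i => 'D_((0, 1) : P) (w i)) t by apply/funext => q; exact: sepf_derive.
rewrite /gop e1 e2 sepf_dx; last by move=> i; exact: smooth_dx2.
rewrite sepf_derive; last by move=> i; exact: smooth_derive.
rewrite /sepf mulr_sumr -big_split -sumrN; apply: eq_bigr => i _ /=; ring.
Qed.

Lemma cont_sum (J : finType) (F : J -> R -> R) : (forall i, continuous (F i)) -> continuous (fun t => \sum_i F i t).
Proof.
move=> cF; have h (r : seq J) : continuous (fun t => \sum_(i <- r) F i t).
  elim: r => [|i r IH].
    by rewrite (_ : (fun t => _) = (fun=> 0)); [exact: cst_continuous|apply/funext => t; rewrite big_nil].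
  rewrite (_ : (fun t => _) = (fun t => F i t + \sum_(i <- r) F i t)); first exact: cadd.
  by apply/funext => t; rewrite big_cons.
exact: h.
Qed.

Section sepdot.
Variable I : finType.

Lemma sepf_L2 (s : I -> R -> R) (v : I -> P -> R) t : (forall i, smooth (v i)) -> L2 mO (sepf s v t).
Proof. by move=> sv; apply/L2_cont/smooth_cont/sepf_smooth. Qed.

Lemma sepf_dot (s : I -> R -> R) (v : I -> P -> R) t phi : (forall i, smooth (v i)) -> L2 mO phi ->
  dot mO (sepf s v t) phi = \sum_i s i t * dot mO (v i) phi.
Proof.
move=> sv lphi; have lv i : L2 mO (v i) by exact/L2_cont/smooth_cont.
rewrite /sepf (@dot_suml _ _ mO I (index_enum I) xpredT (fun i p => s i t * v i p))//; last by move=> i _; exact: L2Z.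
by apply: eq_bigr => i _; rewrite dotZl.
Qed.

Lemma sepf_dot_cont (s : I -> R -> R) (v : I -> P -> R) phi : (forall i, continuous (s i)) ->
  (forall i, smooth (v i)) -> L2 mO phi -> continuous (fun t => dot mO (sepf s v t) phi).
Proof.
move=> cs sv lphi; rewrite (_ : (fun t => _) = (fun t => \sum_i s i t * dot mO (v i) phi)).
  by apply: (cont_sum (F := fun i t => s i t * dot mO (v i) phi)) => i; apply: cmul => //; exact: cst_continuous.
by apply/funext => t; rewrite sepf_dot.
Qed.

Lemma sepf_dot2_cont (s s' : I -> R -> R) (v v' : I -> P -> R) : (forall i, continuous (s i)) ->
  (forall i, continuous (s' i)) ->
  (forall i, smooth (v i)) -> (forall i, smooth (v' i)) -> continuous (fun t => dot mO (sepf s v t) (sepf s' v' t)).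
Proof.
move=> cs cs' sv sv'; rewrite (_ : (fun t => _) = (fun t => \sum_i s i t * dot mO (sepf s' v' t) (v i))).
  apply: (cont_sum (F := fun i t => s i t * dot mO (sepf s' v' t) (v i))) => i; apply: cmul => //.
  apply: sepf_dot_cont => //; exact/L2_cont/smooth_cont.
apply/funext => t; rewrite sepf_dot//; last exact: sepf_L2.
by apply: eq_bigr => i _; rewrite dotC.
Qed.

Section D.
Variables (tau tau' : I -> R -> R) (w : I -> P -> R).
Hypothesis dtau : forall i, D (tau i) (tau' i).
Hypothesis sw : forall i, smooth (w i).
Let f := sepf tau w.
Let ft := sepf tau' w.

Lemma sepf_dot_D phi : L2 mO phi -> D (fun t => dot mO (f t) phi) (fun t => dot mO (ft t) phi).
Proof.
move=> lphi; have := @hasD_sum R I (index_enum I) xpredT (1:R)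
  (fun i t => dot mO (w i) phi * tau i t) (fun i t => dot mO (w i) phi * tau' i t).
move=> /(_ (fun i _ => hasD_scale _ (dtau i))); apply: hasD_ext => t; rewrite sepf_dot//;
  by apply: eq_bigr => i _; rewrite mulrC.
Qed.

Lemma sepf_sqr_D : D (fun t => dot mO (f t) (f t)) (fun t => 2 * dot mO (ft t) (f t)).
Proof.
have lw i : L2 mO (w i) by exact/L2_cont/smooth_cont.
have := @hasD_sum R I (index_enum I) xpredT (1:R)
  (fun i t => tau i t * dot mO (f t) (w i)) (fun i t => tau' i t * dot mO (f t) (w i) + tau i t * dot mO (ft t) (w i)).
move=> /(_ (fun i _ => hasD_mul (dtau i) (sepf_dot_D (lw i)))); apply: hasD_ext => t.
  by rewrite sepf_dot//; [apply: eq_bigr => i _; rewrite dotC|exact: sepf_L2].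
rewrite big_split/= mulrDl mul1r.
have -> : \sum_i tau' i t * dot mO (f t) (w i) = dot mO (ft t) (f t).
  by rewrite sepf_dot//; [apply: eq_bigr => i _; rewrite dotC|exact: sepf_L2].
congr (_ + _); rewrite dotC sepf_dot//; last exact: sepf_L2.
by apply: eq_bigr => i _; rewrite dotC.
Qed.

End D.

End sepdot.

Section energy.
Variable T : R.
Hypothesis T0 : 0 < T.
Local Notation mC := (@mu_cylinder R T).
Local Notation II := (`]0, T[%classic : set R).
Variables (I : finType) (tau tau' : I -> R -> R) (w : I -> P -> R).
Hypothesis dtau : forall i, D (tau i) (tau' i).
Hypothesis ctau' : forall i, continuous (tau' i).
Hypothesis sw : forall i, smooth (w i).
Hypothesis bw : forall i, vanishing (w i).
Let f := sepf tau w.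
Let ft := sepf tau' w.
Let ctau i : continuous (tau i). Proof. exact: D_cont (dtau i). Qed.
Let lf t : L2 mO (f t). Proof. exact: sepf_L2. Qed.
Let lft t : L2 mO (ft t). Proof. exact: sepf_L2. Qed.
Let sf t : smooth (f t). Proof. exact: sepf_smooth. Qed.
Let lgf t : L2 mO (gop (f t)). Proof. exact/L2_cont/smooth_cont/smooth_gop. Qed.

Definition sepF (tau tau' : I -> R -> R) (w : I -> P -> R) (t : R) (p : P) : R :=
  sepf tau' w t p + gop (sepf tau w t) p.

Let F := sepF tau tau' w.
Let lF t : L2 mO (F t). Proof. by apply: L2D. Qed.

Lemma sepf_V t : V_grad (f t) (dx (f t)) (xdy (f t)).
Proof. by have [h1 h2] := sepf_vanishing tau t bw; exact: V_smooth. Qed.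

Definition dirichlet t : R := dot mO (dx (f t)) (dx (f t)) + dot mO (xdy (f t)) (xdy (f t)).

Lemma dirichletE t : dirichlet t = dot mO (f t) (gop (f t)).
Proof. exact: V_gop (sepf_V t) (sf t). Qed.

Lemma dirichlet_cont : continuous dirichlet.
Proof.
have -> : dirichlet = fun t => dot mO (sepf tau w t) (sepf tau (fun i => gop (w i)) t).
  by apply/funext => t; rewrite dirichletE; apply: eq_Rintegral => p _; rewrite /f sepf_gop.
exact: (sepf_dot2_cont ctau ctau sw (fun i => smooth_gop (sw i))).
Qed.

Lemma energy_identity t : dot mO (ft t) (f t) = dot mO (F t) (f t) - dirichlet t.
Proof. by rewrite /F /sepF dotDl// (dotC mO (gop _)) dirichletE addrK. Qed.

Let A t := dot mO (f t) (f t).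

Lemma AF_bound (B : R) t : 0 <= B -> nrm mO (F t) <= B -> 2 * dot mO (F t) (f t) <= A t + B ^+ 2.
Proof.
move=> B0 FB; have h := le_trans (ler_norm _) (CauchySchwarz (lF t) (lf t)).
have : dot mO (F t) (f t) <= B * nrm mO (f t) by apply: (le_trans h); rewrite ler_wpM2r// nrm_ge0.
rewrite /A -nrm_sqr; have := sqr_ge0 (nrm mO (f t) - B).
move: (nrm mO (f t)) (dot _ _ _) => a b h1 h2; nra.
Qed.

(** Gronwall's argument: by the energy identity the derivative of [A] is at most [A + B ^ 2], so the
    weight [exp (- t)] removes the term in [A]. *)
Lemma energy_sup (B : R) : 0 <= B -> (forall t, 0 <= t <= T -> nrm mO (F t) <= B) ->
  forall t, 0 <= t <= T -> A t <= expR T * (A 0 + B ^+ 2).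
Proof.
move=> B0 FB t /andP[t0 tT].
have ce : continuous (fun s : R => expR (- s)).
  exact: smooth_cont (smooth_comp (smoothN smooth_id) smooth_exp).
have de : D (fun s : R => expR (- s)) (fun s => - expR (- s)).
  by apply: hasD_ext (hasD_comp (hasD_opp (@D_id)) (@D_exp)) => // s; rewrite mulrN1.
have dA := sepf_sqr_D dtau sw.
have cA : continuous A by exact: D_cont dA.
have cA' : continuous (fun s => 2 * dot mO (ft s) (f s)) by apply: cscale; exact: sepf_dot2_cont.
have dg := hasD_mul de dA.
have cg : continuous (fun s => - expR (- s) * A s + expR (- s) * (2 * dot mO (ft s) (f s))).
  apply: cadd; apply: cmul => //.
  by rewrite (_ : (fun s => _) = (fun s => -1 * expR (- s))); [exact: cscale|apply/funext => s; rewrite mulN1r].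
have h1 := FTC t0 dg cg.
have h2 : Int 0 t (fun s => - expR (- s) * A s + expR (- s) * (2 * dot mO (ft s) (f s))) <= Int 0 t (fun s => - (B ^+ 2) * - expR (- s)).
  have cc : continuous (fun s : R => - (B ^+ 2) * - expR (- s)).
    apply: cscale; rewrite (_ : (fun s => _) = (fun s => -1 * expR (- s))); [exact: cscale|apply/funext => s; rewrite mulN1r//].
  apply: Int_le => // s /andP[s0 st]; rewrite energy_identity.
  have h := AF_bound B0 (FB s _); rewrite s0 (le_trans st tT) in h.
  have {}h := h isT; have : 0 <= dirichlet s by rewrite /dirichlet addr_ge0// dot_ge0.
  have e0 := expR_gt0 (- s); move=> d0; move: (expR _) e0 (A s) (dot mO (F s) _) h (dirichlet s) d0 => e e0 a b h d d0.
  rewrite -subr_ge0 (_ : _ - _ = e * ((a + B ^+ 2 - 2 * b) + 2 * d)); last by ring.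
  by rewrite mulr_ge0 ?(ltW e0)// addr_ge0 ?subr_ge0// mulr_ge0.
have h3 := FTC t0 (hasD_scale (- B ^+ 2) de).
rewrite h1 h3 in h2; last first.
  apply: cscale; rewrite (_ : (fun s => _) = (fun s => -1 * expR (- s))); [exact: cscale|apply/funext => s; rewrite mulN1r//].
rewrite oppr0 expR0 mul1r in h2.
have h4 : expR (- t) * A t <= A 0 + B ^+ 2.
  have := expR_gt0 (- t); move: h2; rewrite /A; move: (expR _) (dot _ _ _) (dot _ _ _) => e a b; have := sqr_ge0 B; nra.
have : A t <= expR t * (A 0 + B ^+ 2) by rewrite -ler_pdivrMl ?expR_gt0// -expRN.
move/le_trans; apply; rewrite ler_wpM2r ?ler_expR//.
by rewrite addr_ge0 ?sqr_ge0 ?dot_ge0.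
Qed.

Lemma energy_dirichlet (B : R) : 0 <= B -> (forall t, 0 <= t <= T -> nrm mO (F t) <= B) ->
  Int 0 T dirichlet <= (T * (expR T + 1) + 1) * (A 0 + B ^+ 2).
Proof.
move=> B0 FB.
have dA := sepf_sqr_D dtau sw.
have cA' : continuous (fun s => 2 * dot mO (ft s) (f s)) by apply: cscale; exact: sepf_dot2_cont.
have cE : continuous (fun s => dirichlet s - - (2 * dot mO (ft s) (f s))).
  apply: csub; first exact: dirichlet_cont.
  by rewrite (_ : (fun s => _) = (fun s => -1 * (2 * dot mO (ft s) (f s)))); [exact: cscale|apply/funext => s; rewrite mulN1r].
have h1 := FTC (ltW T0) dA cA'.
have K0 : 0 <= A 0 + B ^+ 2 by rewrite addr_ge0 ?sqr_ge0 ?dot_ge0.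
have h2 : Int 0 T (fun s => dirichlet s + 2 * dot mO (ft s) (f s)) <= Int 0 T (fun=> expR T * (A 0 + B ^+ 2) + B ^+ 2).
  apply: Int_le; [apply: cadd => //; exact: dirichlet_cont|exact: cst_continuous|].
  move=> s sT; rewrite energy_identity.
  have h := AF_bound B0 (FB s sT); have h' := energy_sup B0 FB sT.
  have : 0 <= dirichlet s by rewrite /dirichlet addr_ge0// dot_ge0.
  move: (expR T * _) h' h; move: (A s) (dirichlet s) (dot _ _ _) => a d b e; lra.
rewrite IntD// in h2; last exact: dirichlet_cont.
rewrite h1 Int_cst ?(ltW T0)// subr0 in h2.
have hA : 0 <= A T by exact: dot_ge0.
have hB : 0 <= A 0 by exact: dot_ge0.
have h3 : B ^+ 2 <= A 0 + B ^+ 2 by rewrite lerDr.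
have h4 : B ^+ 2 * T <= (A 0 + B ^+ 2) * T by rewrite ler_wpM2r// ltW.
have h5 := sqr_ge0 B.
move: h2 h4; rewrite -/(A T) -/(A 0); move: (Int _ _ _) => d.
by move: (expR T) => e; move: (A 0) (A T) (B ^+ 2) hA hB h3 h5 => a b c; lra.
Qed.

Lemma sepf_cyl (v : I -> P -> R) : (forall i, smooth (v i)) ->
  L2 mC (fun z : space => sepf tau v z.1 z.2) /\
  nrm mC (fun z : space => sepf tau v z.1 z.2) ^+ 2 = Int 0 T (fun t => dot mO (sepf tau v t) (sepf tau v t)).
Proof.
move=> sv; have lz : L2 mC (fun z : space => sepf tau v z.1 z.2).
  apply: (@L2_sum _ _ mC I (index_enum I) xpredT (fun i z => tau i z.1 * v i z.2)) => i _.
  have [C hC] := continuous_bound_I T (ctau (i := i)).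
  have [] := @L2_tensor T T0 (tau i) (v i) `|C| (normr_ge0 C) (continuous_measurable_R (ctau (i := i))) _ _ => //.
    by move=> t /hC h; apply: (le_trans h); exact: ler_norm.
  exact/L2_cont/smooth_cont.
split=> //; rewrite nrm_sqr /dot.
have mz := L2_measurable lz.
have [_ E _] := @cyl_fubini T (fun z => sepf tau v z.1 z.2 * sepf tau v z.1 z.2) (L2_integrable lz lz) (measurable_funM mz mz).
by rewrite E Int_oo//; exact: sepf_dot2_cont.
Qed.

Lemma sepf_L2_V_grad : L2_V_grad T f (fun z => dx (f z.1) z.2) (fun z => xdy (f z.1) z.2).
Proof.
have e1 : (fun z : space => dx (f z.1) z.2) = (fun z => sepf tau (fun i => dx (w i)) z.1 z.2).
  by apply/funext => z; rewrite sepf_dx.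
have e2 : (fun z : space => xdy (f z.1) z.2) = (fun z => sepf tau (fun i => xdy (w i)) z.1 z.2).
  by apply/funext => z; rewrite sepf_xdy.
split; [rewrite e1|rewrite e2|].
- by have [] := sepf_cyl (fun i => smooth_dx2 (sw i)).
- by have [] := sepf_cyl (fun i => smooth_xdy (sw i)).
- by apply: aeW => t _; exact: sepf_V.
Qed.

Lemma energy_cyl (B : R) : 0 <= B -> (forall t, 0 <= t <= T -> nrm mO (F t) <= B) ->
  nrm mC (fun z => dx (f z.1) z.2) ^+ 2 <= (T * (expR T + 1) + 1) * (A 0 + B ^+ 2) /\
  nrm mC (fun z => xdy (f z.1) z.2) ^+ 2 <= (T * (expR T + 1) + 1) * (A 0 + B ^+ 2).
Proof.
move=> B0 FB; have := energy_dirichlet B0 FB; move: (_ * (A 0 + B ^+ 2)) => K hK.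
have e1 : (fun z : space => dx (f z.1) z.2) = (fun z => sepf tau (fun i => dx (w i)) z.1 z.2).
  by apply/funext => z; rewrite sepf_dx.
have e2 : (fun z : space => xdy (f z.1) z.2) = (fun z => sepf tau (fun i => xdy (w i)) z.1 z.2).
  by apply/funext => z; rewrite sepf_xdy.
have s1 i := smooth_dx2 (sw i); have s2 i := smooth_xdy (sw i).
rewrite e1 e2 (sepf_cyl s1).2 (sepf_cyl s2).2.
have E : dirichlet = fun t => dot mO (sepf tau (fun i => dx (w i)) t) (sepf tau (fun i => dx (w i)) t) +
   dot mO (sepf tau (fun i => xdy (w i)) t) (sepf tau (fun i => xdy (w i)) t).
  by apply/funext => t; congr (_ + _); apply: eq_Rintegral => p _; rewrite ?sepf_dx ?sepf_xdy.
split; apply: le_trans hK; apply: Int_le; rewrite ?E; try exact: sepf_dot2_cont;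
  try (by apply: cadd; exact: sepf_dot2_cont); by move=> t _; rewrite ?lerDl ?lerDr dot_ge0.
Qed.

Lemma sepf_continuous_L2 : continuous_L2 T f.
Proof.
split=> [t _|t0 _]; first exact: lf.
have [_] := @L2_dist_cvg R (within `[0, T] (nbhs t0)) _ f (f t0) (lf t0) (filterE _ lf); apply.
have lw i : L2 mO (w i) by exact/L2_cont/smooth_cont.
have h : (fun t => \sum_i `|tau i t - tau i t0| * nrm mO (w i)) @ t0 --> (0 : R).
  have c : continuous (fun t => \sum_i `|tau i t - tau i t0| * nrm mO (w i)).
    apply: (cont_sum (F := fun i t => `|tau i t - tau i t0| * nrm mO (w i))) => i.
    apply: cmul; last exact: cst_continuous.
    by move=> t; apply: cvg_norm; apply: cvgB; [exact: ctau|exact: cvg_cst].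
  have e0 : \sum_i `|tau i t0 - tau i t0| * nrm mO (w i) = 0.
    by apply: big1 => i _; rewrite subrr normr0 mul0r.
  by have := c t0; rewrite /continuous_at e0.
have h' : (fun t => \sum_i `|tau i t - tau i t0| * nrm mO (w i)) @ within `[0, T] (nbhs t0) --> (0 : R).
  by apply: cvg_trans h; apply: cvg_app; exact: cvg_within.
move/cvgrPdist_le : h' => h'; apply/cvgrPdist_le => e e0; apply: filterS (h' e e0) => t.
rewrite !sub0r !normrN => h1; apply: le_trans h1; rewrite ger0_norm ?nrm_ge0//; apply: le_trans (ler_norm _).
rewrite (_ : (fun p => f t p - f t0 p) = (fun p => \sum_i (tau i t - tau i t0) * w i p)); last first.
  by apply/funext => p; rewrite /f /sepf -sumrB; apply: eq_bigr => i _; rewrite mulrBl.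
apply: (le_trans (@nrm_sum _ _ mO I (index_enum I) xpredT (fun i p => (tau i t - tau i t0) * w i p) _)).
  by move=> i _; exact: L2Z.
by apply: ler_sum => i _; rewrite nrmZ.
Qed.

Lemma test_itv_out (th : R -> R) t : test_function II th -> ~ II t -> th t = 0.
Proof.
move=> [_ _ sD] nD; apply: contrapT => Fp; apply: nD; apply: sD.
by apply: subset_closure; apply/eqP.
Qed.

Lemma sepf_weak phi phix phiy : V_grad phi phix phiy -> forall theta : R -> R, test_function II theta ->
  - (\int[mu]_(t in II) (derive1 theta t * L2_dot (f t) phi)) +
  \int[mu]_(t in II) (theta t * (L2_dot (dx (f t)) phix + L2_dot (xdy (f t)) phiy)) =
  \int[mu]_(t in II) (theta t * L2_dot (F t) phi).
Proof.
move=> Vphi theta tth; have [lphi _ _] := Vphi; have [sth _ _] := tth.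
have dth : D theta ('D_(1:R) theta) by exact: smooth_hasD.
have cth' : continuous ('D_(1:R) theta) by exact: smooth_cont (smooth_derive _ sth).
have cth := smooth_cont sth.
have th0 : theta 0 = 0 by apply: (test_itv_out tth); rewrite /= in_itv/= ltxx.
have thT : theta T = 0 by apply: (test_itv_out tth); rewrite /= in_itv/= ltxx andbF.
have c1 : continuous (fun t => dot mO (f t) phi) by exact: sepf_dot_cont.
have c2 : continuous (fun t => dot mO (ft t) phi) by exact: sepf_dot_cont.
have c3 : continuous (fun t => dot mO (gop (f t)) phi).
  have -> : (fun t => dot mO (gop (f t)) phi) = (fun t => dot mO (sepf tau (fun i => gop (w i)) t) phi).
    by apply/funext => t; apply: eq_Rintegral => p _; rewrite /f sepf_gop.
  exact: sepf_dot_cont ctau (fun i => smooth_gop (sw i)) lphi.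
have e1 : (fun t => theta t * (L2_dot (dx (f t)) phix + L2_dot (xdy (f t)) phiy)) = (fun t => theta t * dot mO (gop (f t)) phi).
  apply/funext => t; rewrite (dotC mO (gop (f t)) phi) -(V_gop Vphi (sf t)) /L2_dot; congr (_ * (_ + _)); exact: (dotC mO).
have e2 : (fun t => theta t * L2_dot (F t) phi) = (fun t => theta t * dot mO (ft t) phi + theta t * dot mO (gop (f t)) phi).
  by apply/funext => t; rewrite -mulrDr -dotDl.
have e3 : (fun t => derive1 theta t * L2_dot (f t) phi) = (fun t => 'D_(1:R) theta t * dot mO (f t) phi).
  by apply/funext => t; rewrite derive1E.
have k2 := cmul cth c2; have k3 := cmul cth c3.
rewrite e1 e2 e3 (Int_oo _ _ (cmul cth' c1)) (Int_oo _ _ k3) (Int_oo _ _ (cadd k2 k3)) (IntD _ _ k2 k3).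
have := Int_parts (ltW T0) dth (sepf_dot_D dtau sw lphi) cth' c2.
by rewrite th0 thT !mul0r subrr sub0r -/f -/ft => ->.
Qed.

End energy.

(** * Limits of separated functions *)

Section limit.
Definition separated (f F : R -> P -> R) : Prop :=
  exists (I : finType) (tau tau' : I -> R -> R) (w : I -> P -> R),
  [/\ forall i, D (tau i) (tau' i), forall i, continuous (tau' i),
    forall i, smooth (w i), forall i, vanishing (w i) & f = sepf tau w /\ F = sepF tau tau' w].

Lemma sepf_sum (I J : finType) (s : I -> R -> R) (s' : J -> R -> R) (v : I -> P -> R) (v' : J -> P -> R) c t p :
  sepf (fun i : I + J => match i with inl i => s i | inr j => fun t => c * s' j t end)
    (fun i => match i with inl i => v i | inr j => v' j end) t p = sepf s v t p + c * sepf s' v' t p.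
Proof.
by rewrite /sepf big_sumType/= mulr_sumr; congr (_ + _); apply: eq_bigr => j _; rewrite mulrA.
Qed.

Lemma separatedB f F g E : separated f F -> separated g E ->
  separated (fun t p => f t p - g t p) (fun t p => F t p - E t p).
Proof.
move=> [I [s [s' [v [d1 c1 s1 b1 [-> ->]]]]]] [J [r [r' [v' [d2 c2 s2 b2 [-> ->]]]]]].
pose tau (i : I + J) := match i with inl i => s i | inr j => fun t => -1 * r j t end.
pose tau' (i : I + J) := match i with inl i => s' i | inr j => fun t => -1 * r' j t end.
pose w (i : I + J) := match i with inl i => v i | inr j => v' j end.
have sw i : smooth (w i) by case: i => [i|j] /=.
exists (I + J)%type, tau, tau', w; split => //.
- by case=> [i|j]; [exact: d1|exact: hasD_scale (d2 j)].
- by case=> [i|j]; [exact: c1|exact: cscale (c2 j)].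
- by case.
split; apply/funext => t; apply/funext => p; first by rewrite sepf_sum mulN1r.
rewrite /sepF !sepf_gop//.
have -> : sepf tau (fun i => gop (w i)) t p = sepf s (fun i => gop (v i)) t p + -1 * sepf r (fun i => gop (v' i)) t p.
  by rewrite -sepf_sum; apply: eq_bigr => -[].
by rewrite sepf_sum; ring.
Qed.

(** The energy space is closed for the graph norm: a diagonal choice among the test functions
    approximating the approximations. *)
Lemma V_grad_limit (f g h : P -> R) : L2 mO f -> L2 mO g -> L2 mO h ->
  (forall e, 0 < e -> exists f' g' h', [/\ V_grad f' g' h', nrm mO (fun p => f' p - f p) <= e,
     nrm mO (fun p => g' p - g p) <= e & nrm mO (fun p => h' p - h p) <= e]) -> V_grad f g h.
Proof.
move=> lf lg lh H.
have L2t phi : test_function Omega phi -> [/\ L2 mO phi, L2 mO (dx phi) & L2 mO (xdy phi)].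
  by move=> [sp _ _]; split; apply: L2_cont; apply: smooth_cont; [exact: sp|exact: smooth_dx2 sp|exact: smooth_xdy sp].
have step n : exists phi, [/\ test_function Omega phi, nrm mO (fun p => phi p - f p) <= 2 / 2 ^+ n,
    nrm mO (fun p => dx phi p - g p) <= 2 / 2 ^+ n & nrm mO (fun p => xdy phi p - h p) <= 2 / 2 ^+ n].
  have e0 : 0 < 1 / 2 ^+ n :> R by rewrite divr_gt0// exprn_gt0.
  have [f' [g' [h' [[lf' lg' lh' [phi [tp p1 p2 p3]]] hf hg hh]]]] := H _ e0.
  have near (F : nat -> P -> R) k' k : (forall n, L2 mO (F n)) -> L2 mO k' -> L2 mO k ->
      L2_dist (F j) k' @[j --> \oo] --> 0%E -> nrm mO (fun p => k' p - k p) <= 1 / 2 ^+ n ->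
      \forall j \near \oo, nrm mO (fun p => F j p - k p) <= 2 / 2 ^+ n.
    move=> lF l' l /(@L2_dist_cvg nat \oo _ F k' l' (filterE _ lF)) /cvgrPdist_le /(_ _ e0) + hk; apply: filterS => j.
    rewrite sub0r normrN ger0_norm ?nrm_ge0// => hj; apply: (le_trans (nrm_triangle (lF j) l' l)).
    by rewrite (_ : 2 / 2 ^+ n = 1 / 2 ^+ n + 1 / 2 ^+ n); [exact: lerD|rewrite -mulrDl].
  have L2p k := L2t _ (tp k).
  have [k _ /(_ k (leqnn k)) [k1 [k2 k3]]] := filterI
    (near _ _ _ (fun k => let: And3 a _ _ := L2p k in a) lf' lf p1 hf)
    (filterI (near _ _ _ (fun k => let: And3 _ a _ := L2p k in a) lg' lg p2 hg)
      (near _ _ _ (fun k => let: And3 _ _ a := L2p k in a) lh' lh p3 hh)).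
  by exists (phi k).
have [phi hphi] := choice step.
have lim (F : nat -> P -> R) k : L2 mO k -> (forall n, L2 mO (F n)) ->
    (forall n, nrm mO (fun p => F n p - k p) <= 2 / 2 ^+ n) -> L2_dist (F n) k @[n --> \oo] --> 0%E.
  move=> l lF Fn; apply/(L2_dist_cvg l); first exact: filterE.
  apply/cvgrPdist_le => e e0; have [N hN] := pow2_small (C := 2) (ler0n R 2) e0.
  exists N => // n /= Nn; rewrite sub0r normrN ger0_norm ?nrm_ge0//.
  by apply: (le_trans (Fn n)); apply: le_trans hN; exact: half_pow_le.
split => //; exists phi; split; first by move=> n; have [] := hphi n.
all: by apply: lim => // n; have [/L2t[? ? ?] ? ? ?] := hphi n.
Qed.

Variable T : R.
Hypothesis T0 : 0 < T.
Local Notation mC := (@mu_cylinder R T).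
Local Notation II := (`]0, T[%classic : set R).

Lemma slice_L2 (G : space -> R) : L2 mC G -> {ae mu, forall t, II t -> L2 mO (fun p => G (t, p))}.
Proof.
move=> lG; have mG := L2_measurable lG.
have [_ _] := @cyl_fubini T (fun z => G z * G z) (L2_integrable lG lG) (measurable_funM mG mG).
move=> H; apply: negligibleS H => t; apply: contra_not => h It; apply: L2P; first exact: slice_measurable.
by have := h It; apply: eq_integrable => // p _ /=; rewrite expr2.
Qed.

(** The squared distances of the slices have summable integrals in time, hence are summable for
    almost every [t]: the whole sequence of slices converges. *)
Lemma slice_cvg (G : nat -> space -> R) (g : space -> R) (C : R) : (forall m, L2 mC (G m)) -> L2 mC g -> 0 <= C ->
  (forall m, nrm mC (fun z => G m z - g z) <= C / 2 ^+ m) ->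
  {ae mu, forall t, II t -> nrm mO (fun p => G m (t, p) - g (t, p)) @[m --> \oo] --> 0}.
Proof.
move=> lG lg C0 hC.
have mI : measurable (II : set (measurableTypeR R)) by exact: measurable_itv.
have lD m : L2 mC (fun z => G m z - g z) by exact: L2B.
have mD m := L2_measurable (lD m).
pose a m t := dot mO (fun p => G m (t, p) - g (t, p)) (fun p => G m (t, p) - g (t, p)).
have a0 m t : 0 <= a m t by exact: dot_ge0.
have fub m := @cyl_fubini T (fun z => (G m z - g z) * (G m z - g z)) (L2_integrable (lD m) (lD m)) (measurable_funM (mD m) (mD m)).
have ia m : mu.-integrable II (EFin \o a m) by have [] := fub m.
have ma m : measurable_fun II (EFin \o a m) by exact: measurable_int (ia m).
have Ea m : (\int[mu]_(t in II) (a m t)%:E = ((nrm mC (fun z => (G m z - g z))) ^+ 2)%:E)%E.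
  rewrite nrm_sqr /dot; have [_ -> _] := fub m.
  by rewrite /Rintegral fineK//; exact: integrable_fin_num (ia m).
have H : {ae mu, forall t, II t -> (\sum_(0 <= k <oo) (a k t)%:E < +oo)%E}.
  apply: (summable_ae (c := C ^+ 2) mI ma a0) => k; rewrite Ea lee_fin.
  apply: (@le_trans _ _ ((C / 2 ^+ k) ^+ 2)); first by rewrite lerXn2r ?nnegrE ?nrm_ge0// divr_ge0// exprn_ge0.
  rewrite expr_div_n ler_wpM2l ?sqr_ge0// lef_pV2 ?posrE ?exprn_gt0//.
  by rewrite expr2 ler_peMr ?exprn_ge0// exprn_ege1// ler1n.
apply: negligibleS H => t; apply: contra_not => St It; have {}St := St It.
have cs : cvgn (series (fun k => a k t)).
  apply: cvgn_bounded_variation; rewrite (eq_eseriesr (g := fun k => (a k t)%:E))//.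
  by move=> k _; rewrite seriesSB /= ger0_norm.
have h := cvg_series_cvg_0 cs.
have h2 := cvg_comp _ _ h (@sqrt_continuous R 0); rewrite sqrtr0 in h2.
exact: h2.
Qed.

End limit.

Lemma limit_combine (am a gm g hm h cm c A B1 B2 B3 p : R) : - am + (gm + hm) = cm ->
  `|am - a| <= A / p -> `|gm - g| <= B1 / p -> `|hm - h| <= B2 / p -> `|cm - c| <= B3 / p ->
  `|- a + (g + h) - c| <= (A + (B1 + B2) + B3) / p.
Proof.
move=> <- h1 h2 h3 h4; rewrite !mulrDl.
rewrite (_ : _ - c = (am - a) + (- (gm - g) - (hm - h)) + (- am + (gm + hm) - c)); last by ring.
apply: (le_trans (ler_normD _ _)); apply: lerD => //; apply: (le_trans (ler_normD _ _)); apply: lerD => //.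
by apply: (le_trans (ler_normB _ _)); rewrite normrN; apply: lerD.
Qed.

Section limit.
Variable T : R.
Hypothesis T0 : 0 < T.
Local Notation mC := (@mu_cylinder R T).
Local Notation II := (`]0, T[%classic : set R).

Lemma separated_L2 (f F : R -> P -> R) : separated f F ->
  (forall t, L2 mO (f t)) /\ L2 mC (fun z => F z.1 z.2).
Proof.
move=> [I [s [s' [v [d1 c1 s1 b1 [-> ->]]]]]]; split; first by move=> t; exact: sepf_L2.
have [l1 _] := sepf_cyl T0 d1 (fun i => smooth_gop (s1 i)).
have l2 : L2 mC (fun z => sepf s' v z.1 z.2).
  apply: (@L2_sum _ _ mC I (index_enum I) xpredT (fun i z => s' i z.1 * v i z.2)) => i _.
  have [C hC] := continuous_bound_I T (c1 i).
  have [] := @L2_tensor T T0 (s' i) (v i) `|C| (normr_ge0 C) (continuous_measurable_R (c1 i)) _ _ => //.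
    by move=> t /hC h; apply: (le_trans h); exact: ler_norm.
  exact/L2_cont/smooth_cont.
have := L2D l2 l1; congr (L2 _ _); apply/funext => z.
by rewrite /sepF sepf_gop.
Qed.

Lemma separated_facts (f F : R -> P -> R) : separated f F ->
  [/\ continuous_L2 T f, L2_V_grad T f (fun z => dx (f z.1) z.2) (fun z => xdy (f z.1) z.2),
    forall t, V_grad (f t) (dx (f t)) (xdy (f t)) &
  forall phi phix phiy, V_grad phi phix phiy -> forall theta : R -> R, test_function II theta ->
  - (\int[mu]_(t in II) (derive1 theta t * L2_dot (f t) phi)) +
  \int[mu]_(t in II) (theta t * (L2_dot (dx (f t)) phix + L2_dot (xdy (f t)) phiy)) =
  \int[mu]_(t in II) (theta t * L2_dot (F t) phi)].
Proof.
move=> [I [s [s' [v [d1 c1 s1 b1 [-> ->]]]]]]; split.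
- exact: sepf_continuous_L2 d1 s1.
- exact: (sepf_L2_V_grad T0 d1).
- exact: sepf_V.
- by move=> phi phix phiy Vphi theta tth; exact: (sepf_weak T0 d1 c1 s1 Vphi).
Qed.

Lemma energy : exists2 K : R, 0 <= K & forall f F B, separated f F -> 0 <= B ->
  (forall t, 0 <= t <= T -> nrm mO (F t) <= B) ->
  [/\ forall t, 0 <= t <= T -> nrm mO (f t) <= K * (nrm mO (f 0) + B),
      nrm mC (fun z => dx (f z.1) z.2) <= K * (nrm mO (f 0) + B) &
      nrm mC (fun z => xdy (f z.1) z.2) <= K * (nrm mO (f 0) + B)].
Proof.
have [K1 [E1 K10]] : exists K1 : R, K1 = expR T /\ 0 <= K1 by exists (expR T); rewrite expR_ge0.
have [K2 [E2 K20]] : exists K2 : R, K2 = T * (expR T + 1) + 1 /\ 0 <= K2.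
  by exists (T * (expR T + 1) + 1); rewrite addr_ge0// mulr_ge0 ?(ltW T0)// addr_ge0// expR_ge0.
pose K := 1 + K1 + K2.
exists K; first by rewrite /K addr_ge0// addr_ge0.
move=> f F B [I [s [s' [v [d1 c1 s1 b1 [-> ->]]]]]] B0 FB.
have tech (k x : R) : 0 <= k -> k <= K -> 0 <= x -> x ^+ 2 <= k * (nrm mO (sepf s v 0) ^+ 2 + B ^+ 2) ->
    x <= K * (nrm mO (sepf s v 0) + B).
  move=> k0 kK x0 h; have n0 := nrm_ge0 mO (sepf s v 0); move: (nrm _ _) n0 h => n n0 h.
  have KK : k <= K ^+ 2.
    apply: (le_trans kK); rewrite expr2 ler_peMr// /K; first by rewrite addr_ge0// addr_ge0.
    by rewrite -addrA lerDl addr_ge0.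
  have K0 : 0 <= K by rewrite /K addr_ge0// addr_ge0.
  rewrite -(@ler_pXn2r _ 2)// ?nnegrE// ?mulr_ge0 ?addr_ge0//.
  apply: (le_trans h); rewrite exprMn; apply: ler_pM => //; first by rewrite addr_ge0 ?sqr_ge0.
  have := mulr_ge0 n0 B0; nra.
have g1 := @energy_sup T I s s' v d1 c1 s1 b1 B B0 FB.
have [g2 g3] := @energy_cyl T T0 I s s' v d1 c1 s1 b1 B B0 FB.
rewrite -nrm_sqr -E2 in g2 g3; split.
- move=> t tT; apply: (tech K1) => //; first by rewrite /K addrAC lerDr addr_ge0.
    exact: nrm_ge0.
  by have := g1 t tT; rewrite -!nrm_sqr E1.
- by apply: (tech K2) => //; [rewrite /K lerDr addr_ge0|exact: nrm_ge0].
- by apply: (tech K2) => //; [rewrite /K lerDr addr_ge0|exact: nrm_ge0].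
Qed.

(** The energy estimate for successive differences gives limits uniformly in time and for both
    gradients. The source [F m] is only asymptotically of the form [1_omega u], which suffices for
    the limit equation. *)
Theorem weak_limit (omega : set P) (f0 : P -> R) (f F : nat -> R -> P -> R) (u : nat -> space -> R) (C : R) :
  measurable (omega : set plane) -> L2 mO f0 -> 0 <= C ->
  (forall m, separated (f m) (F m)) -> (forall m, L2 mC (u m)) ->
  (forall m t, 0 <= t <= T -> nrm mO (fun p => F m.+1 t p - F m t p) <= C / 2 ^+ m) ->
  (forall m, nrm mC (fun z => u m.+1 z - u m z) <= C / 2 ^+ m) ->
  (forall m, nrm mC (fun z => F m z.1 z.2 - \1_omega z.2 * u m z) <= C / 2 ^+ m) ->
  (forall m, nrm mO (fun p => f m 0 p - f0 p) <= C / 2 ^+ m) ->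
  (forall m, f m T = cst 0) ->
  exists u, L2 mC u /\ exists f, weak_solution omega T f0 u f /\ f T = cst 0 %[ae mu_Omega].
Proof.
move=> mom lf0 C0 sep lu FC uC rC f0C fT.
have [K K0 hK] := energy.
have pw m : 0 < 2 ^+ m :> R by rewrite exprn_gt0.
have l0 m t := (separated_L2 (sep m)).1 t.
have inc m : [/\ forall t, 0 <= t <= T -> nrm mO (fun p => f m.+1 t p - f m t p) <= 3 * K * C / 2 ^+ m,
      nrm mC (fun z => dx (f m.+1 z.1) z.2 - dx (f m z.1) z.2) <= 3 * K * C / 2 ^+ m &
      nrm mC (fun z => xdy (f m.+1 z.1) z.2 - xdy (f m z.1) z.2) <= 3 * K * C / 2 ^+ m].
  have h0 : nrm mO (fun p => f m.+1 0 p - f m 0 p) <= 2 * C / 2 ^+ m.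
    apply: (le_trans (nrm_triangle (l0 _ _) lf0 (l0 _ _))).
    have := f0C m.+1; have := f0C m; rewrite nrmBC => h1 h2.
    rewrite mulrDl mul1r mulrDl; apply: lerD => //; apply: (le_trans h2).
    exact: half_pow_le.
  have CC : 0 <= C / 2 ^+ m by rewrite divr_ge0 ?(ltW (pw _)).
  have [h1 h2 h3] := hK _ _ _ (separatedB (sep m.+1) (sep m)) CC (FC m).
  have hb : K * (nrm mO (fun p => f m.+1 0 p - f m 0 p) + C / 2 ^+ m) <= 3 * K * C / 2 ^+ m.
    rewrite (_ : 3 * K * C / _ = K * (2 * C / 2 ^+ m + C / 2 ^+ m)); first by rewrite ler_wpM2l// lerD2r.
    by rewrite -mulrDl mulrA; congr (_ / _); ring.
  have sm k t : smooth (f k t).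
    by have [I [s [s' [v [d1 c1 s1 b1 [-> _]]]]]] := sep k; exact: sepf_smooth.
  have dB t p : dx (fun p => f m.+1 t p - f m t p) p = dx (f m.+1 t) p - dx (f m t) p.
    by rewrite /dx (hasDE p (hasD_sub (smooth_hasD ((1, 0) : P) (sm m.+1 t)) (smooth_hasD ((1, 0) : P) (sm m t)))).
  have yB t p : xdy (fun p => f m.+1 t p - f m t p) p = xdy (f m.+1 t) p - xdy (f m t) p.
    rewrite /xdy -mulrBr; congr (_ * _).
    by rewrite (hasDE p (hasD_sub (smooth_hasD ((0, 1) : P) (sm m.+1 t)) (smooth_hasD ((0, 1) : P) (sm m t)))).
  split; [by move=> t tT; exact: le_trans (h1 t tT) hb|apply: le_trans hb; move: h2|apply: le_trans hb; move: h3].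
    by under eq_fun do rewrite dB.
  by under eq_fun do rewrite yB.
pose C' := 3 * K * C; have C'0 : 0 <= C' by rewrite !mulr_ge0.
have facts m := separated_facts (sep m).
have lG m : L2 mC (fun z => dx (f m z.1) z.2) by have [_ []] := facts m.
have lH m : L2 mC (fun z => xdy (f m z.1) z.2) by have [_ []] := facts m.
have [g [lg hg]] := L2_complete (mu_cyl_fin T0) lG C'0 (fun m => let: And3 _ a _ := inc m in a).
have [h [lh hh]] := L2_complete (mu_cyl_fin T0) lH C'0 (fun m => let: And3 _ _ a := inc m in a).
have [U [lU hU]] := L2_complete (mu_cyl_fin T0) lu C0 uC.
exists U; split => //.
(* The representatives are prescribed at the end points, [f0] at 0 and the zero function at [T];
   outside [0, T] the zero function is a filler. *)
have lim t : exists ft, [/\ L2 mO ft, 0 <= t <= T -> forall m, nrm mO (fun p => f m t p - ft p) <= (2 * C' + C) / 2 ^+ m,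
    t = 0 -> ft = f0 & t = T -> ft = cst 0].
  have [->|tn0] := eqVneq t 0.
    exists f0; split => //; last by move=> e; have := T0; rewrite -e ltxx.
    by move=> _ m; apply: (le_trans (f0C m)); rewrite ler_wpM2r ?invr_ge0 ?(ltW (pw _))// lerDr mulr_ge0.
  have [->|tnT] := eqVneq t T.
    exists (cst 0); split => //; [exact: L20| |by move=> e; have := T0; rewrite e ltxx].
    move=> _ m; rewrite fT (_ : (fun p => _) = (fun=> 0)); last by apply/funext => p; rewrite /= subrr.
    by rewrite /nrm dot0l sqrtr0 divr_ge0 ?(ltW (pw _))// addr_ge0// mulr_ge0.
  have [tT|ntT] := boolP (0 <= t <= T); last first.
    by exists (cst 0); split => //; [exact: L20|move=> e; rewrite e eqxx in tn0].
  have [ft [lft hft]] := L2_complete mu_Omega_fin (l0 ^~ t) C'0 (fun m => let: And3 a _ _ := inc m in a t tT).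
  exists ft; split => // [_ m|e|e]; last by rewrite e eqxx in tnT.
    by apply: (le_trans (hft m)); rewrite ler_wpM2r ?invr_ge0 ?(ltW (pw _))// lerDl.
  by rewrite e eqxx in tn0.
have [ft hft] := choice lim.
have lft t : L2 mO (ft t) by have [] := hft t.
have fC t m : 0 <= t <= T -> nrm mO (fun p => f m t p - ft t p) <= (2 * C' + C) / 2 ^+ m.
  by move=> tT; have [_ /(_ tT)] := hft t.
exists ft; split; last by have [_ _ _ e] := hft T; rewrite (e erefl); exact: aeW.
pose C2 := 2 * C' + C; have C20 : 0 <= C2 by rewrite addr_ge0// mulr_ge0.
have cft : continuous_L2 T ft.
  split=> [t _|t0]; first exact: lft.
  rewrite in_itv/= => t0T.
  have [_] := @L2_dist_cvg R (within `[0, T] (nbhs t0)) _ ft (ft t0) (lft t0) (filterE _ lft); apply.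
  apply/cvgrPdist_le => e e0; have e3 : 0 < e / 3 by rewrite divr_gt0.
  have [m hm] := pow2_small C20 e3.
  have [[_ cm] _ _ _] := facts m.
  have := cm t0; rewrite in_itv/= => /(_ t0T).
  move/(@L2_dist_cvg R (within `[0, T] (nbhs t0)) _ (f m) (f m t0) (l0 m t0) (filterE _ (l0 m))).
  move=> /cvgrPdist_le /(_ _ e3) hc.
  have hin : \forall t \near within `[0, T] (nbhs t0), `[0, T]%classic t by exact: withinT.
  apply: filterS2 hin hc => t; rewrite /= in_itv/= => tT.
  rewrite !sub0r !normrN !ger0_norm ?nrm_ge0// => ht.
  apply: (le_trans (nrm_triangle (lft t) (l0 m t) (lft t0))).
  apply: (@le_trans _ _ (e / 3 + (e / 3 + e / 3))); last by apply: eq_leW; field.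
  apply: lerD; first by rewrite nrmBC; exact: le_trans (fC t m tT) hm.
  apply: (le_trans (nrm_triangle (l0 m t) (l0 m t0) (lft t0))); apply: lerD => //.
  exact: le_trans (fC t0 m t0T) hm.
split => //.
  by have [_ _ e _] := hft 0; rewrite (e erefl); exact: aeW.
exists g, h; split.
  split => //.
  have sl1 := slice_cvg lG lg (mulr_ge0 (ler0n R 2) C'0) hg.
  have sl2 := slice_cvg lH lh (mulr_ge0 (ler0n R 2) C'0) hh.
  have := negligibleU (negligibleU sl1 sl2) (negligibleU (slice_L2 lg) (slice_L2 lh)).
  apply: negligibleS => t; rewrite -!setCI; apply: contra_not => -[[h1 h2] [h3 h4]].
  move=> It'; have It : 0 < t < T by move: It'; rewrite /= in_itv.
  have tT : 0 <= t <= T by case/andP: It => a b; rewrite !ltW.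
  apply: V_grad_limit => //; [exact: h3|exact: h4|].
  move=> e e0; have [k hk] := pow2_small C20 e0.
  have /cvgrPdist_le /(_ _ e0) n1 := h1 It'.
  have /cvgrPdist_le /(_ _ e0) n2 := h2 It'.
  have [m0 _ hm0] : \forall m \near \oo, nrm mO (fun p => dx (f m t) p - g (t, p)) <= e /\ nrm mO (fun p => xdy (f m t) p - h (t, p)) <= e.
    apply: filterS2 n1 n2 => m; rewrite !sub0r !normrN !ger0_norm ?nrm_ge0//.
  pose m := maxn m0 k; have [q1 q2] := hm0 m (leq_maxl m0 k).
  exists (f m t), (dx (f m t)), (xdy (f m t)); split => //.
    by have [_ _ a _] := facts m; exact: a.
  apply: le_trans (fC t m tT) _; apply: le_trans hk; exact: half_pow_le (leq_maxr _ _).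
move=> phi phix phiy Vphi theta tth; have [lphi lphix lphiy _] := Vphi; have [sth _ _] := tth.
have dth : D theta ('D_(1:R) theta) by exact: smooth_hasD.
have cth' : continuous ('D_(1:R) theta) by exact: smooth_cont (smooth_derive _ sth).
have cth := smooth_cont sth.
have [B1 B10 hB1] := continuous_bound 0 T cth'.
have [B2 B20 hB2] := continuous_bound 0 T cth.
have hB2' t : II t -> `|theta t| <= B2.
  by rewrite /= in_itv/= => /andP[a b]; apply: hB2; rewrite !ltW.
have mth := continuous_measurable_R cth.
have mI : measurable (II : set (measurableTypeR R)) by exact: measurable_itv.
have conv (k : R -> P -> R) : continuous_L2 T k -> \int[mu]_(t in II) (derive1 theta t * L2_dot (k t) phi) =
    Int 0 T (fun t => 'D_(1:R) theta t * dot mO (k (clamp T t)) phi).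
  move=> ck; rewrite -Int_oo; last by apply: cmul => //; exact: clamp_dot_cont.
  apply: eq_Rintegral => t; rewrite inE/= in_itv/= => /andP[t0 t1].
  by rewrite derive1E clamp_id ?(ltW t0) ?(ltW t1).
have conv2 (G H : space -> R) : L2 mC G -> L2 mC H ->
    \int[mu]_(t in II) (theta t * (L2_dot (fun p => G (t, p)) phix + L2_dot (fun p => H (t, p)) phiy)) =
    dot mC G (fun z => theta z.1 * phix z.2) + dot mC H (fun z => theta z.1 * phiy z.2).
  move=> lG' lH'; have [i1 <-] := cyl_dot T0 mth hB2' lG' lphix; have [i2 <-] := cyl_dot T0 mth hB2' lH' lphiy.
  by rewrite -RintegralD//; apply: eq_Rintegral => t _; rewrite mulrDr.
have conv3 (G : space -> R) : L2 mC G ->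
    \int[mu]_(t in II) (theta t * L2_dot (fun p => G (t, p)) phi) = dot mC G (fun z => theta z.1 * phi z.2).
  by move=> lG'; have [] := cyl_dot T0 mth hB2' lG' lphi.
have lT (v : P -> R) : L2 mO v -> L2 mC (fun z => theta z.1 * v z.2).
  by move=> lv; have [] := L2_tensor T0 B20 mth hB2' lv.
have L2o (v : space -> R) (lv : L2 mC v) := L2_indic mom lv.
have lF m := (separated_L2 (sep m)).2.
rewrite (conv _ cft) (conv2 _ _ lg lh) (conv3 _ (L2o _ lU).1).
pose N1 := nrm mO phi; pose Nx := nrm mC (fun z => theta z.1 * phix z.2).
pose Ny := nrm mC (fun z => theta z.1 * phiy z.2); pose N := nrm mC (fun z => theta z.1 * phi z.2).
have [N10 Nx0 Ny0 N0] : [/\ 0 <= N1, 0 <= Nx, 0 <= Ny & 0 <= N] by split; exact: nrm_ge0.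
(* The weak equation is verified up to an error of order [2 ^ - m] for every [m]; the constant
   collects the errors on [f], on the two gradients, on the source and on the control. *)
apply: (@pow2_eq (B1 * (C2 * N1) * T + (2 * C' * Nx + 2 * C' * Ny) + (C * N + 2 * C * N))).
  by rewrite !addr_ge0// !mulr_ge0// ltW.
move=> m; have [ck _ _ wk] := facts m; have := wk _ _ _ Vphi _ tth.
rewrite (conv _ ck) (conv2 _ _ (lG m) (lH m)) (conv3 _ (lF m)) => {}wk.
have ka : `|Int 0 T (fun t => 'D_(1:R) theta t * dot mO (f m (clamp T t)) phi) -
    Int 0 T (fun t => 'D_(1:R) theta t * dot mO (ft (clamp T t)) phi)| <= B1 * (C2 * N1) * T / 2 ^+ m.
  have c1 : continuous (fun t => 'D_(1:R) theta t * dot mO (f m (clamp T t)) phi).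
    by apply: cmul => //; exact: clamp_dot_cont.
  have c2 : continuous (fun t => 'D_(1:R) theta t * dot mO (ft (clamp T t)) phi).
    by apply: cmul => //; exact: clamp_dot_cont.
  rewrite -IntB// (_ : _ * T / _ = (B1 * (C2 / 2 ^+ m * N1)) * (T - 0)); last by rewrite subr0; ring.
  apply: Int_abs; [exact: ltW|exact: csub|] => t tT.
  rewrite -mulrBr normrM; apply: ler_pM => //; first exact: hB1.
  rewrite -dotBl//; apply: (le_trans (CauchySchwarz (L2B (l0 m _) (lft _)) lphi)).
  by rewrite ler_wpM2r//; apply: fC; have := clamp_itv T0 t; rewrite in_itv.
have kb (G : nat -> space -> R) (g' : space -> R) Phi : (forall m, L2 mC (G m)) -> L2 mC g' -> L2 mC Phi ->
    (forall m, nrm mC (fun z => G m z - g' z) <= 2 * C' / 2 ^+ m) ->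
    `|dot mC (G m) Phi - dot mC g' Phi| <= 2 * C' * nrm mC Phi / 2 ^+ m.
  move=> lG' lg' lP hG'; rewrite -dotBl//; apply: (le_trans (CauchySchwarz (L2B (lG' m) lg') lP)).
  by rewrite mulrAC ler_wpM2r// nrm_ge0.
have kx := kb _ _ _ lG lg (lT _ lphix) hg; have ky := kb _ _ _ lH lh (lT _ lphiy) hh.
have kc : `|dot mC (fun z => F m z.1 z.2) (fun z => theta z.1 * phi z.2) -
    dot mC (fun z => \1_omega z.2 * U z) (fun z => theta z.1 * phi z.2)| <= (C * N + 2 * C * N) / 2 ^+ m.
  have lTp := lT _ lphi; have [lo _] := L2o _ (lu m); have [loU _] := L2o _ lU.
  have [lod hod] := L2o _ (L2B (lu m) lU).
  rewrite (_ : dot mC _ _ - _ = dot mC (fun z => F m z.1 z.2 - \1_omega z.2 * u m z) (fun z => theta z.1 * phi z.2) +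
    dot mC (fun z => \1_omega z.2 * (u m z - U z)) (fun z => theta z.1 * phi z.2)); last first.
    rewrite -dotBl// -dotDl//; last exact: L2B.
    by congr (dot _ _ _); apply/funext => z; ring.
  rewrite mulrDl; apply: (le_trans (ler_normD _ _)); apply: lerD.
    by apply: (le_trans (CauchySchwarz (L2B (lF m) lo) lTp)); rewrite mulrAC ler_wpM2r.
  apply: (le_trans (CauchySchwarz lod lTp)); rewrite mulrAC ler_wpM2r//.
  exact: le_trans hod (hU m).
rewrite -/N1 -/Nx -/Ny -/N in kx ky kc.
exact: limit_combine wk ka kx ky kc.
Qed.

End limit.

(** * Decay estimates *)

Lemma csqr : continuous (fun x : R => x ^+ 2).
Proof. by move=> x; exact: exprn_continuous. Qed.

Lemma D_sqr : D (fun x : R => x ^+ 2) (fun x => 2 * x).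
Proof.
apply: hasD_ext (hasD_mul (@D_id) (@D_id)) => x; first by rewrite expr2.
by rewrite mul1r mulr1 mulrDl mul1r.
Qed.

Lemma D_gauss_half (c : R) : D (fun x => expR (c * x ^+ 2 / 2)) (fun x => c * x * expR (c * x ^+ 2 / 2)).
Proof.
apply: hasD_ext (hasD_comp (hasD_scale (c / 2) D_sqr) (@D_exp)) => x.
  by congr expR; rewrite mulrAC.
by rewrite (_ : c / 2 * x ^+ 2 = c * x ^+ 2 / 2); [field|rewrite mulrAC].
Qed.

Lemma expR_ge_id (x : R) : x <= expR x.
Proof. by apply: le_trans (expR_ge1Dx x); rewrite lerDr. Qed.

Section mode.
Variables (mu lam : R) (phi phi' : R -> R).
Hypothesis mu0 : 0 < mu.
Hypothesis dphi : D phi phi'.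
Hypothesis dphi' : D phi' (fun x => (mu ^+ 2 * x ^+ 2 - lam) * phi x).
Hypothesis (phiA : phi (-1) = 0) (phiB : phi 1 = 0).
Hypothesis phi1 : inn (-1) 1 phi phi = 1.
Let lt11 : (-1 : R) < 1. Proof. lra. Qed.
Let cphi : continuous phi. Proof. exact: D_cont dphi. Qed.
Let cphi' : continuous phi'. Proof. exact: D_cont dphi'. Qed.

(** The oscillator minus [mu] factors through [d/dx + mu x]: integrating the derivative of
    [phi * r], with [r = phi' + mu x phi], shows that [lam - mu] is the integral of [r ^ 2]. *)
Lemma ground_state : mu <= lam.
Proof.
pose r x := phi' x + mu * x * phi x.
have cr : continuous r by apply: cadd => //; apply: cmul => //; apply: cscale => x; exact: cvg_id.
have dF : D (fun x => phi x * r x) (fun x => r x * r x - (lam - mu) * (phi x * phi x)).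
  have := hasD_mul dphi (hasD_add dphi' (hasD_mul (hasD_scale mu (@D_id)) dphi)).
  by apply: hasD_ext => // x; rewrite /r; ring.
have c1 : continuous (fun x => r x * r x) by exact: cmul.
have c2 : continuous (fun x => (lam - mu) * (phi x * phi x)) by apply: cscale; exact: cmul.
have := FTC (ltW lt11) dF (csub c1 c2).
rewrite phiA phiB !mul0r subrr IntB// IntZ; last exact: cmul.
rewrite -/(inn (-1) 1 phi phi) phi1 mulr1 => /eqP; rewrite subr_eq0 => /eqP E.
by rewrite -subr_ge0 -E ip_ge0.
Qed.

Let lam0 : 0 < lam. Proof. exact: lt_le_trans mu0 ground_state. Qed.

Section weight.
Variable c : R.
Let w x := expR (c * mu * x ^+ 2 / 2).
Let g x := w x * phi x.
Let g' x := w x * (phi' x + c * mu * x * phi x).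
Let cw : continuous w. Proof. exact: D_cont (D_gauss_half (c * mu)). Qed.
Let cg : continuous g. Proof. exact: cmul. Qed.
Let cg' : continuous g'.
Proof. by apply: cmul => //; apply: cadd => //; apply: cmul => //; apply: cscale => x; exact: cvg_id. Qed.

Lemma weighted_D : D g g'.
Proof. by apply: hasD_ext (hasD_mul (D_gauss_half (c * mu)) dphi) => // x; rewrite /g' /w; ring. Qed.

(** The equation is multiplied by [w ^ 2 phi] and integrated by parts. Since [w'] equals [c mu x w],
    the weight lowers the effective potential from [mu ^ 2 x ^ 2] to [(1 - c ^ 2) mu ^ 2 x ^ 2]. *)
Lemma agmon_identity : Int (-1) 1 (fun x => g' x * g' x) =
  Int (-1) 1 (fun x => (lam - (1 - c ^+ 2) * mu ^+ 2 * x ^+ 2) * (g x * g x)).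
Proof.
have dw := D_gauss_half (c * mu).
have dF : D (fun x => g x * (w x * phi' x)) (fun x => g' x * g' x - (lam - (1 - c ^+ 2) * mu ^+ 2 * x ^+ 2) * (g x * g x)).
  have := hasD_mul weighted_D (hasD_mul dw dphi').
  by apply: hasD_ext => // x; rewrite /g' /g /w; ring.
have c1 : continuous (fun x => g' x * g' x) by exact: cmul.
have c2 : continuous (fun x : R => (lam - (1 - c ^+ 2) * mu ^+ 2 * x ^+ 2) * (g x * g x)).
  apply: cmul; last exact: cmul.
  by apply: csub; [exact: cst_continuous|exact: cscale csqr].
have := FTC (ltW lt11) dF (csub c1 c2).
by rewrite /g phiA phiB !mulr0 !mul0r subrr IntB// => /eqP; rewrite subr_eq0 => /eqP.
Qed.

Lemma weighted_sup x : -1 <= x <= 1 -> g x ^+ 2 <= 2 * Int (-1) 1 (fun x => g' x * g' x).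
Proof.
move=> /andP[x0 x1]; have := @sobolev (-1) 1 g g' (-1) x weighted_D cg' (lexx _) x0 x1.
rewrite [g (-1)](_ : _ = 0) ?subr0; last by rewrite /g phiA mulr0.
move/le_trans; apply; rewrite ler_wpM2r ?ip_ge0//; lra.
Qed.

(** Where [ep mu ^ 2 x ^ 2 >= 2 lam] the integrand on the right of [agmon_identity] is nonpositive;
    elsewhere the squared weight is at most [exp (2 lam / (ep mu))] and [phi] is normalized. *)
Lemma agmon (ep : R) : 0 < ep -> ep <= 1 - c ^+ 2 -> 0 <= c <= 1 -> forall x, -1 <= x <= 1 ->
  g x ^+ 2 <= 4 * lam * expR (2 * lam / (ep * mu)).
Proof.
move=> ep0 epc /andP[c0 c1] x xI.
pose K := expR (2 * lam / (ep * mu)).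
have em0 : 0 < ep * mu by rewrite mulr_gt0.
apply: (le_trans (weighted_sup xI)); rewrite -[4 * lam * _]/(4 * lam * K) agmon_identity.
have cc2 : continuous (fun x : R => (lam - (1 - c ^+ 2) * mu ^+ 2 * x ^+ 2) * (g x * g x)).
  apply: cmul; last exact: cmul.
  by apply: csub; [exact: cst_continuous|exact: cscale csqr].
have cp : continuous (fun x => (2 * lam * K) * (phi x * phi x)) by apply: cscale; exact: cmul.
have pt z : -1 <= z <= 1 -> (lam - (1 - c ^+ 2) * mu ^+ 2 * z ^+ 2) * (g z * g z) <= (2 * lam * K) * (phi z * phi z).
  move=> zI; have gg0 : 0 <= g z * g z by rewrite -expr2 sqr_ge0.
  have pp0 : 0 <= phi z * phi z by rewrite -expr2 sqr_ge0.
  have K0 : 0 < K by exact: expR_gt0.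
  have m2 : 0 <= mu ^+ 2 * z ^+ 2 by rewrite mulr_ge0 ?sqr_ge0.
  have s1 : (lam - (1 - c ^+ 2) * mu ^+ 2 * z ^+ 2) * (g z * g z) <= (lam - ep * (mu ^+ 2 * z ^+ 2)) * (g z * g z).
    by rewrite ler_wpM2r// lerD2l lerN2 -mulrA ler_wpM2r.
  apply: (le_trans s1).
  have [big|small] := leP (2 * lam) (ep * (mu ^+ 2 * z ^+ 2)).
    apply: (@le_trans _ _ 0); first by rewrite mulr_le0_ge0// subr_le0 (le_trans _ big)// ler_peMl ?(ltW lam0)// ler1n.
    by rewrite mulr_ge0// mulr_ge0 ?(ltW K0)// mulr_ge0 ?(ltW lam0).
  apply: (@le_trans _ _ (2 * lam * (g z * g z))).
    by rewrite ler_wpM2r//; have := mulr_ge0 (ltW ep0) m2; have := lam0; lra.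
  rewrite -!mulrA ler_wpM2l// ler_wpM2l ?(ltW lam0)// /g.
  rewrite (_ : w z * _ = (w z * w z) * (phi z * phi z)); last by ring.
  rewrite ler_wpM2r// /w -expRD ler_expR -splitr.
  apply: (@le_trans _ _ (mu * z ^+ 2)); first by rewrite ler_wpM2r ?sqr_ge0// ler_piMl// ltW.
  have E : mu * z ^+ 2 * (ep * mu) = ep * (mu ^+ 2 * z ^+ 2) by ring.
  by rewrite ler_pdivlMr// E ltW.
have := Int_le cc2 cp pt; rewrite IntZ; last exact: cmul.
rewrite -/(inn (-1) 1 phi phi) phi1 mulr1 => h.
by apply: (@le_trans _ _ (2 * (2 * lam * K))); [rewrite ler_wpM2l|lra].
Qed.

End weight.

(** For [mu >= 1 / ep ^ 2], Agmon with [c = 1 - ep]: of [4 ep lam], one [ep lam] absorbs the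
    prefactor [lam], two come from [2 lam / (ep mu)], and one restores the full Gaussian through
    [mu x ^ 2 <= lam]. For smaller [mu] the Gaussian is bounded below by [exp (- 1 / ep ^ 2)] and
    the unweighted sup bound is enough. *)
Lemma eigenfunction_decay (ep : R) : 0 < ep -> ep <= 1 -> forall x, -1 <= x <= 1 ->
  phi x ^+ 2 <= 4 / ep * expR (1 / ep ^+ 2) * expR (4 * ep * lam) * expR (- (mu * x ^+ 2)).
Proof.
move=> ep0 ep1 x xI.
have x2 : 0 <= x ^+ 2 <= 1.
  by rewrite sqr_ge0/= -(expr1n R 2) -real_normK ?num_real// lerXn2r ?nnegrE// ler_norml.
have lamexp : lam <= expR (ep * lam) / ep by rewrite ler_pdivlMr// mulrC; exact: expR_ge_id.
have E4 : 0 <= 4 / ep by rewrite divr_ge0// ltW.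
have elam : 0 <= ep * lam by rewrite mulr_ge0 ?(ltW ep0) ?(ltW lam0).
have [big|small] := leP (1 / ep ^+ 2) mu.
  have h := @agmon (1 - ep) ep ep0 _ _ x xI.
  have {}h : (expR ((1 - ep) * mu * x ^+ 2 / 2) * phi x) ^+ 2 <= 4 * lam * expR (2 * lam / (ep * mu)).
    by apply: h; [have := ep1; have := ep0; nra|lra].
  have s1 : 2 * lam / (ep * mu) <= 2 * (ep * lam).
    rewrite ler_pdivrMr ?mulr_gt0//.
    have : 1 <= ep ^+ 2 * mu by rewrite -ler_pdivrMl ?exprn_gt0// mulr1 -div1r.
    move=> h1; rewrite (_ : 2 * (ep * lam) * (ep * mu) = 2 * lam * (ep ^+ 2 * mu)); last by ring.
    by rewrite ler_peMr// mulr_ge0 ?(ltW lam0).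
  have s2 : phi x ^+ 2 <= 4 * lam * expR (2 * (ep * lam)) * expR (- ((1 - ep) * mu * x ^+ 2)).
    rewrite expRN ler_pdivlMr ?expR_gt0//; move: h; rewrite exprMn [expR _ ^+ 2]expr2 -expRD -splitr.
    rewrite mulrC => h; apply: (le_trans h); rewrite ler_wpM2l ?mulr_ge0 ?(ltW lam0)//.
    by rewrite ler_expR.
  apply: (le_trans s2).
  have s3 : expR (- ((1 - ep) * mu * x ^+ 2)) <= expR (ep * lam) * expR (- (mu * x ^+ 2)).
    rewrite -expRD ler_expR.
    have : ep * (mu * x ^+ 2) <= ep * lam.
      rewrite ler_wpM2l ?(ltW ep0)//; apply: le_trans ground_state; rewrite ler_piMr ?(ltW mu0)//; lra.
    lra.
  apply: (@le_trans _ _ (4 * (expR (ep * lam) / ep) * expR (2 * (ep * lam)) * (expR (ep * lam) * expR (- (mu * x ^+ 2))))).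
    apply: ler_pM; rewrite ?expR_ge0 ?mulr_ge0 ?expR_ge0 ?(ltW lam0)//.
    by rewrite ler_wpM2r ?expR_ge0// ler_wpM2l.
  rewrite (_ : 4 * ep * lam = ep * lam + 2 * (ep * lam) + ep * lam); last by ring.
  rewrite !expRD; set a := expR (ep * lam); set b := expR (2 * _); set d := expR (- _).
  rewrite (_ : 4 * (a / ep) * b * (a * d) = 4 / ep * 1 * (a * b * a) * d); last by field; rewrite gt_eqF.
  rewrite ler_wpM2r ?expR_ge0// ler_wpM2r ?mulr_ge0 ?expR_ge0// ler_wpM2l//.
  by rewrite -expR0 ler_expR divr_ge0// exprn_ge0// ltW.
have h := @weighted_sup 0 x xI.
have W z : expR (0 * mu * z ^+ 2 / 2) = 1 by rewrite !mul0r expR0.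
rewrite agmon_identity W mul1r in h.
have c1 : continuous (fun z : R => (lam - mu ^+ 2 * z ^+ 2) * (phi z * phi z)).
  apply: cmul; last exact: cmul.
  by apply: csub; [exact: cst_continuous|exact: cscale csqr].
have c2 : continuous (fun x => lam * (phi x * phi x)) by apply: cscale; exact: cmul.
rewrite (@eq_Int _ _ _ (fun z => (lam - mu ^+ 2 * z ^+ 2) * (phi z * phi z))) in h; last first.
  by move=> z _; rewrite W !mul1r expr0n subr0 mul1r.
have s1 : phi x ^+ 2 <= 2 * lam.
  apply: (le_trans h); rewrite ler_wpM2l//; apply: (le_trans (Int_le c1 c2 _)).
    by move=> z zI; rewrite ler_wpM2r -?expr2 ?sqr_ge0// gerBl mulr_ge0 ?sqr_ge0.
  by rewrite IntZ; [rewrite -/(inn (-1) 1 phi phi) phi1 mulr1|exact: cmul].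
apply: (le_trans s1); apply: (@le_trans _ _ (4 / ep * expR (ep * lam))).
  apply: (@le_trans _ _ (4 * (expR (ep * lam) / ep))); last by rewrite mulrA mulrAC.
  by apply: ler_pM => //; [exact: ltW|lra].
rewrite -[leRHS]mulrA -[leRHS]mulrA ler_wpM2l// -!expRD ler_expR.
have : mu * x ^+ 2 <= 1 / ep ^+ 2.
  by apply: le_trans (ltW small); rewrite ler_piMr ?(ltW mu0)//; lra.
lra.
Qed.

End mode.

(** The [k]-fold iterated integral of 1 from the flat end -1. Each step of the chain integrates
    twice, hence the factor [(2 i)!] in the denominators. *)
Definition taylor k (x : R) : R := (x + 1) ^+ k / k`!%:R.

Lemma taylor_D k : D (taylor k.+1) (taylor k).
Proof.
have hh : D (fun x : R => (x + 1) ^+ k.+1) (fun x => k.+1%:R * (x + 1) ^+ k * (1 + 0)).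
  by move=> z; have := is_derive_pow k (hasD_add (@D_id) (hasD_cst (1:R) 1) z).
have f0 : (k`!%:R : R) != 0 by rewrite pnatr_eq0 -lt0n fact_gt0.
have s0 : (k.+1%:R : R) != 0 by rewrite pnatr_eq0.
apply: hasD_ext (hasD_scale (k.+1`!%:R)^-1 hh) => x; first by rewrite mulrC.
by rewrite /taylor factS natrM addr0 mulr1 invfM mulrACA mulVf// mul1r mulrC.
Qed.

Lemma taylor_cont k : continuous (taylor k).
Proof. by case: k => [|k]; [move=> x; rewrite /taylor /=; under eq_fun do rewrite expr0; exact: cvg_cst|exact: D_cont (@taylor_D k)]. Qed.

Lemma taylor_ge0 k x : -1 <= x -> 0 <= taylor k x.
Proof. by move=> h; rewrite divr_ge0// exprn_ge0//; lra. Qed.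

Section weight.
Variables (mu lam : R).
Hypothesis (mu0 : 0 < mu) (mulam : mu <= lam).
Let lam0 : 0 < lam. Proof. exact: lt_le_trans mulam. Qed.

(** The exponential of a primitive of [rho] is a supersolution of [psi'' = (mu ^ 2 x ^ 2 - lam) psi]
    as soon as [rho' + rho ^ 2] dominates the potential in absolute value. The term [4 lam] absorbs
    [rho'], which is at least [- mu], and costs only [2 sqrt lam] in the rate. *)
Definition wkb_rate (x : R) : R := Num.sqrt (mu ^+ 2 * x ^+ 2 + 4 * lam).

Local Notation rho := wkb_rate.

Definition wkb_rate' (x : R) : R := mu ^+ 2 * x / rho x.

(** An odd phase, close to [mu x |x| / 2]: its exponential follows the decay of the eigenfunction
    for [x < 0] and the worst possible growth for [x > 0]. A chain flat at -1 is thus still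
    controlled in the middle of the interval. *)
Definition wkb_phase : R -> R := pr 0 rho.

Local Notation Q := wkb_phase.
Let arg0 x : 0 < mu ^+ 2 * x ^+ 2 + 4 * lam.
Proof. by apply: ltr_wpDl; [rewrite mulr_ge0 ?sqr_ge0|rewrite mulr_gt0]. Qed.

Lemma rho_gt0 x : 0 < rho x. Proof. by rewrite /wkb_rate sqrtr_gt0. Qed.

Lemma rho_sqr x : rho x ^+ 2 = mu ^+ 2 * x ^+ 2 + 4 * lam.
Proof. by rewrite /wkb_rate sqr_sqrtr// ltW. Qed.

Lemma rho_D : D rho wkb_rate'.
Proof.
have h := hasD_add (hasD_scale (mu ^+ 2) (@D_sqr)) (hasD_cst (1:R) (4 * lam)).
move=> x; have h1 := is_derive1_sqrt (arg0 x).
have := is_derive1_comp (f := Num.sqrt) (g := fun x => mu ^+ 2 * x ^+ 2 + 4 * lam) _ (h x).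
move=> /(_ _ h1) h2; apply: is_derive_eq h2 _.
have := rho_gt0 x; rewrite /wkb_rate' /GRing.scale/= -/(rho x) => r0; field; rewrite gt_eqF//.
Qed.

Lemma rho_cont : continuous rho. Proof. exact: D_cont rho_D. Qed.

Lemma phase_D : D Q rho. Proof. by have [] := prP 0 rho_cont. Qed.

Lemma phase0 : Q 0 = 0. Proof. by have [] := prP 0 rho_cont. Qed.

Lemma rho_ge x : mu * `|x| <= rho x.
Proof.
rewrite -(@ler_pXn2r _ 2)// ?nnegrE ?(ltW (rho_gt0 x))// ?mulr_ge0 ?(ltW mu0)//.
by rewrite exprMn real_normK ?num_real// rho_sqr lerDl mulr_ge0// ltW.
Qed.

Lemma rho_le x : rho x <= mu * `|x| + 2 * Num.sqrt lam.
Proof.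
have s0 := sqrtr_ge0 lam; have s2 : Num.sqrt lam ^+ 2 = lam by rewrite sqr_sqrtr// ltW.
have m0 : 0 <= mu * `|x| by rewrite mulr_ge0// ltW.
rewrite -(@ler_pXn2r _ 2)// ?nnegrE ?(ltW (rho_gt0 x))// ?addr_ge0 ?mulr_ge0 ?(ltW mu0)//.
rewrite rho_sqr sqrrD exprMn real_normK ?num_real// exprMn s2 -natrX.
have h : 0 <= mu * `|x| * (2 * Num.sqrt lam) by rewrite mulr_ge0// mulr_ge0.
by rewrite -addrA lerD2l lerDr mulrn_wge0.
Qed.

Lemma potential_le x : `|mu ^+ 2 * x ^+ 2 - lam| <= wkb_rate' x + rho x ^+ 2.
Proof.
have r0 := rho_gt0 x.
have : `|wkb_rate' x| <= mu.
  rewrite /wkb_rate' normrM normrM (ger0_norm (sqr_ge0 mu)) normfV (gtr0_norm r0) ler_pdivrMr//.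
  by rewrite expr2 -mulrA ler_wpM2l ?(ltW mu0)// rho_ge.
rewrite ler_norml => /andP[h _]; rewrite rho_sqr.
have m2 : 0 <= mu ^+ 2 * x ^+ 2 by rewrite mulr_ge0 ?sqr_ge0.
have := mulam; have := lam0; move: (mu ^+ 2 * x ^+ 2) m2 (wkb_rate' x) h => a a0 b h l1 l2.
rewrite ler_norml; lra.
Qed.

Lemma phase_mono x y : x <= y -> Q x <= Q y.
Proof.
move=> xy; rewrite -subr_ge0 -(FTC xy phase_D rho_cont); apply: Int_ge0 => z _; exact: ltW (rho_gt0 z).
Qed.

Let model_D : D (fun x => mu * x ^+ 2 / 2) (fun x => mu * x).
Proof.
apply: hasD_ext (hasD_scale (mu / 2) (@D_sqr)) => x; first by rewrite mulrAC.
by field.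
Qed.
Let cmx (s : R) : continuous (fun x => mu * x + 2 * Num.sqrt lam * s).
Proof. by apply: cadd; [apply: cscale => x; exact: cvg_id|exact: cst_continuous]. Qed.

Lemma phase_le x : 0 <= x -> Q x <= mu * x ^+ 2 / 2 + 2 * Num.sqrt lam * x.
Proof.
move=> x0; have d := hasD_add model_D (hasD_scale (2 * Num.sqrt lam) (@D_id)).
have := @Int_le 0 x rho (fun x => mu * x + 2 * Num.sqrt lam * 1) rho_cont (cmx (s:=1)).
rewrite (FTC x0 phase_D rho_cont) (FTC x0 d (cmx (s:=1))) phase0 expr0n/= !mulr0 mul0r addr0 !subr0; apply.
by move=> z /andP[z0 _]; have := rho_le z; rewrite ger0_norm// mulr1.
Qed.

Lemma phase_ge x : x <= 0 -> - (mu * x ^+ 2 / 2) + 2 * Num.sqrt lam * x <= Q x.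
Proof.
move=> x0; have d := hasD_sub (hasD_scale (2 * Num.sqrt lam) (@D_id)) model_D.
have cc : continuous (fun x => 2 * Num.sqrt lam * 1 - mu * x).
  by apply: csub; [exact: cst_continuous|apply: cscale => z; exact: cvg_id].
have hz z : x <= z <= 0 -> rho z <= 2 * Num.sqrt lam * 1 - mu * z.
  by move=> /andP[_ z0]; have := rho_le z; rewrite ler0_norm// mulr1 mulrN addrC.
have := Int_le rho_cont cc hz.
rewrite (FTC x0 phase_D rho_cont) (FTC x0 d cc) phase0 expr0n/= !mulr0 mul0r; lra.
Qed.

Lemma sqrt_amgm (ep : R) : 0 < ep -> 2 * Num.sqrt lam <= ep * lam + 1 / ep.
Proof.
move=> e0; have s2 : Num.sqrt lam ^+ 2 = lam by rewrite sqr_sqrtr// ltW.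
have h : 0 <= (ep * Num.sqrt lam - 1) ^+ 2 / ep by rewrite divr_ge0 ?sqr_ge0// ltW.
have E : (ep * Num.sqrt lam - 1) ^+ 2 / ep = ep * Num.sqrt lam ^+ 2 + 1 / ep - 2 * Num.sqrt lam.
  by field; rewrite gt_eqF.
by rewrite E s2 subr_ge0 in h.
Qed.

Variables (phi phi' : R -> R) (B : R).
Hypothesis dphi : D phi phi'.
Hypothesis dphi' : D phi' (fun x => (mu ^+ 2 * x ^+ 2 - lam) * phi x).
Hypothesis B0 : 0 <= B.
Hypothesis phiB : forall x, -1 <= x <= 1 -> `|phi x| <= B * expR (Q x).

Definition flat_chain (psi psi' : nat -> R -> R) : Prop :=
  [/\ psi 0%N = phi, psi' 0%N = phi', forall i, D (psi i) (psi' i),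
    forall i, D (psi' i.+1) (fun x => (mu ^+ 2 * x ^+ 2 - lam) * psi i.+1 x + psi i x) &
    forall i, psi i.+1 (-1) = 0 /\ psi' i.+1 (-1) = 0].

Lemma cpot : continuous (fun x : R => mu ^+ 2 * x ^+ 2 - lam).
Proof. by apply: csub; [exact: cscale (@csqr)|exact: cst_continuous]. Qed.

Lemma flat_chain_exists : exists psi psi', flat_chain psi psi'.
Proof.
have step (yz : (R -> R) * (R -> R)) : exists yz' : (R -> R) * (R -> R), continuous yz.1 ->
    [/\ D yz'.1 yz'.2, D yz'.2 (fun x => (mu ^+ 2 * x ^+ 2 - lam) * yz'.1 x + yz.1 x), yz'.1 (-1) = 0 & yz'.2 (-1) = 0].
  have [cy|ncy] := pselect (continuous yz.1); last by exists yz.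
  by have [y [y' h]] := ode_exists (-1) 0 0 cpot cy; exists (y, y').
have [F hF] := choice step.
pose S i := iter i F (phi, phi').
have dS i : D (S i).1 (S i).2.
  by elim: i => [//|i IH]; have [] := hF (S i) (D_cont IH).
exists (fun i => (S i).1), (fun i => (S i).2); split => // i; have [] := hF (S i) (D_cont (dS i)) => //.
Qed.

(** Comparison with [B exp (Q) taylor (2 i)]. In the second derivative of the majorant, the terms in
    [rho' + rho ^ 2] beat the potential, and the term where [taylor] is differentiated twice is the
    majorant of the previous member. *)
Lemma flat_chain_bound psi psi' : flat_chain psi psi' -> forall i x, -1 <= x <= 1 ->
  `|psi i x| <= B * expR (Q x) * taylor i.*2 x /\
  `|psi' i.+1 x| <= B * expR (Q x) * (rho x * taylor i.*2.+2 x + taylor i.*2.+1 x).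
Proof.
move=> [h0 h0' h1 h2 h3].
have lt11 : (-1 : R) < 1 by lra.
have dE : D (fun x => expR (Q x)) (fun x => expR (Q x) * rho x) by exact: hasD_comp phase_D (@D_exp).
have step i : (forall x, -1 <= x <= 1 -> `|psi i x| <= B * expR (Q x) * taylor i.*2 x) -> forall x, -1 <= x <= 1 ->
    `|psi i.+1 x| <= B * expR (Q x) * taylor i.*2.+2 x /\
    `|psi' i.+1 x| <= B * expR (Q x) * (rho x * taylor i.*2.+2 x + taylor i.*2.+1 x).
  move=> IH; set k := i.*2 in IH *.
  pose Y x := B * expR (Q x) * taylor k.+2 x.
  pose Y' x := B * expR (Q x) * (rho x * taylor k.+2 x + taylor k.+1 x).
  pose Y'' x := B * expR (Q x) * ((wkb_rate' x + rho x ^+ 2) * taylor k.+2 x + 2 * rho x * taylor k.+1 x + taylor k x).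
  have dY : D Y Y'.
    apply: hasD_ext (hasD_mul (hasD_scale B dE) (@taylor_D k.+1)) => // x; rewrite /Y'; ring.
  have dY' : D Y' Y''.
    apply: hasD_ext (hasD_mul (hasD_scale B dE) (hasD_add (hasD_mul rho_D (@taylor_D k.+1)) (@taylor_D k))) => // x.
    by rewrite /Y''; ring.
  have cwr : continuous wkb_rate'.
    have -> : wkb_rate' = (fun x => mu ^+ 2 * x * (rho x)^-1) by [].
    apply: cmul; first by apply: cscale => x; exact: cvg_id.
    by move=> x; apply: cvgV; [rewrite gt_eqF// rho_gt0|exact: rho_cont].
  have cY'' : continuous Y''.
    apply: cmul; first by apply: cscale; exact: D_cont dE.
    apply: cadd; last exact: taylor_cont; apply: cadd.
      apply: cmul; last exact: taylor_cont; apply: cadd => //.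
      by under eq_fun do rewrite expr2; apply: cmul; exact: rho_cont.
    by apply: cmul; [apply: cscale; exact: rho_cont|exact: taylor_cont].
  have BE x : 0 <= B * expR (Q x) by rewrite mulr_ge0 ?expR_ge0.
  have [p0 p0'] := h3 i.
  apply: (ode_comparison cpot (D_cont (h1 i)) (h1 i.+1) (h2 i) p0 p0' dY dY' cY'').
  - by move=> x /andP[x0 _]; rewrite mulr_ge0 ?taylor_ge0.
  - have t0 k' : 0 <= taylor k' (-1) by exact: taylor_ge0.
    by rewrite /Y' mulr_ge0// addr_ge0// mulr_ge0//; exact: ltW (rho_gt0 _).
  - move=> x xI; have /andP[x0 _] := xI; rewrite /Y /Y''.
    rewrite -addrA mulrDr; apply: lerD.
      by rewrite mulrCA ler_wpM2l// ler_wpM2r ?taylor_ge0// potential_le.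
    rewrite mulrDr; apply: le_trans (IH x xI) _; rewrite lerDr mulr_ge0// mulr_ge0 ?taylor_ge0// mulr_ge0//.
    exact: ltW (rho_gt0 _).
have main i : forall x, -1 <= x <= 1 -> `|psi i x| <= B * expR (Q x) * taylor i.*2 x.
  elim: i => [|i IH] x xI; last by have [] := step i IH x xI.
  by rewrite h0 /taylor /= expr0 fact0 divr1 mulr1; exact: phiB.
by move=> i x xI; split; [exact: main|have [] := step i (main i) x xI].
Qed.

End weight.

(** The constant is uniform over the modes. In [5 ep lam], two parts come from the square root of
    the eigenfunction decay, two from [4 sqrt lam <= 2 ep lam + 2 / ep], one from the rate in
    [psi']. In [8 ^ i], [4 ^ i] comes from [(x + 1) ^ (2 i)], and [2 ^ i] absorbs the factor [i]
    lost by differentiating [taylor]. *)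
Lemma chain_exists (a ep : R) : 0 < a -> a <= 1 -> 0 < ep -> ep <= 1 -> exists2 C, 0 <= C &
  forall mu lam phi phi', 0 < mu -> D phi phi' -> D phi' (fun x => (mu ^+ 2 * x ^+ 2 - lam) * phi x) ->
  phi (-1) = 0 -> phi 1 = 0 -> inn (-1) 1 phi phi = 1 ->
  exists psi psi', flat_chain mu lam phi phi' psi psi' /\
  forall i x, -1 <= x <= a ->
    let K := C * expR (5 * ep * lam + mu * a ^+ 2 / 2) * (8 ^+ i / (2 * i)`!%:R) in
    `|psi i x| <= K /\ ((0 < i)%N -> `|psi' i x| <= K).
Proof.
move=> a0 a1 ep0 ep1.
pose b := Num.sqrt (4 / ep * expR (1 / ep ^+ 2)).
have b0 : 0 <= b by exact: sqrtr_ge0.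
have i0 : 0 < ep^-1 by rewrite invr_gt0.
exists (b * expR (2 / ep) * (3 / ep)); first by rewrite !mulr_ge0 ?expR_ge0// ltW.
move=> mu lam phi phi' mu0 d1 d2 pA pB p1.
have ml := ground_state d1 d2 pA pB p1.
have lam0 : 0 < lam by exact: lt_le_trans ml.
have el0 : 0 <= ep * lam by rewrite mulr_ge0 ?ltW.
pose s := Num.sqrt lam; have s0 : 0 <= s by exact: sqrtr_ge0.
pose B := b * expR (2 * ep * lam) * expR (2 * s).
have B0 : 0 <= B by rewrite !mulr_ge0 ?expR_ge0.
have phiB x : -1 <= x <= 1 -> `|phi x| <= B * expR (wkb_phase mu lam x).
  move=> xI; have h := eigenfunction_decay mu0 d1 d2 pA pB p1 ep0 ep1 xI.
  have {}h : `|phi x| <= b * expR (2 * ep * lam) * expR (- (mu * x ^+ 2 / 2)).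
    apply: sqr_le_norm; first by rewrite !mulr_ge0 ?expR_ge0.
    apply: (le_trans h); rewrite !exprMn sqr_sqrtr ?mulr_ge0 ?expR_ge0 ?(ltW i0)//.
    rewrite !expr2 -!expRD -!mulrDl.
    rewrite (_ : (2 + 2) * ep * lam = 4 * ep * lam); last by rewrite -natrD.
    by rewrite -opprD -splitr.
  apply: (le_trans h); rewrite /B -[leRHS]mulrA ler_wpM2l ?mulr_ge0 ?expR_ge0// -expRD ler_expR.
  have [x0|x0] := leP x 0.
    have := phase_ge mu0 ml x0; rewrite -/s; have : - s <= s * x by rewrite -mulrN1 ler_wpM2l//; lra.
    lra.
  have := phase_mono mu0 ml (ltW x0); rewrite phase0//.
  have : 0 <= mu * x ^+ 2 by rewrite mulr_ge0 ?sqr_ge0 ?ltW.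
  lra.
have [psi [psi' hc]] := @flat_chain_exists mu lam phi phi' d1.
exists psi, psi'; split => // i x /andP[x0 xa] K.
have xI : -1 <= x <= 1 by rewrite x0 (le_trans xa).
have hb := flat_chain_bound mu0 ml B0 phiB hc.
have two k : (taylor k x) <= 2 ^+ k / k`!%:R.
  rewrite /taylor ler_wpM2r// lerXn2r ?nnegrE//; lra.
have f0 k : 0 <= 2 ^+ k / k`!%:R :> R by rewrite divr_ge0 ?exprn_ge0.
have BQ : B * expR (wkb_phase mu lam x) <= b * expR (2 / ep) * expR (4 * ep * lam + mu * a ^+ 2 / 2).
  rewrite /B -!mulrA ler_wpM2l// -!expRD ler_expR.
  have h1 : wkb_phase mu lam x <= mu * a ^+ 2 / 2 + 2 * s.
    apply: (le_trans (phase_mono mu0 ml xa)); apply: (le_trans (phase_le mu0 ml (ltW a0))).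
    by rewrite lerD2l ler_piMr// mulr_ge0.
  have h2 := sqrt_amgm mu0 ml ep0; rewrite -/s in h2.
  rewrite (_ : 2 / ep = 1 / ep + 1 / ep); last by rewrite -mulrDl.
  lra.
have E4 : expR (5 * ep * lam + mu * a ^+ 2 / 2) = expR (ep * lam) * expR (4 * ep * lam + mu * a ^+ 2 / 2).
  by rewrite -expRD; congr expR; ring.
set X := expR (4 * ep * lam + mu * a ^+ 2 / 2) in BQ E4.
have X0 : 0 <= X by exact: expR_ge0.
set G := b * expR (2 / ep) in BQ K *.
have G0 : 0 <= G by rewrite mulr_ge0 ?expR_ge0.
have e1 : 1 <= expR (ep * lam) by rewrite -[leLHS]expR0 ler_expR.
have q1 : 1 <= ep^-1 by rewrite -[leLHS]invr1 lef_pV2 ?posrE.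
have F2 : 0 <= (2 * i)`!%:R^-1 :> R by rewrite invr_ge0.
have p2 : 1 <= 2 ^+ i :> R by rewrite exprn_ege1// ler1n.
have e84 : 8 ^+ i = 4 ^+ i * 2 ^+ i :> R by rewrite -exprMn -natrM.
have e42 : 2 ^+ i.*2 = 4 ^+ i :> R by rewrite -mul2n exprM -natrX.
have p4 : 0 <= 4 ^+ i :> R by rewrite exprn_ge0.
have KE : K = G * X * ((3 * expR (ep * lam) / ep) * (4 ^+ i * 2 ^+ i) / (2 * i)`!%:R).
  by rewrite /K E4 e84; ring.
rewrite KE; split.
  apply: (le_trans (hb i x xI).1); apply: ler_pM; [by rewrite mulr_ge0 ?expR_ge0|exact: taylor_ge0|exact: BQ|].
  apply: (le_trans (two _)); rewrite e42 -mul2n ler_wpM2r//.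
  rewrite mulrCA ler_peMr// -[leLHS]mulr1; apply: ler_pM => //.
  by rewrite -[leLHS]mulr1; apply: ler_pM => //; lra.
case: i K F2 p2 e84 e42 p4 KE => // i K F2 p2 e84 e42 p4 KE _.
apply: (le_trans (hb i x xI).2).
pose w := 4 ^+ i.+1 / (2 * i.+1)`!%:R : R.
have w0 : 0 <= w by rewrite mulr_ge0.
have W2 : taylor i.*2.+2 x <= w.
  by apply: (le_trans (two _)); rewrite /w -e42 mul2n doubleS.
have W1 : taylor i.*2.+1 x <= i.+1%:R * w.
  apply: (le_trans (two _)); rewrite /w -e42 mul2n doubleS.
  have n1 : (i.*2.+1`!%:R : R) != 0 by rewrite pnatr_eq0 -lt0n fact_gt0.
  have n2 : (i.+1%:R : R) != 0 by rewrite pnatr_eq0.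
  rewrite [i.*2.+2`!]factS natrM [2 ^+ i.*2.+2]exprS (_ : i.*2.+2%:R = 2 * i.+1%:R :> R); last by rewrite -natrM mul2n doubleS.
  rewrite invfM [(2 * i.+1%:R)^-1]invfM (_ : i.+1%:R * _ = (2 * 2^-1) * (i.+1%:R * i.+1%:R^-1) * (2 ^+ i.*2.+1 / i.*2.+1`!%:R)); last by ring.
  by rewrite !divff// !mul1r.
set e := expR (ep * lam) in e1 E4 KE.
have rx : wkb_rate mu lam x <= 2 * e / ep.
  apply: (le_trans (rho_le mu0 ml x)); rewrite -/s.
  have h1 : mu * `|x| <= lam.
    by apply: le_trans ml; rewrite ler_piMr ?(ltW mu0)// ler_norml.
  have h2 := sqrt_amgm mu0 ml ep0; rewrite -/s in h2.
  have h3 : ep * lam + 1 <= e by rewrite addrC; exact: expR_ge1Dx.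
  have h4 : 2 * (ep * lam + 1) / ep <= 2 * e / ep by rewrite ler_wpM2r ?(ltW i0)// ler_wpM2l.
  have h5 : 2 * (ep * lam + 1) / ep = 2 * lam + 2 / ep by field; rewrite gt_eqF.
  have h6 : ep * lam <= lam by rewrite ler_piMl// ltW.
  move: h2 h4; rewrite h5 div1r; move: (2 * e / ep) i0 => z i0; lra.
have e0 : 0 <= e / ep by rewrite mulr_ge0 ?expR_ge0 ?ltW.
have en : 1 <= e / ep by rewrite -[leLHS]mulr1; apply: ler_pM.
have ni : i.+1%:R <= 2 ^+ i.+1 :> R by rewrite -natrX ler_nat ltnW// ltn_expl.
rewrite -/e; apply: ler_pM => //; first by rewrite mulr_ge0 ?expR_ge0.
  by rewrite addr_ge0 ?taylor_ge0// mulr_ge0 ?taylor_ge0//; exact: ltW (rho_gt0 mu0 ml _).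
apply: (@le_trans _ _ (2 * e / ep * w + 2 ^+ i.+1 * w)).
  apply: lerD; last by apply: (le_trans W1); rewrite ler_wpM2r.
  apply: ler_pM => //; [exact: ltW (rho_gt0 mu0 ml _)|exact: taylor_ge0].
rewrite (_ : 3 * e / ep * _ / _ = (2 * (e / ep) * 2 ^+ i.+1) * w + (e / ep * 2 ^+ i.+1) * w); last by rewrite /w; ring.
apply: lerD; rewrite ler_wpM2r// ?ler_peMl ?exprn_ge0//.
by rewrite -mulrA ler_peMr// mulr_ge0.
Qed.

(** * Cutoffs across the control region *)

Section cut.
Local Notation P := (R * R)%type.

(* Continuous induction on [0, b]: a smooth function between lo and hi on [0, t]
   is glued to a constant on a neighbourhood of the supremum of such t. *)
Lemma smooth_between (lo hi : R -> R) (b : R) : 0 <= b -> continuous lo -> continuous hi ->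
  (forall y, 0 <= y <= b -> lo y < hi y) ->
  exists p : R -> R, smooth p /\ forall y, 0 <= y <= b -> lo y < p y < hi y.
Proof.
move=> b0 clo chi lohi.
pose E := [set t | 0 <= t <= b /\ exists p : R -> R, smooth p /\ forall y, 0 <= y <= t -> lo y < p y < hi y].
have E0 : E 0.
  split; first by rewrite lexx.
  exists (fun=> (lo 0 + hi 0) / 2); split; first exact: smooth_cst.
  move=> y /le_anti <-; have := lohi 0; rewrite lexx b0 => /(_ isT) h; lra.
have uE : ubound E b by move=> t [/andP[_ ->]].
have nE : E !=set0 by exists 0.
have hE : has_sup E by split => //; exists b.
pose s := sup E.
have s0 : 0 <= s by apply: ub_le_sup => //; exists b.
have sb : s <= b by exact: ge_sup.
have [S [S' [sS _ S0 S1 [S01 _]]]] := @smooth_step.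
pose c := (lo s + hi s) / 2.
have [c1 c2] : lo s < c /\ c < hi s by have := lohi s; rewrite s0 sb => /(_ isT) h; split; rewrite /c; lra.
have n1 : nbhs s (fun y => lo y < c) by apply: (clo s (fun z => z < c)); exact: lt_nbhsl.
have n2 : nbhs s (fun y => c < hi y) by apply: (chi s (fun z => c < z)); exact: lt_nbhsr.
have n12 : nbhs s (fun y => lo y < c /\ c < hi y) by exact: filterI n1 n2.
move/nbhs_normP : (n12) => [d /= d0 hd].
have near_c y : `|y - s| < d -> lo y < c < hi y.
  by move=> h; have := hd y; rewrite /= distrC => /(_ h) [-> ->].
have [t [/andP[t0 tb] [p [sp hp]]] ts] : exists2 t, E t & s - d < t by exact: sup_adherent.
have tsup : t <= s by apply: ub_le_sup => //; [exists b|split; [rewrite t0|exists p]].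
pose r := (s - d + t) / 2.
have rt : 0 < t - r by rewrite /r; lra.
pose sig y := S (1 + (y - r) / (t - r)).
have ssig : smooth sig.
  apply: (smooth_comp (f := fun y : R => 1 + (y - r) / (t - r)) _ sS).
  apply: smoothD; first exact: smooth_cst.
  apply: (smoothM (f := fun y => y - r)); last exact: smooth_cst.
  by apply: smoothB; [exact: smooth_id|exact: smooth_cst].
pose q y := p y + (c - p y) * sig y.
have sq : smooth q.
  exact: (smoothD sp (smoothM (smoothB (smooth_cst c) sp) ssig)).
have hq y : 0 <= y -> y < s + d -> lo y < q y < hi y.
  move=> y0 yd; have [yr|ry] := leP y r.
    have sg0 : sig y = 0 by apply: S0; rewrite gerDl ler_pdivrMr// mul0r subr_le0.
    by rewrite /q sg0 mulr0 addr0; apply: hp; rewrite y0 (le_trans yr)//; lra.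
  have yc : lo y < c < hi y by apply: near_c; rewrite ltr_norml; apply/andP; split; move: ry; rewrite /r; lra.
  have [yt|ty] := leP t y.
    have sg1 : sig y = 1 by apply: S1; rewrite (_ : 2 = 1 + 1)// lerD2l ler_pdivlMr// mul1r lerD2r.
    by rewrite /q sg1 mulr1 addrC subrK.
  have := hp y; rewrite y0 (ltW ty) => /(_ isT) /andP[p1 p2].
  have /andP[g0 g1] := S01 (1 + (y - r) / (t - r)); rewrite -/(sig y) in g0 g1.
  have /andP[q1 q2] := yc; rewrite /q (_ : _ + _ = (1 - sig y) * p y + sig y * c); last by ring.
  move: (sig y) g0 g1 => g g0 g1.
  have [->|g00] := eqVneq g 0; first by rewrite subr0 mul1r mul0r addr0 p1.
  have gp : 0 < g by rewrite lt_neqAle eq_sym g00.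
  have g1' : 0 <= 1 - g by rewrite subr_ge0.
  have h1 : (1 - g) * lo y <= (1 - g) * p y by rewrite ler_wpM2l// ltW.
  have h2 : (1 - g) * p y <= (1 - g) * hi y by rewrite ler_wpM2l// ltW.
  have h3 : g * lo y < g * c by rewrite ltr_pM2l.
  have h4 : g * c < g * hi y by rewrite ltr_pM2l.
  lra.
have [bs|sb'] := leP b s.
  exists q; split => // y /andP[y0 yb]; apply: hq => //; lra.
pose v := Num.min b (s + d / 2).
have Ev : E v.
  split; first by rewrite le_min b0 addr_ge0 ?divr_ge0 ?(ltW d0)//= ge_min lexx.
  exists q; split => // y /andP[y0]; rewrite le_min => /andP[yb ys]; apply: hq => //; lra.
have : v <= s by apply: ub_le_sup => //; exists b.
rewrite /v ge_min leNgt sb' /= => h.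
by exfalso; lra.
Qed.

Lemma derive_locally_cst (O : set P) (f : P -> R) (c : R) v : open O -> (forall q, O q -> f q = c) ->
  forall q, O q -> 'D_v f q = 0.
Proof.
move=> oO hO q Oq; rewrite (near_eq_derive (g := fun=> c)) ?derive_cst//.
by apply: filterS (open_nbhs_nbhs (conj oO Oq)) => z /hO.
Qed.

Variables (g1 g2 : R -> R).
Hypothesis g1_cont : {within `[0, pi], continuous g1}.
Hypothesis g2_cont : {within `[0, pi], continuous g2}.
Hypothesis g1_range : forall y, y \in `[0, pi] -> -1 < g1 y < 1.
Hypothesis g2_range : forall y, y \in `[0, pi] -> -1 < g2 y < 1.
Hypothesis g12 : forall y, y \in `[0, pi] -> g1 y < g2 y.
Local Notation om := ([set p : P | Omega p /\ g1 p.2 < p.1 < g2 p.2]).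
Let a : R := Num.max (sup (g2^\- @` `[0, pi])) (sup (g1^\+ @` `[0, pi])).

(** [a] bounds [g1] from above and [- g2], so any [b] beyond [a] lets every horizontal section of
    the region meet (-b, b). The choice is midway between [a] and [sqrt (2 T)], capped by 1. *)
Lemma corridor (T : R) : 0 < T -> a ^+ 2 / 2 < T -> exists b : R,
  [/\ 0 < b, b <= 1, b ^+ 2 / 2 < T & forall y, 0 <= y <= pi -> g1 y < b /\ - b < g2 y].
Proof.
move=> T0 aT; have /andP[a0 a1] := width_range g1_range g2_range; rewrite -/a in a0 a1.
pose r := Num.sqrt (2 * T).
have r0 : 0 < r by rewrite sqrtr_gt0 mulr_gt0.
have r2 : r ^+ 2 = 2 * T by rewrite sqr_sqrtr// mulr_ge0// ltW.
have ar : a < r by rewrite -(ltr_pXn2r (n := 2)) ?nnegrE ?(ltW r0)// r2; lra.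
pose e := (a + r) / 2.
have e0 : 0 < e by rewrite /e; lra.
have er : e < r by rewrite /e; lra.
have ae : a < e by rewrite /e; lra.
have up (g : R -> R) y : (forall y, y \in `[0, pi] -> 0 <= g y <= 1) -> 0 <= y <= pi -> g y <= sup (g @` `[0, pi]).
  move=> h yI; apply: ub_le_sup; last by exists y => //=; rewrite in_itv.
  by exists 1 => _ [z zI <-]; have /andP[] := h z zI.
exists (Num.min 1 e); split.
- by rewrite lt_min ltr01.
- by rewrite ge_min lexx.
- have h : Num.min 1 e <= e by rewrite ge_min lexx orbT.
  have h0 : 0 <= Num.min 1 e by rewrite le_min ler01 ltW.
  have : (Num.min 1 e) ^+ 2 < r ^+ 2 by rewrite ltrXn2r// (le_lt_trans h).
  rewrite r2; lra.
move=> y yI; have yI' : y \in `[0, pi] by rewrite in_itv.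
have /andP[u1 u2] := g1_range yI'; have /andP[v1 v2] := g2_range yI'.
have k1 : g1 y <= a.
  apply: (@le_trans _ _ (g1^\+ y)); first by rewrite /funrpos le_max lexx.
  by rewrite /a le_max (up _ _ (fun y yy => (part_range (g1_range yy)).2) yI) orbT.
have k2 : - g2 y <= a.
  apply: (@le_trans _ _ (g2^\- y)); first by rewrite /funrneg le_max lexx.
  by rewrite /a le_max (up _ _ (fun y yy => (part_range (g2_range yy)).1) yI).
split; first by rewrite lt_min u2 (le_lt_trans k1).
by rewrite ltrNl lt_min (le_lt_trans k2 ae) andbT; lra.
Qed.

(** A smooth curve is drawn inside both the control region and the corridor, with a margin [e] on
    each side; [th] falls from 1 to 0 within that margin and is locally constant elsewhere. *)
Lemma separating_cutoff (b : R) : 0 < b -> b <= 1 ->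
  (forall y, 0 <= y <= pi -> g1 y < b /\ - b < g2 y) ->
  exists th : P -> R, [/\ smooth th, forall p, 0 <= th p <= 1,
    forall y, 0 <= y <= pi -> th (-1, y) = 1 /\ th (1, y) = 0,
    forall p, Omega p -> (th p != 0 -> p.1 <= b) /\ (th p != 1 -> - b <= p.1) &
    forall p, Omega p -> (om p /\ -b <= p.1 <= b) \/
      [/\ dx th p = 0, 'D_((0, 1) : P) th p = 0, dx (dx th) p = 0 & 'D_((0, 1) : P) ('D_((0, 1) : P) th) p = 0]].
Proof.
move=> b0 b1 hb; have p0 := pi_gt0 R.
pose lo y := Num.max (g1 (clamp pi y)) (- b); pose hi y := Num.min (g2 (clamp pi y)) b.
have clo : continuous lo.
  move=> y; apply: (@continuous_max _ R (fun y => g1 (clamp pi y)) (cst (- b))); last exact: cvg_cst.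
  exact: clamp_within.
have chi : continuous hi.
  move=> y; apply: (@continuous_min _ R (fun y => g2 (clamp pi y)) (cst b)); last exact: cvg_cst.
  exact: clamp_within.
have lohi y : 0 <= y <= pi -> lo y < hi y.
  move=> yI; have [h1 h2] := hb y yI; rewrite /lo /hi clamp_id// gt_max !lt_min h1 h2 !andbT.
  by rewrite g12 ?in_itv//=; lra.
have cd : {within `[0, pi], continuous (fun y => hi y - lo y)} by apply: continuous_subspaceT; exact: csub.
have [z zI hz] := EVT_min (ltW p0) cd.
(* A quarter of the smallest gap leaves a nonempty room for the curve once [e] is removed on both
   sides. *)
pose e := (hi z - lo z) / 4.
have e0 : 0 < e by rewrite divr_gt0// subr_gt0 lohi//; move: zI; rewrite in_itv.
have sep y : 0 <= y <= pi -> lo y + e < hi y - e.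
  move=> yI; have := hz y; rewrite in_itv/= => /(_ yI); have : 4 * e = hi z - lo z by rewrite /e; field.
  move: (hi y) (lo y) (hi z) (lo z) => h l h' l'; lra.
have [p [sp hp]] := smooth_between (ltW p0) (cadd clo (@cst_continuous R R e)) (csub chi (@cst_continuous R R e)) sep.
have [S [S' [sS _ S0 S1 [S01 _]]]] := @smooth_step.
have e2 : 0 < 2 * e by rewrite mulr_gt0.
(* Affine rescaling of the distance to the curve, sending [-e, e] onto the transition interval
   [1, 2] of the step [S]. *)
pose arg (q : P) := 3 / 2 + (q.1 - p q.2) / (2 * e).
pose th q := 1 - S (arg q).
have spd : smooth (fun q : P => q.1 - p q.2).
  by apply: smoothB; [exact: smooth_fst|exact: (smooth_comp smooth_snd sp)].
have sarg : smooth arg.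
  apply: smoothD; first exact: smooth_cst.
  exact: (smoothM (f := fun q : P => q.1 - p q.2) spd (smooth_cst _)).
have sth : smooth th by apply: smoothB; [exact: smooth_cst|exact: (smooth_comp sarg sS)].
have thl q : q.1 - p q.2 <= - e -> th q = 1.
  move=> h; rewrite /th S0 ?subr0// /arg.
  have : (q.1 - p q.2) / (2 * e) <= - e / (2 * e) by rewrite ler_wpM2r// invr_ge0 ltW.
  rewrite (_ : - e / (2 * e) = - (1 / 2)); [lra|field; rewrite gt_eqF//].
have thr q : e <= q.1 - p q.2 -> th q = 0.
  move=> h; rewrite /th S1 ?subrr// /arg.
  have : e / (2 * e) <= (q.1 - p q.2) / (2 * e) by rewrite ler_wpM2r// invr_ge0 ltW.
  rewrite (_ : e / (2 * e) = 1 / 2); [lra|field; rewrite gt_eqF//].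
have lob y : - b <= lo y by rewrite /lo le_max lexx orbT.
have hib y : hi y <= b by rewrite /hi ge_min lexx orbT.
exists th; split => //.
- by move=> q; have /andP[s0 s1] := S01 (arg q); rewrite /th subr_ge0 s1 gerBl.
- move=> y yI; have /andP[h1 h2] := hp y yI; have := lob y; have := hib y; split; [apply: thl => /=; lra|apply: thr => /=; lra].
- move=> q /Omega_itv[_ yI]; have /andP[h1 h2] := hp _ yI; have k1 := lob q.2; have k2 := hib q.2; split.
    by apply: contra_neqT; rewrite -ltNge => h; apply: thr; lra.
  by apply: contra_neqT; rewrite -ltNge => h; apply: thl; lra.
move=> q Oq; have [_ yI] := Omega_itv Oq; have /andP[h1 h2] := hp _ yI; have k1 := lob q.2; have k2 := hib q.2.
have loc (O : set P) c : open O -> (forall q, O q -> th q = c) -> O q ->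
    [/\ dx th q = 0, 'D_((0, 1) : P) th q = 0, dx (dx th) q = 0 & 'D_((0, 1) : P) ('D_((0, 1) : P) th) q = 0].
  move=> oO hO Oq'; have h v := derive_locally_cst v oO hO.
  split; [exact: h|exact: h|apply: (derive_locally_cst _ oO) Oq'; exact: h|apply: (derive_locally_cst _ oO) Oq'; exact: h].
have csp := smooth_cont spd.
have [xl|xl] := ltP (q.1 - p q.2) (- e).
  right; apply: (loc [set q : P | q.1 - p q.2 < - e] 1) => //; last by move=> z' /= /ltW; exact: thl.
  by apply: (@open_comp _ _ (fun q : P => q.1 - p q.2) [set x | x < - e]); [move=> ? _; exact: csp|exact: open_lt].
have [xr|xr] := ltP e (q.1 - p q.2).
  right; apply: (loc [set q : P | e < q.1 - p q.2] 0) => //; last by move=> z' /= /ltW; exact: thr.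
  by apply: (@open_comp _ _ (fun q : P => q.1 - p q.2) [set x | e < x]); [move=> ? _; exact: csp|exact: open_gt].
left; split; last by lra.
split => //; have l1 : g1 q.2 <= lo q.2 by rewrite /lo clamp_id// le_max lexx.
have l2 : hi q.2 <= g2 q.2 by rewrite /hi clamp_id// ge_min lexx.
lra.
Qed.

End cut.

(** * Completeness of the modes *)

Lemma dot_lim0 (g f : P -> R) (F : nat -> P -> R) (C : R) : L2 mO g ->
  (forall n, L2 mO (F n)) -> L2 mO f -> (forall n p, Omega p -> `|F n p - f p| <= C) ->
  (forall p, Omega p -> F n p @[n --> \oo] --> f p) -> (forall n, dot mO (F n) g = 0) -> dot mO f g = 0.
Proof.
move=> lg lF lf FC Ff F0.
have h := dominated_nrm (fun n => L2_measurable (lF n)) (L2_measurable lf) FC Ff.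
have h2 : dot mO (F n) g @[n --> \oo] --> dot mO f g by exact: dot_cvg.
rewrite (_ : (fun n => dot mO (F n) g) = (fun=> 0)) in h2; last by apply/funext.
by have := cvg_lim (@Rhausdorff R) h2; rewrite lim_cst// => <-.
Qed.

Lemma sum_eq_nat n k0 : \sum_(k < n) ((k == k0 :> nat)%:R : R) = (k0 < n)%:R.
Proof.
elim: n => [|n IH]; first by rewrite big_ord0.
by rewrite big_ord_recr/= IH ltnS; case: ltngtP => _; rewrite ?add0r ?addr0.
Qed.

(** The sets whose indicator, composed with [c] and multiplied by [h], is orthogonal to [g] form a
    Dynkin system; disjoint unions are handled by dominated convergence of the partial sums. *)
Lemma dynkin_dot d (U : measurableType d) (G : set (set U)) (c : plane -> U) (h g : P -> R) :
  measurable_fun setT c -> measurable_fun setT (h : plane -> R) -> bounded_on_Omega h -> L2 mO g ->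
  @measurable _ U = <<s G >> -> setI_closed G -> dot mO h g = 0 ->
  (forall A, G A -> dot mO (fun p => \1_A (c p) * h p) g = 0) ->
  forall A, measurable A -> dot mO (fun p => \1_A (c p) * h p) g = 0.
Proof.
move=> mc mh [C hC] lg mG iG hT hG A mA.
have li B : measurable B -> L2 mO (fun p => \1_B (c p) * h p).
  move=> mB; apply: L2_Omega.
    by apply: measurable_funM => //; apply: (measurableT_comp _ mc); exact: measurable_indic.
  exists C => p Op; rewrite normrM; apply: le_trans (hC p Op).
  by rewrite ler_piMl// indicE; case: (_ \in _); rewrite ?normr1 ?normr0.
have lh : L2 mO h by apply: L2_Omega => //; exists C.
move: (mA); rewrite [X in X A](_ : _ = <<s G >>)//.
apply: (@dynkin_induction _ U G (fun B => dot mO (fun p => \1_B (c p) * h p) g = 0)) => //.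
- by rewrite -hT; congr (dot _ _ _); apply/funext => p; rewrite indicT mul1r.
- move=> B mB hB; rewrite (_ : (fun p => _) = (fun p => h p - \1_B (c p) * h p)).
    by rewrite dotBl// ?hT ?hB ?subrr//; exact: li.
  apply/funext => p; rewrite !indicE in_setC; case: (_ \in _) => /=; rewrite ?mul0r ?mul1r ?subrr ?subr0//.
- move=> F mF tF hF.
  apply: (@dot_lim0 g _ (fun n p => \sum_(k < n) \1_(F k) (c p) * h p) (2 * C)) => //.
  + move=> n; apply: (@L2_sum _ _ mO 'I_n (index_enum _) xpredT (fun k p => \1_(F k) (c p) * h p)) => k _; exact: li.
  + by apply: li; exact: bigcup_measurable.
  + move=> n p Op; have hp := hC p Op; have C0 := le_trans (normr_ge0 _) hp.
    apply: (le_trans (ler_normB _ _)); rewrite mulrDl mul1r; apply: lerD; last first.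
      rewrite normrM; apply: le_trans hp; rewrite ler_piMl// indicE; case: (_ \in _); rewrite ?normr1 ?normr0//.
    rewrite -mulr_suml normrM; apply: le_trans hp; rewrite ler_piMl//.
    have [[k0 _ Fk]|nF] := pselect ((\bigcup_k F k) (c p)).
      rewrite (eq_bigr (fun k : 'I_n => ((k == k0 :> nat)%:R : R))); last first.
        move=> k _; rewrite indicE; congr (_%:R); congr nat_of_bool; apply/idP/eqP; last by move=> ->; rewrite inE.
        rewrite inE => Fk'; apply: (tF _ _ I I); by exists (c p).
      by rewrite sum_eq_nat; case: (_ < _)%N; rewrite ?normr1 ?normr0.
    rewrite big1 ?normr0// => k _; rewrite indicE memNset// => Fk; apply: nF; by exists k.
  + move=> p Op; have [[k0 _ Fk]|nF] := pselect ((\bigcup_k F k) (c p)).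
      apply: cvg_near_cst; exists k0.+1 => // n /= kn; rewrite -mulr_suml indicE mem_set; last by exists k0.
      congr (_ * _); rewrite (eq_bigr (fun k : 'I_n => ((k == k0 :> nat)%:R : R))) ?sum_eq_nat ?kn//.
      move=> k _; rewrite indicE; congr (_%:R); congr nat_of_bool; apply/idP/eqP; last by move=> ->; rewrite inE.
      rewrite inE => Fk'; apply: (tF _ _ I I); by exists (c p).
    apply: cvg_near_cst; apply: nearW => n; rewrite -mulr_suml indicE memNset// mul0r big1 ?mul0r// => k _.
    rewrite indicE memNset// => Fk; apply: nF; by exists k.
  move=> n; rewrite (@dot_suml _ _ mO 'I_n (index_enum _) xpredT (fun k p => \1_(F k) (c p) * h p))//.
    by apply: big1 => k _; exact: hF.
  by move=> k _; exact: li.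
Qed.

Definition nice (lo hi : R) (a : R -> R) : Prop :=
  smooth a /\ exists2 d, 0 < d & forall x, a x != 0 -> lo + d <= x <= hi - d.

(** The ramp [V c n] vanishes for [x <= c] and tends to 1 for [x > c], so the limit is exactly the
    indicator of the half-open interval, a generator of the Borel sets. *)
Lemma nice_step (lo hi al be : R) : lo < hi -> exists E : nat -> R -> R,
  [/\ forall n, nice lo hi (E n), forall n x, 0 <= E n x <= 1 &
    forall x, lo < x < hi -> E n x @[n --> \oo] --> (\1_(`]al, be]%classic : set R) x : R)].
Proof.
move=> lohi; have [K [K' [sK _ K01 suppK [K1 _]]]] := interval_cutoff lohi.
have [S [S' [sS _ S0 S1 [S01 _]]]] := @smooth_step.
pose V (c : R) (n : nat) x := S (1 + n%:R * (x - c)).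
have sV c n : smooth (V c n).
  apply: (smooth_comp (f := fun x : R => 1 + n%:R * (x - c)) _ sS).
  by apply: smoothD; [exact: smooth_cst|apply: smoothZ; apply: smoothB; [exact: smooth_id|exact: smooth_cst]].
have Vl c n x : x <= c -> V c n x = 0.
  by move=> xc; apply: S0; rewrite gerDl mulr_ge0_le0// subr_le0.
have Vr c x : c < x -> \forall n \near \oo, V c n x = 1.
  move=> cx; exists (Num.bound (1 / (x - c))) => // n /= hn; apply: S1.
  have xc : 0 < x - c by rewrite subr_gt0.
  have : 1 / (x - c) < n%:R.
    apply: (@lt_le_trans _ _ (Num.bound (1 / (x - c)))%:R); last by rewrite ler_nat.
    by apply: archi_boundP; rewrite divr_ge0// ltW.
  rewrite ltr_pdivrMr// => h; lra.
exists (fun n x => K n x * (V al n x * (1 - V be n x))); split.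
- move=> n; split; first exact: (smoothM (sK n) (smoothM (sV al n) (smoothB (smooth_cst 1) (sV be n)))).
  have [d d0 hd] := suppK n; exists d => // x; rewrite mulf_eq0 negb_or => /andP[+ _]; exact: hd.
- move=> n x; have /andP[k0 k1] := K01 n x; have /andP[v0 v1] := S01 (1 + n%:R * (x - al)).
  have /andP[w0 w1] := S01 (1 + n%:R * (x - be)); rewrite -/(V al n x) in v0 v1; rewrite -/(V be n x) in w0 w1.
  rewrite !mulr_ge0 ?subr_ge0//= mulr_ile1 ?mulr_ge0 ?subr_ge0// mulr_ile1 ?subr_ge0//.
  by rewrite gerBl.
move=> x xI; apply: cvg_near_cst.
have [xa|ax] := leP x al.
  apply: nearW => n; rewrite Vl// mul0r mulr0 indicE memNset//= in_itv/= => /andP[]; by rewrite ltNge xa.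
have [xb|bx] := leP x be.
  rewrite indicE mem_set; last by rewrite /= in_itv/= ax xb.
  apply: filterS2 (K1 x xI) (Vr _ _ ax) => n [-> _] ->; by rewrite Vl// subr0 !mulr1.
rewrite indicE memNset; last by rewrite /= in_itv/= => /andP[_]; rewrite leNgt bx.
by apply: filterS (Vr _ _ bx) => n ->; rewrite subrr !mulr0.
Qed.

Lemma nice_one (lo hi : R) : lo < hi -> exists E : nat -> R -> R,
  [/\ forall n, nice lo hi (E n), forall n x, 0 <= E n x <= 1 &
    forall x, lo < x < hi -> E n x @[n --> \oo] --> (1 : R)].
Proof.
move=> lohi; have [E [h1 h2 h3]] := nice_step lo hi lohi; exists E; split => // x /[dup] xI /andP[a b].
by have := h3 x xI; rewrite indicE mem_set//= in_itv/= a ltW.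
Qed.

(** Passes from smooth compactly supported factors to indicators in one coordinate: [c] will be a
    projection, and [h] the factor in the other variable. *)
Lemma coord_total (lo hi : R) (c h g : P -> R) : lo < hi -> measurable_fun setT (c : plane -> measurableTypeR R) ->
  (forall p, Omega p -> lo < c p < hi) -> measurable_fun setT (h : plane -> R) -> bounded_on_Omega h -> L2 mO g ->
  (forall a, nice lo hi a -> dot mO (fun p => a (c p) * h p) g = 0) ->
  forall A, measurable (A : set (measurableTypeR R)) -> dot mO (fun p => \1_A (c p) * h p) g = 0.
Proof.
move=> lohi mc cO mh hb lg H.
have [C hC] := hb.
have lm (b : R -> R) : measurable_fun setT (b : measurableTypeR R -> R) -> (forall x, `|b x| <= 1) ->
    L2 mO (fun p => b (c p) * h p).
  move=> mb b1; apply: L2_Omega; first by apply: measurable_funM => //; exact: (measurableT_comp mb).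
  exists C => p Op; rewrite normrM; apply: le_trans (hC p Op); by rewrite ler_piMl.
have key (E : nat -> R -> R) (b : R -> R) : (forall n, nice lo hi (E n)) -> (forall n x, 0 <= E n x <= 1) ->
    measurable_fun setT (b : measurableTypeR R -> R) -> (forall x, 0 <= b x <= 1) ->
    (forall x, lo < x < hi -> E n x @[n --> \oo] --> b x) -> dot mO (fun p => b (c p) * h p) g = 0.
  move=> nE E01 mb b01 cE; apply: (@dot_lim0 g _ (fun n p => E n (c p) * h p) C) => //.
  - move=> n; apply: lm; first by apply: continuous_measurable_R; exact: smooth_cont (nE n).1.
    by move=> x; have /andP[a0 a1] := E01 n x; rewrite ger0_norm.
  - by apply: lm => // x; have /andP[a0 a1] := b01 x; rewrite ger0_norm.
  - move=> n p Op; rewrite -mulrBl normrM; apply: le_trans (hC p Op); rewrite ler_piMl//.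
    by have /andP[a0 a1] := E01 n (c p); have /andP[e0 e1] := b01 (c p); rewrite ler_norml; lra.
  - by move=> p Op; apply: cvgM; [exact/cE/cO|exact: cvg_cst].
  - by move=> n; exact: H.
apply: (@dynkin_dot _ (measurableTypeR R) (@ocitv R) c h g) => //.
- exact: ocitvI.
- have [E [h1 h2 h3]] := nice_one lohi.
  have := key E (fun=> 1) h1 h2 (measurable_cst _) _ h3.
  move=> e; rewrite -[RHS]e; last by move=> x; rewrite ler01 lexx.
  by congr (dot _ _ _); apply/funext => p; rewrite mul1r.
move=> A [[al be] _ <-]; have [E [h1 h2 h3]] := nice_step al be lohi.
apply: (key E (\1_(`]al, be]%classic : set (measurableTypeR R)) : R -> R)) => //.
by move=> x; rewrite indicE; case: (_ \in _); rewrite /= ?lexx ?ler01.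
Qed.

(** Testing with the sets where [g] is positive and where it is negative shows that [g] vanishes
    almost everywhere; [e] is the sign. *)
Lemma dot_sets0 (g : P -> R) : L2 mO g ->
  (forall S, measurable (S : set plane) -> dot mO (\1_S : P -> R) g = 0) -> dot mO g g = 0.
Proof.
move=> lg H; have mg := L2_measurable lg.
have half (e : R) : e ^+ 2 = 1 -> {ae mO, forall p, setT p -> 0 < e * g p -> (e * g p) = 0}.
  move=> e2; pose S := [set p : plane | 0 < e * g p].
  have mS : measurable S.
    by rewrite -[S]setTI; apply: (measurable_fun_ltr (f := fun=> 0)) => //; exact: measurable_funM.
  have l1 : L2 mO (\1_S : P -> R).
    apply: L2_Omega; first exact: measurable_indic.
    by exists 1 => p _; rewrite indicE; case: (_ \in _); rewrite ?normr1 ?normr0.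
  have h1 : \int[mO]_p (\1_S p * (e * g p)) = 0.
    have := H S mS => h; have := dotZr e lg l1; rewrite h mulr0 => <-; apply: eq_Rintegral => p _; by [].
  have i1 : mO.-integrable setT (EFin \o (fun p => \1_S p * (e * g p))).
    by have := L2_integrable l1 (L2Z e lg).
  have h2 : (\int[mO]_p `|(\1_S p * (e * g p))%:E| = 0)%E.
    have <- : (\int[mO]_p (\1_S p * (e * g p))%:E = 0)%E.
      rewrite -[LHS]fineK; last exact: integrable_fin_num i1.
      by rewrite -/(Rintegral _ _ _) h1.
    apply: eq_integral => p _; rewrite gee0_abs// lee_fin indicE; case: (boolP (_ \in _)); rewrite ?mul0r// mul1r inE; exact: ltW.
  have := (ae_eq_integral_abs mO measurableT (measurable_int _ i1)).1 h2.
  move=> h; apply: negligibleS h => p; apply: contra_not => h _ ep.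
  by have := h I; rewrite /= indicE mem_set// mul1r => -[].
have h : {ae mO, forall p, setT p -> g p * g p = 0}.
  have e1 : (1 : R) ^+ 2 = 1 by rewrite expr1n.
  have e2 : (-1 : R) ^+ 2 = 1 by rewrite sqrrN expr1n.
  have := negligibleU (half 1 e1) (half (-1) e2).
  apply: negligibleS => p; rewrite -!setCI; apply: contra_not => -[h1 h2] _.
  have h1' := h1 I; have h2' := h2 I; rewrite mul1r in h1'; rewrite mulN1r oppr_gt0 in h2'.
  have [gn|gp|->] := ltgtP (g p) 0; last by rewrite mulr0.
    by have /eqP := h2' gn; rewrite oppr_eq0 => /eqP ->; rewrite mulr0.
  by rewrite (h1' gp) mulr0.
rewrite /dot (ae_eq_Rintegral (g := fun=> 0) _ _ _ h)//; first by rewrite Rintegral_cst// mul0r.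
exact: measurable_funM.
Qed.

Lemma dot_approx0 (f g : P -> R) : L2 mO f -> L2 mO g ->
  (forall d, 0 < d -> exists F, [/\ L2 mO F, dot mO F g = 0 & dot mO (fun p => f p - F p) (fun p => f p - F p) <= d]) ->
  dot mO f g = 0.
Proof.
move=> lf lg H; apply/eqP; rewrite -sqrf_eq0 -normr_le0; apply/ler_addgt0Pr => e e0; rewrite add0r ger0_norm ?sqr_ge0//.
have g1 : 0 < dot mO g g + 1 by rewrite ltr_wpDl// dot_ge0.
have [F [lF F0 hF]] := H _ (divr_gt0 e0 g1).
have E : dot mO f g = dot mO (fun p => f p - F p) g by rewrite dotBl// F0 subr0.
have h := CauchySchwarz (L2B lf lF) lg; rewrite -E in h.
have : dot mO f g ^+ 2 <= (nrm mO (fun p => f p - F p) * nrm mO g) ^+ 2.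
  by rewrite -real_normK ?num_real// lerXn2r ?nnegrE ?mulr_ge0 ?nrm_ge0.
move/le_trans; apply; rewrite exprMn !nrm_sqr.
apply: (@le_trans _ _ (e / (dot mO g g + 1) * dot mO g g)); first by rewrite ler_wpM2r// dot_ge0.
by rewrite mulrAC ler_pdivrMr// ler_wpM2l ?(ltW e0)// lerDl.
Qed.

Definition spectral_family (A B : R) (q : R -> R) (e : nat -> R -> R) (m : nat -> R) : Prop :=
  [/\ forall k, eigen A B q (e k) (m k), forall i k, (i < k)%N -> inn A B (e k) (e i) = 0 &
  forall k f u u', continuous f -> BVP A B q u u' f -> (forall i, (i < k)%N -> inn A B f (e i) = 0) ->
    inn A B u u <= m k ^+ 2 * inn A B f f].

Lemma nice_dense (A B : R) (q : R -> R) (e : nat -> R -> R) (m : nat -> R) (a : R -> R) : A < B -> continuous q -> (forall x, A <= x <= B -> 0 <= q x) ->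
  spectral_family A B q e m -> nice A B a -> forall d, 0 < d -> exists n,
  let r := (fun x => a x - \sum_(i < n) inn A B a (e i) * e i x) in inn A B r r <= d.
Proof.
move=> AB cq q0 [h1 h2 h3] [sa [d d0 hd]].
pose a' := 'D_(1:R) a; pose a'' := 'D_(1:R) a'.
have sa' : smooth a' := smooth_derive _ sa.
have ca'' : continuous a'' := smooth_cont (smooth_derive _ sa').
have ca := smooth_cont sa.
pose f x := q x * a x - a'' x.
have cf : continuous f by apply: csub => //; exact: cmul.
apply: (@family_complete A B q AB cq q0 e m h1 h2 h3 a a' f cf); split.
- exact: smooth_hasD.
- by apply: hasD_ext (smooth_hasD _ sa') => // x; rewrite /f subKr.
- by apply: contrapT => /eqP /hd; lra.
- by apply: contrapT => /eqP /hd; lra.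
Qed.

Lemma tensor_L2 (a b : R -> R) : continuous a -> continuous b -> L2 mO (fun p : P => a p.1 * b p.2).
Proof. by move=> ca cb; exact: L2_cont (ctensor ca cb). Qed.

Lemma tensor_dot (a b a' b' : R -> R) : continuous a -> continuous b -> continuous a' -> continuous b' ->
  dot mO (fun p : P => a p.1 * b p.2) (fun p => a' p.1 * b' p.2) = inn (-1) 1 a a' * inn 0 pi b b'.
Proof.
move=> ca cb ca' cb'; rewrite /inn -int_prod; [|exact: cmul|exact: cmul].
by apply: eq_Rintegral => p _; rewrite mulrACA.
Qed.

Lemma total_slice (A B : R) (q : R -> R) (e : nat -> R -> R) (m : nat -> R) (c h g : P -> R) (K : R) (a : R -> R) : A < B ->
  continuous q -> (forall x, A <= x <= B -> 0 <= q x) -> spectral_family A B q e m -> L2 mO g -> 0 <= K ->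
  (forall f : R -> R, continuous f -> L2 mO (fun p => f (c p) * h p)) ->
  (forall r : R -> R, continuous r -> dot mO (fun p => r (c p) * h p) (fun p => r (c p) * h p) <= K * inn A B r r) ->
  (forall k, dot mO (fun p => e k (c p) * h p) g = 0) -> nice A B a -> dot mO (fun p => a (c p) * h p) g = 0.
Proof.
move=> AB cq q0 he lg K0 lh hK H na; have ca := smooth_cont na.1; have K1 : 0 < K + 1 by rewrite ltr_wpDl.
have ce k : continuous (e k) by have [h1 _ _] := he; exact: eigen_cont (h1 k).
apply: dot_approx0 => // [|d d0]; first exact: lh.
have [N hN] := nice_dense AB cq q0 he na (divr_gt0 d0 K1).
set k := fun i => inn A B a (e i).
have ck : continuous (fun x => \sum_(i < N) k i * e i x) by apply: (csum (f := fun i x => k i * e i x)) => i; exact: cscale.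
exists (fun p => (\sum_(i < N) k i * e i (c p)) * h p); split.
- exact: (lh (fun x => \sum_(i < N) k i * e i x)).
- rewrite (_ : (fun p => _) = (fun p => \sum_(i < N) k i * (e i (c p) * h p))); last first.
    by apply/funext => p; rewrite mulr_suml; apply: eq_bigr => i _; rewrite mulrA.
  rewrite (@dot_suml _ _ mO 'I_N (index_enum _) xpredT (fun i p => k i * (e i (c p) * h p)))//; last first.
    by move=> i _; apply: L2Z; exact: lh.
  by apply: big1 => i _; rewrite dotZl ?H ?mulr0//; exact: lh.
rewrite (_ : (fun p => _) = (fun p => (a (c p) - \sum_(i < N) k i * e i (c p)) * h p)); last first.
  by apply/funext => p; rewrite mulrBl.
apply: (le_trans (hK (fun x => a x - \sum_(i < N) k i * e i x) (csub ca ck))).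
apply: (@le_trans _ _ (K * (d / (K + 1)))); first by rewrite ler_wpM2l.
by rewrite mulrCA ler_piMr ?(ltW d0)// ler_pdivrMr// mul1r lerDl.
Qed.

(** The eigenfunctions are replaced by [nice] functions in [x] for each fixed [n], then in [y];
    indicators of rectangles and of all measurable sets follow. A filler [ms n = 0] is harmless: its
    inverse is 0 and the potential is then 0. *)
Lemma modes_total (s : nat -> R -> R) (ms : nat -> R) (e : nat -> nat -> R -> R) (m : nat -> nat -> R) (g : P -> R) :
  spectral_family 0 pi (fun=> 0) s ms ->
  (forall n, spectral_family (-1) 1 (fun x => (ms n)^-1 * x ^+ 2) (e n) (m n)) ->
  L2 mO g -> (forall n k, dot mO (fun p => e n k p.1 * s n p.2) g = 0) -> dot mO g g = 0.
Proof.
move=> hs he lg H; have [hs1 hs2 hs3] := hs.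
have lt11 : (-1 : R) < 1 by lra.
have pi0 := pi_gt0 R.
have c0 : continuous (fun _ : R => 0 : R) by exact: cst_continuous.
have cs n : continuous (s n) by exact: eigen_cont (hs1 n).
have ce n k : continuous (e n k) by have [h1 _ _] := he n; exact: eigen_cont (h1 k).
have ms0 n : 0 <= (ms n)^-1 by rewrite invr_ge0; case: (hs1 n) => [[-> _]|[/ltW]].
have cq n : continuous (fun x : R => (ms n)^-1 * x ^+ 2).
  by apply: cscale => x; exact: exprn_continuous.
have q0 n x : -1 <= x <= 1 -> 0 <= (ms n)^-1 * x ^+ 2 by rewrite mulr_ge0// sqr_ge0.
have step1 a n : nice (-1) 1 a -> dot mO (fun p => a p.1 * s n p.2) g = 0.
  apply: (total_slice lt11 (cq n) (q0 n) (he n) lg (ip_ge0 0 pi (s n)) _ _ (H n)) => [f cf|r cr]; first exact: tensor_L2.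
  by rewrite tensor_dot// mulrC.
have step2 a b : nice (-1) 1 a -> nice 0 pi b -> dot mO (fun p => b p.2 * a p.1) g = 0.
  move=> na; have ca := smooth_cont na.1; have com (f : R -> R) : (fun p : P => f p.2 * a p.1) = (fun p => a p.1 * f p.2).
    by apply/funext => p; rewrite mulrC.
  apply: (total_slice pi0 c0 (fun _ _ => lexx 0) hs lg (ip_ge0 (-1) 1 a)) => [f cf|r cr|k]; rewrite !com.
  - exact: tensor_L2.
  - by rewrite tensor_dot.
  - exact: step1.
have mf : measurable_fun setT (fst : plane -> measurableTypeR R) by exact: measurable_fst.
have mn : measurable_fun setT (snd : plane -> measurableTypeR R) by exact: measurable_snd.
have Of (p : P) : Omega p -> -1 < p.1 < 1 by case => /=; rewrite in_itv.
have On (p : P) : Omega p -> 0 < p.2 < pi by case => /= _; rewrite in_itv.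
have step3 (A : set (measurableTypeR R)) b : measurable A -> nice 0 pi b -> dot mO (fun p => \1_A p.1 * b p.2) g = 0.
  move=> mA nb; have cb := smooth_cont nb.1.
  apply: (@coord_total (-1) 1 fst (fun p => b p.2) g) => //.
  - by apply: (measurableT_comp _ mn); exact: continuous_measurable_R.
  - have [C C0 hC] := continuous_bound 0 pi cb; exists C => p /On /andP[a c]; apply: hC; by rewrite !ltW.
  - by move=> a na; rewrite -[RHS](step2 a b na nb); congr (dot _ _ _); apply/funext => p; rewrite mulrC.
have step4 (A B : set (measurableTypeR R)) : measurable A -> measurable B -> dot mO (fun p => \1_B p.2 * \1_A p.1) g = 0.
  move=> mA mB; apply: (@coord_total 0 pi snd (fun p => \1_A p.1) g) => //.
  - by apply: (measurableT_comp _ mf); exact: measurable_indic.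
  - by exists 1 => p _; rewrite indicE; case: (_ \in _); rewrite ?normr1 ?normr0.
  - by move=> b nb; rewrite -[RHS](step3 A b mA nb); congr (dot _ _ _); apply/funext => p; rewrite mulrC.
apply: dot_sets0 => // S mS.
have h1 : bounded_on_Omega (fun _ : P => 1 : R) by exists 1 => p _; rewrite normr1.
have := @dynkin_dot _ plane [set A `*` B | A in measurable & B in measurable] id (fun=> 1) g (@measurable_id _ _ setT) (measurable_cst _) h1 lg.
move=> /(_ (measurable_prod_measurableType _ _)) h.
rewrite -[RHS](h _ _ _ S mS).
- by congr (dot _ _ _); apply/funext => p; rewrite mulr1.
- move=> _ _ [A mA [B mB <-]] [A' mA' [B' mB' <-]]; exists (A `&` A'); first exact: measurableI.
  by exists (B `&` B'); [exact: measurableI|rewrite setXI].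
- rewrite -[RHS](step4 setT setT)//; congr (dot _ _ _); apply/funext => p; by rewrite !indicT mulr1.
move=> _ [A mA [B mB <-]]; rewrite -[RHS](step4 A B mA mB); congr (dot _ _ _); apply/funext => p.
rewrite mulr1 !indicE in_setX -natrM; by case: (_ \in A); case: (_ \in B).
Qed.

(** * Expansion in the modes *)

Section fourier.
Lemma nondecreasing_tail (B : nat -> R) (C : R) : (forall m n, (m <= n)%N -> B m <= B n) -> (forall n, B n <= C) ->
  forall d, 0 < d -> exists N, forall M, (N <= M)%N -> B M - B N <= d.
Proof.
move=> mB bB d d0; have nB : {homo B : n m / (n <= m)%N >-> n <= m} by move=> m n; exact: mB.
have cB : cvgn B by apply: nondecreasing_is_cvgn => //; exists C => _ [n _ <-].
have [N _ hN] : \forall n \near \oo, `|limn B - B n| <= d by move/cvgrPdist_le : cB => /(_ d d0).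
exists N => M NM; apply: le_trans (hN N (leqnn N)); apply: le_trans (ler_norm _).
by rewrite lerD2r; exact: nondecreasing_cvgn_le.
Qed.

Variables (s : nat -> R -> R) (ms : nat -> R) (e : nat -> nat -> R -> R) (m : nat -> nat -> R).
Hypothesis hs : spectral_family 0 pi (fun=> 0) s ms.
Hypothesis he : forall n, spectral_family (-1) 1 (fun x => (ms n)^-1 * x ^+ 2) (e n) (m n).

Definition mode n k (p : P) : R := e n k p.1 * s n p.2.

Let lt11 : (-1 : R) < 1. Proof. lra. Qed.
Let hs1 : forall k, eigen 0 pi (fun=> 0) (s k) (ms k). Proof. by case: hs. Qed.
Let he1 n : forall k, eigen (-1) 1 (fun x => (ms n)^-1 * x ^+ 2) (e n k) (m n k). Proof. by case: (he n). Qed.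
Let cs n : continuous (s n). Proof. exact: eigen_cont (hs1 n). Qed.
Let ce n k : continuous (e n k). Proof. exact: eigen_cont (he1 n k). Qed.

Lemma mode_L2 n k : L2 mO (mode n k). Proof. exact: tensor_L2. Qed.

Lemma mode_orth n k n' k' : (n, k) != (n', k') -> dot mO (mode n k) (mode n' k') = 0.
Proof.
move=> h; rewrite /mode tensor_dot//; have [nn|nn] := eqVneq n n'; last first.
  by rewrite (family_orth _ nn) ?mulr0//; case: hs.
rewrite -nn in h *; have kk : k != k' by apply: contra h => /eqP ->.
by rewrite (family_orth _ kk) ?mul0r//; have [_ + _] := he n.
Qed.

(** A mode has norm 1, or it is a filler and its coefficient is 0: in both cases the squared norm
    drops out, and no case distinction is left in the expansions. *)
Lemma mode_unit (f0 : P -> R) n k : dot mO f0 (mode n k) * dot mO (mode n k) (mode n k) = dot mO f0 (mode n k).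
Proof.
have z : mode n k = (fun=> 0) -> dot mO f0 (mode n k) = 0 by move=> ->; rewrite dotC dot0l.
rewrite [X in _ * X]tensor_dot//; case: (hs1 n) => [[_ sn]|[_ -> _]].
  by rewrite z ?mul0r//; apply/funext => p; rewrite /mode sn mulr0.
case: (he1 n k) => [[_ en]|[_ -> _]]; last by rewrite !mulr1.
by rewrite z ?mul0r//; apply/funext => p; rewrite /mode en mul0r.
Qed.

Variable f0 : P -> R.
Hypothesis lf0 : L2 mO f0.

Definition coef n k : R := dot mO f0 (mode n k).

Definition psum N (p : P) : R := \sum_(j : 'I_N * 'I_N) coef j.1 j.2 * mode j.1 j.2 p.

Definition psum2 N : R := \sum_(j : 'I_N * 'I_N) coef j.1 j.2 ^+ 2.

Lemma psum_L2 N : L2 mO (psum N).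
Proof.
apply: (@L2_sum _ _ mO _ (index_enum _) xpredT (fun (j : 'I_N * 'I_N) p => coef j.1 j.2 * mode j.1 j.2 p)) => j _.
by apply: L2Z; exact: mode_L2.
Qed.

Lemma psum_dot N h : L2 mO h -> dot mO (psum N) h = \sum_(j : 'I_N * 'I_N) coef j.1 j.2 * dot mO (mode j.1 j.2) h.
Proof.
move=> lh; rewrite /psum (@dot_suml _ _ mO _ (index_enum _) xpredT (fun (j : 'I_N * 'I_N) p => coef j.1 j.2 * mode j.1 j.2 p))//.
  by apply: eq_bigr => j _; rewrite dotZl//; exact: mode_L2.
by move=> j _; apply: L2Z; exact: mode_L2.
Qed.

Lemma psum_mode N n k : (n < N)%N -> (k < N)%N -> dot mO (psum N) (mode n k) = coef n k.
Proof.
move=> nN kN; rewrite psum_dot; last exact: mode_L2.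
rewrite (bigD1 (Ordinal nN, Ordinal kN))//= mode_unit big1 ?addr0// => -[i j] /= h.
rewrite mode_orth ?mulr0//; apply: contra h => /eqP[h1 h2]; apply/eqP; congr (_, _); exact: val_inj.
Qed.

Lemma psum_psum M N : (N <= M)%N -> dot mO (psum M) (psum N) = psum2 N.
Proof.
move=> NM; rewrite dotC psum_dot; last exact: psum_L2.
by apply: eq_bigr => j _; rewrite dotC psum_mode ?expr2//; exact: leq_trans (ltn_ord _) NM.
Qed.

Lemma psum_f0 N : dot mO (psum N) f0 = psum2 N.
Proof. by rewrite psum_dot//; apply: eq_bigr => j _; rewrite dotC expr2. Qed.

Lemma psum_dist M N : (N <= M)%N -> dot mO (fun p => psum M p - psum N p) (fun p => psum M p - psum N p) = psum2 M - psum2 N.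
Proof.
move=> NM; have lM := psum_L2 M; have lN := psum_L2 N; have lD := L2B lM lN.
rewrite dotBl// !dotBr// !(dotC mO (psum N) (psum M)) !psum_psum//; ring.
Qed.

Lemma psum_f0_dist N : dot mO (fun p => psum N p - f0 p) (fun p => psum N p - f0 p) = dot mO f0 f0 - psum2 N.
Proof.
have lN := psum_L2 N; have lD := L2B lN lf0.
rewrite dotBl// !dotBr// (dotC mO f0 (psum N)) !psum_f0 psum_psum//; ring.
Qed.

Lemma psum2_mono M N : (N <= M)%N -> psum2 N <= psum2 M.
Proof. by move=> NM; rewrite -subr_ge0 -psum_dist// dot_ge0. Qed.

Lemma psum2_le N : psum2 N <= dot mO f0 f0.
Proof. by rewrite -subr_ge0 -psum_f0_dist dot_ge0. Qed.

(** Parseval: a subsequence of the partial sums with geometric increments has a limit with the same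
    coefficients as [f0]; the difference is orthogonal to all modes, hence of norm 0. *)
Lemma psum_dense d : 0 < d -> exists N, dot mO f0 f0 - psum2 N <= d.
Proof.
move=> d0.
have tail l : exists N, (l < N)%N /\ forall M, (N <= M)%N -> psum2 M - psum2 N <= (1 / 2 ^+ l) ^+ 2.
  have [|N hN] := nondecreasing_tail (fun a b => @psum2_mono b a) psum2_le (d := (1 / 2 ^+ l) ^+ 2).
    by rewrite exprn_gt0// divr_gt0// exprn_gt0.
  exists (maxn N l.+1); split; first by rewrite leq_maxr.
  move=> M hM; apply: le_trans (hN M _); last exact: leq_trans (leq_maxl _ _) hM.
  by rewrite lerD2l lerN2; apply: psum2_mono; exact: leq_maxl.
have [t ht] := choice tail.
pose sg := fix sg l := if l is l'.+1 then maxn (sg l') (t l) else t 0%N.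
have sgS l : (sg l <= sg l.+1)%N by rewrite /= leq_maxl.
have tsg l : (t l <= sg l)%N by case: l => [|l] //=; rewrite leq_maxr.
have sgl l : (l < sg l)%N by apply: leq_trans (tsg l); have [] := ht l.
have d1 l : nrm mO (fun p => psum (sg l.+1) p - psum (sg l) p) <= 1 / 2 ^+ l.
  rewrite -(@ler_pXn2r _ 2)// ?nnegrE ?nrm_ge0 ?divr_ge0 ?exprn_ge0//.
  rewrite nrm_sqr psum_dist//; apply: le_trans ((ht l).2 (sg l.+1) _); last exact: leq_trans (tsg l) (sgS l).
  by rewrite lerD2l lerN2; apply: psum2_mono.
have [f [lf hf]] := L2_complete mu_Omega_fin (fun l => psum_L2 (sg l)) ler01 d1.
have pw l : 0 < 2 ^+ l :> R by rewrite exprn_gt0.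
have fE n k : dot mO f (mode n k) = coef n k.
  apply: esym; apply: (@pow2_eq (2 * 1 * nrm mO (mode n k))); first by rewrite !mulr_ge0// nrm_ge0.
  move=> j; pose l := maxn j (maxn n k).
  have nl : (n < sg l)%N by apply: leq_ltn_trans (sgl l); rewrite /l; lia.
  have kl : (k < sg l)%N by apply: leq_ltn_trans (sgl l); rewrite /l; lia.
  rewrite -(psum_mode nl kl) -dotBl//; [|exact: psum_L2|exact: mode_L2].
  apply: (le_trans (CauchySchwarz (L2B (psum_L2 _) lf) (mode_L2 _ _))).
  rewrite mulrAC ler_wpM2r ?nrm_ge0//; apply: (le_trans (hf l)).
  by rewrite half_pow_le ?mulr1// /l leq_maxl.
have g0 : dot mO (fun p => f0 p - f p) (fun p => f0 p - f p) = 0.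
  apply: (modes_total hs he) => [|n k]; first exact: L2B.
  rewrite dotC -/(mode n k) dotBl//; last exact: mode_L2.
  by rewrite fE subrr.
have [l hl] : exists l, (2 * 1 / 2 ^+ l) ^+ 2 <= d.
  have [l hl] := pow2_small (C := 4) (ler0n R 4) d0; exists l; apply: le_trans hl.
  rewrite mulr1 expr_div_n (_ : 2 ^+ 2 = 4 :> R); last by rewrite -natrX.
  by rewrite ler_wpM2l// lef_pV2 ?posrE ?exprn_gt0// expr2 ler_peMr ?(ltW (pw _))// exprn_ege1// ler1n.
exists (sg l); rewrite -psum_f0_dist -nrm_sqr; apply: le_trans hl.
rewrite lerXn2r ?nnegrE ?nrm_ge0 ?divr_ge0 ?(ltW (pw _))//.
apply: (le_trans (nrm_triangle (psum_L2 _) lf lf0)).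
by rewrite (nrmBC _ f f0) {2}/nrm g0 sqrtr0 addr0.
Qed.

End fourier.

(** * Construction of the control *)

(** The energy [s' ^ 2 + mu ^ 2 s ^ 2] is constant, and the normalization makes it [2 mu ^ 2 / pi],
    which is at most [mu ^ 2]. The sines need not be identified. *)
Lemma sine_bound (s s' : R -> R) (mu : R) : 0 < mu -> D s s' -> D s' (fun y => - (mu ^+ 2 * s y)) ->
  s 0 = 0 -> s pi = 0 -> inn 0 pi s s = 1 -> forall y, 0 <= y <= pi -> `|s y| <= 1 /\ `|s' y| <= mu.
Proof.
move=> mu0 d1 d2 s0 sp s1 y /andP[y0 yp].
have cs := D_cont d1; have cs' := D_cont d2; have pi0 := pi_ge0 R.
have c1 : continuous (fun y => s' y * s' y) by exact: cmul.
have c2 : continuous (fun y => mu ^+ 2 * (s y * s y)) by apply: cscale; exact: cmul.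
have e1 : inn 0 pi s' s' = mu ^+ 2.
  have dF : D (fun y => s y * s' y) (fun y => s' y * s' y - mu ^+ 2 * (s y * s y)).
    by apply: hasD_ext (hasD_mul d1 d2) => // z; ring.
  have := FTC pi0 dF (csub c1 c2); rewrite s0 sp !mul0r subrr IntB// IntZ; last exact: cmul.
  by rewrite -/(inn 0 pi s s) s1 mulr1 => /eqP; rewrite subr_eq0 => /eqP.
pose E y := s' y * s' y + mu ^+ 2 * (s y * s y).
have dE : D E (fun=> 0).
  have h := hasD_add (hasD_mul d2 d2) (hasD_scale (mu ^+ 2) (hasD_mul d1 d1)).
  by apply: hasD_ext h => // z; ring.
have c0 : continuous (fun _ : R => 0 : R) by exact: cst_continuous.
have Ecst z : 0 <= z -> E z = E 0.
  move=> z0; have := FTC z0 dE c0; rewrite Int_cst// mul0r => /eqP; by rewrite eq_sym subr_eq0 => /eqP.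
have IE : E 0 * pi = 2 * mu ^+ 2.
  have <- : Int 0 pi E = E 0 * pi.
    by rewrite -[pi in RHS]subr0 -Int_cst//; apply: eq_Int => z /andP[z0 _]; exact: Ecst.
  rewrite IntD// IntZ; last exact: cmul.
  by rewrite -/(inn 0 pi s s) s1 -/(inn 0 pi s' s') e1 mulr1 mulrDl mul1r.
have m2 : 0 < mu ^+ 2 by rewrite exprn_gt0.
have E1 : E 0 <= mu ^+ 2.
  have p2 := pi_ge2 R; have E00 : 0 <= E 0.
    by rewrite /E -!expr2 addr_ge0 ?sqr_ge0// mulr_ge0// sqr_ge0.
  have : E 0 * 2 <= E 0 * pi by rewrite ler_wpM2l.
  rewrite IE; lra.
have := Ecst y y0; rewrite {1}/E => Ey.
have a1 : 0 <= s' y * s' y by rewrite -expr2 sqr_ge0.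
have a2 : 0 <= mu ^+ 2 * (s y * s y) by rewrite mulr_ge0 ?(ltW m2)// -expr2 sqr_ge0.
split; last by apply: sqr_le_norm; [exact: ltW|rewrite expr2; lra].
apply: sqr_le_norm => //; rewrite expr1n expr2 -(ler_pM2l m2) mulr1; lra.
Qed.

(** For smooth arguments this is [th * gop g - gop (th * g)]; it contains only terms with
    derivatives of [th], which is what localizes the control. *)
Definition commutator (th g : P -> R) (p : P) : R :=
  2 * (dx th p * dx g p) + dx (dx th) p * g p +
  p.1 ^+ 2 * (2 * ('D_((0, 1) : P) th p * 'D_((0, 1) : P) g p) + 'D_((0, 1) : P) ('D_((0, 1) : P) th) p * g p).

Lemma D2_blend v (th th1 th2 A A1 A2 B B1 B2 : P -> R) : hasD v th th1 -> hasD v th1 th2 ->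
  hasD v A A1 -> hasD v A1 A2 -> hasD v B B1 -> hasD v B1 B2 ->
  exists2 W1, hasD v (fun p => th p * A p + (1 - th p) * B p) W1 &
  hasD v W1 (fun p => th p * A2 p + (1 - th p) * B2 p + 2 * (th1 p * (A1 p - B1 p)) + th2 p * (A p - B p)).
Proof.
move=> t1 t2 a1 a2 b1 b2.
have h := hasD_add (hasD_mul t1 a1) (hasD_mul (hasD_sub (hasD_cst v 1) t1) b1).
have h2 := hasD_add (hasD_add (hasD_mul t2 a1) (hasD_mul t1 a2))
  (hasD_add (hasD_mul (hasD_sub (hasD_cst v 0) t2) b1) (hasD_mul (hasD_sub (hasD_cst v 1) t1) b2)).
by exists (fun x => th1 x * A x + th x * A1 x + ((0 - th1 x) * B x + (1 - th x) * B1 x)) => //;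
  apply: hasD_ext h2 => // p; ring.
Qed.

Lemma gopE (w wx wxx wy wyy : P -> R) p : Dx w wx -> Dx wx wxx -> Dy w wy -> Dy wy wyy ->
  gop w p = - (wxx p + p.1 ^+ 2 * wyy p).
Proof.
move=> h1 h2 h3 h4; rewrite /gop (_ : dx w = wx); last exact: hasD_fun h1.
rewrite (_ : 'D_((0, 1) : P) w = wy); last exact: hasD_fun h3.
by rewrite (_ : dx wx p = wxx p) ?(hasDE p h4)//; exact: hasDE p h2.
Qed.

Lemma commutatorE th th1 th2 th3 th4 g g1 g3 p : Dx th th1 -> Dx th1 th2 -> Dy th th3 -> Dy th3 th4 ->
  Dx g g1 -> Dy g g3 ->
  commutator th g p = 2 * (th1 p * g1 p) + th2 p * g p + p.1 ^+ 2 * (2 * (th3 p * g3 p) + th4 p * g p).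
Proof.
move=> h1 h2 h3 h4 k1 k3; rewrite /commutator (_ : dx th = th1); last exact: hasD_fun h1.
rewrite (_ : 'D_((0, 1) : P) th = th3); last exact: hasD_fun h3.
rewrite (_ : dx th1 = th2); last exact: hasD_fun h2.
rewrite (_ : dx g = g1); last exact: hasD_fun k1.
by rewrite (hasDE p h4) (hasDE p h3) (hasDE p k3).
Qed.

Lemma smooth_second (f : P -> R) : smooth f -> exists f1 f2 f3 f4,
  [/\ Dx f f1, Dx f1 f2, Dy f f3, Dy f3 f4 & [/\ smooth f1, smooth f2, smooth f3 & smooth f4]].
Proof.
move=> sf; have s1 := smooth_derive ((1, 0) : P) sf; have s3 := smooth_derive ((0, 1) : P) sf.
have s2 := smooth_derive ((1, 0) : P) s1; have s4 := smooth_derive ((0, 1) : P) s3.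
by do 4 eexists; split; [exact: smooth_hasD sf|exact: smooth_hasD s1|exact: smooth_hasD sf|exact: smooth_hasD s3|split].
Qed.

Lemma gop_blend (th A B : P -> R) p : smooth th -> smooth A -> smooth B ->
  gop (fun p => th p * A p + (1 - th p) * B p) p =
  th p * gop A p + (1 - th p) * gop B p - commutator th (fun p => A p - B p) p.
Proof.
move=> /smooth_second[t1 [t2 [t3 [t4 [h1 h2 h3 h4 _]]]]] /smooth_second[a1 [a2 [a3 [a4 [k1 k2 k3 k4 _]]]]].
move=> /smooth_second[b1 [b2 [b3 [b4 [l1 l2 l3 l4 _]]]]].
have [w1 u1 u2] := D2_blend h1 h2 k1 k2 l1 l2; have [w3 u3 u4] := D2_blend h3 h4 k3 k4 l3 l4.
rewrite (gopE p u1 u2 u3 u4) (gopE p k1 k2 k3 k4) (gopE p l1 l2 l3 l4).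
rewrite (commutatorE p h1 h2 h3 h4 (hasD_sub k1 l1) (hasD_sub k3 l3)); ring.
Qed.

Lemma smooth_commutator (th g : P -> R) : smooth th -> smooth g -> smooth (commutator th g).
Proof.
move=> /smooth_second[t1 [t2 [t3 [t4 [h1 h2 h3 h4 [s1 s2 s3 s4]]]]]].
move=> sg; have [g1 [g2 [g3 [g4 [k1 k2 k3 k4 [r1 r2 r3 r4]]]]]] := smooth_second sg.
have E p : commutator th g p = 2 * (t1 p * g1 p) + t2 p * g p + (p.1 * p.1) * (2 * (t3 p * g3 p) + t4 p * g p).
  by rewrite (commutatorE p h1 h2 h3 h4 k1 k3) expr2.
have -> : commutator th g = (fun p => 2 * (t1 p * g1 p) + t2 p * g p + (p.1 * p.1) * (2 * (t3 p * g3 p) + t4 p * g p)).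
  exact/funext.
exact: (smoothD (smoothD (smoothZ 2 (smoothM s1 r1)) (smoothM s2 sg))
  (smoothM (smoothM (@smooth_fst) (@smooth_fst)) (smoothD (smoothZ 2 (smoothM s3 r3)) (smoothM s4 sg)))).
Qed.

(** The factor [1 + x] comes from the derivative in [y] in the commutator. The power 6 pays for
    summability over the modes: with [lam = 1 / m] and [m ^ 2 <= ms], [m ^ 6 <= ms ^ 2 m ^ 2]. *)
Lemma exp_decay (de : R) : 0 < de -> exists2 C, 0 <= C & forall x : R, 0 <= x -> (1 + x) * x ^+ 6 * expR (- (de * x)) <= C.
Proof.
move=> d0; exists ((de^-1) ^+ 6 * 6`!%:R + (de^-1) ^+ 7 * 7`!%:R).
  by rewrite addr_ge0// mulr_ge0// exprn_ge0// invr_ge0 ltW.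
move=> x x0; have dx0 : 0 <= de * x by rewrite mulr_ge0// ltW.
have h k : x ^+ k * expR (- (de * x)) <= (de^-1) ^+ k * k`!%:R.
  have := pow_expR k dx0; rewrite exprMn -mulrA => h.
  rewrite exprVn -(ler_pM2l (exprn_gt0 k d0)) [leRHS]mulrA divff ?mul1r//.
  by rewrite expf_neq0// gt_eqF.
rewrite (_ : _ * _ * _ = x ^+ 6 * expR (- (de * x)) + x ^+ 7 * expR (- (de * x))); first exact: lerD.
by rewrite (exprS x 6); ring.
Qed.

Lemma flat_chain_smooth mu lam (phi phi' : R -> R) psi psi' : D phi phi' ->
  D phi' (fun x => (mu ^+ 2 * x ^+ 2 - lam) * phi x) -> flat_chain mu lam phi phi' psi psi' -> forall i, smooth (psi i).
Proof.
move=> d1 d2 [h0 h0' h1 h2 _].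
have sq : smooth (fun x : R => mu ^+ 2 * x ^+ 2 - lam).
  have := smoothB (smoothZ (mu ^+ 2) (smoothM (@smooth_id) (@smooth_id))) (smooth_cst lam).
  by rewrite (_ : (fun x : R => _) = (fun x : R => mu ^+ 2 * x ^+ 2 - lam))//; apply/funext => x; rewrite expr2.
elim=> [|i IH]; last exact: ode_smooth sq IH (h1 _) (h2 _).
rewrite h0; apply: (ode_smooth sq (smooth_cst 0) d1); apply: hasD_ext d2 => // x; by rewrite addr0.
Qed.

Lemma commutator_bound (f1 f2 f3 f4 g g1 g3 M1 M2 M3 M4 k l y : R) : 0 <= k -> 0 <= l -> 0 <= y <= 1 ->
  `|f1| <= M1 -> `|f2| <= M2 -> `|f3| <= M3 -> `|f4| <= M4 -> `|g1| <= k -> `|g| <= k -> `|g3| <= k * l ->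
  `|2 * (f1 * g1) + f2 * g + y * (2 * (f3 * g3) + f4 * g)| <= 2 * (M1 + M2 + M3 + M4) * k * (1 + l).
Proof.
move=> k0 l0 /andP[y0 y1] h1 h2 h3 h4 k1 kg k3.
have mono (X Y u v : R) : `|X| <= u -> `|Y| <= v -> `|X * Y| <= u * v.
  by move=> hX hY; rewrite normrM; apply: ler_pM.
have e1 := mono _ _ _ _ h1 k1; have e2 := mono _ _ _ _ h2 kg; have e3 := mono _ _ _ _ h3 k3; have e4 := mono _ _ _ _ h4 kg.
have [m1 m2 m3 m4] : [/\ 0 <= M1, 0 <= M2, 0 <= M3 & 0 <= M4] by split; apply: le_trans (normr_ge0 _) _; eassumption.
have s1 : `|2 * (f3 * g3) + f4 * g| <= 2 * (M3 * (k * l)) + M4 * k.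
  apply: (le_trans (ler_normD _ _)); apply: lerD => //; rewrite normrM ger0_norm// ler_wpM2l//.
have s2 : `|y * (2 * (f3 * g3) + f4 * g)| <= 2 * (M3 * (k * l)) + M4 * k.
  rewrite normrM (ger0_norm y0); apply: le_trans s1; rewrite ler_piMl//.
have s3 : `|2 * (f1 * g1)| <= 2 * (M1 * k) by rewrite normrM ger0_norm// ler_wpM2l.
apply: (le_trans (ler_normD _ _)); apply: (le_trans (lerD (le_trans (ler_normD _ _) (lerD s3 e2)) s2)).
have [a1 a2 a3 a4] : [/\ 0 <= M1 * k, 0 <= M2 * k, 0 <= M3 * k & 0 <= M4 * k] by split; exact: mulr_ge0.
have [b1 b2 b3 b4] : [/\ 0 <= M1 * k * l, 0 <= M2 * k * l, 0 <= M3 * k * l & 0 <= M4 * k * l] by split; exact: mulr_ge0.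
rewrite (_ : 2 * _ * k * (1 + l) = 2 * (M1 * k + M2 * k + M3 * k + M4 * k) + 2 * (M1 * k * l + M2 * k * l + M3 * k * l + M4 * k * l)); last by ring.
rewrite (mulrA M3); lra.
Qed.

Section flat.
Variables (th : P -> R) (om : set P) (b t1 : R).
Hypothesis sth : smooth th.
Hypothesis th01 : forall p, 0 <= th p <= 1.
Hypothesis thb : forall y, 0 <= y <= pi -> th (-1, y) = 1 /\ th (1, y) = 0.
Hypothesis thx : forall p, Omega p -> (th p != 0 -> p.1 <= b) /\ (th p != 1 -> - b <= p.1).
Hypothesis thd : forall p, Omega p -> (om p /\ - b <= p.1 <= b) \/
  [/\ dx th p = 0, 'D_((0, 1) : P) th p = 0, dx (dx th) p = 0 & 'D_((0, 1) : P) ('D_((0, 1) : P) th) p = 0].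
Hypothesis (b0 : 0 < b) (b1 : b <= 1) (bt : b ^+ 2 / 2 < t1).

Definition flat_weight i : R := 8 ^+ i / (2 * i)`!%:R.

Lemma flat_weight_ge0 i : 0 <= flat_weight i.
Proof. by rewrite divr_ge0// exprn_ge0. Qed.

(** Each corrector is a blend of the chain flat at -1, used where [th] is nonzero and so [x <= b],
    and the chain flat at 1, used where [x >= - b]. Each is thus evaluated only where it is
    controlled, and the Dirichlet condition holds at both ends. The gluing costs the commutator
    terms [Cc]. *)
Lemma flat_modes : exists2 C, 0 <= C & forall (s e : R -> R) (ms m : R),
  eigen 0 pi (fun=> 0) s ms -> eigen (-1) 1 (fun x => ms^-1 * x ^+ 2) e m ->
  exists lam (W Cc : nat -> P -> R),
  [/\ 0 <= lam, W 0%N = (fun p => e p.1 * s p.2),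
    forall i, [/\ smooth (W i), vanishing (W i) & smooth (Cc i)],
    (forall p, gop (W 0%N) p = lam * W 0%N p) /\
    (forall i p, gop (W i.+1) p = lam * W i.+1 p - W i p - Cc i.+1 p) &
    forall i p, Omega p -> [/\ ~ om p -> Cc i p = 0,
      `|W i p| * expR (- (lam * t1)) <= C * (ms ^+ 2 * m ^+ 2) * flat_weight i &
      `|Cc i p| * expR (- (lam * t1)) <= C * (ms ^+ 2 * m ^+ 2) * flat_weight i]].
Proof.
pose de := t1 - b ^+ 2 / 2.
have d0 : 0 < de by rewrite subr_gt0.
(* Then [5 ep <= de / 2]: with [mu <= lam], the total exponent [5 ep lam + mu b ^ 2 / 2 - lam t1] is
   at most [- (de / 2) lam]. *)
pose ep := Num.min 1 (de / 10).
have ep0 : 0 < ep by rewrite lt_min ltr01 divr_gt0.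
have ep1 : ep <= 1 by rewrite ge_min lexx.
have ep2 : ep <= de / 10 by rewrite ge_min lexx orbT.
have ep3 : 5 * ep <= de / 2 by lra.
have [C1 C10 hC1] := chain_exists b0 b1 ep0 ep1.
have d20 : 0 < de / 2 by rewrite divr_gt0.
have [C2 C20 hC2] := exp_decay d20.
have [f1 [f2 [f3 [f4 [h1 h2 h3 h4 [q1 q2 q3 q4]]]]]] := smooth_second sth.
have [M1 M10 hM1] := continuous_bounded_Omega (smooth_cont q1).
have [M2 M20 hM2] := continuous_bounded_Omega (smooth_cont q2).
have [M3 M30 hM3] := continuous_bounded_Omega (smooth_cont q3).
have [M4 M40 hM4] := continuous_bounded_Omega (smooth_cont q4).
pose M := 1 + 4 * (M1 + M2 + M3 + M4).
have M0 : 0 <= M by rewrite addr_ge0// mulr_ge0// !addr_ge0.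
exists (M * C1 * C2); first by rewrite !mulr_ge0.
move=> s e ms m hs he.
(* Filler eigenpairs give the zero mode, for which everything can be taken to be zero. *)
have trivial_case : (fun p : P => e p.1 * s p.2) = (fun=> 0) -> exists lam (W Cc : nat -> P -> R),
  [/\ 0 <= lam, W 0%N = (fun p => e p.1 * s p.2),
    forall i, [/\ smooth (W i), vanishing (W i) & smooth (Cc i)],
    (forall p, gop (W 0%N) p = lam * W 0%N p) /\
    (forall i p, gop (W i.+1) p = lam * W i.+1 p - W i p - Cc i.+1 p) &
    forall i p, Omega p -> [/\ ~ om p -> Cc i p = 0,
      `|W i p| * expR (- (lam * t1)) <= M * C1 * C2 * (ms ^+ 2 * m ^+ 2) * flat_weight i &
      `|Cc i p| * expR (- (lam * t1)) <= M * C1 * C2 * (ms ^+ 2 * m ^+ 2) * flat_weight i]].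
  move=> E; exists 0, (fun _ _ => 0), (fun _ _ => 0).
  have g0 p : gop (fun _ : P => 0 : R) p = 0.
    have z v : hasD v (fun _ : P => 0 : R) (fun=> 0) by exact: hasD_cst.
    by rewrite (gopE p (z _) (z _) (z _) (z _)) mulr0 addr0 oppr0.
  split; [exact: lexx|by rewrite E|..].
  - by move=> i; split; [exact: smooth_cst|split|exact: smooth_cst].
  - by split => [p|i p]; rewrite g0 mul0r ?subrr ?subr0.
  - move=> i p _; rewrite normr0 mul0r; have w0 : 0 <= ms ^+ 2 * m ^+ 2 by rewrite mulr_ge0// sqr_ge0.
    by split => //; rewrite mulr_ge0 ?flat_weight_ge0// mulr_ge0// !mulr_ge0.
have [[_ s0]|[ms0 s1 [s' [ds ds' sA sB]]]] := hs.
  by apply: trivial_case; apply/funext => p; rewrite s0 mulr0.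
have [[_ e0]|[m0 e1 [e' [de1 de2 eA eB]]]] := he.
  by apply: trivial_case; apply/funext => p; rewrite e0 mul0r.
pose mu := Num.sqrt ms^-1; pose lam := m^-1.
have mu0 : 0 < mu by rewrite sqrtr_gt0 invr_gt0.
have mu2 : mu ^+ 2 = ms^-1 by rewrite sqr_sqrtr// invr_ge0 ltW.
have lam0 : 0 < lam by rewrite invr_gt0.
have {}ds' : D s' (fun y => - (mu ^+ 2 * s y)) by apply: hasD_ext ds' => // y; rewrite mu2 sub0r mulNr.
have {}de2 : D e' (fun x => (mu ^+ 2 * x ^+ 2 - lam) * e x) by apply: hasD_ext de2 => // x; rewrite mu2.
have ml := ground_state de1 de2 eA eB e1.
have dN : D (fun x => - x) (fun=> - 1) by exact: hasD_opp (@D_id).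
(* The potential is even, so the reflected mode is an eigenfunction as well; its chain, reflected
   back, is flat at 1. *)
pose r x := e (- x); pose r' x := - e' (- x).
have dr : D r r' by apply: hasD_ext (hasD_comp dN de1) => // x; rewrite mulrN1.
have dr' : D r' (fun x => (mu ^+ 2 * x ^+ 2 - lam) * r x).
  by apply: hasD_ext (hasD_opp (hasD_comp dN de2)) => // x; rewrite mulrN1 opprK sqrrN.
have r1 : inn (-1) 1 r r = 1.
  have ce := D_cont de1; rewrite -[RHS]e1 /inn -[RHS]Int_reflect; [|lra|exact: cmul].
  by apply: eq_Int => x _; rewrite addNr sub0r.
have rA : r (-1) = 0 by rewrite /r opprK.
have [psi [psi' [hc hb]]] := hC1 _ _ _ _ mu0 de1 de2 eA eB e1.
have [chi [chi' [kc kb]]] := hC1 _ _ _ _ mu0 dr dr' rA eA r1.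
have sbd := sine_bound mu0 ds ds' sA sB s1.
have ss : smooth s.
  by apply: (ode_smooth (smooth_cst (- mu ^+ 2)) (smooth_cst 0) ds); apply: hasD_ext ds' => // y; rewrite addr0 mulNr.
have spsi := flat_chain_smooth de1 de2 hc.
have schi i : smooth (fun x => chi i (- x)).
  exact: (smooth_comp (smoothN (@smooth_id)) (flat_chain_smooth dr dr' kc i)).
have [p0 p0' p1 p2 p3] := hc; have [c0 c0' c1 c2 c3] := kc.
pose A i (p : P) := psi i p.1 * s p.2; pose B i (p : P) := chi i (- p.1) * s p.2.
have sAi i : smooth (A i) := smooth_prod (spsi i) ss.
have sBi i : smooth (B i) := smooth_prod (schi i) ss.
pose W i (p : P) := th p * A i p + (1 - th p) * B i p.
(* At order 0 both chains start from the same mode, so the blend is the mode itself and there is no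
   commutator. *)
pose Cc i : P -> R := if i is j.+1 then commutator th (fun p => A i p - B i p) else fun=> 0.
have dchi i : D (fun x => chi i (- x)) (fun x => - chi' i (- x)).
  by apply: hasD_ext (hasD_comp dN (c1 i)) => // x; rewrite mulrN1.
have dchi' i : D (fun x => - chi' i.+1 (- x)) (fun x => (mu ^+ 2 * x ^+ 2 - lam) * chi i.+1 (- x) + chi i (- x)).
  by apply: hasD_ext (hasD_opp (hasD_comp dN (c2 i))) => // x; rewrite mulrN1 opprK sqrrN.
have gA i p : gop (A i.+1) p = lam * A i.+1 p - A i p.
  by rewrite /gop (grushin_prod p (p1 i.+1) (p2 i) ds ds') /A; ring.
have gB i p : gop (B i.+1) p = lam * B i.+1 p - B i p.
  by rewrite /gop (@grushin_prod (fun x => chi i.+1 (- x)) _ _ s s' _ p (dchi i.+1) (dchi' i) ds ds') /B; ring.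
have W0 : W 0%N = (fun p => e p.1 * s p.2).
  by apply/funext => p; rewrite /W /A /B p0 c0 /r opprK; ring.
exists lam, W, Cc; split; [exact: ltW|exact: W0| | |].
- move=> i; split.
  + exact: (smoothD (smoothM sth (sAi i)) (smoothM (smoothB (smooth_cst 1) sth) (sBi i))).
  + split=> z zI; last by rewrite /W /A /B /= sA sB !mulr0 addr0.
    have [t1' t0'] := thb zI; rewrite /W t1' t0' subrr subr0 !mul0r !mul1r addr0 add0r /A /B /=.
    case: i => [|i]; first by rewrite p0 c0 eA rA !mul0r.
    by rewrite (p3 i).1 (c3 i).1 !mul0r.
  + by case: i => [|i]; [exact: smooth_cst|exact: smooth_commutator sth (smoothB (sAi _) (sBi _))].
- split=> [p|i p]; last first.
    rewrite [LHS](gop_blend p sth (sAi i.+1) (sBi i.+1)) gA gB /W /Cc.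
    move: (commutator _ _ p) (A i.+1 p) (B i.+1 p) (A i p) (B i p) (th p) => *; ring.
  by rewrite W0 /gop (grushin_prod p de1 de2 ds ds'); ring.
move=> i p Op; have [pI1 pI2] := Omega_itv Op.
have /andP[x0 x1] := pI1; have /andP[t0 t1'] := th01 p; have [tl tr] := thx Op.
have [sy sy'] := sbd _ pI2.
pose K := C1 * expR (5 * ep * lam + mu * b ^+ 2 / 2) * flat_weight i.
have K0 : 0 <= K by rewrite !mulr_ge0 ?expR_ge0 ?flat_weight_ge0.
have mono (X Y u v : R) : `|X| <= u -> `|Y| <= v -> 0 <= u -> `|X * Y| <= u * v.
  by move=> hX hY u0; rewrite normrM; apply: ler_pM.
have bA : p.1 <= b -> `|A i p| <= K.
  by move=> xb; rewrite -[K]mulr1; apply: mono => //; have := hb i p.1; rewrite x0 xb => /(_ isT) [].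
have bB : - b <= p.1 -> `|B i p| <= K.
  move=> xb; rewrite -[K]mulr1; apply: mono => //; have := kb i (- p.1).
  by rewrite lerN2 x1 lerNl xb => /(_ isT) [].
have bW : `|W i p| <= K.
  rewrite /W (_ : K = th p * K + (1 - th p) * K); last by ring.
  have u0 : 0 <= 1 - th p by rewrite subr_ge0.
  apply: (le_trans (ler_normD _ _)); rewrite (normrM (th p)) (normrM (1 - th p)) (ger0_norm t0) (ger0_norm u0); apply: lerD.
    by have [->|/tl/bA h] := eqVneq (th p) 0; [rewrite !mul0r|rewrite ler_wpM2l].
  by have [->|/tr/bB h] := eqVneq (th p) 1; [rewrite subrr !mul0r|rewrite ler_wpM2l].
have bC : om p /\ - b <= p.1 <= b -> `|Cc i p| <= (M - 1) * K * (1 + lam).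
  move=> [_ /andP[xl xr]]; have l1 : 0 <= 1 + lam by rewrite addr_ge0// ltW.
  have M10' : 0 <= M - 1 by rewrite /M addrC addKr mulr_ge0// !addr_ge0.
  rewrite /Cc; case: i @K K0 bA bB bW => [|i] K K0 bA bB bW; first by rewrite normr0 !mulr_ge0.
  have k1 := Dx_prod (p1 i.+1) ds; have k3 := Dy_prod (p1 i.+1) ds.
  have l1' := Dx_prod (dchi i.+1) ds; have l3 := Dy_prod (dchi i.+1) ds.
  rewrite (commutatorE p h1 h2 h3 h4 (hasD_sub k1 l1') (hasD_sub k3 l3)).
  have := hb i.+1 p.1; rewrite x0 xr => /(_ isT) /= [a1 /(_ isT) a2].
  have := kb i.+1 (- p.1); rewrite lerN2 x1 lerNl xl => /(_ isT) /= [a3 /(_ isT) a4].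
  have twice (u v : R) k : `|u| <= k -> `|v| <= k -> `|u - v| <= 2 * k.
    by move=> hu hv; apply: (le_trans (ler_normB _ _)); rewrite mulrDl mul1r; exact: lerD.
  have q1' : `|psi' i.+1 p.1 * s p.2 - - chi' i.+1 (- p.1) * s p.2| <= 2 * K.
    by apply: twice; rewrite -[K]mulr1; apply: mono => //; rewrite normrN.
  have q2' : `|A i.+1 p - B i.+1 p| <= 2 * K by apply: twice; [exact: bA|exact: bB].
  have q3' : `|psi i.+1 p.1 * s' p.2 - chi i.+1 (- p.1) * s' p.2| <= 2 * K * lam.
    by rewrite -mulrA; apply: twice; apply: mono => //; exact: le_trans sy' ml.
  have x2 : 0 <= p.1 ^+ 2 <= 1.
    by rewrite sqr_ge0/= -(expr1n R 2) -real_normK ?num_real// lerXn2r ?nnegrE// ler_norml x0.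
  have K20 : 0 <= 2 * K by rewrite mulr_ge0.
  apply: (le_trans (commutator_bound K20 (ltW lam0) x2 (hM1 _ pI1 pI2) (hM2 _ pI1 pI2) (hM3 _ pI1 pI2) (hM4 _ pI1 pI2) q1' q2' q3')).
  have -> : M - 1 = 4 * (M1 + M2 + M3 + M4) by rewrite /M; ring.
  by apply: eq_leW; ring.
have l1 : 1 <= 1 + lam by rewrite lerDl ltW.
have final (X : R) : `|X| <= M * K * (1 + lam) -> `|X| * expR (- (lam * t1)) <= M * C1 * C2 * (ms ^+ 2 * m ^+ 2) * flat_weight i.
  move=> hX; apply: (le_trans (ler_wpM2r (expR_ge0 _) hX)).
  have ex : expR (5 * ep * lam + mu * b ^+ 2 / 2) * expR (- (lam * t1)) <= expR (- (de / 2 * lam)).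
    rewrite -expRD ler_expR.
    have u1 : 5 * ep * lam <= de / 2 * lam by rewrite ler_wpM2r// ltW.
    have u2 : mu * (b ^+ 2 / 2) <= lam * (b ^+ 2 / 2) by rewrite ler_wpM2r// divr_ge0// sqr_ge0.
    have u3 : de / 2 * lam + lam * (b ^+ 2 / 2) - lam * t1 = - (de / 2 * lam) by rewrite /de; field.
    by rewrite -u3 lerD2r lerD// -mulrA.
  have m2 : m ^+ 2 <= ms.
    have : mu ^+ 2 <= lam ^+ 2 by rewrite lerXn2r ?nnegrE// ltW.
    by rewrite mu2 /lam exprVn lef_pV2 ?posrE ?exprn_gt0.
  have m6 : (1 + lam) * expR (- (de / 2 * lam)) <= C2 * (ms ^+ 2 * m ^+ 2).
    have h := hC2 lam (ltW lam0); rewrite mulrAC /lam exprVn ler_pdivrMr ?exprn_gt0// in h.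
    apply: (le_trans h); rewrite ler_wpM2l// (_ : m ^+ 6 = (m ^+ 2) ^+ 2 * m ^+ 2); last by rewrite -exprM -exprD.
    by rewrite ler_wpM2r ?sqr_ge0// lerXn2r ?nnegrE ?sqr_ge0// ltW.
  rewrite (_ : M * K * _ * _ = M * C1 * flat_weight i * ((1 + lam) * (expR (5 * ep * lam + mu * b ^+ 2 / 2) * expR (- (lam * t1))))); last by rewrite /K; ring.
  rewrite (_ : M * C1 * C2 * _ * _ = M * C1 * flat_weight i * (C2 * (ms ^+ 2 * m ^+ 2))); last by ring.
  rewrite ler_wpM2l ?mulr_ge0 ?flat_weight_ge0//; apply: le_trans m6.
  by rewrite ler_wpM2l// (le_trans ler01).
have zC : dx th p = 0 -> 'D_((0, 1) : P) th p = 0 -> dx (dx th) p = 0 ->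
    'D_((0, 1) : P) ('D_((0, 1) : P) th) p = 0 -> Cc i p = 0.
  move=> z1 z2 z3 z4; rewrite /Cc; case: (i) => // j.
  by rewrite /commutator z1 z2 z3 z4 !(mul0r, mulr0, addr0).
have M1' : 1 <= M by rewrite /M lerDl mulr_ge0// !addr_ge0.
have MK : 0 <= M * K by rewrite mulr_ge0.
split.
- by move=> nom; case: (thd Op) => [[]//|[]]; exact: zC.
- apply: final; apply: (le_trans bW); rewrite -[leLHS]mulr1; apply: ler_pM => //; exact: ler_peMl.
apply: final; case: (thd Op) => [h|[z1 z2 z3 z4]].
  apply: (le_trans (bC h)); rewrite ler_wpM2r ?(le_trans ler01)// ler_wpM2r// gerBl; exact: ler01.
by rewrite (zC z1 z2 z3 z4) normr0 mulr_ge0// (le_trans ler01).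
Qed.

End flat.

(** * Summation over modes and correction orders *)

Definition box (N : nat) (a : nat -> nat -> nat -> R) : R := \sum_(n < N) \sum_(k < N) \sum_(i < N) a n k i.

Lemma sum_ord_mono (N M : nat) (g h : nat -> R) : (N <= M)%N -> (forall i, 0 <= h i) -> (forall i, g i <= h i) ->
  \sum_(i < N) g i <= \sum_(i < M) h i.
Proof.
move=> NM h0 gh; apply: (@le_trans _ _ (\sum_(i < N) h i)); first by apply: ler_sum => i _.
rewrite (big_ord_widen _ h NM) [leRHS](bigID (fun i : 'I_M => (i < N)%N))/= lerDl.
exact: sumr_ge0.
Qed.

Lemma box_mono N M a : (N <= M)%N -> (forall n k i, 0 <= a n k i) -> box N a <= box M a.
Proof.
move=> NM a0; have s0 (K : nat) n k : 0 <= \sum_(i < K) a n k i by exact: sumr_ge0.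
apply: (@sum_ord_mono N M (fun n => \sum_(k < N) \sum_(i < N) a n k i) (fun n => \sum_(k < M) \sum_(i < M) a n k i)) => // n.
  by apply: sumr_ge0 => k _.
apply: (@sum_ord_mono N M (fun k => \sum_(i < N) a n k i) (fun k => \sum_(i < M) a n k i)) => // k.
exact: sum_ord_mono.
Qed.

Lemma boxD N a b : box N (fun n k i => a n k i + b n k i) = box N a + box N b.
Proof.
rewrite /box -big_split; apply: eq_bigr => n _; rewrite -big_split; apply: eq_bigr => k _.
by rewrite -big_split.
Qed.

Lemma boxN N a : box N (fun n k i => - a n k i) = - box N a.
Proof.
rewrite /box -sumrN; apply: eq_bigr => n _; rewrite -sumrN; apply: eq_bigr => k _.
by rewrite -sumrN.
Qed.

(** Both [b + a] and [b - a] are nonnegative, so their sums over growing boxes are monotone. *)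
Lemma box_diff N M a b : (N <= M)%N -> (forall n k i, `|a n k i| <= b n k i) ->
  `|box M a - box N a| <= box M b - box N b.
Proof.
move=> NM ab; have p n k i : 0 <= b n k i + a n k i /\ 0 <= b n k i - a n k i.
  by have := ab n k i; rewrite ler_norml subr_ge0 -lerBlDl sub0r => /andP[].
have := box_mono NM (fun n k i => (p n k i).1); rewrite !boxD.
have := box_mono NM (fun n k i => (p n k i).2); rewrite !boxD !boxN.
by rewrite ler_norml => h1 h2; lra.
Qed.

Lemma nrm_cylinder (T : R) (F : space -> R) (C : R) : 0 < T -> measurable_fun setT F -> 0 <= C ->
  (forall z, cylinder T z -> `|F z| <= C) ->
  nrm (mu_cylinder T) F <= C * Num.sqrt (fine (mu_cylinder T setT)).
Proof. by move=> T0 mF C0 FC; have [] := mrestr_bounded (mu_cyl_fin T0) mF C0 FC. Qed.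

(** The Gevrey bound is used with [L = 64 = 8 * 4 * 2]: 8 for [flat_weight], 4 for the quotient of
    [(2 (n + 1))!] by [(2 n)!], and 2 for the geometric decay in the conclusion. *)
Lemma flat_gevrey (M : nat -> R) : (forall n, 0 <= M n) ->
  (forall L : R, 0 <= L -> exists C : R, forall n, M n * L ^+ n <= C * (2 * n)`!%:R) ->
  exists2 K : R, 0 <= K & forall n, M n.+1 * flat_weight n.+1 <= K / 2 ^+ n /\ M n.+1 * flat_weight n <= K / 2 ^+ n.
Proof.
move=> M0 /(_ 64)[|C hC]; first by [].
have C0 : 0 <= C.
  by have := hC 0%N; rewrite expr0 mulr1 muln0 fact0 mulr1 => /(le_trans (M0 _)).
exists C => // n; have hn := hC n.+1.
have f0 k : 0 < k`!%:R :> R by rewrite ltr0n fact_gt0.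
have p0 (x : R) k : 0 < x -> 0 < x ^+ k by move=> ?; rewrite exprn_gt0.
have e64 : 64 ^+ n.+1 = 8 ^+ n.+1 * 8 * 4 ^+ n * 2 ^+ n :> R.
  by rewrite !exprS (_ : 64 = 8 * 4 * 2 :> R) ?exprMn; ring.
have fw : ((2 * n.+1)`!%:R : R) <= 4 * 4 ^+ n * (2 * n)`!%:R.
  have k1 : (n.+1 <= 2 ^ n)%N by rewrite ltn_expl.
  rewrite (_ : 2 * n.+1 = (2 * n).+2)%N ?mulnS// !factS mulnA natrM ler_wpM2r//.
  rewrite -natrX -natrM ler_nat (_ : (4 ^ n = 2 ^ n * 2 ^ n)%N); last by rewrite -expnMn.
  by move: k1; set q := (2 ^ n)%N; nia.
have k1 : 1 <= 4 ^+ n :> R by rewrite exprn_ege1// ler1n.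
split; rewrite /flat_weight mulrA ler_pdivrMr// mulrAC ler_pdivlMr//.
  apply: le_trans hn; rewrite e64 -!mulrA ler_wpM2l// ler_wpM2l ?exprn_ge0//.
  have := p0 2 n; move: k1; move: (4 ^+ n) (2 ^+ n) => x y; nra.
rewrite -(ler_pM2r (p0 4 n _))//.
have : M n.+1 * 64 ^+ n.+1 <= C * (4 * 4 ^+ n * (2 * n)`!%:R) by apply: (le_trans hn); rewrite ler_wpM2l.
rewrite e64 exprS; set a := M _; set f := (_`!)%:R; have a0 : 0 <= a := M0 _.
have p8 : 0 < 8 ^+ n :> R by exact: p0.
have p4 : 0 < 4 ^+ n :> R by exact: p0.
have p2 : 0 < 2 ^+ n :> R by exact: p0.
move: p8 p4 p2; move: (8 ^+ n) (4 ^+ n) (2 ^+ n) => x y z x0 y0 z0 h.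
have q0 : 0 <= a * x * z * y by rewrite !mulr_ge0// ltW.
rewrite (_ : a * (8 * x * 8 * y * z) = 64 * (a * x * z * y)) in h; last by ring.
rewrite (_ : C * (4 * y * f) = 4 * (C * f * y)) in h; last by ring.
lra.
Qed.

Lemma separated_source_L2 (f F : R -> P -> R) t : separated f F -> L2 mO (F t).
Proof.
move=> [I [s [s' [v [d1 c1 s1 b1 [_ ->]]]]]]; rewrite /sepF; apply: L2D; first exact: sepf_L2.
by apply/L2_cont/smooth_cont/smooth_gop; exact: sepf_smooth.
Qed.

(** * Superposition of the corrected modes *)

Section superposition.
Variables (T : R) (X : nat -> R -> R) (lam : nat -> nat -> R) (W Cc : nat -> nat -> nat -> P -> R) (c : nat -> nat -> R).
Hypothesis T0 : 0 < T.
Hypothesis dX : forall i, D (X i) (X i.+1).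
Hypothesis sW : forall n k i, [/\ smooth (W n k i), vanishing (W n k i) & smooth (Cc n k i)].
Hypothesis gW0 : forall n k p, gop (W n k 0%N) p = lam n k * W n k 0%N p.
Hypothesis gWS : forall n k i p, gop (W n k i.+1) p = lam n k * W n k i.+1 p - W n k i p - Cc n k i.+1 p.

Definition damped n k i (t : R) : R := X i t * expR (- (lam n k * t)).

Definition damped' n k i (t : R) : R := damped n k i.+1 t - lam n k * damped n k i t.

Lemma damped_D n k i : D (damped n k i) (damped' n k i).
Proof.
have dE : D (fun t => expR (- lam n k * t)) (fun t => - lam n k * expR (- lam n k * t)).
  apply: hasD_ext (hasD_comp (hasD_scale (- lam n k) (@D_id)) (@D_exp)) => // t.
  by rewrite mulr1 mulrC.
apply: hasD_ext (hasD_mul (dX i) dE) => t; first by rewrite /damped mulNr.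
by rewrite /damped' /damped mulNr; ring.
Qed.

Lemma damped_cont n k i : continuous (damped n k i). Proof. exact: D_cont (damped_D n k i). Qed.

Lemma damped'_cont n k i : continuous (damped' n k i).
Proof. by apply: csub; [exact: damped_cont|apply: cscale; exact: damped_cont]. Qed.

(** [N] truncates the modes and the chains at once. A chain has [N + 1] members, from order 0 to
    order [N], which leaves [N] commutator terms. *)
Definition approx N : R -> P -> R :=
  sepf (fun (j : 'I_N * 'I_N * 'I_N.+1) t => c j.1.1 j.1.2 * damped j.1.1 j.1.2 j.2 t)
    (fun j => W j.1.1 j.1.2 j.2).

Definition source N : R -> P -> R :=
  sepF (fun (j : 'I_N * 'I_N * 'I_N.+1) t => c j.1.1 j.1.2 * damped j.1.1 j.1.2 j.2 t)
    (fun j t => c j.1.1 j.1.2 * damped' j.1.1 j.1.2 j.2 t) (fun j => W j.1.1 j.1.2 j.2).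

Lemma approx_separated N : separated (approx N) (source N).
Proof.
exists ('I_N * 'I_N * 'I_N.+1)%type, (fun (j : 'I_N * 'I_N * 'I_N.+1) t => c j.1.1 j.1.2 * damped j.1.1 j.1.2 j.2 t),
  (fun (j : 'I_N * 'I_N * 'I_N.+1) t => c j.1.1 j.1.2 * damped' j.1.1 j.1.2 j.2 t),
  (fun (j : 'I_N * 'I_N * 'I_N.+1) => W j.1.1 j.1.2 j.2).
split => // j; first exact: hasD_scale (damped_D _ _ _).
- exact: cscale (@damped'_cont _ _ _).
- exact: (let: And3 h _ _ := sW j.1.1 j.1.2 j.2 in h).
- exact: (let: And3 _ h _ := sW j.1.1 j.1.2 j.2 in h).
Qed.

Definition control N (t : R) (p : P) : R := - box N (fun n k i => c n k * damped n k i.+1 t * Cc n k i.+1 p).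

Definition residue N (t : R) (p : P) : R := \sum_(n < N) \sum_(k < N) c n k * damped n k N.+1 t * W n k N p.

Lemma control_L2 N : L2 (mu_cylinder T) (fun z => control N z.1 z.2).
Proof.
have := @sepf_cyl T T0 _ (fun (j : 'I_N * 'I_N * 'I_N) t => c j.1.1 j.1.2 * damped j.1.1 j.1.2 j.2.+1 t)
  (fun j t => c j.1.1 j.1.2 * damped' j.1.1 j.1.2 j.2.+1 t).
move=> /(_ (fun j => hasD_scale _ (damped_D _ _ _)) (fun j => Cc j.1.1 j.1.2 j.2.+1)).
case=> [j|+ _]; first by have [] := sW j.1.1 j.1.2 j.2.+1.
move=> /L2N; congr (L2 _ _); apply/funext => z; rewrite /control /box /sepf; congr (- _).
rewrite [RHS]pair_bigA/= [RHS]pair_bigA/=; apply: eq_bigr => -[[n k] i] _ //.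
Qed.

(** The member of order [i] contributes [damped i.+1 * W i - damped i * W i.-1 - damped i * Cc i],
    without the last two terms at order 0. The sum telescopes to the control and the top term, the
    [residue]. *)
Lemma source_eq N t p : source N t p = control N t p + residue N t p.
Proof.
rewrite /source /sepF sepf_gop; last by move=> j; have [] := sW j.1.1 j.1.2 j.2.
rewrite /sepf -big_split/= -(pair_bigA _ (fun (j : 'I_N * 'I_N) (i : 'I_N.+1) =>
  c j.1 j.2 * damped' j.1 j.2 i t * W j.1 j.2 i p + c j.1 j.2 * damped j.1 j.2 i t * gop (W j.1 j.2 i) p))/=.
rewrite -(pair_bigA _ (fun (n k : 'I_N) => \sum_(i < N.+1)
  (c n k * damped' n k i t * W n k i p + c n k * damped n k i t * gop (W n k i) p)))/=.
rewrite /control /residue /box -sumrN -big_split/=; apply: eq_bigr => n _.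
rewrite -sumrN -big_split/=; apply: eq_bigr => k _.
have tele I : \sum_(i < I.+1) (c n k * damped' n k i t * W n k i p + c n k * damped n k i t * gop (W n k i) p) =
  - (\sum_(i < I) c n k * damped n k i.+1 t * Cc n k i.+1 p) + c n k * damped n k I.+1 t * W n k I p.
  elim: I => [|I IH]; first by rewrite big_ord_recr !big_ord0/= gW0 /damped'; ring.
  by rewrite big_ord_recr/= IH [in RHS]big_ord_recr/= gWS /damped'; ring.
exact: tele.
Qed.

Lemma approx_sum N t p : approx N t p = \sum_(n < N) \sum_(k < N) \sum_(i < N.+1) c n k * damped n k i t * W n k i p.
Proof.
rewrite /approx /sepf [RHS]pair_bigA/= [RHS]pair_bigA/=; apply: eq_bigr => -[[n k] i] _ //.
Qed.

Lemma approx_final N : (forall i, X i T = 0) -> approx N T = cst 0.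
Proof.
move=> XT; apply/funext => p; rewrite approx_sum big1// => n _; rewrite big1// => k _; rewrite big1// => i _.
by rewrite /damped XT mul0r mulr0 mul0r.
Qed.

Lemma approx_initial N p : X 0%N 0 = 1 -> (forall i, X i.+1 0 = 0) ->
  approx N 0 p = \sum_(j : 'I_N * 'I_N) c j.1 j.2 * W j.1 j.2 0%N p.
Proof.
move=> X1 X0; rewrite approx_sum -(pair_bigA _ (fun n k : 'I_N => c n k * W n k 0%N p))/=.
apply: eq_bigr => n _; apply: eq_bigr => k _; rewrite big_ord_recl/= big1 ?addr0.
  by rewrite /damped X1 mulr0 oppr0 expR0 !mulr1.
by move=> i _; rewrite /damped X0 mul0r mulr0 mul0r.
Qed.

Variables (w : nat -> nat -> R) (S : R) (om : set P).
Hypothesis w0 : forall n k, 0 <= w n k.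
Hypothesis wS : forall N, \sum_(n < N) \sum_(k < N) w n k <= S.
Hypothesis hC : forall n k i t p, 0 <= t <= T -> Omega p -> `|c n k * damped n k i.+1 t * Cc n k i.+1 p| <= w n k / 2 ^+ i.
Hypothesis hW : forall n k i t p, 0 <= t <= T -> Omega p -> `|c n k * damped n k i.+1 t * W n k i p| <= w n k / 2 ^+ i.
Hypothesis om_Cc : forall n k i p, Omega p -> ~ om p -> Cc n k i p = 0.
Hypothesis mom : measurable (om : set plane).
Let b n k i := w n k / 2 ^+ i.
Let b0 n k i : 0 <= b n k i. Proof. by rewrite divr_ge0// exprn_ge0. Qed.

Lemma residue_bound N t p : 0 <= t <= T -> Omega p -> `|residue N t p| <= S / 2 ^+ N.
Proof.
move=> tT Op; apply: (@le_trans _ _ (\sum_(n < N) \sum_(k < N) w n k / 2 ^+ N)); last first.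
  rewrite (_ : \sum_(n < N) _ = (\sum_(n < N) \sum_(k < N) w n k) / 2 ^+ N).
    by rewrite ler_wpM2r// invr_ge0 exprn_ge0.
  by rewrite mulr_suml; apply: eq_bigr => n _; rewrite mulr_suml.
apply: (le_trans (ler_norm_sum _ _ _)); apply: ler_sum => n _.
by apply: (le_trans (ler_norm_sum _ _ _)); apply: ler_sum => k _; exact: hW.
Qed.

Lemma geometric_partial N : \sum_(i < N) (2 ^+ i)^-1 <= 2 :> R.
Proof.
have h : \sum_(i < N) (2 ^+ i)^-1 = 2 - 2 / 2 ^+ N :> R.
  elim: N => [|N IH]; first by rewrite big_ord0 expr0 divr1 subrr.
  by rewrite big_ord_recr/= IH exprS; field; rewrite expf_neq0.
by rewrite h gerBl divr_ge0// exprn_ge0.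
Qed.

Lemma box_bound N : box N b <= 2 * S.
Proof.
apply: (@le_trans _ _ (2 * \sum_(n < N) \sum_(k < N) w n k)); last by rewrite ler_wpM2l.
rewrite mulr_sumr; apply: ler_sum => n _; rewrite mulr_sumr; apply: ler_sum => k _.
by rewrite -mulr_sumr mulrC ler_wpM2r// geometric_partial.
Qed.

Lemma control_diff N M t p : (N <= M)%N -> 0 <= t <= T -> Omega p ->
  `|control M t p - control N t p| <= box M b - box N b.
Proof.
move=> NM tT Op; rewrite /control -opprD normrN; apply: box_diff => // n k i; exact: hC.
Qed.

(** Controls converge because their increments are tails of a bounded box sum, and the residue has
    the additional factor [2 ^ - N]: the sources become supported in the control region in the
    limit. *)
Lemma superposition_limit (f0 : P -> R) : L2 mO f0 -> (forall i, X i T = 0) ->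
  (forall d, 0 < d -> exists N, forall M, (N <= M)%N -> nrm mO (fun p => approx M 0 p - f0 p) <= d) ->
  exists u, L2 (mu_cylinder T) u /\ exists f, weak_solution om T f0 u f /\ f T = cst 0 %[ae mu_Omega].
Proof.
move=> lf0 XT dense.
have p2 l : 0 < 2 ^- l :> R by rewrite invr_gt0 exprn_gt0.
have mb (m n : nat) : (m <= n)%N -> box m b <= box n b by move=> mn; exact: box_mono.
have [N1 hN1] := choice (fun l : nat => nondecreasing_tail mb box_bound (p2 l)).
have [N2 hN2] := choice (fun l : nat => dense _ (p2 l)).
(* A cumulative sum is nondecreasing and dominates [N1 l], [N2 l] and [l] at the same time. *)
pose sg l := (\sum_(j < l.+1) (N1 j + N2 j + j))%N.
have sgS l : (sg l <= sg l.+1)%N by rewrite /sg [leqRHS]big_ord_recr leq_addr.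
have sgl l : (N1 l + N2 l + l <= sg l)%N by rewrite /sg big_ord_recr leq_addl.
have sg1 l : (N1 l <= sg l)%N by have := sgl l; lia.
have sg2 l : (N2 l <= sg l)%N by have := sgl l; lia.
have sg3 l : (l <= sg l)%N by have := sgl l; lia.
have S0 : 0 <= S by have := wS 0; rewrite big_ord0.
have udiff l t p : 0 <= t <= T -> Omega p -> `|control (sg l.+1) t p - control (sg l) t p| <= 1 / 2 ^+ l.
  move=> tT Op; apply: (le_trans (control_diff (sgS l) tT Op)); rewrite div1r.
  apply: le_trans (hN1 l (sg l.+1) _); last exact: leq_trans (sg1 l) (sgS l).
  by rewrite lerD2l lerN2; exact: mb.
have rb N l t p : (l <= N)%N -> 0 <= t <= T -> Omega p -> `|residue N t p| <= S / 2 ^+ l.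
  move=> lN tT Op; apply: (le_trans (residue_bound N tT Op)); exact: half_pow_le.
pose A := Num.sqrt (fine (mO setT)); pose B := Num.sqrt (fine (mu_cylinder T setT)).
have A0 : 0 <= A by exact: sqrtr_ge0.
have B0 : 0 <= B by exact: sqrtr_ge0.
pose k := 1 + 2 * S; have k0 : 0 <= k by rewrite addr_ge0// mulr_ge0.
have Sk : S <= k by rewrite /k; lra.
have k1 : 1 <= k by rewrite /k lerDl mulr_ge0.
have CE l : (k * A + k * B + 1) / 2 ^+ l = k / 2 ^+ l * A + k / 2 ^+ l * B + 1 / 2 ^+ l by ring.
have i0 l : 0 <= 2 ^- l :> R by exact: ltW.
have cyl z : cylinder T z -> 0 <= z.1 <= T /\ Omega z.2.
  by move=> [+ Oz] => /=; rewrite in_itv/= => /andP[a b']; split => //; rewrite !ltW.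
have lF m := (separated_L2 T0 (approx_separated m)).2.
have kA l : 0 <= k / 2 ^+ l * A by rewrite !mulr_ge0.
have kB l : 0 <= k / 2 ^+ l * B by rewrite !mulr_ge0.
apply: (@weak_limit T T0 om f0 (fun l => approx (sg l)) (fun l => source (sg l)) (fun l z => control (sg l) z.1 z.2)
  (k * A + k * B + 1)) => //.
- by rewrite !addr_ge0// mulr_ge0.
- by move=> m; exact: approx_separated.
- by move=> m; exact: control_L2.
- move=> l t tT; rewrite CE; apply: (@le_trans _ _ (k / 2 ^+ l * A)); last first.
    by rewrite -addrA lerDl addr_ge0// mul1r.
  apply: nrm_Omega.
  + by apply: L2_measurable; apply: L2B; exact: separated_source_L2 (approx_separated _).
  + by rewrite mulr_ge0.
  move=> p Op; rewrite !source_eq.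
  have h1 := udiff l t p tT Op; have h2 := rb (sg l) l t p (sg3 l) tT Op.
  have h3 := rb (sg l.+1) l t p (leq_trans (sg3 l) (sgS l)) tT Op.
  rewrite (_ : _ - _ = (control (sg l.+1) t p - control (sg l) t p) + (residue (sg l.+1) t p - residue (sg l) t p)); last by ring.
  apply: (le_trans (ler_normD _ _)); rewrite /k !mulrDl; apply: lerD => //.
  by apply: (le_trans (ler_normB _ _)); rewrite !mul1r; exact: lerD.
- move=> l; rewrite CE; apply: (@le_trans _ _ (k / 2 ^+ l * B)); last first.
    by rewrite addrAC lerDr addr_ge0// mul1r.
  apply: nrm_cylinder => //; first by apply: L2_measurable; apply: L2B; exact: control_L2.
    by rewrite mulr_ge0.
  move=> z /cyl[tz Oz]; apply: (le_trans (udiff l _ _ tz Oz)).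
  by rewrite ler_wpM2r.
- move=> l; rewrite CE; apply: (@le_trans _ _ (k / 2 ^+ l * B)); last first.
    by rewrite addrAC lerDr addr_ge0// mul1r.
  apply: nrm_cylinder => //.
  + apply: measurable_funB; first exact: L2_measurable (lF _).
    exact: L2_measurable (L2_indic mom (control_L2 _)).1.
  + by rewrite mulr_ge0.
  move=> z /cyl[tz Oz]; rewrite source_eq.
  have uo : \1_om z.2 * control (sg l) z.1 z.2 = control (sg l) z.1 z.2.
    rewrite indicE; have [_|/negP zo] := boolP (z.2 \in om); first by rewrite mul1r.
    rewrite mul0r /control /box big1 ?oppr0// => n _; rewrite big1// => j _; rewrite big1// => i _.
    by rewrite om_Cc ?mulr0// => h; apply: zo; rewrite inE.
  rewrite uo addrAC subrr add0r; apply: (le_trans (rb _ l _ _ (sg3 l) tz Oz)).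
  by rewrite ler_wpM2r.
- move=> l; rewrite CE; apply: (@le_trans _ _ (1 / 2 ^+ l)); last by rewrite lerDr addr_ge0.
  by rewrite div1r; exact: hN2.
- by move=> l; exact: approx_final.
Qed.

End superposition.

Lemma grushin_spectral : exists (s : nat -> R -> R) (ms : nat -> R) (e : nat -> nat -> R -> R) (m : nat -> nat -> R),
  spectral_family 0 pi (fun=> 0) s ms /\
  forall n, spectral_family (-1) 1 (fun x : R => (ms n)^-1 * x ^+ 2) (e n) (m n).
Proof.
have [s [ms hs]] := @spectral 0 pi (fun=> 0) (pi_gt0 R) (@cst_continuous _ _ _) (fun _ _ => lexx 0).
have ms0 n : 0 <= ms n by case: hs => h _ _; case: (h n) => [[-> _]//|[/ltW]].
have lt11 : (-1 : R) < 1 by lra.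
have h n : exists em : (nat -> R -> R) * (nat -> R), spectral_family (-1) 1 (fun x : R => (ms n)^-1 * x ^+ 2) em.1 em.2.
  have [|x _|e [m h]] := @spectral (-1) 1 (fun x => (ms n)^-1 * x ^+ 2) lt11.
  - by apply: cscale; apply: D_cont D_sqr.
  - by rewrite mulr_ge0 ?invr_ge0 ?sqr_ge0.
  by exists (e, m).
by have [em hem] := choice h; exists s, ms, (fun n => (em n).1), (fun n => (em n).2).
Qed.

Lemma coef_bound (s : nat -> R -> R) (ms : nat -> R) (e : nat -> nat -> R -> R) (m : nat -> nat -> R) (f0 : P -> R) n k :
  spectral_family 0 pi (fun=> 0) s ms ->
  (forall n, spectral_family (-1) 1 (fun x : R => (ms n)^-1 * x ^+ 2) (e n) (m n)) ->
  L2 mO f0 -> `|coef s e f0 n k| <= nrm mO f0.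
Proof.
move=> hs he lf0; rewrite -sqrtr_sqr ler_wsqrtr//.
have nN : (n < (maxn n k).+1)%N by rewrite ltnS leq_maxl.
have kN : (k < (maxn n k).+1)%N by rewrite ltnS leq_maxr.
apply: le_trans (psum2_le hs he lf0 (maxn n k).+1).
rewrite /psum2 (bigD1 (Ordinal nN, Ordinal kN))//= lerDl.
by apply: sumr_ge0 => j _; exact: sqr_ge0.
Qed.

(** Two Hilbert-Schmidt bounds: one in [x], on an interval of length 2 and uniform in [n], then one
    in [y] on an interval of length [pi]. *)
Lemma weight_sum (s : nat -> R -> R) (ms : nat -> R) (e : nat -> nat -> R -> R) (m : nat -> nat -> R) N :
  spectral_family 0 pi (fun=> 0) s ms ->
  (forall n, spectral_family (-1) 1 (fun x : R => (ms n)^-1 * x ^+ 2) (e n) (m n)) ->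
  \sum_(n < N) \sum_(k < N) ms n ^+ 2 * m n k ^+ 2 <= pi ^+ 4 * 2 ^+ 4.
Proof.
move=> hs he; have lt11 : (-1 : R) < 1 by lra.
have q0 n x : -1 <= x <= 1 -> 0 <= (ms n)^-1 * x ^+ 2.
  by move=> _; rewrite mulr_ge0 ?sqr_ge0// invr_ge0; case: hs => h _ _; case: (h n) => [[-> _]//|[/ltW]].
have qc n : continuous (fun x : R => (ms n)^-1 * x ^+ 2) by apply: cscale; apply: D_cont D_sqr.
apply: (@le_trans _ _ (\sum_(n < N) ms n ^+ 2 * 2 ^+ 4)).
  apply: ler_sum => n _; rewrite -mulr_sumr ler_wpM2l ?sqr_ge0//.
  have [h1 h2 h3] := he n.
  have := @family_sum (-1) 1 _ lt11 (qc n) (q0 n) _ _ h1 h2 N.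
  by rewrite (_ : 1 - -1 = 2 :> R)//; lra.
rewrite -mulr_suml ler_wpM2r ?exprn_ge0//.
have [h1 h2 h3] := hs.
have := @family_sum 0 pi _ (pi_gt0 R) (@cst_continuous _ _ _) (fun _ _ => lexx 0) _ _ h1 h2 N.
by rewrite subr0.
Qed.

Theorem null_controllable_wide (g1 g2 : R -> R) (T : R) :
  {within `[0, pi], continuous g1} -> {within `[0, pi], continuous g2} ->
  (forall y, y \in `[0, pi] -> -1 < g1 y < 1) ->
  (forall y, y \in `[0, pi] -> -1 < g2 y < 1) ->
  (forall y, y \in `[0, pi] -> g1 y < g2 y) -> 0 < T ->
  Num.max (sup (g2^\- @` `[0, pi])) (sup (g1^\+ @` `[0, pi])) ^+ 2 / 2 < T ->
  null_controllable [set p : P | Omega p /\ g1 p.2 < p.1 < g2 p.2] T.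
Proof.
move=> c1 c2 r1 r2 g12 T0 aT f0 lf0; set om := [set p | _].
have [b [b0 b1 bT hb]] := corridor r1 r2 T0 aT.
have [th [sth th01 thb thx thd]] := separating_cutoff c1 c2 g12 b0 b1 hb.
(* Strictly between [b ^ 2 / 2] and [T]: room is needed below for the exponential gain and above for
   the time cutoff. *)
pose t1 := (b ^+ 2 / 2 + T) / 2.
have bt : b ^+ 2 / 2 < t1 by rewrite /t1; lra.
have t1T : t1 < T by rewrite /t1; lra.
have t10 : 0 < t1 by apply: le_lt_trans bt; rewrite divr_ge0// sqr_ge0.
have [X [dX X1 X0 X01 [XS [M [XM hM]]]]] := gevrey_cutoff t1T.
have M0 n : 0 <= M n by apply: le_trans (XM n 0).
have [K K0 hK] := flat_gevrey M0 hM.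
have [s [ms [e [m [hs he]]]]] := grushin_spectral.
have [C C0 hF] := flat_modes sth th01 thb thx thd b0 b1 bt.
pose good (nk : nat * nat) (q : R * ((nat -> P -> R) * (nat -> P -> R))) :=
  [/\ 0 <= q.1, q.2.1 0%N = mode s e nk.1 nk.2,
    forall i, [/\ smooth (q.2.1 i), vanishing (q.2.1 i) & smooth (q.2.2 i)],
    (forall p, gop (q.2.1 0%N) p = q.1 * q.2.1 0%N p) /\
    (forall i p, gop (q.2.1 i.+1) p = q.1 * q.2.1 i.+1 p - q.2.1 i p - q.2.2 i.+1 p) &
    forall i p, Omega p -> [/\ ~ om p -> q.2.2 i p = 0,
      `|q.2.1 i p| * expR (- (q.1 * t1)) <= C * (ms nk.1 ^+ 2 * m nk.1 nk.2 ^+ 2) * flat_weight i &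
      `|q.2.2 i p| * expR (- (q.1 * t1)) <= C * (ms nk.1 ^+ 2 * m nk.1 nk.2 ^+ 2) * flat_weight i]].
have exg nk : exists q, good nk q.
  have [hs1 _ _] := hs; have [he1 _ _] := he nk.1.
  by have [l [W [Cc h]]] := hF _ _ _ _ (hs1 nk.1) (he1 nk.2); exists (l, (W, Cc)).
have [q hq] := choice exg.
pose lam n k := (q (n, k)).1; pose W n k := (q (n, k)).2.1; pose Cc n k := (q (n, k)).2.2.
pose w n k := nrm mO f0 * K * C * (ms n ^+ 2 * m n k ^+ 2).
have w0 n k : 0 <= w n k.
  have h : 0 <= ms n ^+ 2 * m n k ^+ 2 by rewrite mulr_ge0// sqr_ge0.
  by rewrite /w !(mulr_ge0 _ h)// !mulr_ge0// nrm_ge0.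
have wS N : \sum_(n < N) \sum_(k < N) w n k <= nrm mO f0 * K * C * (pi ^+ 4 * 2 ^+ 4).
  have h : 0 <= nrm mO f0 * K * C by rewrite !mulr_ge0// nrm_ge0.
  apply: le_trans (ler_wpM2l h (weight_sum N hs he)); rewrite mulr_sumr.
  by apply: ler_sum => n _; rewrite mulr_sumr.
have main n k i t (V fw : R) : `|V| * expR (- (lam n k * t1)) <= C * (ms n ^+ 2 * m n k ^+ 2) * fw ->
    0 <= fw -> M i.+1 * fw <= K / 2 ^+ i -> `|coef s e f0 n k * damped X lam n k i.+1 t * V| <= w n k / 2 ^+ i.
  move=> hV fw0 hMf; have wi : 0 <= w n k / 2 ^+ i by rewrite divr_ge0// exprn_ge0.
  (* The derivatives of the cutoff live in [t1 < t < T], where [exp (- lam t)] is at most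
     [exp (- lam t1)]. *)
  rewrite /damped; have [tt|/negbTE tt] := boolP ((t <= t1) || (T <= t)).
    by rewrite XS// mul0r mulr0 mul0r normr0.
  have tt1 : t1 <= t by move/negbT: tt; rewrite negb_or -!ltNge => /andP[/ltW].
  have [l0 _ _ _ _] := hq (n, k); rewrite -/(lam n k) in l0.
  rewrite !normrM (ger0_norm (expR_ge0 _)).
  have hE : `|V| * expR (- (lam n k * t)) <= C * (ms n ^+ 2 * m n k ^+ 2) * fw.
    by apply: le_trans hV; rewrite ler_wpM2l// ler_expR lerN2 ler_wpM2l.
  rewrite (_ : _ * _ * `|V| = `|coef s e f0 n k| * (`|X i.+1 t| * (`|V| * expR (- (lam n k * t))))); last by ring.
  have h2 : 0 <= C * (ms n ^+ 2 * m n k ^+ 2).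
    by rewrite mulr_ge0//; rewrite mulr_ge0// sqr_ge0.
  rewrite (_ : w n k / 2 ^+ i = nrm mO f0 * (C * (ms n ^+ 2 * m n k ^+ 2) * (K / 2 ^+ i))); last by rewrite /w; ring.
  have h1 := coef_bound n k hs he lf0.
  apply: ler_pM; [exact: normr_ge0| |exact: h1|].
    by rewrite mulr_ge0// mulr_ge0// expR_ge0.
  apply: (@le_trans _ _ (M i.+1 * (C * (ms n ^+ 2 * m n k ^+ 2) * fw))).
    by apply: ler_pM => //; rewrite mulr_ge0// expR_ge0.
  by rewrite mulrCA ler_wpM2l.
have ini N p : approx X lam W (coef s e f0) N 0 p = psum s e f0 N p.
  have hX0 : X 0%N 0 = 1 by apply: X1; exact: ltW.
  have hXS i : X i.+1 0 = 0 by apply: XS; rewrite ltW.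
  rewrite (approx_initial _ _ _ _ p hX0 hXS); apply: eq_bigr => j _.
  by have [_ E _ _ _] := hq (val j.1, val j.2); rewrite /W E.
have := @superposition_limit T X lam W Cc (coef s e f0) T0 dX _ _ _ w _ om w0 wS _ _ _ _ f0 lf0.
apply.
- by move=> n k i; have [_ _ /(_ i) h _ _] := hq (n, k); exact: h.
- by move=> n k p; have [_ _ _ [+ _] _] := hq (n, k); exact.
- by move=> n k i p; have [_ _ _ [_ +] _] := hq (n, k); exact.
- move=> n k i t p tT Op; have [_ _ _ _ h] := hq (n, k); have [_ _ h3] := h i.+1 p Op.
  by apply: main h3 _ _; [exact: flat_weight_ge0|exact: (hK i).1].
- move=> n k i t p tT Op; have [_ _ _ _ h] := hq (n, k); have [_ h3 _] := h i p Op.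
  by apply: main h3 _ _; [exact: flat_weight_ge0|exact: (hK i).2].
- by move=> n k i p Op nom; have [_ _ _ _ h] := hq (n, k); have [+ _ _] := h i p Op; exact.
- exact: om_measurable.
- by case=> [|i]; [exact: X0|apply: XS; rewrite lexx orbT].
move=> d d0; have d2 : 0 < d ^+ 2 by rewrite exprn_gt0.
have [N hN] := psum_dense hs he lf0 d2; exists N => K' NK.
rewrite -(@ler_pXn2r _ 2)// ?nnegrE ?nrm_ge0 ?(ltW d0)// nrm_sqr.
rewrite (_ : (fun p => _) = (fun p => psum s e f0 K' p - f0 p)); last by apply/funext => p; rewrite ini.
rewrite (psum_f0_dist hs he lf0); apply: le_trans hN.
by rewrite lerD2l lerN2; exact: (psum2_mono hs he f0 NK).
Qed.

End grushin_control.

Theorem corollary3p5 (R : realType) (gamma1 gamma2 : R -> R)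
    (gamma1_cont : {within `[0, pi], continuous gamma1})
    (gamma2_cont : {within `[0, pi], continuous gamma2})
    (gamma1_range : forall y, y \in `[0, pi] -> -1 < gamma1 y < 1)
    (gamma2_range : forall y, y \in `[0, pi] -> -1 < gamma2 y < 1)
    (gamma12 : forall y, y \in `[0, pi] -> gamma1 y < gamma2 y)
    (T : R) (T_gt0 : 0 < T) :
  let omega : set (R * R) :=
    [set p | Omega p /\ gamma1 p.2 < p.1 < gamma2 p.2] in
  let a : R := Num.max (sup (gamma2^\- @` `[0, pi]))
                       (sup (gamma1^\+ @` `[0, pi])) in
  (a ^+ 2 / 2 < T -> null_controllable omega T) /\
  (T < a ^+ 2 / 2 -> ~ null_controllable omega T).
Proof.
move=> omega a; split; first exact: null_controllable_wide.
exact: not_null_controllable.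
Qed.
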